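(* Let $n\ge 2$ and let $F$ be a field containing elements $q,z$ such that $q$, $z$, $q-q^{-1}$ and $z-z^{-1}$ are invertible. Let $\mathcal B_n(q,z)$ be the $q$-Brauer algebra over $F$, and let $e$ be the quantum characteristic of $q^2$. Then $\mathcal B_n(q,z)$ is (split) semisimple if and only if $e>n$ and $z^2\neq q^{2a}$ for every $$a\in\{i\in\mathbb Z\mid 4-2n\le i\le n-2\}\setminus\{i\in\mathbb Z\mid 4-2n<i\le 3-n,\ 2\nmid i\}.$$
   Context: Quantum characteristic of $q^2$: the least positive integer $e$ with $1+q^2+\cdots+q^{2e-2}=0$ in $F$, and $e=\infty$ if there is no such integer. Put $\delta=(z-z^{-1})/(q-q^{-1})$. For $n\ge 2$ the $q$-Brauer algebra $\mathcal B_n(q,z)$ over $F$ is the unital associative $F$-algebra with generators $T_1,\dots,T_{n-1},E_1$ and relations (whenever the generators occurring exist): $(T_i-q)(T_i+q^{-1})=0$; $T_iT_j=T_jT_i$ for $|i-j|>1$; $T_kT_{k+1}T_k=T_{k+1}T_kT_{k+1}$ for $1\le k\le n-2$; $E_1^2=\delta E_1$; $T_1E_1=qE_1=E_1T_1$; $E_1T_2E_1=zE_1$; $T_iE_1=E_1T_i$ for $i>2$; $T_2T_3T_1^{-1}T_2^{-1}E_{(2)}=E_{(2)}=E_{(2)}T_2T_3T_1^{-1}T_2^{-1}$, where $E_{(2)}=E_1T_2T_3T_1^{-1}T_2^{-1}E_1$. *)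

(* Defs.v *)
From HB Require Import structures.
From mathcomp Require Import all_boot all_order all_algebra.
From mathcomp Require Import generic_quotient ring_quotient.
From mathcomp Require Import boolp monalg.

Set Implicit Arguments.
Unset Strict Implicit.
Unset Printing Implicit Defensive.

Import GRing.Theory.
Local Open Scope ring_scope.
Local Open Scope quotient_scope.

(* Least e > 0 with 1 + x + ... + x^(e-1) = 0; None stands for infinity. *)
Definition qchar_zero (F : fieldType) (x : F) (e : nat) : bool :=
  (0 < e)%N && (\sum_(i < e) x ^+ i == 0).

Definition quantum_char (F : fieldType) (x : F) : option nat :=
  if pselect (exists e, qchar_zero x e) is left ex_e then Some (ex_minn ex_e)
  else None.

Definition ltn_qchar (n : nat) (e : option nat) : bool :=
  if e is Some m then (n < m)%N else true.

Lemma quantum_charP (F : fieldType) (x : F) (n : nat) :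
  ltn_qchar n (quantum_char x) <->
  forall e : nat, (0 < e <= n)%N -> \sum_(i < e) x ^+ i <> 0.
Proof.
rewrite /quantum_char; case: pselect => [ex_e|nex_e] /=.
  case: ex_minnP => m /andP[m_gt0 /eqP m0] min_m; split=> [ltnm e|].
    case/andP=> e_gt0 le_en e0.
    have: (m <= e)%N by apply: min_m; rewrite /qchar_zero e_gt0 e0 eqxx.
    by rewrite leqNgt (leq_ltn_trans le_en ltnm).
  by move=> H; rewrite ltnNge; apply/negP => le_mn; apply: (H m); rewrite ?m_gt0.
split=> // _ e /andP[e_gt0 _] e0; apply: nex_e; exists e.
by rewrite /qchar_zero e_gt0 e0 eqxx.
Qed.

(* Every subset of V is given by some U : {pred V}, thanks to [asbool]. *)
Definition semisimple_module (R : nzRingType) (V : lmodType R) : Prop :=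
  forall U : {pred V}, submod_closed U ->
  exists W : {pred V},
    [/\ submod_closed W,
        forall v, v \in U -> v \in W -> v = 0 &
        forall v, exists u w, [/\ u \in U, w \in W & v = u + w]].

(* A^o is A as a left module over itself, so its submodules are the left
   ideals. *)
Definition semisimple (A : nzRingType) : Prop := semisimple_module A^o.

(* A is isomorphic to a finite product of full matrix algebras over F; the
   isomorphism is given by its components phi i. *)
Definition split_semisimple (F : fieldType) (A : algType F) : Prop :=
  exists (k : nat) (d : 'I_k -> nat)
         (phi : forall i : 'I_k, {lrmorphism A -> 'M[F]_((d i).+1)}),
    (forall a b : A, (forall i, phi i a = phi i b) -> a = b) /\
    (forall M : forall i : 'I_k, 'M[F]_((d i).+1),
       exists a : A, forall i, phi i a = M i).

Section Presentation.
Context (F : fieldType) (I : choiceType).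

Definition free_alg := {malg F[{fmonom I}]}.
HB.instance Definition _ := GRing.Lalgebra.on free_alg.

Definition free_gen (i : I) : free_alg := mkmalgU (fmu i) 1.

Lemma free_scalerAr (c : F) (x y : free_alg) : c *: (x * y) = x * (c *: y).
Proof.
pose Z := {malg F[{fmonom I}]}.
suff comm (u : Z) : c%:MP * u = u * c%:MP.
  by rewrite -!mul_malgC !mulrA (comm x).
rewrite !malgM_def fgmulUg fgmulgU; apply: eq_bigr => k _.
by rewrite mul1m mulm1 mulrC.
Qed.
HB.instance Definition _ := GRing.Lalgebra_isAlgebra.Build F free_alg
  free_scalerAr.

Section Eval.
Context (B : algType F) (g : I -> B).

Definition word_eval (m : {fmonom I}) : B := \prod_(i <- (m : seq I)) g i.

Lemma word_eval_morph : mmorphism word_eval.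
Proof.
split=> [x y|]; rewrite /word_eval; first by rewrite fmM big_cat.
by rewrite fm1 big_nil.
Qed.
HB.instance Definition _ := isMultiplicative.Build _ _ word_eval
  word_eval_morph.

Definition free_eval : free_alg -> B := mmap (in_alg B) word_eval.

Lemma free_eval_additive : zmod_morphism free_eval.
Proof. exact: (raddfB (mmap (in_alg B) word_eval)). Qed.
HB.instance Definition _ := GRing.isZmodMorphism.Build free_alg B free_eval
  free_eval_additive.

Lemma free_eval_monoid : monoid_morphism free_eval.
Proof.
have [|H1 H2] := @commr_mmap_is_multiplicative _ _ _ (in_alg B) word_eval.
  by move=> x m m'; rewrite /GRing.comm /= -scalerAl -scalerAr mul1r mulr1.
by split.
Qed.
HB.instance Definition _ := GRing.isMonoidMorphism.Build free_alg B free_eval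
  free_eval_monoid.

Lemma free_eval_scalable : scalable free_eval.
Proof.
move=> c x; rewrite /free_eval (@mmapZ _ _ _ (in_alg B) word_eval) /=.
by rewrite -scalerAl mul1r.
Qed.
HB.instance Definition _ := GRing.isScalable.Build F free_alg B *:%R free_eval
  free_eval_scalable.

Lemma free_eval_gen i : free_eval (free_gen i) = g i.
Proof.
by rewrite /free_eval mmapU /= scale1r mul1r /word_eval fmU big_seq1.
Qed.
End Eval.

Lemma free_alg_ext (B : algType F) (f h : {lrmorphism free_alg -> B}) :
  (forall i, f (free_gen i) = h (free_gen i)) -> f =1 h.
Proof.
move=> fh x.
have mon (m : {fmonom I}) :
    f (mkmalgU m 1 : free_alg) = h (mkmalgU m 1 : free_alg).
  case: m => s; elim: s => [|i s IH].
    have -> : (mkmalgU (FMonom [::]) 1 : free_alg) = 1.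
      by congr (mkmalgU _ _); apply/eqP; rewrite fmP fm1.
    by rewrite !rmorph1.
  have -> : (mkmalgU (FMonom (i :: s)) 1 : free_alg) =
            free_gen i * mkmalgU (FMonom s) 1.
    rewrite [RHS]fgmulUU mulr1; congr (mkmalgU _ _).
    by apply/eqP; rewrite fmP fmM fmU.
  by rewrite !rmorphM /= fh IH.
rewrite [x]monalgE !(raddf_sum f, raddf_sum h); apply: eq_bigr => m _.
have -> : (mkmalgU m (x@_m) : free_alg) = x@_m *: (mkmalgU m 1 : free_alg).
  by apply/malgP => k; rewrite mcoeffZ !mcoeffU mulrnAr mulr1.
transitivity (x@_m *: f (mkmalgU m 1 : free_alg)); first exact: linearZ_LR.
by rewrite mon; apply/esym; exact: linearZ_LR.
Qed.

Section Quotient.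
(* The two-sided ideal generated by the elements x - y with rel x y. *)
Context (rel : free_alg -> free_alg -> Prop).

Inductive in_relideal : free_alg -> Prop :=
| relideal_gen x y : rel x y -> in_relideal (x - y)
| relideal_0 : in_relideal 0
| relideal_D x y : in_relideal x -> in_relideal y -> in_relideal (x + y)
| relideal_Ml a x : in_relideal x -> in_relideal (a * x)
| relideal_Mr a x : in_relideal x -> in_relideal (x * a).

Definition relideal : {pred free_alg} := fun x => `[< in_relideal x >].

Lemma relideal_zmod : zmod_closed relideal.
Proof.
split=> [|x y /asboolP x_in /asboolP y_in]; apply/asboolP.
  exact: relideal_0.
by rewrite -mulN1r; apply: relideal_D => //; apply: relideal_Ml.
Qed.
HB.instance Definition _ := GRing.isZmodClosed.Build free_alg relideal
  relideal_zmod.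

Definition pres := Quotient.quot relideal.
HB.instance Definition _ := GRing.Zmodule.on pres.
HB.instance Definition _ := EqQuotient.on pres.

Definition pres_pi (x : free_alg) : pres := \pi x.
Definition pres_one : pres := pres_pi 1.
Definition pres_mul (x y : pres) : pres := pres_pi (repr x * repr y).
Definition pres_scale (c : F) (x : pres) : pres := pres_pi (c *: repr x).

Lemma pres_piP x y : (pres_pi x = pres_pi y) <-> in_relideal (x - y).
Proof.
split=> [|xy]; last by apply/eqP; rewrite -Quotient.idealrBE; apply/asboolP.
by move/eqP; rewrite -Quotient.idealrBE => /asboolP.
Qed.

Lemma pres_reprK (x : pres) : pres_pi (repr x) = x.
Proof. exact: reprK. Qed.

Lemma pres_reprP x : in_relideal (repr (pres_pi x) - x).
Proof. by apply/pres_piP; rewrite pres_reprK. Qed.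

Lemma pres_piB : {morph pres_pi : x y / x - y}.
Proof.
by move=> x y; rewrite /pres_pi (Quotient.pi_add _ x (- y)) Quotient.pi_opp.
Qed.

Lemma pres_piD : {morph pres_pi : x y / x + y}.
Proof. by move=> x y; exact: Quotient.pi_add. Qed.

Lemma pres_pi0 : pres_pi 0 = 0.
Proof. by rewrite -[X in pres_pi X](subrr 0) pres_piB subrr. Qed.

Lemma pres_piM x y : pres_pi (x * y) = pres_mul (pres_pi x) (pres_pi y).
Proof.
apply/esym/pres_piP; set x' := repr _; set y' := repr _.
have -> : x' * y' - x * y = x' * (y' - y) + (x' - x) * y.
  by rewrite mulrBr mulrBl addrA subrK.
apply: relideal_D; first by apply: relideal_Ml; apply: pres_reprP.
by apply: relideal_Mr; apply: pres_reprP.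
Qed.

Lemma pres_piZ c x : pres_pi (c *: x) = pres_scale c (pres_pi x).
Proof.
apply/esym/pres_piP; rewrite -scalerBr -[_ - _]mul1r scalerAl.
by apply: relideal_Ml; apply: pres_reprP.
Qed.

Lemma pres_ind (P : pres -> Prop) :
  (forall x, P (pres_pi x)) -> forall x, P x.
Proof. by move=> H x; rewrite -[x]pres_reprK. Qed.

Lemma pres_mulA : associative pres_mul.
Proof.
by do 3!elim/pres_ind => ?; rewrite -!pres_piM mulrA.
Qed.
Lemma pres_mul1 : left_id pres_one pres_mul.
Proof. by elim/pres_ind => x; rewrite -pres_piM mul1r. Qed.
Lemma pres_mulr1 : right_id pres_one pres_mul.
Proof. by elim/pres_ind => x; rewrite -pres_piM mulr1. Qed.
Lemma pres_mulDl : left_distributive pres_mul +%R.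
Proof.
by do 3!elim/pres_ind => ?; rewrite -!(pres_piM, pres_piD) mulrDl.
Qed.
Lemma pres_mulDr : right_distributive pres_mul +%R.
Proof.
by do 3!elim/pres_ind => ?; rewrite -!(pres_piM, pres_piD) mulrDr.
Qed.
HB.instance Definition _ := GRing.Zmodule_isPzRing.Build pres
  pres_mulA pres_mul1 pres_mulr1 pres_mulDl pres_mulDr.

Lemma pres_scaleA c d x :
  pres_scale c (pres_scale d x) = pres_scale (c * d) x.
Proof. by elim/pres_ind: x => x; rewrite -!pres_piZ scalerA. Qed.
Lemma pres_scale1 : left_id 1 pres_scale.
Proof. by elim/pres_ind => x; rewrite -!pres_piZ scale1r. Qed.
Lemma pres_scaleDr : right_distributive pres_scale +%R.
Proof.
by move=> c; do 2!elim/pres_ind => ?; rewrite -!(pres_piZ, pres_piD) scalerDr.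
Qed.
Lemma pres_scaleDl x : {morph pres_scale^~ x : c d / c + d}.
Proof.
by elim/pres_ind: x => x c d; rewrite -!(pres_piZ, pres_piD) scalerDl.
Qed.
HB.instance Definition _ := GRing.Zmodule_isLmodule.Build F pres
  pres_scaleA pres_scale1 pres_scaleDr pres_scaleDl.
End Quotient.
End Presentation.

(* The relations are indexed as usual: T i stands for T_i with 1 <= i <= n-1. *)
Section Relations.
Context (F : fieldType) (n : nat) (q z : F).

Definition qB_delta : F := (z - z^-1) / (q - q^-1).

Section InAlgebra.
Context (A : algType F) (T : nat -> A) (E : A).

(* (T_i - q)(T_i + q^-1) = 0 makes T_i invertible (for q != 0) with this
   inverse; see qB_TinvP. *)
Definition qB_Tinv (i : nat) : A := T i - (q - q^-1)%:A.

Definition qB_E2 : A := E * T 2 * T 3 * qB_Tinv 1 * qB_Tinv 2 * E.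

Inductive qB_rel : A -> A -> Prop :=
| qB_quad i : (0 < i < n)%N ->
    qB_rel ((T i - q%:A) * (T i + q^-1%:A)) 0
| qB_comm i j : (0 < i < n)%N -> (0 < j < n)%N ->
    (i.+1 < j)%N || (j.+1 < i)%N ->
    qB_rel (T i * T j) (T j * T i)
| qB_braid k : (1 <= k)%N -> (k.+1 < n)%N ->
    qB_rel (T k * T k.+1 * T k) (T k.+1 * T k * T k.+1)
| qB_EE : qB_rel (E * E) (qB_delta *: E)
| qB_TE : (1 < n)%N -> qB_rel (T 1 * E) (q *: E)
| qB_ET : (1 < n)%N -> qB_rel (E * T 1) (q *: E)
| qB_ETE : (2 < n)%N -> qB_rel (E * T 2 * E) (z *: E)
| qB_TEcomm i : (2 < i < n)%N -> qB_rel (T i * E) (E * T i)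
| qB_E2l : (3 < n)%N ->
    qB_rel (T 2 * T 3 * qB_Tinv 1 * qB_Tinv 2 * qB_E2) qB_E2
| qB_E2r : (3 < n)%N ->
    qB_rel (qB_E2 * (T 2 * T 3 * qB_Tinv 1 * qB_Tinv 2)) qB_E2.

Definition qB_relations : Prop := forall x y, qB_rel x y -> x = y.
End InAlgebra.

Lemma qB_rel_morph (A B : algType F) (T0 : nat -> A) (E0 : A)
    (T : nat -> B) (E : B) (f : {lrmorphism A -> B}) :
  (forall i, (0 < i < n)%N -> f (T0 i) = T i) -> f E0 = E ->
  forall x y, qB_rel T0 E0 x y -> qB_rel T E (f x) (f y).
Proof.
move=> fT fE x y.
have fA (c : F) : f c%:A = c%:A by rewrite linearZ /= rmorph1.
have fZ (c : F) : f (c *: E0) = c *: E by rewrite linearZ /= fE.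
have fI i : (0 < i < n)%N -> f (qB_Tinv T0 i) = qB_Tinv T i.
  by move=> Hi; rewrite /qB_Tinv rmorphB /= fT // fA.
have fE2 : (3 < n)%N -> f (qB_E2 T0 E0) = qB_E2 T E.
  move=> n3; have n2 := ltnW n3; have n1 := ltnW n2.
  by rewrite /qB_E2 !rmorphM /= fE !fI ?fT.
case=> {x y}.
- move=> i Hi; rewrite rmorph0 rmorphM /=.
  have -> : f (T0 i - q%:A) = T i - q%:A by rewrite rmorphB /= fT // fA.
  have -> : f (T0 i + q^-1%:A) = T i + q^-1%:A.
    by rewrite rmorphD /= fT // fA.
  exact: qB_quad.
- by move=> i j Hi Hj Hij; rewrite !rmorphM /= (fT i) ?(fT j) //; apply: qB_comm.
- move=> k Hk Hk1; have Hk0 : (0 < k < n)%N by rewrite Hk ltnW.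
  by rewrite !rmorphM /= (fT k) ?(fT k.+1) //; apply: qB_braid.
- by rewrite fZ rmorphM /= fE; apply: qB_EE.
- by move=> Hn; rewrite fZ rmorphM /= fE (fT 1) //; apply: qB_TE.
- by move=> Hn; rewrite fZ rmorphM /= fE (fT 1) //; apply: qB_ET.
- by move=> Hn; rewrite fZ !rmorphM /= fE (fT 2) //; apply: qB_ETE.
- move=> i /andP[Hi Hin]; have Hi0 : (0 < i < n)%N.
    by rewrite Hin andbT; apply: leq_trans Hi.
  by rewrite !rmorphM /= fE (fT i) //; apply: qB_TEcomm; rewrite Hi.
- move=> Hn; have H2 := ltnW Hn; have H1 := ltnW H2.
  by rewrite rmorphM /= fE2 // !rmorphM /= (fI 1) ?(fI 2) ?(fT 2) ?(fT 3) //;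
     apply: qB_E2l.
- move=> Hn; have H2 := ltnW Hn; have H1 := ltnW H2.
  by rewrite rmorphM /= fE2 // !rmorphM /= (fI 1) ?(fI 2) ?(fT 2) ?(fT 3) //;
     apply: qB_E2r.
Qed.

Lemma qB_relations_morph (A B : algType F) (T0 : nat -> A) (E0 : A)
    (f : {lrmorphism A -> B}) :
  (forall x y, qB_rel T0 E0 x y -> f x = f y) ->
  qB_relations (fun i => f (T0 i)) (f E0).
Proof.
move=> f_rel.
have fA (c : F) : f c%:A = c%:A by rewrite linearZ /= rmorph1.
have fI i : qB_Tinv (fun i => f (T0 i)) i = f (qB_Tinv T0 i).
  by rewrite /qB_Tinv rmorphB /= fA.
have fE2 : qB_E2 (fun i => f (T0 i)) (f E0) = f (qB_E2 T0 E0).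
  by rewrite /qB_E2 !rmorphM /= !fI.
move=> x y; case=> {x y}.
- move=> i Hi; have := f_rel _ _ (qB_quad T0 E0 Hi).
  by rewrite rmorph0 rmorphM rmorphB rmorphD /= !fA.
- by move=> i j Hi Hj Hij; rewrite -!rmorphM; apply/f_rel/qB_comm.
- by move=> k Hk Hk1; rewrite -!rmorphM; apply/f_rel/qB_braid.
- by rewrite -rmorphM -linearZ; apply/f_rel/qB_EE.
- by move=> Hn; rewrite -rmorphM -linearZ; apply/f_rel/qB_TE.
- by move=> Hn; rewrite -rmorphM -linearZ; apply/f_rel/qB_ET.
- by move=> Hn; rewrite -!rmorphM -linearZ; apply/f_rel/qB_ETE.
- by move=> i Hi; rewrite -!rmorphM; apply/f_rel/qB_TEcomm.
- by move=> Hn; rewrite !fI fE2 -!rmorphM; apply/f_rel/qB_E2l.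
- by move=> Hn; rewrite !fI fE2 -!rmorphM; apply/f_rel/qB_E2r.
Qed.

Lemma qB_TinvP (A : algType F) (T : nat -> A) (E : A) (i : nat) :
  q != 0 -> qB_relations T E -> (0 < i < n)%N ->
  T i * qB_Tinv T i = 1 /\ qB_Tinv T i * T i = 1.
Proof.
move=> q0 rel Hi; have H := rel _ _ (qB_quad T E Hi).
rewrite mulrBl !mulrDr -!scalerAl -!scalerAr !mul1r !mulr1 in H.
rewrite scalerA divff // scale1r in H.
have key : T i * T i - (q - q^-1) *: T i = 1.
  by apply/eqP; rewrite -subr_eq0 -[X in _ == X]H scalerBl opprB opprD !addrA.
split; first by rewrite /qB_Tinv mulrBr -scalerAr mulr1.
by rewrite /qB_Tinv mulrBl -scalerAl mul1r.
Qed.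

Definition qB_index : choiceType := {i : nat | (0 < i < n)%N}.

(* Some i is the generator T_i and None is E_1. *)
Definition qB_free : algType F := free_alg F (option qB_index).
(* The value outside 1 <= i <= n-1 never occurs in the relations. *)
Definition qB_freeT (i : nat) : qB_free :=
  if insub i : option qB_index is Some j then free_gen F (Some j) else 0.
Definition qB_freeE : qB_free := free_gen F None.

Definition qBrauer := pres (qB_rel qB_freeT qB_freeE).
HB.instance Definition _ := GRing.PzRing.on qBrauer.
HB.instance Definition _ := GRing.Lmodule.on qBrauer.

Lemma relideal_eval (B : algType F) (T : nat -> B) (E : B)
    (f : {lrmorphism qB_free -> B}) :
  (forall i, (0 < i < n)%N -> f (qB_freeT i) = T i) -> f qB_freeE = E ->
  qB_relations T E ->
  forall x, in_relideal (qB_rel qB_freeT qB_freeE) x -> f x = 0.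
Proof.
move=> fT fE rTE x; elim=> {x}.
- move=> x y /(qB_rel_morph fT fE) /rTE fxy.
  by rewrite rmorphB /= fxy subrr.
- exact: rmorph0.
- by move=> x y _ fx _ fy; rewrite rmorphD /= fx fy addr0.
- by move=> a x _ fx; rewrite rmorphM /= fx mulr0.
- by move=> a x _ fx; rewrite rmorphM /= fx mul0r.
Qed.

Definition qB_gen_eval (B : algType F) (T : nat -> B) (E : B) :
    option qB_index -> B :=
  fun g => if g is Some j then T (val j) else E.

Lemma qB_free_evalT (B : algType F) (T : nat -> B) (E : B) i :
  (0 < i < n)%N -> free_eval (qB_gen_eval T E) (qB_freeT i) = T i.
Proof.
move=> Hi; rewrite /qB_freeT.
by case: insubP => [j _ <-|]; rewrite ?Hi // free_eval_gen.
Qed.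

Lemma qB_free_evalE (B : algType F) (T : nat -> B) (E : B) :
  free_eval (qB_gen_eval T E) qB_freeE = E.
Proof. by rewrite free_eval_gen. Qed.

(* T_i |-> q, E_1 |-> 0 is a one-dimensional representation. *)
Lemma qB_trivial_rep : qB_relations (fun _ => q : F^o) 0.
Proof.
move=> x y; case=> {x y}.
- by move=> i _; rewrite /GRing.scale /= mulr1 subrr mul0r.
- by [].
- by [].
- by rewrite mulr0 scaler0.
- by rewrite mulr0 scaler0.
- by rewrite mul0r scaler0.
- by rewrite mulr0 scaler0.
- by rewrite mulr0 mul0r.
- by rewrite /qB_E2 !mulr0.
- by rewrite /qB_E2 !mulr0 mul0r.
Qed.

Lemma qBrauer_one_neq0 : (1 : qBrauer) != 0.
Proof.
apply/eqP => one0.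
have /pres_piP := etrans one0 (esym (pres_pi0 (qB_rel qB_freeT qB_freeE))).
rewrite subr0 => ideal1.
have := relideal_eval (@qB_free_evalT F^o _ 0) (qB_free_evalE _ _)
  qB_trivial_rep ideal1.
by rewrite rmorph1 => /eqP; rewrite oner_eq0.
Qed.
HB.instance Definition _ := GRing.PzSemiRing_isNonZero.Build qBrauer
  qBrauer_one_neq0.

Lemma qBrauer_scalerAl (c : F) (x y : qBrauer) : c *: (x * y) = (c *: x) * y.
Proof.
elim/pres_ind: x => x; elim/pres_ind: y => y.
by rewrite /GRing.mul /GRing.scale /= -!(pres_piM, pres_piZ) scalerAl.
Qed.
HB.instance Definition _ := GRing.Lmodule_isLalgebra.Build F qBrauer
  qBrauer_scalerAl.

Lemma qBrauer_scalerAr (c : F) (x y : qBrauer) : c *: (x * y) = x * (c *: y).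
Proof.
elim/pres_ind: x => x; elim/pres_ind: y => y.
by rewrite /GRing.mul /GRing.scale /= -!(pres_piM, pres_piZ) scalerAr.
Qed.
HB.instance Definition _ := GRing.Lalgebra_isAlgebra.Build F qBrauer
  qBrauer_scalerAr.

Definition qB_pi (x : qB_free) : qBrauer := pres_pi _ x.

Lemma qB_pi_zmod : zmod_morphism qB_pi.
Proof. exact: pres_piB. Qed.
HB.instance Definition _ := GRing.isZmodMorphism.Build qB_free qBrauer qB_pi
  qB_pi_zmod.
Lemma qB_pi_monoid : monoid_morphism qB_pi.
Proof. split; [exact: erefl | exact: pres_piM]. Qed.
HB.instance Definition _ := GRing.isMonoidMorphism.Build qB_free qBrauer qB_pi
  qB_pi_monoid.
Lemma qB_pi_scalable : scalable qB_pi.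
Proof. by move=> c x; exact: pres_piZ. Qed.
HB.instance Definition _ := GRing.isScalable.Build F qB_free qBrauer *:%R qB_pi
  qB_pi_scalable.

Lemma qB_ind (P : qBrauer -> Prop) : (forall x, P (qB_pi x)) -> forall x, P x.
Proof. exact: pres_ind. Qed.

Definition qB_T (i : nat) : qBrauer := qB_pi (qB_freeT i).
Definition qB_E : qBrauer := qB_pi qB_freeE.

Lemma qBrauer_relations : qB_relations qB_T qB_E.
Proof.
apply: (qB_relations_morph (f := qB_pi)) => x y xy.
by apply/pres_piP; apply: relideal_gen.
Qed.

Section Universal.
Context (B : algType F) (T : nat -> B) (E : B) (relTE : qB_relations T E).

Definition qB_lift (x : qBrauer) : B := free_eval (qB_gen_eval T E) (repr x).

Lemma qB_liftE x : qB_lift (qB_pi x) = free_eval (qB_gen_eval T E) x.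
Proof.
apply/eqP; rewrite -subr_eq0 -rmorphB /=; apply/eqP.
apply: (relideal_eval (@qB_free_evalT B T E) (qB_free_evalE _ _) relTE).
exact: pres_reprP.
Qed.

Lemma qB_lift_zmod : zmod_morphism qB_lift.
Proof.
elim/qB_ind => x; elim/qB_ind => y.
by rewrite -(rmorphB qB_pi) !qB_liftE rmorphB.
Qed.
Lemma qB_lift_monoid : monoid_morphism qB_lift.
Proof.
split; first by rewrite -(rmorph1 qB_pi) qB_liftE rmorph1.
elim/qB_ind => x; elim/qB_ind => y.
by rewrite -(rmorphM qB_pi) !qB_liftE rmorphM.
Qed.
Lemma qB_lift_scalable : scalable qB_lift.
Proof.
move=> c; elim/qB_ind => x.
by rewrite -(linearZ_LR qB_pi) !qB_liftE linearZ_LR.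
Qed.
HB.instance Definition _ := GRing.isZmodMorphism.Build qBrauer B qB_lift
  qB_lift_zmod.
HB.instance Definition _ := GRing.isMonoidMorphism.Build qBrauer B qB_lift
  qB_lift_monoid.
HB.instance Definition _ := GRing.isScalable.Build F qBrauer B *:%R qB_lift
  qB_lift_scalable.

Theorem qBrauer_universal :
  exists2 f : {lrmorphism qBrauer -> B},
    (forall i, (0 < i < n)%N -> f (qB_T i) = T i) /\ f qB_E = E &
    forall g : {lrmorphism qBrauer -> B},
      (forall i, (0 < i < n)%N -> g (qB_T i) = T i) -> g qB_E = E -> g =1 f.
Proof.
have liftT i : (0 < i < n)%N -> qB_lift (qB_T i) = T i.
  by move=> Hi; rewrite /qB_T qB_liftE qB_free_evalT.
have liftE : qB_lift qB_E = E by rewrite /qB_E qB_liftE qB_free_evalE.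
exists qB_lift => // g gT gE; elim/qB_ind => x.
apply: (free_alg_ext (f := g \o qB_pi) (h := qB_lift \o qB_pi)) => -[j|] /=.
  have Hj := valP j; have -> : free_gen F (Some j) = qB_freeT (val j).
    by rewrite /qB_freeT valK.
  by rewrite -/(qB_T _) gT // liftT.
by rewrite -/qB_freeE -/qB_E gE liftE.
Qed.
End Universal.
End Relations.

(* Main.v *)
From HB Require Import structures.
Require Import Defs.
From mathcomp Require Import all_boot all_order all_algebra.
From mathcomp Require Import boolp monalg ring zify.

Set Implicit Arguments.
Unset Strict Implicit.
Unset Printing Implicit Defensive.

Import Order.TTheory GRing.Theory Num.Theory.
Local Open Scope ring_scope.

(** The algebra B_n on n points is compared with the Hecke algebra H_n generated by the T_i,
    which is the quotient of B_n by the ideal of E, and with the algebra on n - 2 points, which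
    is the corner of E.

    Semisimplicity is expressed through complete systems of orthogonal idempotents p with
    p A p = F p whose nonzero matrix coefficients are invertible (min_idems). Such systems give
    semisimplicity and a splitting into matrix algebras, and conversely a split semisimple
    algebra has one. So it suffices to construct a system when the condition holds, and to
    show that a semisimple B_n satisfies the condition.

    Sufficiency is proved by induction on n (brauer_split). If the powers q^2, ..., q^2n are
    not 1, then the Jucys-Murphy elements of H_n are diagonalisable, their joint eigenvalues
    are the content sequences of standard tableaux (Kall), and the projections to the joint
    eigenspaces form a system for H_n (pid_corner, pid_link). For the ideal of E, the
    idempotents of the algebra on n - 2 points are transported to the corner of E and spread
    over the left ideal A E, which works as soon as E A acts faithfully on A E and dually
    (brauer_idems). For faithfulness, the sum of all conjugates of E commutes with H_n and acts
    on A E, modulo the ideal of the element E2 with two arcs, through a central element of H_n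
    (qQ_E). A vector killed by E A would be an eigenvector with eigenvalue q^2 / z^2, so that z^2
    would be a power q^2a, and the combinatorics of the last two contents confines a to the
    range in the theorem (content_sum, T_last_spectrum).

    For necessity all B_n act on functions of perfect matchings of the natural numbers
    (rho_relations). If B_n is semisimple and q^2j = 1 for some j <= n, then the symmetriser of
    H_n would have to lie in the ideal of E, which the action excludes (qfact_neq0). If z^2 = q^2a for an exponent in
    the range, then at the smallest such n the value of a is 4 - 2n, 4 - n or n - 2, and for
    these three values a functional on functions of matchings is written down that factors
    through E and is killed by B_n E (hook_e1, hook_e12, hook_e2). Such a functional is
    incompatible with the unit that the ideal of E has in a semisimple algebra
    (bad_not_semisimple). The same functional works on one more point (kill_next), and adding
    an arc carries the argument from n to n + 2 (bad_step). *)

(** * Identities in noncommutative algebras *)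

Inductive nc_expr (F : Type) :=
| NCvar of nat | NCzero | NCone
| NCadd of nc_expr F & nc_expr F
| NCopp of nc_expr F
| NCmul of nc_expr F & nc_expr F
| NCscale of F & nc_expr F.
Arguments NCvar {F}. Arguments NCzero {F}. Arguments NCone {F}.

Section NC.
Context (F : fieldType) (A : algType F).
Implicit Types (e : nc_expr F) (env : seq A) (w : seq nat).

Fixpoint nc_eval env e : A :=
  match e with
  | NCvar i => nth 0 env i
  | NCzero => 0
  | NCone => 1
  | NCadd a b => nc_eval env a + nc_eval env b
  | NCopp a => - nc_eval env a
  | NCmul a b => nc_eval env a * nc_eval env b
  | NCscale c a => c *: nc_eval env a
  end.

Fixpoint nc_word env w : A :=
  if w is i :: w' then nth 0 env i * nc_word env w' else 1.

(** A noncommutative polynomial is a list of coefficients with words in the variables, so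
    that comparing normal forms leaves only equations between coefficients. *)
Fixpoint nc_poly env (p : seq (F * seq nat)) : A :=
  if p is (c, w) :: p' then c *: nc_word env w + nc_poly env p' else 0.

Fixpoint nat_eqb (m n : nat) :=
  match m, n with
  | 0, 0 => true
  | S m', S n' => nat_eqb m' n'
  | _, _ => false
  end%N.

Fixpoint word_eqb (v w : seq nat) :=
  match v, w with
  | [::], [::] => true
  | i :: v', j :: w' => if nat_eqb i j then word_eqb v' w' else false
  | _, _ => false
  end.

Fixpoint nc_insert (c : F) w (p : seq (F * seq nat)) :=
  match p with
  | [::] => [:: (c, w)]
  | cons (d, v) p' =>
      if word_eqb w v then (c + d, v) :: p' else (d, v) :: nc_insert c w p'
  end.

Fixpoint nc_append (v w : seq nat) := if v is i :: v' then i :: nc_append v' w else w.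

Fixpoint nc_add (p r : seq (F * seq nat)) :=
  match p with [::] => r | cons (c, w) p' => nc_insert c w (nc_add p' r) end.

Fixpoint nc_scale (c : F) (p : seq (F * seq nat)) :=
  match p with [::] => [::] | cons (d, w) p' => (c * d, w) :: nc_scale c p' end.

Fixpoint nc_opp (p : seq (F * seq nat)) :=
  match p with [::] => [::] | cons (d, w) p' => (- d, w) :: nc_opp p' end.

Fixpoint nc_mulm (c : F) w (p : seq (F * seq nat)) :=
  match p with
  | [::] => [::]
  | cons (d, v) p' => (c * d, nc_append w v) :: nc_mulm c w p'
  end.

Fixpoint nc_mul (p r : seq (F * seq nat)) :=
  match p with
  | [::] => [::]
  | cons (c, w) p' => nc_add (nc_mulm c w r) (nc_mul p' r)
  end.

Fixpoint nc_norm e : seq (F * seq nat) :=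
  match e with
  | NCvar i => [:: (1, [:: i])]
  | NCzero => [::]
  | NCone => [:: (1, [::])]
  | NCadd a b => nc_add (nc_norm a) (nc_norm b)
  | NCopp a => nc_opp (nc_norm a)
  | NCmul a b => nc_mul (nc_norm a) (nc_norm b)
  | NCscale c a => nc_scale c (nc_norm a)
  end.

Fixpoint nc_null (p : seq (F * seq nat)) : Prop :=
  match p with [::] => True | cons (c, _) p' => c = 0 /\ nc_null p' end.

Lemma nat_eqbP m n : nat_eqb m n = (m == n).
Proof. by elim: m n => [|m IH] [|n] //=; rewrite IH. Qed.

Lemma word_eqbP v w : word_eqb v w = (v == w).
Proof.
elim: v w => [|i v IH] [|j w] //=; rewrite nat_eqbP eqseq_cons IH.
by case: (i == j).
Qed.

Lemma nc_insertE env c w p :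
  nc_poly env (nc_insert c w p) = c *: nc_word env w + nc_poly env p.
Proof.
elim: p => [|[d v] p IH] //=; rewrite word_eqbP; case: eqP => [->|_] /=.
  by rewrite scalerDl addrA.
by rewrite IH addrCA.
Qed.

Lemma nc_appendE env v w :
  nc_word env (nc_append v w) = nc_word env v * nc_word env w.
Proof. by elim: v => [|i v IH] /=; rewrite ?mul1r // IH mulrA. Qed.

Lemma nc_addE env p r : nc_poly env (nc_add p r) = nc_poly env p + nc_poly env r.
Proof.
by elim: p => [|[c w] p IH] /=; rewrite ?add0r // nc_insertE IH addrA.
Qed.

Lemma nc_scaleE env c p : nc_poly env (nc_scale c p) = c *: nc_poly env p.
Proof.
by elim: p => [|[d w] p IH] /=; rewrite ?scaler0 // IH scalerDr scalerA.
Qed.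

Lemma nc_oppE env p : nc_poly env (nc_opp p) = - nc_poly env p.
Proof.
by elim: p => [|[d w] p IH] /=; rewrite ?oppr0 // IH opprD scaleNr.
Qed.

Lemma nc_mulmE env c w p :
  nc_poly env (nc_mulm c w p) = c *: nc_word env w * nc_poly env p.
Proof.
elim: p => [|[d v] p IH] /=; first by rewrite mulr0.
by rewrite IH nc_appendE mulrDr -!scalerAl -scalerAr scalerA.
Qed.

Lemma nc_mulE env p r : nc_poly env (nc_mul p r) = nc_poly env p * nc_poly env r.
Proof.
elim: p => [|[d v] p IH] /=; first by rewrite mul0r.
by rewrite nc_addE nc_mulmE IH mulrDl.
Qed.

Lemma nc_normE env e : nc_poly env (nc_norm e) = nc_eval env e.
Proof.
elim: e => [i|||a IHa b IHb|a IHa|a IHa b IHb|c a IHa] //=.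
- by rewrite scale1r mulr1 addr0.
- by rewrite scale1r addr0.
- by rewrite nc_addE IHa IHb.
- by rewrite nc_oppE IHa.
- by rewrite nc_mulE IHa IHb.
- by rewrite nc_scaleE IHa.
Qed.

Lemma nc_nullE env p : nc_null p -> nc_poly env p = 0.
Proof. by elim: p => [|[c w] p IH] //= [-> /IH ->]; rewrite scale0r addr0. Qed.

Lemma nc_correct env a b :
  nc_null (nc_norm (NCadd a (NCopp b))) -> nc_eval env a = nc_eval env b.
Proof.
by move=> /(nc_nullE env); rewrite nc_normE /= => /eqP; rewrite subr_eq0 => /eqP.
Qed.
End NC.

Ltac nc_mem x l :=
  lazymatch l with
  | [::] => constr:(false)
  | x :: _ => constr:(true)
  | _ :: ?l' => nc_mem x l'
  end.
Ltac nc_index x l :=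
  lazymatch l with
  | x :: _ => constr:(0%N)
  | _ :: ?l' => let i := nc_index x l' in constr:(S i)
  end.
Ltac nc_atoms t l :=
  lazymatch t with
  | @GRing.add _ ?a ?b => let l' := nc_atoms a l in nc_atoms b l'
  | @GRing.opp _ ?a => nc_atoms a l
  | @GRing.mul _ ?a ?b => let l' := nc_atoms a l in nc_atoms b l'
  | @GRing.scale _ _ _ ?a => nc_atoms a l
  | @GRing.zero _ => l
  | @GRing.one _ => l
  | _ => lazymatch nc_mem t l with true => l | false => constr:(t :: l) end
  end.
Ltac nc_reify F t l :=
  lazymatch t with
  | @GRing.add _ ?a ?b =>
      let a' := nc_reify F a l in let b' := nc_reify F b l in
      constr:(@NCadd F a' b')
  | @GRing.opp _ ?a => let a' := nc_reify F a l in constr:(@NCopp F a')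
  | @GRing.mul _ ?a ?b =>
      let a' := nc_reify F a l in let b' := nc_reify F b l in
      constr:(@NCmul F a' b')
  | @GRing.scale _ _ ?c ?a => let a' := nc_reify F a l in constr:(@NCscale F c a')
  | @GRing.zero _ => constr:(@NCzero F)
  | @GRing.one _ => constr:(@NCone F)
  | _ => let i := nc_index t l in constr:(@NCvar F i)
  end.
Ltac nc_with A :=
  lazymatch goal with
  | |- @eq _ ?a ?b =>
    let F := lazymatch type of A with GRing.Algebra.type ?F => F end in
    let l0 := nc_atoms a (@nil A) in
    let l := nc_atoms b l0 in
    let ea := nc_reify F a l in
    let eb := nc_reify F b l in
    change (nc_eval (A := A) l ea = nc_eval (A := A) l eb);
    apply: nc_correct;
    cbv [nc_norm nc_add nc_opp nc_mul nc_scale nc_insert nc_mulm nc_append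
         word_eqb nat_eqb nc_null];
    repeat (apply: conj); try exact: I; try ring
  end.
Ltac nc := match goal with A : GRing.Algebra.type _ |- _ => nc_with A end.

(** An equality holds as soon as the difference of its sides is, by free
    expansion, a combination of known relations. *)
Lemma nc_cert_eq (V : zmodType) (x y t : V) : x - y = t -> t = 0 -> x = y.
Proof. by move=> <- /eqP; rewrite subr_eq0 => /eqP. Qed.
Ltac nc_cert t := apply: (@nc_cert_eq _ _ _ t); [nc |].

(** * Opposite algebras and generated subalgebras *)

(** Statements about left ideals are proved once and read on the right in this algebra. *)
Definition op_alg (F : fieldType) (A : algType F) : Type := A.
Section OpAlg.
Context (F : fieldType) (A : algType F).
HB.instance Definition _ := GRing.Lmodule.on (op_alg A).
Let opmul (x y : op_alg A) : op_alg A := (y : A) * (x : A).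
Fact op_mulA : associative opmul. Proof. by move=> x y z; rewrite /opmul mulrA. Qed.
Fact op_mul1 : left_id (1 : A) opmul. Proof. by move=> x; rewrite /opmul mulr1. Qed.
Fact op_mulr1 : right_id (1 : A) opmul. Proof. by move=> x; rewrite /opmul mul1r. Qed.
Fact op_mulDl : left_distributive opmul +%R.
Proof. by move=> x y z; rewrite /opmul mulrDr. Qed.
Fact op_mulDr : right_distributive opmul +%R.
Proof. by move=> x y z; rewrite /opmul mulrDl. Qed.
HB.instance Definition _ := GRing.Zmodule_isPzRing.Build (op_alg A)
  op_mulA op_mul1 op_mulr1 op_mulDl op_mulDr.
Fact op_one_neq0 : (1 : op_alg A) != 0. Proof. by apply/eqP => /(congr1 (fun x => x : A)) /eqP; rewrite (negPf (oner_neq0 A)). Qed.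
HB.instance Definition _ := GRing.PzSemiRing_isNonZero.Build (op_alg A) op_one_neq0.
Fact op_scaleAl (c : F) (x y : op_alg A) : c *: (x * y) = (c *: x : op_alg A) * y.
Proof. exact: (@scalerAr F A c (y : A) (x : A)). Qed.
HB.instance Definition _ := GRing.Lmodule_isLalgebra.Build F (op_alg A) op_scaleAl.
Fact op_scaleAr (c : F) (x y : op_alg A) : c *: (x * y) = x * (c *: y : op_alg A).
Proof. exact: (@scalerAl F A c (y : A) (x : A)). Qed.
HB.instance Definition _ := GRing.Lalgebra_isAlgebra.Build F (op_alg A) op_scaleAr.
End OpAlg.

Section InAlg.
Context (F : fieldType) (A : algType F).
Inductive in_alg_of (S : A -> Prop) : A -> Prop :=
| ia_gen x : S x -> in_alg_of S x
| ia_scal c : in_alg_of S c%:A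
| ia_add x y : in_alg_of S x -> in_alg_of S y -> in_alg_of S (x + y)
| ia_mul x y : in_alg_of S x -> in_alg_of S y -> in_alg_of S (x * y).
Context (S : A -> Prop).
Lemma ia_one : in_alg_of S 1. Proof. by rewrite -[1]scale1r; apply: ia_scal. Qed.
Lemma ia_zero : in_alg_of S 0. Proof. by rewrite -[0](scale0r 1); apply: ia_scal. Qed.
Lemma ia_scale c x : in_alg_of S x -> in_alg_of S (c *: x).
Proof. by move=> Sx; rewrite -[x]mul1r scalerAl; apply: ia_mul => //; apply: ia_scal. Qed.
Lemma ia_opp x : in_alg_of S x -> in_alg_of S (- x).
Proof. by rewrite -scaleN1r; apply: ia_scale. Qed.
Lemma ia_sub x y : in_alg_of S x -> in_alg_of S y -> in_alg_of S (x - y).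
Proof. by move=> Sx Sy; apply: ia_add => //; apply: ia_opp. Qed.
Lemma ia_sum (I : Type) (r : seq I) (P : pred I) (f : I -> A) :
  (forall i, P i -> in_alg_of S (f i)) -> in_alg_of S (\sum_(i <- r | P i) f i).
Proof. by move=> H; apply: big_ind => //; [exact: ia_zero | exact: ia_add]. Qed.
Lemma ia_comm y x : (forall s, S s -> s * y = y * s) -> in_alg_of S x -> x * y = y * x.
Proof.
move=> H; elim=> {x} [x /H //|c|x1 x2 _ H1 _ H2|x1 x2 _ H1 _ H2].
- by rewrite -scalerAl -scalerAr mul1r mulr1.
- by rewrite mulrDl mulrDr H1 H2.
- by rewrite -mulrA H2 mulrA H1 mulrA.
Qed.
Lemma ia_sub_gen (S' : A -> Prop) x :
  (forall s, S s -> in_alg_of S' s) -> in_alg_of S x -> in_alg_of S' x.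
Proof.
move=> H; elim=> {x} [x /H //|c|x1 x2 _ H1 _ H2|x1 x2 _ H1 _ H2].
- exact: ia_scal.
- exact: ia_add.
- exact: ia_mul.
Qed.
End InAlg.

(** * Systems of minimal idempotents *)

(** The diagonal matrix units of a product of matrix algebras, without a choice of the blocks:
    p and r lie in the same block when some corner p x r is nonzero, and such corners are
    invertible by the last condition. The zero idempotent may occur. *)
Definition min_idems (F : fieldType) (A : algType F) (ps : seq A) : Prop :=
  [/\ \sum_(p <- ps) p = 1,
      forall p, p \in ps -> p * p = p,
      forall p r, p \in ps -> r \in ps -> p != r -> p * r = 0,
      forall p x, p \in ps -> exists c, p * x * p = c *: p &
      forall p r x, p \in ps -> r \in ps -> p * x * r != 0 ->
        exists y, p * x * r * y * p = p].

Definition split_idems (F : fieldType) (A : algType F) : Prop :=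
  exists ps : seq A, min_idems ps.

Lemma seq_choice (T : eqType) (B : Type) (b0 : B) (s : seq T) (P : T -> B -> Prop) :
  (forall x, x \in s -> exists b, P x b) ->
  exists f : T -> B, forall x, x \in s -> P x (f x).
Proof.
move=> H; suff /choice[f Hf] : forall x, exists b, x \in s -> P x b by exists f.
by move=> x; have [/H[b Pb]|_] := boolP (x \in s); [exists b | exists b0].
Qed.

Section MinIdems.
Context (F : fieldType) (A : algType F) (ps : seq A) (psP : min_idems ps).

Lemma mi_sum : \sum_(p <- ps) p = 1. Proof. by case: psP. Qed.
Lemma mi_idem p : p \in ps -> p * p = p. Proof. by case: psP => _ H _ _ _; apply: H. Qed.
Lemma mi_orth p r : p \in ps -> r \in ps -> p != r -> p * r = 0.
Proof. by case: psP => _ _ H _ _; apply: H. Qed.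
Lemma mi_scal p x : p \in ps -> exists c, p * x * p = c *: p.
Proof. by case: psP => _ _ _ H _; apply: H. Qed.
Lemma mi_inv p r x : p \in ps -> r \in ps -> p * x * r != 0 ->
  exists y, p * x * r * y * p = p.
Proof. by case: psP => _ _ _ _ H; apply: H. Qed.

Lemma mi_neq0 x : x != 0 -> exists2 p, p \in ps & p * x != 0.
Proof.
move=> x0; apply: contrapT => H; move/eqP: x0; apply.
rewrite -[x]mul1r -mi_sum mulr_suml big1_seq // => p /andP[_ pin].
by apply/eqP/negP => /negP px; apply: H; exists p.
Qed.

Lemma mi_neq0r x : x != 0 -> exists2 p, p \in ps & x * p != 0.
Proof.
move=> x0; apply: contrapT => H; move/eqP: x0; apply.
rewrite -[x]mulr1 -mi_sum mulr_sumr big1_seq // => p /andP[_ pin].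
by apply/eqP/negP => /negP px; apply: H; exists p.
Qed.

Lemma mi_simple p a : p \in ps -> a * p != 0 -> exists b, b * (a * p) = p.
Proof.
move=> pin ap0; have [r rin rap0] := mi_neq0 ap0.
rewrite mulrA in rap0; have [y Hy] := mi_inv rin pin rap0.
have [c Hc] := mi_scal (y * r * a) pin.
have c0 : c != 0.
  apply: contra_neq rap0 => c0; rewrite c0 scale0r in Hc.
  have -> : r * a * p = r * a * p * y * r * (r * a * p) by rewrite Hy !mulrA mi_idem.
  have -> : r * a * p * y * r * (r * a * p) = r * a * (p * (y * (r * r) * a) * p) by nc.
  by rewrite mi_idem // Hc mulr0.
exists (c^-1 *: (p * y * r)); rewrite -scalerAl.
have -> : p * y * r * (a * p) = p * (y * r * a) * p by nc.
by rewrite Hc scalerA mulVf // scale1r.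
Qed.

(** Each A p is a simple left module by mi_simple. A complement of U is built by going through
    the idempotents: A p is either contained in what is already there or meets it trivially,
    and is then added to the complement. *)
Lemma min_idems_semisimple : semisimple A.
Proof.
move=> U [U0 Ulin].
suff H (l : seq A) : {subset l <= ps} -> exists W : {pred A^o},
    [/\ submod_closed W, forall v, v \in U -> v \in W -> v = 0 &
        forall p, p \in l -> exists u w, [/\ u \in U, w \in W & p = u + w]].
  have [//|W [sW W0 Wps]] := H ps; exists W; split => // v.
  have [W00 Wlin] := sW.
  have : v = \sum_(p <- ps) v * p by rewrite -mulr_sumr mi_sum mulr1.
  have [f Hf] : exists f : A -> A * A, forall p, p \in ps ->
      [/\ (f p).1 \in U, (f p).2 \in W & p = (f p).1 + (f p).2].
      apply: (@seq_choice _ _ (0, 0) ps (fun (p : A) (uw : A * A) =>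
       [/\ uw.1 \in U, uw.2 \in W & p = uw.1 + uw.2])) => p /Wps[u [w H3]].
    by exists (u, w).
  move=> ->; exists (\sum_(p <- ps) v * (f p).1), (\sum_(p <- ps) v * (f p).2).
  have sumU (V : {pred A^o}) (g : A -> A) : submod_closed V ->
      (forall p, p \in ps -> g p \in V) -> \sum_(p <- ps) v * g p \in V.
    move=> [V0 Vlin] gV; rewrite big_seq; apply: (big_ind (fun x => x \in V)) => //.
      by move=> x y Vx Vy; rewrite -[x]scale1r; apply: Vlin.
    by move=> p pin; rewrite -[v * _]addr0; apply: (Vlin v) => //; apply: gV.
  split; [apply: sumU => // p /Hf[] // | apply: sumU => // p /Hf[] // |].
  by rewrite -big_split /= big_seq [RHS]big_seq; apply: eq_bigr => p /Hf[_ _ {1}->];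
     rewrite mulrDr.
elim: l => [|p l IH] lps.
  exists (fun x => x == 0); split => //.
  - split; first exact: eqxx.
    by move=> a u v; rewrite !unfold_in => /eqP-> /eqP->; rewrite scaler0 addr0.
  - by move=> v _; rewrite unfold_in => /eqP.
have [|W [[W0 Wlin] UW Wl]] := IH; first by move=> x xl; apply: lps; rewrite inE xl orbT.
have pin : p \in ps by apply: lps; rewrite inE eqxx.
case: (pselect (exists u w, [/\ u \in U, w \in W & p = u + w])) => [Hp|Hp].
  exists W; split => // x; rewrite inE => /predU1P[->//|]; exact: Wl.
have Hap a u w : u \in U -> w \in W -> a * p = u + w -> a * p = 0.
  move=> Uu Ww apE; apply: contrapT => /eqP /(mi_simple pin) [b bap].
  apply: Hp; exists (b * u), (b * w); split.
  - by rewrite -[b * u]addr0; apply: (Ulin b).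
  - by rewrite -[b * w]addr0; apply: (Wlin b).
  - by rewrite -mulrDr -apE.
exists (fun x => `[< exists w a, w \in W /\ x = w + a * p >]); split.
- split; first by apply/asboolP; exists 0, 0; rewrite mul0r addr0.
  move=> c x y /asboolP[w [a [Ww ->]]] /asboolP[w' [a' [Ww' ->]]].
  apply/asboolP; exists (c *: w + w'), (c * a + a'); split; first exact: Wlin.
  by rewrite mulrDl scalerDr addrACA -mulrA.
- move=> v Uv /asboolP[w [a [Ww vE]]].
  have ap0 : a * p = 0.
    apply: (Hap a v ((-1 : A) *: w : A^o)) => //.
      by rewrite -[_ *: _]addr0; apply: (Wlin (-1)).
    by rewrite vE [_ *: w]mulN1r addrAC subrr add0r.
  by rewrite ap0 addr0 in vE; apply: UW => //; rewrite vE.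
- move=> x; rewrite inE => /predU1P[->|/Wl[u [w [Uu Ww xE]]]].
    exists 0, p; split; rewrite ?add0r //; apply/asboolP; exists 0, 1.
    by rewrite mul1r add0r.
  exists u, w; split => //; apply/asboolP; exists w, 0.
  by rewrite mul0r addr0.
Qed.
End MinIdems.

Lemma split_semisimple_idems (F : fieldType) (A : algType F) :
  split_semisimple A -> split_idems A.
Proof.
move=> [k [d [phi [inj sur]]]].
pose D (i : 'I_k) (a b : nat) : forall j, 'M[F]_((d j).+1) := fun j =>
  \matrix_(r, s) ((j == i) && (r == a :> nat) && (s == b :> nat))%:R.
have /choice[e He] : forall t : {i : 'I_k & 'I_(d i).+1}, exists a : A,
   forall j, phi j a = D (tag t) (tagged t) (tagged t) j.
  by move=> t; apply: (sur (D (tag t) (tagged t) (tagged t))).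
exists [seq e t | t <- enum {: {i : 'I_k & 'I_(d i).+1}}].
have De i (a b : 'I_(d i).+1) : D i a b i = delta_mx a b.
  by apply/matrixP => r s; rewrite !mxE eqxx.
have D0 i j a b : j != i -> D i a b j = 0.
  by move=> /negPf ji; apply/matrixP => r s; rewrite !mxE ji.
have dXd n (X : 'M[F]_n.+1) a b : delta_mx a a *m X *m delta_mx b b = X a b *: delta_mx a b.
  apply/matrixP => r s; rewrite !mxE (bigD1 b) //= big1 => [|j jb]; last first.
    by rewrite !mxE (negPf jb) mulr0.
  rewrite !mxE eqxx /= (bigD1 a) //= big1 => [|j ja]; last first.
    by rewrite !mxE (negPf ja) andbF mul0r.
  rewrite !mxE eqxx andbT !addr0.
  by case: (r == a); case: (s == b); rewrite ?mul1r ?mulr1 ?mulr0 ?mul0r.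
have eXe t1 t2 x j : phi j (e t1 * x * e t2) =
   if (j == tag t1) && (j == tag t2) then phi j (e t1 * x * e t2) else 0.
  case: ifP => // /negbT; rewrite negb_and !rmorphM /= !He => /orP[] /D0 ->.
    by rewrite !mul0r.
  by rewrite mulr0.
split.
- rewrite big_map big_enum /=; apply: inj => j; rewrite raddf_sum rmorph1 /=.
  apply/matrixP => r s; rewrite summxE.
  rewrite (bigD1 (Tagged (fun i => 'I_(d i).+1) r)) //= He !mxE /= !eqxx /=.
  rewrite big1 ?addr0 => [|[i a] ne]; first by rewrite eq_sym.
  rewrite He !mxE /=; case: eqP => //= ij; subst i.
  case: eqP => //= ra; move/eqP: ne; case; congr Tagged.
  by apply/val_inj => /=; rewrite ra.
- move=> _ /mapP[t _ ->]; apply: inj => j; rewrite rmorphM /= !He.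
  case: (eqVneq j (tag t)) => [jt|/D0->]; last by rewrite mul0r.
  by subst j; rewrite De [_ * _]mul_delta_mx.
- move=> _ _ /mapP[t _ ->] /mapP[t' _ ->] ne; apply: inj => j.
  rewrite rmorphM rmorph0 /= !He; case: (eqVneq j (tag t)) => [jt|/D0->]; last by rewrite mul0r.
  case: (eqVneq j (tag t')) => [jt'|/D0->]; last by rewrite mulr0.
  case: t t' jt jt' ne => [i a] [i' a'] /= ji ji'; subst i' i => ne.
  rewrite !De [_ * _]mul_delta_mx_cond; case: (eqVneq a a') ne => [->|_ _]; last by rewrite mulr0n.
  by rewrite eqxx.
- move=> _ x /mapP[t _ ->]; exists (phi (tag t) x (tagged t) (tagged t)).
  apply: inj => j; rewrite linearZ /=.
  case: (eqVneq j (tag t)) => [jt|jt]; last first.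
    by rewrite eXe (negPf jt) /= He D0 // scaler0.
  by subst j; rewrite !rmorphM /= He De [LHS]dXd.
- move=> _ _ x /mapP[[i a] _ ->] /mapP[[i' a'] _ ->] ne.
  have ii : i = i'.
    apply/eqP; apply: contraNT ne => /eqP ne; apply/eqP/inj => j; rewrite rmorph0 eXe.
    by case: andP => // -[/eqP ji /eqP ji']; case: ne; rewrite -[LHS]ji -[RHS]ji'.
  subst i'; pose X := phi i x.
  have E1 : phi i (e (existT _ i a) * x * e (existT _ i a')) = X a a' *: delta_mx a a'.
    by rewrite !rmorphM /= !He /= !De; apply: dXd.
  have Xne : X a a' != 0.
    apply: contraNneq ne => X0; apply/eqP/inj => j; rewrite rmorph0 eXe /=.
    by case: eqP => //= ji; subst j; rewrite E1 X0 scale0r.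
  have [y Hy] := sur (fun j => (X a a')^-1 *: D i a' a j).
  exists y; apply: inj => j.
  rewrite (rmorphM (phi j) (_ * y)) (rmorphM (phi j) _ y) /=.
  case: (eqVneq j i) => [ji|ji]; last by rewrite !He /= D0 // !mulr0.
  subst j; rewrite E1 Hy !He /= !De -scalerAr -!scalerAl scalerA mulVf //.
  by rewrite scale1r -!mulmxE !mul_delta_mx.
Qed.

(** * Two-sided ideals *)

Section Tideal.
Context (F : fieldType) (A : algType F).

Definition tideal (x y : A) : Prop :=
  exists s : seq (A * A), y = \sum_(ab <- s) ab.1 * x * ab.2.

Context (x : A).
Lemma tideal0 : tideal x 0. Proof. by exists [::]; rewrite big_nil. Qed.
Lemma tideal_gen a b : tideal x (a * x * b).
Proof. by exists [:: (a, b)]; rewrite big_seq1. Qed.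
Lemma tidealD y y' : tideal x y -> tideal x y' -> tideal x (y + y').
Proof. by move=> [s ->] [s' ->]; exists (s ++ s'); rewrite big_cat. Qed.
Lemma tidealMl a y : tideal x y -> tideal x (a * y).
Proof.
move=> [s ->]; exists [seq (a * t.1, t.2) | t <- s]; rewrite big_map mulr_sumr.
by apply: eq_bigr => t _; rewrite !mulrA.
Qed.
Lemma tidealMr a y : tideal x y -> tideal x (y * a).
Proof.
move=> [s ->]; exists [seq (t.1, t.2 * a) | t <- s]; rewrite big_map mulr_suml.
by apply: eq_bigr => t _; rewrite !mulrA.
Qed.
Lemma tidealZ c y : tideal x y -> tideal x (c *: y).
Proof. by move=> xy; rewrite -[y]mul1r scalerAl; apply: tidealMl. Qed.
Lemma tidealN y : tideal x y -> tideal x (- y).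
Proof. by rewrite -scaleN1r; apply: tidealZ. Qed.
Lemma tidealB y y' : tideal x y -> tideal x y' -> tideal x (y - y').
Proof. by move=> Hy Hy'; apply: tidealD => //; apply: tidealN. Qed.
Lemma tideal_self : tideal x x.
Proof. by have := tideal_gen 1 1; rewrite mul1r mulr1. Qed.
Lemma tideal_sum (I : Type) (r : seq I) (P : pred I) (f : I -> A) :
  (forall i, P i -> tideal x (f i)) -> tideal x (\sum_(i <- r | P i) f i).
Proof. by move=> H; apply: big_ind => //; [exact: tideal0 | exact: tidealD]. Qed.
Lemma tideal_ind (P : A -> Prop) : P 0 -> (forall a b, P (a * x * b)) ->
  (forall y z, P y -> P z -> P (y + z)) -> forall y, tideal x y -> P y.
Proof. by move=> P0 Pg PD y [s ->]; apply: big_ind. Qed.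
End Tideal.


Lemma tideal_morph (F : fieldType) (A B : algType F) (f : {lrmorphism A -> B}) x y :
  tideal x y -> tideal (f x) (f y).
Proof.
move=> [s ->]; rewrite rmorph_sum /=; apply: tideal_sum => t _.
by rewrite !rmorphM; apply: tideal_gen.
Qed.

(** In a semisimple algebra a two-sided ideal is generated by a central
    idempotent, which is its unit. *)
Lemma semisimple_tideal_unit (F : fieldType) (A : algType F) (x : A) :
  semisimple A ->
  exists2 u, tideal x u & forall y, tideal x y -> u * y = y /\ y * u = y.
Proof.
move=> ssA.
have [W [[W0 Wlin] JW HW]] := ssA (fun y => `[< tideal x y >])
  (conj (introT (asboolP _) (tideal0 x))
    (fun a y z (Hy : `[< tideal x y >]) (Hz : `[< tideal x z >]) =>
       introT (asboolP _) (tidealD (tidealMl a (asboolP _ Hy)) (asboolP _ Hz)))).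
have [u [w [/asboolP Ju Ww uw]]] := HW 1.
have ur y : tideal x y -> y * u = y.
  move=> Jy; apply/eqP; rewrite eq_sym -subr_eq0; apply/eqP; apply: JW.
    by apply/asboolP; apply: tidealB => //; apply: tidealMr.
  have -> : y - y * u = y * w by rewrite -[X in X - _]mulr1 uw mulrDr addrC addKr.
  by rewrite -[y * w]addr0; apply: (Wlin y).
exists u => // y Jy; split; last exact: ur.
apply/eqP; rewrite -subr_eq0; apply/eqP; set v := u * y - y.
have Jv : tideal x v by apply: tidealB => //; apply: tidealMl.
have Jv0 j : tideal x j -> j * v = 0.
  by move=> Jj; rewrite mulrBr mulrA ur // subrr.
have [V [[V0 Vlin] UV HV]] := ssA (fun y => `[< exists a, y = a * v >])
  (conj (introT (asboolP _) (ex_intro _ 0 (esym (mul0r v))))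
    (fun a y z Hy Hz => match asboolP _ Hy, asboolP _ Hz with
      ex_intro b Eb, ex_intro c Ec => introT (asboolP _)
       (ex_intro _ (a * b + c) (eq_trans (f_equal2 (fun y z : A => a * y + z) Eb Ec)
         (esym (eq_trans (mulrDl _ _ _) (f_equal (fun t => t + c * v)
          (esym (mulrA a b v)))))))
      end)).
have [_ [v' [/asboolP[a ->] Vv' av]]] := HV 1.
apply: UV; first by apply/asboolP; exists 1; rewrite mul1r.
have -> : v = v * v'.
  rewrite -{1}[v]mulr1 av mulrDr mulrA Jv0 ?add0r //; exact: tidealMr.
by rewrite -[v * v']addr0; apply: (Vlin v).
Qed.

(** * From minimal idempotents to matrix algebras *)

Section SplitOfIdems.
Context (F : fieldType) (A : algType F) (ps0 : seq A) (ps0P : min_idems ps0).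

Let ps := [seq p <- undup ps0 | p != 0].
Let in_ps p : (p \in ps) = (p != 0) && (p \in ps0).
Proof. by rewrite mem_filter mem_undup. Qed.
Let ps_in p : p \in ps -> p \in ps0. Proof. by rewrite in_ps => /andP[]. Qed.
Let ps_ne p : p \in ps -> p != 0. Proof. by rewrite in_ps => /andP[]. Qed.

(** The blocks are the classes of this relation; r0 i is the representative of the i-th one,
    and L p, Rr p are the matrix units that connect p with its representative. *)
Let linked (p r : A) : bool := `[< exists x, p * x * r != 0 >].
Let linked_refl p : p \in ps -> linked p p.
Proof.
by move=> pin; apply/asboolP; exists 1; rewrite mulr1 (mi_idem ps0P) ?ps_ne ?ps_in.
Qed.
Let linked_sym p r : p \in ps -> r \in ps -> linked p r -> linked r p.
Proof.
move=> pin rin /asboolP[x xne].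
have [y Hy] := mi_inv ps0P (ps_in pin) (ps_in rin) xne.
apply/asboolP; exists y; apply: contraTneq (ps_ne pin) => E0.
by rewrite negbK -Hy -!mulrA (mulrA r) E0 !mulr0.
Qed.
Let linked_trans p r s : p \in ps -> r \in ps -> s \in ps ->
  linked p r -> linked r s -> linked p s.
Proof.
move=> pin rin sin lpr lrs.
have /asboolP[x xne] := linked_sym pin rin lpr; have /asboolP[y yne] := lrs.
have [u Hu] := mi_inv ps0P (ps_in rin) (ps_in pin) xne.
apply/asboolP; exists (u * r * y); apply: contraNneq yne => E0; apply/eqP.
rewrite -Hu; have -> : r * x * p * u * r * y * s = r * x * (p * (u * r * y) * s) by nc.
by rewrite E0 mulr0.
Qed.

Let rep p := nth 0 ps (find (linked p) ps).
Let rep_has p : p \in ps -> has (linked p) ps.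
Proof. by move=> pin; apply/hasP; exists p => //; apply: linked_refl. Qed.
Let rep_in p : p \in ps -> rep p \in ps.
Proof. by move=> pin; rewrite mem_nth // -has_find rep_has. Qed.
Let rep_linked p : p \in ps -> linked p (rep p).
Proof. by move=> pin; apply: nth_find; apply: rep_has. Qed.
Let rep_eq p r : p \in ps -> r \in ps -> linked p r -> rep p = rep r.
Proof.
move=> pin rin lpr; congr nth; apply: eq_in_find => s sin; apply/idP/idP.
  by apply: linked_trans => //; apply: linked_sym.
exact: linked_trans.
Qed.

Let reps := undup [seq rep p | p <- ps].
Let k := size reps.
Let r0 (i : 'I_k) : A := nth 0 reps i.
Let blk (i : 'I_k) := [seq p <- ps | rep p == r0 i].
Let d (i : 'I_k) := (size (blk i)).-1.
Let r0_in i : r0 i \in ps.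
Proof.
have : r0 i \in reps by apply: mem_nth.
by rewrite mem_undup => /mapP[p pin ->]; apply: rep_in.
Qed.
Let blk_size i : size (blk i) = (d i).+1.
Proof.
have : r0 i \in reps by apply: mem_nth.
rewrite mem_undup => /mapP[p pin pE].
have : p \in blk i by rewrite mem_filter pE eqxx.
by rewrite /d; case: (blk i).
Qed.
Let m i (a : 'I_(d i).+1) : A := nth 0 (blk i) a.
Let m_in i (a : 'I_(d i).+1) : m a \in blk i.
Proof. by apply: mem_nth; rewrite blk_size. Qed.
Let m_ps i (a : 'I_(d i).+1) : m a \in ps.
Proof. by have := m_in a; rewrite mem_filter => /andP[]. Qed.
Let m_rep i (a : 'I_(d i).+1) : rep (m a) = r0 i.
Proof. by have := m_in a; rewrite mem_filter => /andP[/eqP]. Qed.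

Let connP : exists LR : A -> A * A, forall p, p \in ps ->
  [/\ p * (LR p).1 * rep p = (LR p).1, rep p * (LR p).2 * p = (LR p).2,
      (LR p).1 * (LR p).2 = p & (LR p).2 * (LR p).1 = rep p].
Proof.
apply: (@seq_choice _ _ (0, 0) ps (fun p (LR : A * A) =>
  [/\ p * LR.1 * rep p = LR.1, rep p * LR.2 * p = LR.2,
      LR.1 * LR.2 = p & LR.2 * LR.1 = rep p])) => p pin.
have rin := rep_in pin; have pin0 := ps_in pin; have rin0 := ps_in rin.
have /asboolP[x xne] := rep_linked pin.
have [y Hy] := mi_inv ps0P pin0 rin0 xne.
have pp := mi_idem ps0P pin0; have rr := mi_idem ps0P rin0.
exists (p * x * rep p, rep p * y * p); split => /=.
- by rewrite -!mulrA rr !mulrA pp.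
- by rewrite -!mulrA pp !mulrA rr.
- by rewrite -!mulrA (mulrA (rep p) (rep p)) rr !mulrA.
- have -> : rep p * y * p * (p * x * rep p) = rep p * (y * (p * p) * x) * rep p by nc.
  rewrite pp; have [c Hc] := mi_scal ps0P (y * p * x) rin0; rewrite Hc.
  have E : p * x * rep p = c *: (p * x * rep p).
    rewrite [RHS]scalerAr -Hc.
    have -> : p * x * (rep p * (y * p * x) * rep p) = (p * x * rep p * y * p) * x * rep p by nc.
    by rewrite Hy.
  suff -> : c = 1 by rewrite scale1r.
  apply/eqP; rewrite -subr_eq0; apply: contraTT xne => c1.
  by rewrite negbK -(inj_eq (scalerI c1)) scaler0 scalerBl scale1r -E subrr.
Qed.

Let LR := sval (cid connP).
Let L p := (LR p).1.
Let Rr p := (LR p).2.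
Let LRP p : p \in ps -> [/\ p * L p * rep p = L p, rep p * Rr p * p = Rr p,
   L p * Rr p = p & Rr p * L p = rep p].
Proof. exact: (svalP (cid connP)). Qed.

Let coef_ex (i : 'I_k) x : exists c, r0 i * x * r0 i = c *: r0 i.
Proof. exact: (mi_scal ps0P x (ps_in (r0_in i))). Qed.
Let coef i x := sval (cid (coef_ex i x)).
Let coefP i x : r0 i * x * r0 i = coef i x *: r0 i.
Proof. exact: (svalP (cid (coef_ex i x))). Qed.
Let coef_uniq i x c : r0 i * x * r0 i = c *: r0 i -> coef i x = c.
Proof.
rewrite coefP => /eqP; rewrite -subr_eq0 -scalerBl scaler_eq0 (negPf (ps_ne (r0_in i))).
by rewrite orbF subr_eq0 => /eqP.
Qed.
Let coefLR i x (a b : 'I_(d i).+1) : Rr (m a) * x * L (m b) = coef i (Rr (m a) * x * L (m b)) *: r0 i.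
Proof.
rewrite -coefP; have [_ Ea _ _] := LRP (m_ps a); have [Eb _ _ _] := LRP (m_ps b).
rewrite !m_rep in Ea Eb; have rr := mi_idem ps0P (ps_in (r0_in i)).
by rewrite -Ea -Eb -!mulrA rr !mulrA rr.
Qed.

Definition block_map (i : 'I_k) (x : A) : 'M[F]_((d i).+1) :=
  \matrix_(a, b) coef i (Rr (m a) * x * L (m b)).

Lemma block_map_zmod i : zmod_morphism (block_map i).
Proof.
move=> x y; apply/matrixP => a b; rewrite !mxE; apply: coef_uniq.
rewrite scalerBl -!coefP; nc.
Qed.
Lemma block_map_scalable i : scalable (block_map i).
Proof.
move=> c x; apply/matrixP => a b; rewrite !mxE; apply: coef_uniq.
rewrite -scalerA -!coefP; nc.
Qed.

Let sum_ps : \sum_(p <- ps) p = 1.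
Proof.
rewrite big_filter big_mkcond /= -(mi_sum ps0P); have [_ _ orth _ _] := ps0P.
have -> : \sum_(p <- undup ps0) (if p != 0 then p else 0) = \sum_(p <- undup ps0) p.
  by apply: eq_bigr => p _; case: eqP => // ->.
have E : \sum_(p <- ps0) p = 1 by exact: mi_sum.
(* a repeated nonzero idempotent would give twice itself *)
have mult p : p \in ps0 -> p = p *+ count_mem p ps0.
  move=> pin; rewrite -{1}[p]mulr1 -E mulr_sumr.
  rewrite (bigID (pred1 p)) /= [X in _ + X]big1_seq ?addr0; last first.
    by move=> r /andP[ne rin]; rewrite orth // eq_sym.
  rewrite (eq_bigr (fun _ => p)) => [|r /eqP ->]; last exact: (mi_idem ps0P).
  by rewrite big_const_seq; elim: (count _ _) => //= c ->; rewrite mulrS.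
rewrite -(big_undup_iterop_count _ ps0) /=.
rewrite big_seq [RHS]big_seq; apply: eq_bigr => p; rewrite mem_undup => pin.
rewrite {1}(mult p pin) Monoid.iteropE.
by elim: (count_mem p ps0) => [|c IH]; rewrite ?mulr0n // mulrS IH.
Qed.

Lemma block_map_monoid i : monoid_morphism (block_map i).
Proof.
have rr := mi_idem ps0P (ps_in (r0_in i)).
split=> [|x y]; apply/matrixP => a b; rewrite !mxE.
  apply: coef_uniq; rewrite mulr1; case: (eqVneq a b) => [<-|ne].
    by have [_ _ _ ->] := LRP (m_ps a); rewrite m_rep rr rr scale1r.
  have [_ Ea _ _] := LRP (m_ps a); have [Eb _ _ _] := LRP (m_ps b).
  rewrite -Ea -Eb scale0r.
  have -> : r0 i * (rep (m a) * Rr (m a) * m a * (m b * L (m b) * rep (m b))) * r0 i =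
     r0 i * (rep (m a) * Rr (m a) * (m a * m b) * L (m b) * rep (m b)) * r0 i by nc.
  rewrite (mi_orth ps0P (ps_in (m_ps a)) (ps_in (m_ps b))) ?mulr0 ?mul0r ?mulr0 ?mul0r //.
  by rewrite /m nth_uniq ?blk_size ?filter_uniq ?undup_uniq.
apply: coef_uniq.
have -> : Rr (m a) * (x * y) * L (m b) =
   \sum_(p <- ps) (Rr (m a) * x * p * (y * L (m b))).
  rewrite -mulr_suml -mulr_sumr sum_ps; nc.
rewrite (bigID (fun p => rep p == r0 i)) /= [X in _ + X]big1_seq ?addr0; last first.
  move=> p /andP[ne pin]; have [_ Ea _ _] := LRP (m_ps a).
  rewrite -Ea m_rep; apply/eqP; apply: contraTT ne => ne; rewrite negbK.
  have l : linked (r0 i) p.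
    apply/asboolP; exists (Rr (m a) * m a * x); apply: contra_neq ne => E0.
    have -> : r0 i * Rr (m a) * m a * x * p * (y * L (m b)) =
      r0 i * (Rr (m a) * m a * x) * p * (y * L (m b)) by nc.
    by rewrite E0 mul0r.
  have l2 := rep_linked (m_ps a); rewrite m_rep in l2.
  apply/eqP; rewrite -(m_rep a); apply/esym/rep_eq => //.
  exact: (linked_trans _ (r0_in i)).
rewrite -big_filter -/(blk i) (big_nth 0) blk_size big_mkord.
rewrite scaler_suml mulr_sumr mulr_suml; apply: eq_bigr => j _; rewrite !mxE.
have [_ _ E _] := LRP (m_ps j).
have -> : Rr (m a) * x * nth 0 (blk i) j * (y * L (m b)) =
  (Rr (m a) * x * L (m j)) * (Rr (m j) * y * L (m b)).
  by rewrite -[nth 0 (blk i) j]E; nc.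
have := coefLR y j b; have := coefLR x a j.
set c := coef i (Rr (m a) * x * L (m j)); set c' := coef i (Rr (m j) * y * L (m b)).
move=> -> ->.
have -> : r0 i * (c *: r0 i * (c' *: r0 i)) * r0 i = (c * c') *: (r0 i * r0 i * r0 i * r0 i) by nc.
by rewrite !rr.
Qed.

HB.instance Definition _ i := GRing.isZmodMorphism.Build A _ (block_map i)
  (@block_map_zmod i).
HB.instance Definition _ i := GRing.isMonoidMorphism.Build A _ (block_map i)
  (@block_map_monoid i).
HB.instance Definition _ i := GRing.isScalable.Build F A _ *:%R (block_map i)
  (@block_map_scalable i).

Let RL p r : p \in ps -> r \in ps -> Rr p * L r = if p == r then rep p else 0.
Proof.
move=> pin rin; case: eqP => [<-|/eqP ne]; first by have [_ _ _ ->] := LRP pin.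
have [_ <- _ _] := LRP pin; have [<- _ _ _] := LRP rin.
have -> : rep p * Rr p * p * (r * L r * rep r) = rep p * Rr p * (p * r) * L r * rep r by nc.
by rewrite (mi_orth ps0P (ps_in pin) (ps_in rin) ne) mulr0 !mul0r.
Qed.

Let m_inj i j (a : 'I_(d i).+1) (b : 'I_(d j).+1) :
  (m a == m b) = (i == j) && (a == b :> nat).
Proof.
apply/eqP/andP => [ab|[/eqP ij /eqP ab]]; last by subst j; rewrite /m ab.
have ij : i = j.
  apply: ord_inj; apply/eqP; rewrite -(@nth_uniq _ 0 reps) ?undup_uniq //.
  by rewrite -/(r0 i) -/(r0 j) -(m_rep a) -(m_rep b) ab.
subst j; split; rewrite // -(@nth_uniq _ 0 (blk i)) ?blk_size ?filter_uniq ?undup_uniq //.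
exact/eqP.
Qed.

Lemma min_idems_split : split_semisimple A.
Proof.
exists k, d, (fun i => block_map i : {lrmorphism A -> 'M[F]_((d i).+1)}); split.
  move=> x y xy; apply/eqP; rewrite -subr_eq0; apply/eqP.
  have {xy}z0 i : block_map i (x - y) = 0 by rewrite raddfB /= xy subrr.
  set z := x - y in z0 *.
  apply: contrapT => /eqP /(mi_neq0 ps0P)[p pin /(mi_neq0r ps0P)[r rin ne]].
  have pin' : p \in ps.
    by rewrite in_ps pin andbT; apply: contra_neq ne => ->; rewrite !mul0r.
  have rin' : r \in ps.
    by rewrite in_ps rin andbT; apply: contra_neq ne => ->; rewrite !mulr0.
  have rpr : rep p = rep r by apply: rep_eq => //; apply/asboolP; exists z.
  have [i iE] : exists i : 'I_k, r0 i = rep p.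
    have rr : rep p \in reps by rewrite mem_undup map_f.
    have lt : (index (rep p) reps < k)%N by rewrite index_mem.
    by exists (Ordinal lt); rewrite /r0 nth_index.
  have blkE s : s \in ps -> rep s = rep p -> exists a : 'I_(d i).+1, m a = s.
    move=> sin sE; have sb : s \in blk i by rewrite mem_filter sE iE eqxx.
    have lt : (index s (blk i) < (d i).+1)%N by rewrite -blk_size index_mem.
    by exists (Ordinal lt); rewrite /m nth_index.
  have [a aE] := blkE p pin' erefl; have [b bE] := blkE r rin' (esym rpr).
  have := congr1 (fun M : 'M_ _ => M a b) (z0 i); rewrite !mxE => c0.
  have E := coefLR z a b; rewrite c0 scale0r aE bE in E.
  have [_ _ Ep _] := LRP pin'; have [_ _ Er _] := LRP rin'.
  move/eqP: ne; apply; rewrite -Ep -[in LHS]Er.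
  have -> : L p * Rr p * z * (L r * Rr r) = L p * (Rr p * z * L r) * Rr r by nc.
  by rewrite E mulr0 mul0r.
move=> M; exists (\sum_(i < k) \sum_(a < (d i).+1) \sum_(b < (d i).+1)
   M i a b *: (L (m a) * Rr (m b))) => j.
apply/matrixP => a b; rewrite mxE; apply: coef_uniq.
have rr := mi_idem ps0P (ps_in (r0_in j)).
have E i (a' b' : 'I_(d i).+1) :
    Rr (m a) * (M i a' b' *: (L (m a') * Rr (m b'))) * L (m b) =
    if (i == j) && ((a' == a :> nat) && (b' == b :> nat)) then M i a' b' *: r0 j else 0.
  have -> : Rr (m a) * (M i a' b' *: (L (m a') * Rr (m b'))) * L (m b) =
     M i a' b' *: ((Rr (m a) * L (m a')) * (Rr (m b') * L (m b))) by nc.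
  rewrite !RL // !m_inj !m_rep (eq_sym j).
  case: eqP => [ij|_] /=; last by rewrite mul0r scaler0.
  subst i; rewrite (eq_sym (val a)); case: eqP => _ /=; last by rewrite mul0r scaler0.
  by case: eqP => _ /=; rewrite ?rr // mulr0 scaler0.
rewrite mulr_sumr mulr_suml (bigD1 j) //= [X in _ + X]big1 => [|i /negPf ij]; last first.
  rewrite mulr_sumr mulr_suml big1 // => a' _; rewrite mulr_sumr mulr_suml big1 // => b' _.
  by rewrite E ij.
rewrite addr0 mulr_sumr mulr_suml (bigD1 a) //= [X in _ + X]big1 => [|a' /negPf aa]; last first.
  rewrite mulr_sumr mulr_suml big1 // => b' _.
  by rewrite E eqxx; have -> : (a' == a :> nat) = false by [].
rewrite addr0 mulr_sumr mulr_suml (bigD1 b) //= [X in _ + X]big1 => [|b' /negPf bb]; last first.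
  by rewrite E !eqxx; have -> : (b' == b :> nat) = false by [].
by rewrite addr0 E !eqxx -scalerAr -scalerAl rr rr.
Qed.
End SplitOfIdems.

(** * Contents of standard tableaux *)

(** Standard tableaux are recorded by the contents of their boxes, latest box first. A box of
    content b can be added when its diagonal is empty but a neighbouring diagonal is not, or
    when both neighbouring diagonals were used since the last box on that diagonal. *)
Definition addable (t : seq int) (b : int) : bool :=
  if t is [::] then b == 0
  else if b \in t then (b - 1 \in take (index b t) t) && (b + 1 \in take (index b t) t)
  else (b - 1 \in t) || (b + 1 \in t).

Fixpoint content_seq (t : seq int) : bool :=
  if t is b :: t' then addable t' b && content_seq t' else true.

Definition addables (t : seq int) : seq int :=
  [seq b <- [seq i%:Z - (size t)%:Z | i <- iota 0 (size t).*2.+1] | addable t b].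

Lemma mem_count (t : seq int) (b : int) : (b \in t) = (0 < count_mem b t)%N.
Proof. by rewrite -has_pred1 has_count. Qed.

Section Contents.
Implicit Types (t : seq int) (a b c u v w : int).

Lemma addable_near t b : t != [::] -> addable t b ->
  [\/ b \in t, b - 1 \in t | b + 1 \in t].
Proof.
case: t => // c t _; rewrite /addable.
by case: ifP => [bt _|_ /orP[]]; [constructor 1 | constructor 2 | constructor 3].
Qed.

(** A new diagonal is adjacent to one that is already occupied. *)
Lemma content_conn t u v w : content_seq t -> u \in t -> v \in t -> u <= w <= v -> w \in t.
Proof.
elim: t u v w => // b t IH u v w /= /andP[addb ct].
have [->|tn] := eqVneq t [::]; first by rewrite !inE => /eqP-> /eqP-> /le_anti ->.
have near : exists2 b', b' \in t & (b - 1 <= b' <= b + 1).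
  by case: (addable_near tn addb) => H; [exists b | exists (b - 1) | exists (b + 1)];
     rewrite // ?lexx; lia.
have {near}[b' b't b'b] := near.
rewrite !inE => /predU1P[->|ut] /predU1P[->|vt] uwv.
- by apply/orP; left; apply/eqP; lia.
- have [->|wb] := eqVneq w b; first by [].
  by rewrite (IH b' v) //; lia.
- have [->|wb] := eqVneq w b; first by [].
  by rewrite (IH u b') //; lia.
- by rewrite (IH u v) ?orbT.
Qed.

Lemma uniq_count_size (s t : seq int) : uniq s -> (\sum_(c <- s) count_mem c t <= size t)%N.
Proof.
elim: t => [|b t IH] us; first by rewrite big1.
rewrite /= big_split /= -addn1 addnC leq_add ?IH //.
rewrite (eq_bigr (fun c => (c == b : nat))) => [|c _]; last by rewrite eq_sym.
rewrite -big_mkcond /= sum1_count -/(count_mem b s) count_uniq_mem //; by case: (_ \in _).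
Qed.

Lemma range_size (s t : seq int) : uniq s -> {subset s <= t} -> (size s <= size t)%N.
Proof. exact: uniq_leq_size. Qed.

Definition int_range (a : int) (k : nat) : seq int := [seq a + i%:Z | i <- iota 0 k].
Lemma mem_int_range a k c : (c \in int_range a k) = (a <= c < a + k%:Z).
Proof.
apply/mapP/idP => [[i]|ac]; first by rewrite mem_iota => ik ->; lia.
by exists `|c - a|%N; rewrite ?mem_iota; lia.
Qed.
Lemma int_range_uniq a k : uniq (int_range a k).
Proof. by rewrite map_inj_uniq ?iota_uniq // => i j; lia. Qed.

Lemma int_rangeD a k l : int_range a (k + l) = int_range a k ++ int_range (a + k%:Z) l.
Proof.
rewrite /int_range iotaD map_cat add0n -[X in iota X l]addn0 iotaDl -map_comp.
by congr (_ ++ _); apply: eq_map => i /=; lia.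
Qed.

(** The contents that occur form an interval, so that they differ by less than the number of
    boxes; this keeps the powers of q that they label distinct. *)
Lemma content_dist t u v : content_seq t -> u \in t -> v \in t -> `|u - v| < (size t)%:Z.
Proof.
move=> ct ut vt; wlog uv : u v ut vt / u <= v.
  by case: (leP u v) => uv H; [exact: H | rewrite distrC; apply: H => //; lia].
have : (size (int_range u `|v - u|.+1) <= size t)%N.
  apply: range_size; first exact: int_range_uniq.
  by move=> w; rewrite mem_int_range => H; apply: (content_conn ct ut vt); lia.
by rewrite size_map size_iota; lia.
Qed.

Lemma content_zero t : content_seq t -> t != [::] -> 0 \in t.
Proof.
elim: t => // b [|c t] IH /= /andP[addb ct] _; first by rewrite (eqP addb) inE.
by rewrite inE IH ?orbT.
Qed.

Lemma mem_addables t b : content_seq t -> (b \in addables t) = addable t b.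
Proof.
move=> ct; rewrite mem_filter; apply: andb_idr => addb.
have bt : `|b| <= (size t)%:Z.
  have [t0|tn] := eqVneq t [::].
    by move: addb; rewrite t0 /= => /eqP->.
  have c : content_seq (b :: t) by rewrite /= addb.
  have := content_dist c (mem_head _ _) (mem_behead (s := b :: t) (content_zero ct tn)).
  by rewrite /=; lia.
by apply/mapP; exists (absz (b + (size t)%:Z)); rewrite ?mem_iota; lia.
Qed.

Lemma addables_uniq t : uniq (addables t).
Proof. by rewrite filter_uniq // map_inj_uniq ?iota_uniq // => i j; lia. Qed.

Lemma addable_dist t u b : content_seq t -> addable t b -> u \in t ->
  `|u - b| <= (size t)%:Z.
Proof.
move=> ct addb ut; have c : content_seq (b :: t) by rewrite /= addb.
have := content_dist c (mem_behead (s := b :: t) ut) (mem_head _ _); rewrite /=; lia.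
Qed.

Lemma addables_dist t b c : content_seq t -> addable t b -> addable t c ->
  `|b - c| <= (size t)%:Z + 1.
Proof.
move=> ct addb addc; have [t0|tn] := eqVneq t [::].
  by move: addb addc; rewrite t0 /= => /eqP-> /eqP->.
have [H|H|H] := addable_near tn addb; have := addable_dist ct addc H; lia.
Qed.

Lemma addable_last t a : ~~ addable (a :: t) a.
Proof. by rewrite /addable inE eqxx /= eqxx. Qed.

Lemma addable_far t a b : content_seq (a :: t) ->
  a != b -> a != b - 1 -> a != b + 1 -> addable (a :: t) b = addable t b.
Proof.
move=> ct ab ab1 ab2; case: t ct => [|c t] ct.
  move: ct; rewrite /= andbT => /eqP a0; rewrite /addable !inE /=.
  by subst a; rewrite eq_sym (negPf ab) /= ![_ == 0]eq_sym (negPf ab1) (negPf ab2).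
have E : take (index b (a :: c :: t)) (a :: c :: t) = a :: take (index b (c :: t)) (c :: t).
  by rewrite /= (negPf ab).
have m1 s : (b - 1 \in a :: s) = (b - 1 \in s) by rewrite inE eq_sym (negPf ab1).
have m2 s : (b + 1 \in a :: s) = (b + 1 \in s) by rewrite inE eq_sym (negPf ab2).
by rewrite /addable E !m1 !m2 [b \in a :: _]inE [b == a]eq_sym (negPf ab).
Qed.

Lemma content_first t b : content_seq (b :: t) -> 1 <= b -> b - 1 \in t.
Proof.
move=> /= /andP[addb ct] b1; have tn : t != [::].
  by apply: contraTneq addb => ->; rewrite /=; lia.
have t0 := content_zero ct tn.
case: (addable_near tn addb) => [H|//|H]; last by apply: (content_conn ct t0 H); lia.
by apply: (content_conn ct t0 H); lia.
Qed.

Lemma addable_opp t b : addable (map -%R t) (- b) = addable t b.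
Proof.
have minj : injective (-%R : int -> int) by exact: oppr_inj.
case: t => [|c t]; first by rewrite /= oppr_eq0.
have -> : addable [seq - i | i <- c :: t] (- b) =
  if - b \in map -%R (c :: t) then
    (- b - 1 \in take (index (- b) (map -%R (c :: t))) (map -%R (c :: t))) &&
    (- b + 1 \in take (index (- b) (map -%R (c :: t))) (map -%R (c :: t)))
  else (- b - 1 \in map -%R (c :: t)) || (- b + 1 \in map -%R (c :: t)) by [].
rewrite index_map // -map_take mem_map //.
have -> : - b - 1 = - (b + 1) by rewrite opprD.
have -> : - b + 1 = - (b - 1) by rewrite opprB addrC.
by rewrite !mem_map // andbC orbC.
Qed.

Lemma content_opp t : content_seq (map -%R t) = content_seq t.
Proof. by elim: t => //= b t ->; rewrite addable_opp. Qed.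

(** Of the last boxes on the diagonals a and a + 1, the later one blocks its own diagonal. *)
Lemma addable_noadj t a : content_seq t -> addable t a -> addable t (a + 1) -> False.
Proof.
move=> ct adda addb; have [t0|tn] := eqVneq t [::].
  by move: adda addb; rewrite t0 /= => /eqP->.
have t0 := content_zero ct tn.
move: adda addb; case: t tn ct t0 => // c t _ ct t0; rewrite /addable addrK.
have [at_|an] := boolP (a \in c :: t); have [bt|bn] := boolP (a + 1 \in c :: t).
- move=> /andP[_ b1] /andP[a1 _].
  have lt x y : x \in take (index y (c :: t)) (c :: t) -> (index x (c :: t) < index y (c :: t))%N.
    by move=> xin; rewrite -in_take // (mem_take xin).
  by have := lt _ _ b1; have := lt _ _ a1; lia.
- by move=> /andP[_ /mem_take]; rewrite (negPf bn).
- by move=> _ /andP[/mem_take]; rewrite (negPf an).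
- rewrite /= orbF => am1 ap2.
  by move: an; rewrite (content_conn ct am1 ap2) //; lia.
Qed.

Lemma content_suffix s t : content_seq (s ++ t) -> content_seq t.
Proof. by elim: s => //= b s IH /andP[_ /IH]. Qed.

Lemma mem_split t b : b \in t -> exists g t', t = g ++ b :: t' /\ b \notin g /\ take (index b t) t = g.
Proof.
move=> bt; exists (take (index b t) t), (drop (index b t).+1 t).
rewrite -{1}(cat_take_drop (index b t) t) (drop_nth 0) ?index_mem // nth_index //.
by split=> //; split=> //; rewrite in_take // ltnn.
Qed.

(** A second box on the diagonal b forces a 2 by (b + 2) rectangle. *)
Lemma content_repeat t b : content_seq t -> 0 <= b -> (1 < count_mem b t)%N ->
  (forall c, 0 <= c <= b -> (1 < count_mem c t)%N) /\ -1 \in t.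
Proof.
move=> ct b0.
have step c : 0 <= c -> (1 < count_mem c t)%N ->
    c - 1 \in t /\ (1 <= c -> (1 < count_mem (c - 1)%R t)%N).
  move=> c0 c2; have c1 : c \in t by rewrite mem_count; lia.
  have [g [t1 [tE [cg _]]]] := mem_split c1.
  have ct1 : content_seq (c :: t1) by apply: (@content_suffix g); rewrite -tE.
  have ct1in : c \in t1.
    move: c2; rewrite tE count_cat /= eqxx; have -> : count_mem c g = 0%N by apply/count_memPn.
    by rewrite add0n add1n mem_count.
  have [g1 [t2 [t1E [_ gE]]]] := mem_split ct1in.
  have /andP[m1 _] : (c - 1 \in g1) && (c + 1 \in g1).
    move: ct1 => /= /andP[+ _]; rewrite /addable.
    by case: (t1) ct1in gE => // x s xin <-; rewrite xin.
  split; first by rewrite tE mem_cat inE t1E mem_cat m1 !orbT.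
  move=> c1'; have m2 : c - 1 \in t2.
    apply: content_first => //; apply: (@content_suffix (g ++ c :: g1)).
    by rewrite -catA /= -t1E -tE.
  rewrite tE t1E !count_cat /= !count_cat /=.
  move: m1 m2; rewrite !mem_count => m1 m2.
  move: (count_mem _ g1) m1 (count_mem _ t2) m2 (count_mem _ g) (nat_of_bool _) => x Hx y Hy u v; lia.
move=> b2.
have H (k : nat) : (k%:Z <= b) -> (1 < count_mem (b - k%:Z)%R t)%N.
  elim: k => [|k IH] kb; first by rewrite subr0.
  have -> : b - k.+1%:Z = b - k%:Z - 1 by lia.
  by apply: (step (b - k%:Z) _ _).2; rewrite ?IH //; lia.
split=> [c cb|].
  have E : b - `|b - c|%N%:Z = c by lia.
  by rewrite -E; apply: H; lia.
have E : b - `|b|%N%:Z = 0 by lia.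
have H0 : (1 < count_mem (0 : int) t)%N by rewrite -E; apply: H; lia.
by have [] := step 0 (lexx _) H0.
Qed.

Lemma addable_nonadjacent t a b : content_seq t -> addable t a -> addable t b ->
  2 <= `|a - b| -> `|a + b| < (size t)%:Z.
Proof.
wlog ba : a b / b < a.
  move=> H ct ha hb ab; case: (ltP b a) => [|ab']; first by move/H; apply.
  by rewrite addrC; apply: H => //; rewrite ?[_ < _]lt_neqAle; lia.
wlog ab0 : t a b ba / 0 <= a + b.
  move=> H ct ha hb ab; case: (leP 0 (a + b)) => [|ab']; first by move/H; apply.
  have : `|- b + - a| < (size t)%:Z.
    by rewrite -(size_map -%R t); apply: H; rewrite ?addable_opp ?content_opp //; lia.
  lia.
move=> ct ha hb ab; have a1 : 1 <= a by lia.
have ta : a - 1 \in t by apply: content_first; rewrite /= ?ha.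
have tn : t != [::] by apply: contraTneq ta => ->.
have t0 := content_zero ct tn.
have ge1 c : 0 <= c <= a - 1 -> (0 < count_mem c t)%N.
  by move=> ca; rewrite -mem_count; apply: (content_conn ct t0 ta).
case: (ltP b 0) => b0.
  have : (size (int_range 0 `|a|%N) <= size t)%N.
    apply: range_size; first exact: int_range_uniq.
    move=> c; rewrite mem_int_range => ca; rewrite mem_count; apply: ge1; lia.
  rewrite size_map size_iota; lia.
have bt : b \in t by rewrite mem_count; apply: ge1; lia.
have ctb : content_seq (b :: t) by rewrite /= hb.
have b2 : (1 < count_mem b (b :: t))%N by rewrite /= eqxx add1n ltnS -mem_count.
have [rep m1] := content_repeat ctb b0 b2.
have ge2 c : 0 <= c <= b - 1 -> (1 < count_mem c t)%N.
  move=> cb; have : (1 < count_mem c (b :: t))%N by apply: rep; lia.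
  by rewrite /=; have -> : (b == c) = false by lia.
have m1t : (0 < count_mem (-1 : int) t)%N.
  by rewrite -mem_count; move: m1; rewrite inE; have -> : (-1 == b) = false by lia.
have := @uniq_count_size (int_range (-1) `|a|.+1) t (int_range_uniq _ _).
have -> : int_range (-1) `|a|.+1 = -1 :: int_range 0 `|b|%N ++ int_range b `|a - b|%N.
  rewrite (_ : `|a|.+1 = (1 + (`|b| + `|a - b|))%N); last by lia.
  rewrite !int_rangeD /= addr0; congr (_ :: _ ++ int_range _ _); lia.
rewrite big_cons big_cat /=.
have s1 : (`|b| * 2 <= \sum_(c <- int_range 0 `|b|) count_mem c t)%N.
  rewrite -[X in (X * 2)%N](size_iota 0) -(size_map (fun i : nat => 0 + i%:Z)) -/(int_range 0 `|b|).
  rewrite -sum1_size big_distrl /=; rewrite big_seq [X in (_ <= X)%N]big_seq; apply: leq_sum => c.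
  by rewrite mem_int_range => cb; rewrite mul1n; apply: ge2; lia.
have s2 : (`|a - b| <= \sum_(c <- int_range b `|a - b|) count_mem c t)%N.
  rewrite -[X in (X <= _)%N](size_iota 0) -(size_map (fun i : nat => b + i%:Z)) -/(int_range b `|a - b|).
  rewrite -sum1_size; rewrite big_seq [X in (_ <= X)%N]big_seq; apply: leq_sum => c.
  by rewrite mem_int_range => cb; apply: ge1; lia.
move: (bigop _ (int_range 0 _) _) s1 (bigop _ (int_range b _) _) s2
  (count_mem (-1 : int) t) m1t (size t) => x1 H1 x2 H2 x3 H3 x4; lia.
Qed.

Lemma addable_row t a : content_seq t -> addable t a -> addable (a :: t) (a + 1) ->
  - (size t)%:Z < 2 * a + 1.
Proof.
move=> ct ha hb; case: (leP 0 a) => a0; first by lia.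
have cta : content_seq (a :: t) by rewrite /= ha.
have ctb : content_seq (a + 1 :: a :: t) by apply/andP.
have bt : a + 1 \in t.
  have := @content_first (map -%R t) (- a).
  rewrite -map_cons content_opp => /(_ cta); rewrite -opprD.
  by rewrite mem_map; [apply; lia | exact: oppr_inj].
have cE c : count_mem (- c) (map -%R (a + 1 :: a :: t)) = count_mem c (a + 1 :: a :: t).
  by rewrite count_map; apply: eq_count => x /=; rewrite eqr_opp.
have c2 : (1 < count_mem (- (a + 1))%R (map -%R [:: a + 1, a & t]%R))%N.
  rewrite cE /= eqxx add1n ltnS addn_gt0; apply/orP; right; move: bt; rewrite mem_count.
  by rewrite -/(count_mem (a + 1) t).
have ct' : content_seq (map -%R (a + 1 :: a :: t)) by rewrite content_opp.
have b0 : 0 <= - (a + 1) by lia.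
have [rep p1] := content_repeat ct' b0 c2.
have {}rep c : a + 1 <= c <= 0 -> (1 < count_mem c [:: a + 1, a & t]%R)%N.
  by move=> ca; rewrite -cE; apply: rep => //; lia.
have {}p1 : (0 < count_mem (1 : int) [:: a + 1, a & t]%R)%N.
  by rewrite -cE -mem_count; apply: p1.
have := @uniq_count_size (int_range a `|a - 2|%N) (a + 1 :: a :: t) (int_range_uniq _ _).
have -> : int_range a `|a - 2|%N = a :: rcons (int_range (a + 1) `|a|%N) 1.
  rewrite (_ : `|a - 2|%N = (1 + (`|a| + 1))%N); last by lia.
  rewrite !int_rangeD /= addr0 cats1; congr (_ :: rcons _ _); lia.
rewrite big_cons big_rcons.
have s1 : (`|a| * 2 <= \sum_(c <- int_range (a + 1) `|a|) count_mem c [:: a + 1, a & t]%R)%N.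
  rewrite -[X in (X * 2)%N](size_iota 0) -(size_map (fun i : nat => a + 1 + i%:Z)) -/(int_range (a + 1) `|a|).
  rewrite -sum1_size big_distrl /=; rewrite big_seq [X in (_ <= X)%N]big_seq; apply: leq_sum => c.
  by rewrite mem_int_range => cb; rewrite mul1n; apply: rep; lia.
have ca : (0 < count_mem a [:: a + 1, a & t]%R)%N by rewrite -mem_count !inE eqxx orbT.
have sz : size [:: a + 1, a & t] = (size t).+2 by [].
move: sz s1 p1 ca; move: (bigop _ (int_range (a + 1) _) _) (count_mem (1 : int) _).
move: (count_mem a _) (size _) (size t) => x1 x2 x3 x4 x5 /=; lia.
Qed.

(** Large sums only occur for two boxes in the same row, b = a + 1, and are then odd; otherwise
    addable_nonadjacent applies. *)
Lemma content_sum t a b : content_seq (b :: a :: t) -> b != a - 1 ->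
  let n := (size t).+2%:Z in
  [/\ 3 - n <= a + b, a + b <= 2 * n - 3 & ~~ (2 %| 1 - (a + b))%Z -> a + b < n - 2].
Proof.
move=> ct ba n.
have [hb ct1] := andP (ct : addable (a :: t) b && content_seq (a :: t)).
have [ha ct0] := andP (ct1 : addable t a && content_seq t).
have an : `|a| <= (size t)%:Z.
  have [t0|tn] := eqVneq t [::]; first by move: ha; rewrite t0 => /eqP->.
  by have := addable_dist ct0 ha (content_zero ct0 tn); lia.
have ab : a != b by apply: contraTneq hb => ->; rewrite (negPf (addable_last _ _)).
have [bE|bE] := eqVneq b (a + 1).
  by subst b; have := addable_row ct0 ha hb; rewrite /n => H; split; lia.
have hb' : addable t b.
  by rewrite -(@addable_far t a) // ?ha //; apply/eqP; move/eqP: ba; move/eqP: bE; lia.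
have := addable_nonadjacent ct0 ha hb'; rewrite /n => H.
have {}H : `|a + b| < (size t)%:Z by apply: H; lia.
by split; lia.
Qed.
End Contents.

(** * The Hecke algebra and its Jucys-Murphy elements *)

Definition hecke_rel (F : fieldType) (A : algType F) (q : F) (n : nat) (T : nat -> A) : Prop :=
  [/\ forall i, (0 < i < n)%N -> T i * T i = 1 + (q - q^-1) *: T i,
      forall i j, (0 < i)%N -> (i.+1 < j)%N -> (j < n)%N -> T i * T j = T j * T i &
      forall i, (0 < i)%N -> (i.+1 < n)%N ->
        T i * T i.+1 * T i = T i.+1 * T i * T i.+1].

Definition gens (F : fieldType) (A : algType F) (T : nat -> A) (n : nat) (x : A) : Prop :=
  exists i, (0 < i < n)%N /\ x = T i.

(** The multiplicative Jucys-Murphy elements, starting with 1. *)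
Fixpoint jm (F : fieldType) (A : algType F) (T : nat -> A) (i : nat) : A :=
  if i is j.+1 then T j.+1 * jm T j * T j.+1 else 1.

Arguments jm {F A} T i : simpl never.

Lemma jm_S (F : fieldType) (A : algType F) (T : nat -> A) i :
  jm T i.+1 = T i.+1 * jm T i * T i.+1.
Proof. by []. Qed.

Section Horner.
Context (F : fieldType) (A : algType F).
Lemma horner_alg_intertwine (a x y : A) P : a * x = y * a ->
  a * horner_alg x P = horner_alg y P * a.
Proof.
move=> axy; elim/poly_ind: P => [|P c IH]; first by rewrite !raddf0 mulr0 mul0r.
rewrite !rmorphD !rmorphM /= !horner_algX !horner_algC mulrDr mulrDl mulrA IH.
by rewrite -!mulrA axy -scalerAl -scalerAr mul1r mulr1.
Qed.
Lemma horner_alg_eigen (x r : A) c P : x * r = c *: r -> horner_alg x P * r = P.[c] *: r.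
Proof.
move=> xr; elim/poly_ind: P => [|P d IH]; first by rewrite raddf0 mul0r horner0 scale0r.
rewrite rmorphD rmorphM /= horner_algX horner_algC mulrDl -mulrA xr -scalerAr IH.
by rewrite hornerD hornerM hornerX hornerC scalerDl scalerA mulrC -scalerAl mul1r.
Qed.
End Horner.

Section Intertwiner.
Context (F : fieldType) (A : algType F) (q h : F) (q0 : q != 0) (hE : h = q - q^-1).
Context (T x y : A) (TT : T * T = 1 + h *: T) (yE : y = T * x * T) (xy : x * y = y * x).

Lemma hecke_Tx : T * x = y * T - h *: y.
Proof.
rewrite yE; nc_cert (- (T * x * (T * T - (1 + h *: T)))).
by rewrite TT subrr mulr0 oppr0.
Qed.
Lemma hecke_Ty : T * y = x * T + h *: y.
Proof.
rewrite yE; nc_cert ((T * T - (1 + h *: T)) * x * T).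
by rewrite TT subrr !mul0r.
Qed.
(** An intertwiner: it exchanges the commuting elements x and y = T x T, and its square is a
    polynomial in them, so that it is invertible except on special pairs of eigenvalues. *)
Definition phi : A := T * (x - y) + h *: y.
Lemma phi_x : phi * x = y * phi.
Proof.
have R1 := hecke_Tx; have R2 := hecke_Ty; rewrite /phi.
nc_cert ((T * x - (y * T - h *: y)) * x - (T * y - (x * T + h *: y)) * x
  - x * (T * x - (y * T - h *: y)) + y * (T * y - (x * T + h *: y))
  + h *: (x * y - y * x) - (x * y - y * x) * T).
by rewrite R1 R2 xy !subrr !(mul0r, mulr0, scaler0, subr0, addr0, oppr0).
Qed.
Lemma phi_y : phi * y = x * phi.
Proof.
have R1 := hecke_Tx; have R2 := hecke_Ty; rewrite /phi.
nc_cert ((T * x - (y * T - h *: y)) * y - (T * y - (x * T + h *: y)) * y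
  - x * (T * x - (y * T - h *: y)) + y * (T * y - (x * T + h *: y))
  - (x * y - y * x) * T).
by rewrite R1 R2 xy !subrr !(mul0r, mulr0, scaler0, subr0, addr0, oppr0).
Qed.
Lemma phi_sqr : phi * phi = - ((y - q ^+ 2 *: x) * (y - q ^- 2 *: x)).
Proof.
have -> : phi * phi = T * phi * (y - x) + h *: (phi * x).
  rewrite {1}/phi phi_x.
  nc_cert (T * (x * phi - phi * y) - T * (y * phi - phi * x)).
  by rewrite phi_x phi_y !subrr.
have -> : T * phi = x - y + h *: (T * x).
  rewrite /phi; nc_cert ((T * T - (1 + h *: T)) * (x - y)).
  by rewrite TT subrr mul0r.
rewrite /phi; nc_cert (h *: (T * (x * y - y * x)) + (1 - q ^+ 2) *: (x * y - y * x)).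
all: try by rewrite ?hE; field; rewrite ?q0.
by rewrite xy !subrr !(mulr0, scaler0) addr0.
Qed.
End Intertwiner.

Section JM.
Context (F : fieldType) (A : algType F) (q : F) (n : nat) (T : nat -> A).
Context (q0 : q != 0) (TP : hecke_rel q n T).
Notation h := (q - q^-1).
Notation J := (jm T).

Lemma he_quad i : (0 < i < n)%N -> T i * T i = 1 + h *: T i.
Proof. by case: TP => H _ _; apply: H. Qed.
Lemma he_comm i j : (0 < i)%N -> (i.+1 < j)%N -> (j < n)%N -> T i * T j = T j * T i.
Proof. by case: TP => _ H _; apply: H. Qed.
Lemma he_braid i : (0 < i)%N -> (i.+1 < n)%N ->
  T i * T i.+1 * T i = T i.+1 * T i * T i.+1.
Proof. by case: TP => _ _ H; apply: H. Qed.

Lemma jm_gens i : in_alg_of (gens T i.+1) (J i).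
Proof.
elim: i => [|i IH]; first exact: ia_one.
rewrite jm_S.
have g : in_alg_of (gens T i.+2) (T i.+1) by apply: ia_gen; exists i.+1; rewrite ltnSn.
apply: ia_mul => //; apply: ia_mul => //; apply: ia_sub_gen IH => _ [j [/andP[j0 ji] ->]].
by apply: ia_gen; exists j; rewrite j0 ltnW.
Qed.

Lemma T_jm_far i j : (i.+1 < j)%N -> (j < n)%N -> T j * J i = J i * T j.
Proof.
move=> ij jn; apply/esym; apply: ia_comm (jm_gens i) => _ [l [/andP[l0 li] ->]].
by apply: he_comm => //; apply: leq_trans ij; rewrite !ltnS in li *.
Qed.

Lemma T_jm_near i j : (0 < j)%N -> (j < i)%N -> (i < n)%N -> T j * J i = J i * T j.
Proof.
elim: i => // i IH j0; rewrite ltnS leq_eqVlt => /predU1P[ji|ji] iN; last first.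
  have jn : (i.+1 < n)%N by []; have c := he_comm j0 (ji : (j.+1 < i.+1)%N) iN.
  by rewrite jm_S !mulrA c -2!(mulrA (T i.+1)) IH ?(ltnW iN) // !mulrA -(mulrA _ (T j) (T i.+1)) c !mulrA.
subst j; case: i iN j0 {IH} => [//|i] iN _.
have b := he_braid (ltn0Sn i) iN; have c := T_jm_far (ltnSn i.+1) iN.
have -> : J i.+2 = T i.+2 * (T i.+1 * J i * T i.+1) * T i.+2 by [].
set t1 := T i.+1 in b c *; set t2 := T i.+2 in b c *; move: (J i) c => x c.
nc_cert ((t1 * t2 * t1 - t2 * t1 * t2) * x * t1 * t2
  + t2 * t1 * (t2 * x - x * t2) * t1 * t2 - t2 * t1 * x * (t1 * t2 * t1 - t2 * t1 * t2)).
by rewrite b c !subrr !(mulr0, mul0r, addr0, subr0).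
Qed.

Lemma jm_comm i j : (i < n)%N -> (j < n)%N -> J i * J j = J j * J i.
Proof.
wlog ij : i j / (i < j)%N.
  move=> H; case: (ltngtP i j) => [ij|ji|->] iN jN //; first exact: H.
  by apply/esym; apply: H.
move=> _ jn; apply: ia_comm (jm_gens i) => _ [l [/andP[l0 li] ->]].
by apply: T_jm_near => //; apply: leq_trans ij.
Qed.

Definition Phi i : A := phi h (T i.+1) (J i) (J i.+1).

Lemma Phi_jm i : (i.+1 < n)%N -> Phi i * J i = J i.+1 * Phi i.
Proof.
by move=> iN; apply: phi_x; rewrite ?he_quad //; apply: jm_comm => //; apply: ltnW.
Qed.
Lemma Phi_jmS i : (i.+1 < n)%N -> Phi i * J i.+1 = J i * Phi i.
Proof.
by move=> iN; apply: phi_y; rewrite ?he_quad //; apply: jm_comm => //; apply: ltnW.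
Qed.
Lemma Phi_sqr i : (i.+1 < n)%N ->
  Phi i * Phi i = - ((J i.+1 - q ^+ 2 *: J i) * (J i.+1 - q ^- 2 *: J i)).
Proof.
by move=> iN; apply: phi_sqr; rewrite ?he_quad //; apply: jm_comm => //; apply: ltnW.
Qed.
Lemma Phi_comm a i : (i.+1 < n)%N -> T i.+1 * a = a * T i.+1 -> J i * a = a * J i ->
  J i.+1 * a = a * J i.+1 -> Phi i * a = a * Phi i.
Proof.
move=> iN ta xa ya; rewrite /Phi /phi.
nc_cert (T i.+1 * ((J i * a - a * J i) - (J i.+1 * a - a * J i.+1))
  + (T i.+1 * a - a * T i.+1) * (J i - J i.+1) + h *: (J i.+1 * a - a * J i.+1)).
by rewrite ta xa ya !subrr !(mulr0, mul0r, scaler0, addr0).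
Qed.
Lemma Phi_jm_other i j : (i.+1 < n)%N -> (j < n)%N -> j != i -> j != i.+1 ->
  Phi i * J j = J j * Phi i.
Proof.
move=> iN jn ji ji1; have iN' := ltnW iN.
apply: Phi_comm => //; rewrite ?(jm_comm _ jn) //.
case: (ltnP j i) => jl; first by apply: T_jm_far.
by apply: T_jm_near => //; lia.
Qed.
End JM.

(** * Weight vectors *)

Section Spectrum.
Context (F : fieldType) (A : algType F) (q : F) (n : nat) (T : nat -> A).
Context (q0 : q != 0) (h0 : q - q^-1 != 0) (TP : hecke_rel q n T).
Context (qn : forall k, (0 < k <= n)%N -> q ^+ (2 * k) != 1).
Notation h := (q - q^-1).
Notation J := (jm T).
Notation Phi := (Phi q T).
Implicit Types (t g : seq int) (a b c : int) (r s : A).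

Definition wtv b : F := q ^ (2 * b).

Lemma wtv_neq0 b : wtv b != 0. Proof. exact: expfz_neq0. Qed.
Lemma wtvD a b : wtv (a + b) = wtv a * wtv b.
Proof. by rewrite /wtv mulrDr expfzDr. Qed.
Lemma wtv1 : wtv 1 = q ^+ 2. Proof. by rewrite /wtv mulr1. Qed.
Lemma wtvN1 : wtv (-1) = q ^- 2. Proof. by rewrite /wtv mulrN1. Qed.
Lemma wtv_inj a b : a != b -> `|a - b| <= n%:Z -> wtv a != wtv b.
Proof.
wlog ab : a b / b < a.
  move=> H ne; case: (ltP b a) => [|ab d]; first by move/H; apply.
  by rewrite eq_sym; apply: H => //; rewrite 1?eq_sym // ?lt_neqAle 1?ne //; lia.
move=> _ d; apply: contraTneq isT => E.
have := @qn `|a - b|%N; have -> : (0 < `|a - b| <= n)%N by lia.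
move/(_ isT)/negP; case.
have -> : q ^+ (2 * `|a - b|) = wtv (a - b).
  by rewrite /wtv; have -> : 2 * (a - b) = (2 * `|a - b|)%N%:Z by lia.
by rewrite wtvD E -wtvD subrr /wtv mulr0 expr0z.
Qed.

(** A simultaneous eigenvector of the Jucys-Murphy elements whose eigenvalue at each step is the
    power of q given by the content at that step. *)
Fixpoint wt t r : Prop :=
  if t is b :: t' then J (size t') * r = wtv b *: r /\ wt t' r else True.

Lemma wt_mulr t r s : wt t r -> wt t (r * s).
Proof.
by elim: t => //= b t IH [H /IH W]; split => //; rewrite mulrA H scalerAl.
Qed.
Lemma wt_mull t r (x : A) : (forall i, (i < size t)%N -> J i * x = x * J i) ->
  wt t r -> wt t (x * r).
Proof.
elim: t => //= b t IH ca [H W]; split; last by apply: IH => // i it; apply: ca; apply: ltnW.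
by rewrite mulrA ca // -mulrA H scalerAr.
Qed.
Lemma wt_cat g t r : wt (g ++ t) r -> wt t r.
Proof. by elim: g => //= b g IH [_ /IH]. Qed.

Lemma wt_Phi g u b t r : ((size (g ++ u :: b :: t)) <= n)%N ->
  wt (g ++ u :: b :: t) r -> wt (g ++ b :: u :: t) (Phi (size t) * r).
Proof.
elim: g => [|c g IH] /= sn.
  move=> [xu [xb W]]; have sn' := ltnW sn; split.
    by rewrite mulrA -(Phi_jm TP) // -mulrA xb scalerAr.
  split; first by rewrite mulrA -(Phi_jmS TP) // -mulrA xu scalerAr.
  apply: wt_mull W => i it; rewrite (Phi_jm_other q0 TP) //; lia.
move=> [xc W]; split; last by apply: IH => //; apply: ltnW.
rewrite !size_cat /= in xc sn *.
rewrite mulrA -(Phi_jm_other q0 TP) ?size_cat //=; try lia.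
by rewrite -mulrA xc scalerAr.
Qed.

Lemma Phi_sqr_wt g u b t r : ((size (g ++ u :: b :: t)) <= n)%N ->
  wt (g ++ u :: b :: t) r ->
  Phi (size t) * (Phi (size t) * r) =
  - ((wtv u - wtv (b + 1)) * (wtv u - wtv (b - 1))) *: r.
Proof.
move=> sn /wt_cat [/= xu [xb _]].
have sn' : ((size t).+1 < n)%N by move: sn; rewrite size_cat /=; lia.
rewrite mulrA (Phi_sqr q0 TP) //.
nc_cert (- (J (size t).+1 - q ^+ 2 *: J (size t)) *
    ((J (size t).+1 * r - wtv u *: r) - q ^- 2 *: (J (size t) * r - wtv b *: r))
  - (wtv u - q ^- 2 * wtv b) *: ((J (size t).+1 * r - wtv u *: r)
    - q ^+ 2 *: (J (size t) * r - wtv b *: r))).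
all: rewrite ?wtvD ?wtv1 ?wtvN1; try by ring.
by rewrite xu xb !subrr !scaler0 !subr0 !(mulr0, scaler0) subr0.
Qed.

(** Every generalised eigenvector of J j is an eigenvector. *)
Definition jm_ss (j : nat) : Prop := forall (c : F) s,
  (J j - c%:A) * ((J j - c%:A) * s) = 0 -> (J j - c%:A) * s = 0.

(** Two consecutive strands never carry the same weight: otherwise T r would be
    a generalised eigenvector of a diagonalisable operator. *)
Lemma wt_equal0 j (c : F) r : (j.+1 < n)%N -> jm_ss j -> J j * r = c *: r ->
  J j.+1 * r = c *: r -> c != 0 -> r = 0.
Proof.
move=> jn ss xr yr c0.
have Tx := hecke_Ty (he_quad TP (jn : (0 < j.+1 < n)%N)) (jm_S T j).
set t := T j.+1 in Tx *; set x := J j in xr Tx *; set y := J j.+1 in yr Tx *.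
have E : (x - c%:A) * (t * r) = - (h * c) *: r.
  nc_cert (t * (y * r - c *: r) - (t * y - (x * t + h *: y)) * r
     - h *: (y * r - c *: r)).
  by rewrite yr Tx !subrr !(mulr0, mul0r, scaler0) !subr0.
have Z : (x - c%:A) * ((x - c%:A) * (t * r)) = 0.
  rewrite E -scalerAr; nc_cert (- (h * c) *: (x * r - c *: r)).
  by rewrite xr subrr scaler0.
have := ss _ _ Z; rewrite E => /eqP; rewrite scaler_eq0 oppr_eq0 mulf_eq0.
by rewrite (negPf h0) (negPf c0) => /eqP.
Qed.

Lemma Phi0_T j r (c d : F) : Phi j * r = 0 -> J j * r = c *: r -> J j.+1 * r = d *: r ->
  c != d -> T j.+1 * r = (h * d / (d - c)) *: r.
Proof.
move=> P0 xr yr cd; have cd' : d - c != 0 by rewrite subr_eq0 eq_sym.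
rewrite /Phi /phi in P0.
nc_cert ((d - c)^-1 *: (- ((T j.+1 * (J j - J j.+1) + h *: J j.+1) * r)
  + T j.+1 * (J j * r - c *: r) - T j.+1 * (J j.+1 * r - d *: r)
  + h *: (J j.+1 * r - d *: r))).
all: try by field; rewrite ?q0 ?cd'.
by rewrite P0 xr yr !subrr !(mulr0, scaler0) oppr0 !addr0 scaler0.
Qed.

(** The pattern (b, far letters, a, b) with a = b -+ 1 does not occur: the far letters
    can be moved out of the way, and the pattern (b, a, b) contradicts the braid
    relation. *)
Lemma wt_chain (e : bool) a g t r : let b := if e then a + 1 else a - 1 in
  let d := if e then a + 2 else a - 2 in
  (1 < n)%N -> ((size g + size t).+2 < n)%N ->
  (forall j, (j <= (size g + size t).+1)%N -> jm_ss j) ->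
  (forall u, u \in g -> wtv u != wtv a /\ wtv u != wtv d) ->
  wt (b :: a :: g ++ b :: t) r -> r = 0.
Proof.
move=> b d n1; elim/last_ind: g t r => [|g u IH] t r /=.
  rewrite add0n => tn ss _ W.
  have ss1 := ss (size t).+1 (leqnn _); have ss0 := ss (size t) (leqnSn _).
  have [yb [ya [xb _]]] := W.
  have n2 : ((size t).+1 < n)%N by apply: ltnW.
  have ab : wtv a != wtv b by apply: wtv_inj; rewrite /b; case: (e); lia.
  have P1 : Phi (size t) * r = 0.
    have [y1 [x1 _]] := @wt_Phi [:: b] a b t r (tn : (_ <= _)%N) W.
    exact: (wt_equal0 tn ss1 x1 y1 (wtv_neq0 _)).
  have P2 : Phi (size t).+1 * r = 0.
    have [_ [x1 [x0 _]]] := @wt_Phi [::] b a (b :: t) r tn W.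
    exact: (wt_equal0 n2 ss0 x0 x1 (wtv_neq0 _)).
  have T1 := Phi0_T P1 xb ya; rewrite eq_sym ab in T1; have {}T1 := T1 isT.
  have {}P2 := Phi0_T P2 ya yb ab.
  have bw : wtv b = (if e then q ^+ 2 else q ^- 2) * wtv a.
    by rewrite /b; case: (e); rewrite wtvD ?wtv1 ?wtvN1 mulrC.
  have w0 := wtv_neq0 a.
  have q21 : q ^+ 2 - 1 != 0.
    by rewrite subr_eq0; have := @qn 1; rewrite muln1; apply; rewrite /= ltnW.
  have q21' : q ^+ 2 + 1 != 0.
    have := @qn 2; rewrite muln2 /= => /(_ n1); apply: contra_neq => E.
    have -> : q ^+ 4 = (q ^+ 2 + 1) * (q ^+ 2 - 1) + 1 by ring.
    by rewrite E mul0r add0r.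
  set m1 := if e then - q^-1 else q; set m2 := if e then q else - q^-1.
  have {}T1 : T (size t).+1 * r = m1 *: r.
    rewrite T1; congr (_ *: _); apply: (canLR (mulfK _)); first by rewrite subr_eq0.
    by rewrite bw /m1; case: (e); field.
  have {}T2 : T (size t).+2 * r = m2 *: r.
    rewrite P2; congr (_ *: _); apply: (canLR (mulfK _)); first by rewrite subr_eq0 eq_sym.
    by rewrite bw /m2; case: (e); field.
  have br := he_braid TP (ltn0Sn (size t)) tn.
  set t1 := T (size t).+1 in T1 br; set t2 := T (size t).+2 in T2 br.
  have E : (m1 * m2 * (m1 - m2)) *: r = 0.
    nc_cert (- (t1 * t2 * (t1 * r - m1 *: r)) - m1 *: (t1 * (t2 * r - m2 *: r))
      - (m1 * m2) *: (t1 * r - m1 *: r) + t2 * t1 * (t2 * r - m2 *: r)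
      + m2 *: (t2 * (t1 * r - m1 *: r)) + (m1 * m2) *: (t2 * r - m2 *: r)
      + (t1 * t2 * t1 - t2 * t1 * t2) * r).
    by rewrite T1 T2 br !subrr !(mulr0, mul0r, scaler0, oppr0, addr0).
  move/eqP: E; rewrite scaler_eq0 => /orP[|/eqP //]; rewrite !mulf_eq0 => E.
  case: (negP q21'); move: E; rewrite /m1 /m2; case: (e);
    rewrite ?oppr_eq0 ?invr_eq0 (negPf q0) ?orbF /= => E.
    have -> : q ^+ 2 + 1 = - q * (- q^-1 - q) by field.
    by rewrite (eqP E) mulr0.
  have -> : q ^+ 2 + 1 = q * (q - - q^-1) by field.
  by rewrite (eqP E) mulr0.
rewrite size_rcons => tn ss far; rewrite cat_rcons => W.
have farg v : v \in g -> wtv v != wtv a /\ wtv v != wtv d.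
  by move=> vg; apply: far; rewrite mem_rcons inE vg orbT.
have sz : (size ([:: b, a & g] ++ u :: b :: t) <= n)%N by rewrite size_cat /=; lia.
have P0 : Phi (size t) * r = 0.
  have W' := @wt_Phi [:: b, a & g] u b t r sz W.
  apply: (IH (u :: t) _ _ _ farg W'); rewrite /= ?addnS; first by lia.
  by move=> j jl; apply: ss; lia.
have := Phi_sqr_wt sz W; rewrite P0 mulr0 => /esym/eqP.
rewrite scaler_eq0 oppr_eq0 mulf_eq0 !subr_eq0 => /orP[|/eqP //].
have [ua ud] := far u (ltac:(by rewrite mem_rcons mem_head)).
have E1 : (if e then b + 1 else b - 1) = d by rewrite /b /d; case: (e); lia.
have E2 : (if e then b - 1 else b + 1) = a by rewrite /b; case: (e); lia.
by case: (e) E1 E2 => -> ->; rewrite (negPf ua) (negPf ud).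
Qed.
End Spectrum.

(** * Completeness of the weight idempotents *)

Fixpoint tabs (m : nat) : seq (seq int) :=
  if m is m'.+1 then flatten [seq [seq b :: t | b <- addables t] | t <- tabs m']
  else [:: [::]].

Lemma mem_tabs m t : (t \in tabs m) = content_seq t && (size t == m).
Proof.
elim: m t => [|m IH] t /=.
  by rewrite inE size_eq0; case: eqP => [->|]; rewrite ?andbF.
apply/flatten_mapP/idP => [[u]|].
  rewrite IH => /andP[cu /eqP su] /mapP[b].
  by rewrite mem_addables // => ab ->; rewrite /= ab cu su eqxx.
case: t => [|b t] // /andP[/= /andP[ab ct] st]; exists t; first by rewrite IH ct.
by apply/mapP; exists b; rewrite ?mem_addables.
Qed.

Section Annihilator.
Context (F : fieldType) (w : int -> F).
Implicit Types (s : seq int) (b c : int).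

Definition ann s : {poly F} := \prod_(c <- s) ('X - (w c)%:P).
(** The Lagrange interpolation polynomial of b at the nodes w c. *)
Definition lag s b : {poly F} :=
  (\prod_(c <- s | c != b) (w b - w c))^-1 *: \prod_(c <- s | c != b) ('X - (w c)%:P).

Lemma lag_ann s b : b \in s -> uniq s ->
  exists k, ('X - (w b)%:P) * lag s b = k *: ann s.
Proof.
move=> bs us; exists ((\prod_(c <- s | c != b) (w b - w c))^-1).
by rewrite /lag /ann -scalerAr [in RHS](bigD1_seq b).
Qed.

Hypothesis (s : seq int) (us : uniq s) (inj : {in s &, injective w}).

Lemma lag_id b : b \in s -> (lag s b).[w b] = 1.
Proof.
move=> bs; rewrite hornerZ horner_prod.
rewrite [X in _ * X](eq_bigr (fun c => w b - w c)); last by move=> c _; rewrite !hornerE.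
rewrite mulVf // prodf_seq_neq0; apply/allP => c cs; apply/implyP => cb.
by rewrite subr_eq0; apply: contra_neq cb => /esym/inj->.
Qed.
Lemma lag_other b c : b \in s -> c \in s -> c != b -> (lag s b).[w c] = 0.
Proof.
move=> bs cs cb; rewrite hornerZ horner_prod.
apply/eqP; rewrite mulf_eq0; apply/orP; right; rewrite prodf_seq_eq0.
by apply/hasP; exists c => //; rewrite cb !hornerE subrr eqxx.
Qed.
Lemma lag_sum : exists k : {poly F}, \sum_(b <- s) lag s b = 1 + k * ann s.
Proof.
have roots : all (root (\sum_(b <- s) lag s b - 1)) (map w s).
  apply/allP => _ /mapP[c cs ->]; rewrite rootE hornerD hornerN hornerC horner_sum.
  rewrite (bigD1_seq c) //= lag_id // big_seq_cond big1 ?addr0 ?subrr // => b /andP[bs bc].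
  by rewrite lag_other // eq_sym.
have uw : uniq_roots (map w s) by rewrite uniq_rootsE map_inj_in_uniq.
have [k E] := uniq_roots_prod_XsubC roots uw.
by exists k; rewrite /ann -(big_map w xpredT (fun x => 'X - x%:P)) -E addrC subrK.
Qed.
End Annihilator.

Lemma dist_chain (e : bool) (a c u : int) (k m : nat) :
  c = (if e then a + 1 else a - 1) -> `|u - a| <= k%:Z -> `|u - c| < k%:Z -> (k.+1 < m)%N ->
  `|u - a| <= m%:Z /\ `|u - (if e then a + 2 else a - 2)| <= m%:Z.
Proof. by case: e; lia. Qed.

Section Completeness.
Context (F : fieldType) (A : algType F) (q : F) (n : nat) (T : nat -> A).
Context (q0 : q != 0) (h0 : q - q^-1 != 0) (TP : hecke_rel q n T).
Context (qn : forall k, (0 < k <= n)%N -> q ^+ (2 * k) != 1).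
Notation h := (q - q^-1).
Notation J := (jm T).
Notation Phi := (Phi q T).
Notation wtv := (wtv q).
Notation wt := (wt q T).
Notation ann := (ann wtv).
Notation lag := (lag wtv).
Implicit Types (t u g : seq int) (a b c : int) (r s : A).

(** The projection to the weight space of t, a product of Lagrange interpolations at the
    contents that were addable at each step. *)
Fixpoint pid t : A :=
  if t is b :: t' then pid t' * horner_alg (J (size t')) (lag (addables t') b) else 1.

Lemma horner_alg_comm (x y : A) P : x * y = y * x -> x * horner_alg y P = horner_alg y P * x.
Proof. exact: horner_alg_intertwine. Qed.

Lemma pid_comm t (x : A) : (forall i, (i < size t)%N -> x * J i = J i * x) ->
  x * pid t = pid t * x.
Proof.
elim: t => [|b t IH] xJ /=; first by rewrite mulr1 mul1r.
by rewrite mulrA IH => [|i /ltnW/xJ //]; rewrite -!mulrA horner_alg_comm // xJ /=.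
Qed.

Lemma wtv_addables_inj t : content_seq t -> (size t < n)%N -> {in addables t &, injective wtv}.
Proof.
move=> ct tn b c; rewrite !mem_addables // => ab ac E; apply/eqP; apply: contraTT isT => bc.
have d := addables_dist ct ab ac; have /negP[] := wtv_inj q0 h0 qn bc ltac:(lia).
by rewrite E.
Qed.

(** On the weight space of t the next Jucys-Murphy element has only the eigenvalues of addable
    contents. *)
Definition Kprop t := pid t * horner_alg (J (size t)) (ann (addables t)) = 0.
Definition Kupto m := forall t, content_seq t -> (size t < m)%N -> Kprop t.

Section Upto.
Context (m : nat) (mn : (m <= n)%N) (K : Kupto m).

Lemma pid_wt t : content_seq t -> (size t <= m)%N -> wt t (pid t).
Proof.
elim: t => // b t IH ctb tm; move/andP: (ctb) => [/= ab ct]; split; last first.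
  by apply: wt_mulr; apply: IH => //; apply: ltnW.
have bt : b \in addables t by rewrite mem_addables.
have [k E] := lag_ann wtv bt (addables_uniq t).
have JP : J (size t) * pid t = pid t * J (size t).
  by apply: pid_comm => i it; apply: (jm_comm TP); move: tm mn it; rewrite /=; lia.
apply/eqP; rewrite -subr_eq0; apply/eqP.
have -> : J (size t) * (pid t * horner_alg (J (size t)) (lag (addables t) b)) -
    wtv b *: (pid t * horner_alg (J (size t)) (lag (addables t) b)) =
  pid t * horner_alg (J (size t)) (('X - (wtv b)%:P) * lag (addables t) b).
  rewrite rmorphM rmorphB /= horner_algX horner_algC mulrA JP.
  by rewrite mulrA mulrBr mulrBl mulr_algr -scalerAl.
by rewrite E linearZ_LR /= mulr_algl -scalerAr (K ct tm) scaler0.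
Qed.

Lemma pid_tabs_sum k : (k <= m)%N -> \sum_(t <- tabs k) pid t = 1.
Proof.
elim: k => [|k IH] km; first by rewrite big_seq1.
rewrite /= big_flatten big_map -[RHS](IH (ltnW km)) big_seq [in RHS]big_seq.
apply: eq_bigr => t; rewrite mem_tabs => /andP[ct /eqP st]; rewrite big_map /= -mulr_sumr.
have tm : (size t < m)%N by rewrite st.
have tn : (size t < n)%N by apply: leq_trans mn.
have [p E] := lag_sum (addables_uniq t) (wtv_addables_inj ct tn).
rewrite -(raddf_sum (horner_alg (J (size t)))) E /= rmorphD rmorphM rmorph1 /= mulrDr mulr1.
have -> : horner_alg (J (size t)) p * horner_alg (J (size t)) (ann (addables t)) =
  horner_alg (J (size t)) (ann (addables t)) * horner_alg (J (size t)) p.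
  by rewrite -!rmorphM mulrC.
by rewrite mulrA (K ct tm) mul0r addr0.
Qed.

Lemma jm_ss_upto j : (j < m)%N -> jm_ss T j.
Proof.
move=> jm c s E.
have decomp x : x = \sum_(t <- tabs j.+1) pid t * x by rewrite -mulr_suml pid_tabs_sum ?mul1r.
rewrite [LHS]decomp big_seq big1 // => t; rewrite mem_tabs => /andP[ct /eqP st].
case: t ct st => // b t ct [st].
have Jp : (J j - c%:A) * pid (b :: t) = pid (b :: t) * (J j - c%:A).
  apply: pid_comm => i it; rewrite mulrBl mulrBr -scalerAl -scalerAr mul1r mulr1.
  by rewrite (jm_comm TP) //; move: it; rewrite /= st; lia.
have ev : (J j - c%:A) * pid (b :: t) = (wtv b - c) *: pid (b :: t).
  have [+ _] := pid_wt ct (ltac:(by rewrite /= st) : (size (b :: t) <= m)%N).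
  by rewrite st mulrBl => ->; rewrite -scalerAl mul1r scalerBl.
have : pid (b :: t) * ((J j - c%:A) * ((J j - c%:A) * s)) = 0 by rewrite E mulr0.
rewrite mulrA -Jp ev -scalerAl (mulrA (pid _)) -Jp ev -scalerAl scalerA => /eqP.
rewrite scaler_eq0 mulf_eq0 orbb => /orP[/eqP->|/eqP->].
  by rewrite scale0r.
by rewrite scaler0.
Qed.
End Upto.

(** A vector of weight c :: t vanishes as soon as c is one of the spurious candidates
    coming from the previous strand. *)
Lemma wt_not_addable a t c r : content_seq (a :: t) -> ((size t).+1 < n)%N ->
  (forall j, (j <= size t)%N -> jm_ss T j) ->
  c \in [:: a + 1, a - 1 & addables t] -> ~~ addable (a :: t) c ->
  wt [:: c, a & t] r -> r = 0.
Proof.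
move=> cta tn ss cin nadd W; move/andP: (cta) => [/= ada ct].
have n1 : (1 < n)%N by lia.
have Ja := wtv_neq0 q0 a.
have [E|ca] := eqVneq c a.
  subst c; case: W => /= [y [x _]]; exact: (wt_equal0 h0 TP tn (ss _ (leqnn _)) x y Ja).
have chain (e : bool) : c = (if e then a + 1 else a - 1) -> r = 0.
  move=> ce.
  have ct' : c \in t.
    apply: contraR nadd => nt; rewrite /addable inE (negPf ca) (negPf nt) /= !inE.
    by rewrite ce; case: (e); rewrite ?addrK ?subrK eqxx ?orbT.
  have [g [t' [tE [cg tkE]]]] := mem_split ct'.
  have ag : a \notin g.
    apply/negP => ag; have at_ : a \in t by rewrite tE mem_cat ag.
    have ii : (index a t <= size g)%N.
      by rewrite tE index_cat ag ltnW // index_mem.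
    have sub : {subset take (index a t) t <= g}.
      move=> x; rewrite tE take_cat; case: ltnP => [_ /mem_take //|il].
      have -> : (index a (g ++ c :: t') - size g)%N = 0%N by apply/eqP; rewrite -tE.
      by rewrite take0 cats0.
    move: ada; rewrite /addable; case: (t) at_ sub => // y t0 at_ sub.
    rewrite at_ => /andP[/sub H1 /sub H2].
    by move: cg; rewrite ce; case: (e); rewrite ?H1 ?H2.
  have dg : (if e then a + 2 else a - 2) \notin g.
    apply: contra nadd => dg; rewrite /addable inE (negPf ca) ct' /=.
    rewrite eq_sym (negPf ca) /= tkE !inE ce.
    have -> : (if e then a + 1 else a - 1) - 1 = (if e then a else a - 2) by case: (e); ring.
    have -> : (if e then a + 1 else a - 1) + 1 = (if e then a + 2 else a) by case: (e); ring.
    by case: (e) dg => ->; rewrite eqxx ?orbT.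
  have stE : size t = (size g + size t').+1 by rewrite tE size_cat /= addnS.
  apply: (@wt_chain _ _ q n T q0 h0 TP qn e a g t' r n1); rewrite -?stE //.
    move=> u ug; have ut : u \in t by rewrite tE mem_cat ug.
    have d1 := addable_dist ct ada ut; have d2 := content_dist ct ut ct'.
    have [d3 d4] := dist_chain ce d1 d2 tn.
    split; apply: (wtv_inj q0 h0 qn) => //; first by apply: contraNneq ag => <-.
    by apply: contraNneq dg => <-.
  by rewrite -ce -tE.
move: cin; rewrite !inE => /or3P[/eqP E|/eqP E|]; [exact: (chain true)|exact: (chain false)|].
rewrite mem_addables // => addc; case/negP: nadd; rewrite addable_far //.
- by rewrite eq_sym.
- by apply/eqP => E; apply: (addable_noadj ct ada); rewrite E subrK.
by apply/eqP => E; apply: (addable_noadj ct addc); rewrite -E.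
Qed.

(** Candidate eigenvalues without weight vectors can be dropped from an annihilating polynomial. *)
Lemma ann_prune t r (s1 s2 : seq int) : wt t r -> (size t < n)%N ->
  (forall c x, c \in s1 -> ~~ addable t c -> wt (c :: t) x -> x = 0) ->
  horner_alg (J (size t)) (ann (s1 ++ s2)) * r = 0 ->
  horner_alg (J (size t)) (ann ([seq c <- s1 | addable t c] ++ s2)) * r = 0.
Proof.
move=> W tn; elim: s1 s2 => // c s1 IH s2 bad /=.
have bad' c' x : c' \in s1 -> ~~ addable t c' -> wt (c' :: t) x -> x = 0.
  by move=> c's; apply: bad; rewrite inE c's orbT.
have swap (s3 : seq int) : ann (s3 ++ c :: s2) = ann (c :: s3 ++ s2).
  by rewrite /ann !(big_cat, big_cons) /= mulrCA.
have [addc|naddc] := boolP (addable t c).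
  by rewrite /= -!swap; apply: IH bad'.
rewrite /ann big_cons rmorphM /= => E; apply: IH => //.
apply: (bad c _ (mem_head _ _) naddc); split; last first.
  apply: wt_mull W => i it; rewrite horner_alg_comm // (jm_comm TP) //; lia.
apply/eqP; rewrite -subr_eq0; apply/eqP; rewrite -[RHS]E rmorphB /= horner_algX horner_algC.
by rewrite !mulrBl mulr_algl -!scalerAl mulrA.
Qed.

(** By induction on the length: the intertwiner of the last two strands bounds the eigenvalues
    of the new element by those of the previous one and their neighbours, and wt_not_addable
    removes the candidates that are not addable. *)
Lemma Kall : Kupto n.
Proof.
suff H m : (m <= n)%N -> Kupto m by exact: H.
elim: m => [|m IH] mn t ct //; rewrite ltnS leq_eqVlt => /predU1P[st|/(IH (ltnW mn)) H]; last exact: H.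
have K := IH (ltnW mn); have {}mn : (m < n)%N := mn; have mn' := ltnW mn.
case: t ct st => [|a t] cta st.
  rewrite /Kprop /= mul1r; have -> : addables [::] = [:: 0] by [].
  rewrite /ann big_seq1 rmorphB /= horner_algX horner_algC /jm /wtv mulr0 expr0z.
  by rewrite scale1r subrr.
move/andP: (cta) => [/= ada ct]; have tn : (size t < m)%N by rewrite -st.
have tn1 : ((size t).+1 < n)%N by rewrite -st in mn.
have Kt := K t ct tn; have W := pid_wt mn' K cta (eq_leq st).
set x := J (size t); set y := J (size t).+1; set P := Phi (size t).
have Pp : P * pid t = pid t * P.
  by apply: pid_comm => i it; apply: (Phi_jm_other q0 TP); lia.
have yp (r : seq int) : (size r <= (size t).+1)%N -> y * pid r = pid r * y.
  by move=> rt; apply: pid_comm => i it; apply: (jm_comm TP); lia.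
have PP : P * P * pid (a :: t) = - horner_alg y (ann [:: a + 1; a - 1]) * pid (a :: t).
  have [xp _] := W; have xy : x * y = y * x by apply: (jm_comm TP); lia.
  move: (pid _) xp => p xp; rewrite (Phi_sqr q0 TP tn1) -/x -/y /ann big_cons big_seq1 rmorphM !rmorphB /=.
  rewrite !horner_algX !horner_algC -/x in xp *.
  nc_cert (q ^- 2 *: ((y - q ^+ 2 *: x) * (x * p - wtv a *: p)) + q ^+ 2 *: ((y - wtv (a - 1) *: 1) * (x * p - wtv a *: p))
    + q ^+ 2 *: ((x * y - y * x) * p)).
  all: rewrite ?wtvD ?wtv1 ?wtvN1 //; try by field; rewrite ?q0.
  by rewrite xp xy !subrr !(mulr0, mul0r, scaler0, addr0, subr0).
pose s1 := [:: a + 1, a - 1 & addables t].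
have E : horner_alg y (ann s1) * pid (a :: t) = 0.
  have -> : ann s1 = ann (addables t) * ann [:: a + 1; a - 1].
    by rewrite /ann !big_cons big_nil mulr1 mulrA mulrC.
  have Z : horner_alg y (ann (addables t)) * (P * P * pid t) = 0.
    have Pf := horner_alg_intertwine (ann (addables t)) (Phi_jm TP tn1).
    have pf : horner_alg x (ann (addables t)) * pid t = 0.
      rewrite -[RHS]Kt; apply: pid_comm => i it; apply/esym; apply: horner_alg_comm.
      by apply: (jm_comm TP); lia.
    by rewrite -mulrA Pp !mulrA -Pf -2!mulrA (mulrA (horner_alg _ _)) pf mul0r mulr0.
  have pe : pid (a :: t) = pid t * horner_alg x (lag (addables t) a) by [].
  rewrite rmorphM /= -mulrA -[X in _ * X]opprK -mulNr -PP pe mulrN.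
  by rewrite (mulrA (P * P)) mulrA Z mul0r oppr0.
have bad c r : c \in s1 -> ~~ addable (a :: t) c -> wt (c :: a :: t) r -> r = 0.
  move=> cs nc; apply: wt_not_addable cs nc => // j jt.
  by apply: (jm_ss_upto mn' K); rewrite -st.
have := @ann_prune (a :: t) _ s1 [::] W tn1 bad.
rewrite !cats0 => /(_ E) {}E.
have us : uniq [seq c <- s1 | addable (a :: t) c].
  rewrite filter_uniq //= addables_uniq !inE !mem_addables // !negb_or andbT.
  have -> : a + 1 != a - 1 by apply/eqP => /addrI.
  apply/andP; split; first by apply/negP/(addable_noadj ct ada).
  by apply/negP => H; apply: (addable_noadj ct H); rewrite subrK.
set s2 := [seq c <- s1 | _] in us E.
rewrite /Kprop; have us3 := addables_uniq (a :: t); have := mem_addables (t := a :: t) ^~ cta.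
move: (addables (a :: t)) us3 => s3 us3 ms3.
have pe : perm_eq s3 (s2 ++ [seq c <- s3 | c \notin s2]).
  apply: uniq_perm; rewrite // ?cat_uniq ?us ?filter_uniq // ?andbT.
    by apply/hasPn => c; rewrite mem_filter => /andP[].
  move=> c; have ms2 : (c \in s2) = addable (a :: t) c && (c \in s1) by rewrite mem_filter.
  rewrite mem_cat [c \in [seq _ <- s3 | _]]mem_filter ms2 ms3.
  by case: (addable (a :: t) c); case: (c \in s1).
have -> : ann s3 = ann s2 * ann [seq c <- s3 | c \notin s2].
  by rewrite /ann -big_cat; apply: perm_big.
rewrite rmorphM /= mulrA -/(pid (a :: t)) -/y -pid_comm ?E ?mul0r // => i it.
by apply/esym/horner_alg_comm; apply: (jm_comm TP); lia.
Qed.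
End Completeness.

Lemma tabs_uniq m : uniq (tabs m).
Proof.
elim: m => // m IH; apply: allpairs_uniq_dep => // [t _|]; first exact: addables_uniq.
by move=> [t b] [u c] _ _ /= [-> ->].
Qed.

Section Idempotents.
Context (F : fieldType) (A : algType F) (q : F) (n : nat) (T : nat -> A).
Context (q0 : q != 0) (h0 : q - q^-1 != 0) (TP : hecke_rel q n T).
Context (qn : forall k, (0 < k <= n)%N -> q ^+ (2 * k) != 1).
Notation h := (q - q^-1).
Notation J := (jm T).
Notation Phi := (Phi q T).
Notation wtv := (wtv q).
Notation wt := (wt q T).
Notation pid := (pid q T).
Implicit Types (t u g : seq int) (a b c : int) (r s x : A).

Lemma pidW t : content_seq t -> (size t <= n)%N -> wt t (pid t).
Proof. exact: (pid_wt q0 h0 TP (leqnn _) (Kall q0 h0 TP qn)). Qed.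
Lemma pid_sum k : (k <= n)%N -> \sum_(t <- tabs k) pid t = 1.
Proof. exact: (pid_tabs_sum q0 h0 qn (leqnn _) (Kall q0 h0 TP qn)). Qed.
Lemma ss j : (j < n)%N -> jm_ss T j.
Proof. exact: (jm_ss_upto q0 h0 TP qn (leqnn _) (Kall q0 h0 TP qn)). Qed.

Lemma wtv_eq b c r : wtv b *: r = wtv c *: r -> r != 0 -> `|b - c| <= n%:Z -> b = c.
Proof.
move=> E r0 d; apply/eqP; apply: contraT => bc.
have /negP[] := wtv_inj q0 h0 qn bc d.
move/eqP: E; rewrite -subr_eq0 -scalerBl scaler_eq0 (negPf r0) orbF subr_eq0 => /eqP->.
exact: eqxx.
Qed.

Lemma addables_dist1 (k m : nat) (x y : int) : `|x - y| <= k%:Z + 1 -> (k < m)%N -> `|x - y| <= m%:Z.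
Proof. clear; lia. Qed.
Lemma wt_eq t u r : content_seq t -> content_seq u -> size t = size u -> (size t <= n)%N ->
  wt t r -> wt u r -> r != 0 -> t = u.
Proof.
move=> + + + + + + r0; elim: t u => [|b t IH] [|c u] //=.
move=> /andP[ab ct] /andP[ac cu] [stu] tn [Jb Wt] [Jc Wu].
have E := IH _ ct cu stu (ltnW tn) Wt Wu; subst u; congr (_ :: _).
apply: (wtv_eq (r := r)) => //; first by rewrite -Jb.
exact: addables_dist1 (addables_dist ct ab ac) tn.
Qed.

Lemma pid_J t j : (size t <= n)%N -> (j < n)%N -> J j * pid t = pid t * J j.
Proof. by move=> tn jn; apply: pid_comm => i it; apply: (jm_comm TP) => //; apply: leq_trans tn. Qed.

Lemma wt_pid t u r : (size t <= n)%N -> (size u <= n)%N -> wt u r -> wt u (pid t * r).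
Proof. by move=> tn un; apply: wt_mull => i iu; apply: pid_J => //; apply: leq_trans un. Qed.

Lemma pid_neq t u r : content_seq t -> content_seq u -> size t = size u -> (size t <= n)%N ->
  wt u r -> t != u -> pid t * r = 0.
Proof.
move=> ct cu stu tn W tu; apply/eqP; apply: contraNT tu => r0; apply/eqP.
apply: (wt_eq (r := pid t * r)) => //; first by apply/wt_mulr/pidW.
by apply: wt_pid; rewrite // -stu.
Qed.
Lemma pid_fix t r : content_seq t -> (size t <= n)%N -> wt t r -> pid t * r = r.
Proof.
move=> ct tn W; rewrite -[RHS]mul1r -(pid_sum tn) mulr_suml.
rewrite (bigD1_seq t) ?tabs_uniq ?mem_tabs ?ct ?eqxx //= big_seq_cond big1 ?addr0 // => u.
rewrite mem_tabs => /andP[/andP[cu /eqP su] ut].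
by apply: (pid_neq cu ct); rewrite // su.
Qed.
Lemma pid_idem t : content_seq t -> (size t <= n)%N -> pid t * pid t = pid t.
Proof. by move=> ct tn; apply: pid_fix => //; apply: pidW. Qed.
Lemma pid_orth t u : content_seq t -> content_seq u -> size t = size u -> (size t <= n)%N ->
  t != u -> pid t * pid u = 0.
Proof. by move=> ct cu su tn; apply: pid_neq; rewrite // -?su //; apply: pidW; rewrite -?su. Qed.
Lemma wt_nonzero m r : (m <= n)%N -> r != 0 ->
  exists t, [/\ content_seq t, size t = m & pid t * r != 0].
Proof.
move=> mn r0; apply: contrapT => H; case/negP: r0; apply/eqP.
rewrite -[LHS]mul1r -(pid_sum mn) mulr_suml big_seq big1 // => t.
rewrite mem_tabs => /andP[ct /eqP st]; apply/eqP; apply: contraT => rt.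
by case: H; exists t.
Qed.

Lemma swap_near g (u b : int) t (c : int) : content_seq (g ++ u :: b :: t) ->
  addable (g ++ b :: u :: t) c -> exists2 v, v \in g ++ u :: b :: t & `|v - c| <= 1.
Proof.
move=> _; have sub v : v \in g ++ b :: u :: t -> v \in g ++ u :: b :: t.
  by rewrite !mem_cat !inE => /or4P[->|->|->|->]; rewrite ?orbT.
have ne : g ++ b :: u :: t != [::] by case: g {sub}.
case/(addable_near ne) => /sub H; [exists c | exists (c - 1) | exists (c + 1)] => //.
all: clear; lia.
Qed.

Lemma swap_dist (k m : nat) (x y v : int) : `|v - x| <= k%:Z -> `|v - y| <= 1 -> (k < m)%N ->
  `|y - x| <= m%:Z.
Proof. clear; lia. Qed.

(** The swapped sequence is not known to belong to a tableau; a nonzero vector that also has the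
    weight of the tableau v identifies the two. *)
Lemma wt_swap g (u b : int) t (v : seq int) r : content_seq (g ++ u :: b :: t) -> content_seq v ->
  size v = size (g ++ b :: u :: t) -> (size v <= n)%N ->
  wt v r -> wt (g ++ b :: u :: t) r -> r != 0 -> v = g ++ b :: u :: t.
Proof.
move=> + + + + + + r0; elim: g v => [|c g IH] v /=; last first.
  case: v => //= d v /andP[ac cu] /andP[ad cv] [sv] vn [Jd Wv] [Jc W].
  have E := IH _ cu cv sv (ltnW vn) Wv W; subst v; congr (_ :: _).
  have [x xu xd] := swap_near cu ad; have xc := addable_dist cu ac xu.
  apply: (wtv_eq (r := r)) => //; first by rewrite -Jd.
  by apply: swap_dist xc xd _; move: vn; rewrite !size_cat.
case: v => [|d1 [|d0 v]] //= /andP[au /andP[ab ct]] /andP[ad1 /andP[ad0 cv]] [sv] vn.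
move=> [Jd1 [Jd0 Wv]] [Jb [Ju Wt]].
have E := wt_eq cv ct sv (ltnW (ltnW vn)) Wv Wt r0; subst v.
have E0 : d0 = u.
  apply: (wtv_eq (r := r)) => //; first by rewrite -Jd0.
  have cb : content_seq (b :: t) by rewrite /= ab.
  have [t0|tn] := eqVneq t [::].
    move: ad0 ab au vn; rewrite t0 /= => /eqP-> /eqP->; rewrite /addable !inE.
    by case: ifP => //; clear; lia.
  have : exists2 x, x \in t & `|x - d0| <= 1.
    by case: (addable_near tn ad0) => H; [exists d0 | exists (d0 - 1) | exists (d0 + 1)] => //; clear; lia.
  case=> x xt xd; have xu := addable_dist cb au (mem_behead (s := b :: t) xt).
  exact: swap_dist xu xd vn.
subst d0; congr [:: _, _ & _].
apply: (wtv_eq (r := r)) => //; first by rewrite -Jd1.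
have cd : content_seq (u :: t) by rewrite /= ad0.
have [t0|tn] := eqVneq t [::].
  move: ad0 ab ad1 vn; rewrite t0 /= => /eqP-> /eqP->; rewrite /addable !inE.
  by case: ifP => //; clear; lia.
have : exists2 x, x \in t & `|x - b| <= 1.
  by case: (addable_near tn ab) => H; [exists b | exists (b - 1) | exists (b + 1)] => //; clear; lia.
case=> x xt xb; have xd := addable_dist cd ad1 (mem_behead (s := u :: t) xt).
by rewrite distrC; apply: swap_dist xd xb vn.
Qed.
End Idempotents.

(** * Matrix units of the Hecke algebra *)

Section DoubleCosets.
Context (F : fieldType) (A : algType F) (q : F) (n : nat) (T : nat -> A).
Context (TP : hecke_rel q n T).
Notation h := (q - q^-1).
Notation J := (jm T).
Notation H m := (in_alg_of (gens T m)).
Implicit Types (x : A).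

Lemma gens_sub k m x : (k <= m)%N -> H k x -> H m x.
Proof.
move=> km; apply: ia_sub_gen => _ [j [/andP[j0 ji] ->]].
by apply: ia_gen; exists j; rewrite j0 (leq_trans ji).
Qed.
Lemma gens_T m i : (0 < i < m)%N -> H m (T i).
Proof. by move=> im; apply: ia_gen; exists i. Qed.
Lemma gens_J m i : (i < m)%N -> H m (J i).
Proof. by move=> im; apply: gens_sub im (jm_gens T i). Qed.
Lemma horner_alg_gens m x P : H m x -> H m (horner_alg x P).
Proof.
move=> xm; elim/poly_ind: P => [|P c IH]; first by rewrite raddf0; apply: ia_zero.
rewrite rmorphD rmorphM /= horner_algX horner_algC.
by apply: ia_add; [apply: ia_mul | apply: ia_scal].
Qed.
Inductive sandwich (m : nat) : A -> Prop :=
| sw_base y : H m y -> sandwich m y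
| sw_mid y z : H m y -> H m z -> sandwich m (y * T m * z)
| sw_add x y : sandwich m x -> sandwich m y -> sandwich m (x + y).

Lemma sandwich_mul m x y z : H m x -> H m z -> sandwich m y -> sandwich m (x * y * z).
Proof.
move=> xm zm; elim=> {y} [y ym|y1 y2 m1 m2|y1 y2 _ IH1 _ IH2].
- by apply: sw_base; apply: ia_mul => //; apply: ia_mul.
- have -> : x * (y1 * T m * y2) * z = (x * y1) * T m * (y2 * z) by rewrite !mulrA.
  by apply: sw_mid; apply: ia_mul.
by rewrite mulrDr mulrDl; apply: sw_add.
Qed.

Lemma gens_far m i x : (m < i)%N -> (i < n)%N -> H m x -> T i * x = x * T i.
Proof.
move=> mi iN xm; apply/esym; apply: ia_comm xm => _ [j [/andP[j0 jm] ->]].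
by apply: (he_comm TP) => //; apply: leq_trans mi.
Qed.
Lemma gens_comm m x y : (m <= 1)%N -> H m x -> x * y = y * x.
Proof.
by move=> m1 xm; apply: ia_comm xm => s [j [/andP[j0 jm] _]]; have := leq_trans jm m1; rewrite ltnS leqNgt j0.
Qed.

(** The double coset decomposition of the Hecke algebra relative to its last
    generator. *)
Lemma sandwichP m x : (0 < m < n)%N -> H m.+1 x -> sandwich m x.
Proof.
elim: m x => // m IH x /andP[_ mn].
have TwT w : H m.+1 w -> sandwich m.+1 (T m.+1 * w * T m.+1).
  have [->|m0] := posnP m.
    move=> w1; rewrite -(gens_comm _ (leqnn _) w1) -mulrA (he_quad TP) ?(leq_ltn_trans _ mn) //.
    rewrite mulrDr mulr1 -scalerAr; apply: sw_add; first exact: sw_base.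
    have -> : (q - q^-1) *: (w * T 1) = ((q - q^-1) *: w) * T 1 * 1.
      by rewrite mulr1 scalerAl.
    by apply: sw_mid; [apply: ia_scale | apply: ia_one].
  move/IH; rewrite m0 (ltnW mn) => /(_ isT).
  elim=> {w} [y ym|y z ym zm|y z _ IH1 _ IH2].
  - rewrite (gens_far (ltnSn m) mn ym) -mulrA (he_quad TP) ?mn // mulrDr mulr1 -scalerAr.
    have ym1 := gens_sub (leqnSn m) ym; apply: sw_add; first exact: sw_base.
    have -> : (q - q^-1) *: (y * T m.+1) = ((q - q^-1) *: y) * T m.+1 * 1.
      by rewrite mulr1 scalerAl.
    by apply: sw_mid; [apply: ia_scale | apply: ia_one].
  - have cy := gens_far (ltnSn m) mn ym; have cz := gens_far (ltnSn m) mn zm.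
    have br := he_braid TP m0 mn.
    have -> : T m.+1 * (y * T m * z) * T m.+1 = (y * T m) * T m.+1 * (T m * z).
      rewrite !mulrA cy -!mulrA -cz; congr (_ * _); rewrite !mulrA; congr (_ * _).
      by rewrite br.
    have Tm : H m.+1 (T m) by apply: gens_T; rewrite m0 /=.
    by apply: sw_mid; apply: ia_mul => //; apply: gens_sub (leqnSn m) _.
  by rewrite mulrDr mulrDl; apply: sw_add.
have mul x1 x2 : sandwich m.+1 x1 -> sandwich m.+1 x2 -> sandwich m.+1 (x1 * x2).
  move=> s1; elim: s1 x2 => {x1} [y ym|y z ym zm|y z _ IH1 _ IH2] x2 s2.
  - by rewrite -[y * x2]mulr1; apply: sandwich_mul => //; apply: ia_one.
  - elim: s2 => {x2} [y' ym'|y' z' ym' zm'|y' z' _ IH1 _ IH2].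
    + by rewrite -mulrA; apply: sw_mid => //; apply: ia_mul.
    + have -> : y * T m.+1 * z * (y' * T m.+1 * z') = y * (T m.+1 * (z * y') * T m.+1) * z'.
        by rewrite !mulrA.
      by apply: sandwich_mul => //; apply: TwT; apply: ia_mul.
    by rewrite mulrDr; apply: sw_add.
  by rewrite mulrDl; apply: sw_add; [apply: IH1 | apply: IH2].
elim=> {x} [_ [i [/andP[i0 im] ->]]|c|x y _ sx _ sy|x y _ sx _ sy].
- move: im; rewrite ltnS leq_eqVlt => /predU1P[->|im].
    by rewrite -[T _]mul1r -[_ * _]mulr1; apply: sw_mid; apply: ia_one.
  by apply: sw_base; apply: gens_T; rewrite i0.
- by apply: sw_base; apply: ia_scal.
- exact: sw_add.
exact: mul.
Qed.

Lemma gens_scalar m x : (m <= 1)%N -> H m x -> exists c : F, x = c%:A.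
Proof.
move=> m1; elim=> {x} [s [i [/andP[i0 im] _]]|c|x y _ [a ->] _ [b ->]|x y _ [a ->] _ [b ->]].
- lia.
- by exists c.
- by exists (a + b); rewrite scalerDl.
by exists (a * b); rewrite -scalerAl mul1r scalerA.
Qed.

End DoubleCosets.

Section Matrices.
Context (F : fieldType) (A : algType F) (q : F) (n : nat) (T : nat -> A).
Context (q0 : q != 0) (h0 : q - q^-1 != 0) (TP : hecke_rel q n T).
Context (qn : forall k, (0 < k <= n)%N -> q ^+ (2 * k) != 1).
Notation h := (q - q^-1).
Notation J := (jm T).
Notation Phi := (Phi q T).
Notation wtv := (wtv q).
Notation wt := (wt q T).
Notation pid := (pid q T).
Notation H m := (in_alg_of (gens T m)).
Implicit Types (t u g : seq int) (a b c : int) (r s x : A).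

Lemma pid_gens t m : (size t <= m)%N -> H m (pid t).
Proof.
elim: t => [|b t IH] /= tm; first exact: ia_one.
by apply: ia_mul; [apply: IH; apply: ltnW | apply: horner_alg_gens; apply: gens_J].
Qed.

(** By induction on t, with the double coset decomposition sandwichP. *)
Lemma pid_corner t x : content_seq t -> (size t <= n)%N -> H (size t) x ->
  exists c : F, pid t * x * pid t = c *: pid t.
Proof.
elim: t x => [|b t IH] x ct tn xt.
  by case: (gens_scalar _ xt) => // c ->; exists c; rewrite mul1r mulr1.
have pp := pid_idem q0 h0 TP qn ct tn; have ct' := content_suffix (s := [:: b]) ct.
have W := pidW q0 h0 TP qn ct tn; move/andP: (ct) => [/= ab _].
have [t0|tpos] := posnP (size t).
  have [|c ->] := gens_scalar _ xt; first by rewrite /= t0.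
  by exists c; rewrite mulr_algr -scalerAl pp.
have tn' := ltnW (tn : (size t < n)%N).
have Pt : pid t * pid (b :: t) = pid (b :: t) by apply: (pid_fix q0 h0 TP qn) => //; case: W.
have tP : pid (b :: t) * pid t = pid (b :: t).
  rewrite -[RHS]Pt; apply/esym; apply: pid_comm => i it; apply/esym; apply: (pid_J TP) => //.
  exact: leq_trans it tn.
have base y : H (size t) y -> exists c : F, pid (b :: t) * y * pid (b :: t) = c *: pid (b :: t).
  move=> /(IH _ ct' tn')[c E]; exists c.
  have -> : pid (b :: t) * y * pid (b :: t) = pid (b :: t) * (pid t * y * pid t) * pid (b :: t).
    by rewrite !mulrA tP -!mulrA Pt.
  by rewrite E -scalerAr -scalerAl tP pp.
have tn1 : (0 < size t < n)%N by rewrite tpos.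
have := sandwichP TP tn1 xt; elim=> {x xt} [y /base //|y z ym zm|x y _ [c1 E1] _ [c2 E2]]; last first.
  by exists (c1 + c2); rewrite mulrDr mulrDl E1 E2 scalerDl.
set m := size t in tn1 ym zm base *; set p := pid (b :: t) in base *.
have Jp : J m * p = wtv b *: p by case: W.
have pJ : p * J m = wtv b *: p.
  by rewrite -Jp; apply/esym; apply: (pid_J TP) => //; case/andP: tn1.
have JH w : H m w -> J m * w = w * J m.
  move=> wm; apply/esym; apply: ia_comm wm => _ [j [/andP[j0 jm] ->]].
  by apply: (T_jm_near TP) => //; case/andP: tn1.
have term v : v \in tabs m -> exists c : F, p * y * T m * (pid v * z * p) = c *: p.
  rewrite mem_tabs => /andP[cv /eqP sv]; have vn : (size v <= n)%N by rewrite sv.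
  have vm := pid_gens (eq_leq sv).
  case: v cv sv vn vm => [|d v] cv sv vn vm; first by move: tn1; rewrite -sv.
  have [c E] := base (y * pid (d :: v) * z) (ia_mul (ia_mul ym vm) zm).
  set r := pid (d :: v) * z * p; have {}E : p * y * r = c *: p by rewrite -E /r !mulrA.
  have yr : J m * r = wtv b *: r.
    by rewrite /r mulrA JH; [rewrite -mulrA Jp -scalerAr | apply: ia_mul].
  have [k mE] : exists k, m = k.+1 by case: (m) tn1 => // k _; exists k.
  have xr : J k * r = wtv d *: r.
    have [+ _] := pidW q0 h0 TP qn cv vn; have -> : size v = k by move: sv; rewrite mE => -[].
    by rewrite /r !mulrA => ->; rewrite -!scalerAl.
  rewrite mE in tn1 yr *; have [bd|bd] := eqVneq (wtv d) (wtv b).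
    have r0 : r = 0.
      case/andP: tn1 => _ kn.
      by rewrite bd in xr; apply: (wt_equal0 h0 TP kn _ xr yr (wtv_neq0 q0 _));
         apply: (ss q0 h0 TP qn); apply: ltnW.
    by exists 0; rewrite r0 mulr0 scale0r.
  have Tx := hecke_Tx (he_quad TP tn1) (jm_S T k).
  exists ((wtv b - wtv d)^-1 * (h * wtv b) * c).
  have ly : p * y * J k.+1 = wtv b *: (p * y).
    by rewrite -mulrA -mE -JH // mulrA pJ -scalerAl.
  rewrite -mulrA -scalerA -E; nc_cert (- (wtv b - wtv d)^-1 *: (
      p * y * (T k.+1 * J k - (J k.+1 * T k.+1 - h *: J k.+1)) * r
      - p * y * T k.+1 * (J k * r - wtv d *: r)
      + (p * y * J k.+1 - wtv b *: (p * y)) * (T k.+1 * r - h *: r))).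
  all: try by field; rewrite subr_eq0 eq_sym.
  by rewrite Tx xr ly !subrr !(mulr0, mul0r, subrr, addr0, scaler0).
have -> : p * (y * T m * z) * p = \sum_(v <- tabs m) p * y * T m * (pid v * z * p).
  rewrite -mulr_sumr -!mulr_suml (pid_sum q0 h0 TP qn) ?mul1r ?mulrA //.
rewrite big_seq; elim/big_ind: _ => [|x1 x2 [c1 ->] [c2 ->]|v /term //].
  by exists 0; rewrite scale0r.
by exists (c1 + c2); rewrite scalerDl.
Qed.

Section Words.
Context (m : nat) (t : seq int) (mn : (m <= n)%N) (ct : content_seq t) (st : size t = m).
(** The vectors obtained from pid t by invertible intertwiners, each in a single weight space;
    they span the left ideal of pid t. *)
Definition good (W : A) : Prop := [/\ H m W, W * pid t = W &
  exists u, [/\ content_seq u, size u = m, pid u * W = W & exists2 y, H m y & y * W = pid t]].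
Inductive span : A -> Prop :=
| span0 : span 0
| spanD (k : F) W x : good W -> span x -> span (k *: W + x).

Lemma span_add x y : span x -> span y -> span (x + y).
Proof.
move=> + sy; elim=> {x} [|c W x gW _ IH]; first by rewrite add0r.
by rewrite -addrA; apply: spanD.
Qed.
Lemma span_scale (k : F) x : span x -> span (k *: x).
Proof.
elim=> {x} [|d W x gW _ IH]; first by rewrite scaler0; apply: span0.
by rewrite scalerDr scalerA; apply: spanD.
Qed.
Lemma span_good W : good W -> span W.
Proof. by move=> gW; rewrite -[W]scale1r -[_ *: _]addr0; apply: spanD gW span0. Qed.

Lemma T_good W i : (0 < i < m)%N -> good W -> span (T i * W).
Proof.
case: i => [|i] // /= im gW; case: (gW) => HW Wt [u [cu su uW [y Hy yW]]].
have iN : (i.+1 < n)%N by apply: leq_trans mn.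
have im' := ltnW im.
have [W0|Wn0] := eqVneq W 0; first by rewrite W0 mulr0; apply: span0.
have un : (size u <= n)%N by rewrite su.
have Wu : wt u W by rewrite -uW; apply/wt_mulr/(pidW q0 h0 TP qn).
have [g [u1 [b1 [t0 [uE st0]]]]] : exists g (u1 b1 : int) t0, u = g ++ u1 :: b1 :: t0 /\ size t0 = i.
  exists (take (m - i.+2) u); have := cat_take_drop (m - i.+2) u.
  have : size (drop (m - i.+2) u) = i.+2 by rewrite size_drop su subKn.
  case: (drop _ u) => [|u1 [|b1 t0]] //= [s0] E.
  by exists u1, b1, t0.
rewrite uE in cu Wu un; have [xe [ye _]] := wt_cat Wu; rewrite /= st0 in xe ye.
have ub : wtv b1 != wtv u1.
  apply: contra_neq Wn0 => E; rewrite -E in xe.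
  by apply: (wt_equal0 h0 TP iN _ ye xe (wtv_neq0 q0 _)); apply: (ss q0 h0 TP qn); apply: ltnW.
set W' := Phi i * W.
have TE : T i.+1 * W = (wtv b1 - wtv u1)^-1 *: W' - ((wtv b1 - wtv u1)^-1 * (h * wtv u1)) *: W.
  rewrite /W' /Phi /phi; nc_cert ((wtv b1 - wtv u1)^-1 *: (
    - T i.+1 * (J i * W - wtv b1 *: W) + T i.+1 * (J i.+1 * W - wtv u1 *: W)
    - h *: (J i.+1 * W - wtv u1 *: W))).
  all: try by field; rewrite subr_eq0.
  by rewrite xe ye !subrr !(mulr0, scaler0, addr0, subr0).
rewrite TE; apply: span_add; last by rewrite -scaleNr; apply: span_scale (span_good gW).
apply: span_scale; have [->|W'0] := eqVneq W' 0; first exact: span0.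
apply: span_good; have sw : size (g ++ b1 :: u1 :: t0) = m by rewrite -su uE !size_cat.
have Wp : wt (g ++ b1 :: u1 :: t0) W' by rewrite /W' -st0; apply: (wt_Phi q0 h0 TP).
have cw : content_seq (g ++ b1 :: u1 :: t0).
  have [v [cv sv vW]] := wt_nonzero q0 h0 TP qn mn W'0.
  suff <- : v = g ++ b1 :: u1 :: t0 by [].
  have vn : (size v <= n)%N by rewrite sv.
  apply: (wt_swap q0 h0 qn cu cv _ vn (r := pid v * W')) => //; first by rewrite sv.
    by apply/wt_mulr/(pidW q0 h0 TP qn).
  by apply: (wt_pid TP) => //; rewrite sw.
have HP : H m (Phi i).
  rewrite /Phi /phi; apply: ia_add.
    by apply: ia_mul; [apply: gens_T | apply: ia_sub; apply: gens_J].
  by apply/ia_scale/gens_J.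
split; [exact: ia_mul | by rewrite /W' -mulrA Wt |].
exists (g ++ b1 :: u1 :: t0); split=> //.
  by apply: (pid_fix q0 h0 TP qn) => //; rewrite sw.
set k := - ((wtv u1 - wtv (b1 + 1)) * (wtv u1 - wtv (b1 - 1))).
have PW : Phi i * W' = k *: W by rewrite /W' -st0; apply: (Phi_sqr_wt q0 h0 TP un Wu).
have k0 : k != 0.
  have [/= au /andP[ab c0]] := andP (content_suffix cu).
  have [/= _ /andP[au0 _]] := andP (content_suffix cw).
  have dd := addables_dist c0 au0 ab; rewrite st0 in dd.
  rewrite oppr_eq0 mulf_neq0 // subr_eq0; apply: (wtv_inj q0 h0 qn).
  - by apply/eqP => E; apply: (addable_noadj c0 ab); rewrite -E.
  - by move: dd iN; clear; lia.
  - by apply/eqP => E; apply: (addable_noadj c0 au0); rewrite E subrK.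
  by move: dd iN; clear; lia.
exists (k^-1 *: (y * Phi i)); first by apply: ia_scale; apply: ia_mul.
by rewrite -scalerAl -mulrA PW -scalerAr yW scalerA mulVf // scale1r.
Qed.

Lemma span_H x : H m x -> span (x * pid t).
Proof.
suff main w : span w -> H m x -> span (x * w).
  apply: main; apply: span_good; split; first by apply: pid_gens; rewrite st.
    by rewrite (pid_idem q0 h0 TP qn) // st.
  exists t; split=> //; first by rewrite (pid_idem q0 h0 TP qn) // st.
  by exists 1; [exact: ia_one | rewrite mul1r].
move=> + xm; elim: xm w => {x} [_ [i [im ->]]|c|x y _ IH1 _ IH2|x y _ IH1 _ IH2] w sw.
- elim: sw => {w} [|c W w gW _ IH]; first by rewrite mulr0; apply: span0.
  by rewrite mulrDr -scalerAr; apply: span_add IH; apply/span_scale/T_good.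
- by rewrite -scalerAl mul1r; apply: span_scale.
- by rewrite mulrDl; apply: span_add; [apply: IH1 | apply: IH2].
by rewrite -mulrA; apply/IH1/IH2.
Qed.

(** A nonzero matrix coefficient is invertible: some weight vector obtained by
    applying intertwiners has the right weight, and intertwiners are invertible. *)
Lemma pid_link (s : seq int) x : content_seq s -> size s = m -> H m x -> pid s * x * pid t != 0 ->
  exists2 y, H m y & pid s * x * pid t * y * pid s = pid s.
Proof.
move=> cs ssz Hx; have sn : (size s <= n)%N by rewrite ssz.
rewrite -mulrA => nz.
have [W gW sW] : exists2 W, good W & pid s * W != 0.
  elim: (span_H Hx) nz => [|k W w gW _ IH]; first by rewrite mulr0 eqxx.
  have [W0|W0] := eqVneq (pid s * W) 0; last by exists W.
  by rewrite mulrDr -scalerAr W0 scaler0 add0r.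
have [HW Wt [u [cu su uW [y Hy yW]]]] := gW.
have us : s = u.
  apply/eqP; apply: contraNT sW => us; apply/eqP.
  by rewrite -uW mulrA (pid_orth q0 h0 TP qn) ?mul0r ?ssz.
subst u; have W0 : W != 0 by apply: contraNneq sW => ->; rewrite mulr0.
have Hs : H m (pid s) by apply: pid_gens; rewrite ssz.
have [k1 E1] : exists k, pid s * (x * y) * pid s = k *: pid s.
  by apply: (pid_corner cs sn); rewrite ssz; apply: ia_mul.
have [k2 E2] : exists k, pid s * (W * y) * pid s = k *: pid s.
  by apply: (pid_corner cs sn); rewrite ssz; apply: ia_mul.
have E3 : pid s * (x * pid t) = k1 *: W.
  by rewrite -yW -[in LHS]uW -[in RHS]uW scalerAl -E1 !mulrA.
have k2E : k2 = 1.
  have : k2 *: W = W by rewrite -[in LHS]uW scalerAl -E2 -!mulrA uW yW Wt uW.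
  by move/eqP; rewrite -subr_eq0 -[X in _ - X]scale1r -scalerBl scaler_eq0 (negPf W0) orbF
       subr_eq0 => /eqP.
have k10 : k1 != 0 by apply: contraNneq nz => k0; rewrite E3 k0 scale0r.
exists (k1^-1 *: y); first exact: ia_scale.
rewrite E3 -scalerAr -!scalerAl scalerA mulVf // scale1r.
by rewrite -{1}uW -(mulrA (pid s)) E2 k2E scale1r.
Qed.
End Words.

(** The spectral information on the last two strands: away from the weights where T is
    -q^-1, the sum of the two contents is constrained. *)
Definition last_sums (k : nat) : seq int :=
  flatten [seq (if t is b :: a :: _ then if b == a - 1 then [::] else [:: a + b] else [::])
          | t <- tabs k].

Lemma last_sumsP k (s : int) : s \in last_sums k ->
  [/\ 3 - k%:Z <= s, s <= 2 * k%:Z - 3 & ~~ (2 %| 1 - s)%Z -> s < k%:Z - 2].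
Proof.
case/flatten_mapP => t; rewrite mem_tabs => /andP[ct /eqP st].
case: t ct st => [|b [|a t]] //= ct st; case: eqP => // /eqP ba; rewrite inE => /eqP->.
by have := content_sum (t := t) (a := a) (b := b) ct ba; rewrite st.
Qed.

(** Where the last two contents are b = a - 1 the braid T acts by -1/q, which the first factor
    kills; everywhere else J k J k.+1 acts by a power of q whose exponent is in last_sums. *)
Lemma T_last_spectrum k : n = k.+2 ->
  (T k.+1 + q^-1%:A) * horner_alg (J k * J k.+1) (ann wtv (last_sums n)) = 0.
Proof.
move=> nE; set X := _ * _; rewrite -[LHS]mulr1 -(pid_sum q0 h0 TP qn (leqnn n)).
rewrite mulr_sumr big_seq big1 // => t tn; have := tn; rewrite mem_tabs => /andP[ct /eqP st].
have W := pidW q0 h0 TP qn ct (eq_leq st).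
case: t ct st tn W => [|b [|a t]] ct st tn W; rewrite ?nE // in st.
set p := pid _ in W *; case: W => + [+ _]; have [stk] : (size t).+2 = k.+2 by [].
rewrite /= stk => yp xp.
have ev : J k * J k.+1 * p = wtv (a + b) *: p.
  by rewrite -mulrA yp -scalerAr xp scalerA addrC wtvD.
have [ba|ba] := eqVneq b (a - 1); last first.
  have mem : a + b \in last_sums n.
    by apply/flatten_mapP; exists (b :: a :: t) => //; rewrite (negPf ba) inE.
  rewrite /X -mulrA (horner_alg_eigen _ ev) /ann horner_prod (big_rem _ mem) /=.
  by rewrite !hornerE subrr mul0r scale0r mulr0.
rewrite /X -mulrA (horner_alg_eigen _ ev) -scalerAr.
have kn : (k.+1 < n)%N by rewrite nE.
have sz : size [:: b, a & t] = n by rewrite nE -stk.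
have P0 : Phi k * p = 0.
  apply/eqP; apply: contraT => P0.
  have Wp : wt [:: a, b & t] (Phi k * p).
    rewrite -stk; apply: (@wt_Phi _ _ q n T q0 h0 TP [::]); first by rewrite /= stk nE.
    by apply: (pidW q0 h0 TP qn); rewrite // sz.
  have [v [cv sv vP]] := wt_nonzero q0 h0 TP qn (leqnn n) P0.
  have E : v = [:: a, b & t].
    apply: (@wt_swap _ _ q n T q0 h0 qn [::] b a t v _ ct cv _ _ _ _ vP).
    - by rewrite sv -sz.
    - by rewrite sv.
    - by apply/wt_mulr/(pidW q0 h0 TP qn); rewrite // sv.
    by apply: (wt_pid TP) => //; rewrite ?sv //= stk nE.
  move: cv ct; rewrite E /= => /andP[_ /andP[bt _]] /andP[_ /andP[at_ c0]].
  by exfalso; apply: (addable_noadj c0 bt); rewrite ba subrK.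
have ab : wtv a != wtv b.
  by apply: (wtv_inj q0 h0 qn); rewrite ba; [apply/eqP => /eqP; clear; lia | move: kn; clear; lia].
rewrite mulrDl (Phi0_T P0 xp yp ab) -scalerAl mul1r -scalerDl.
have -> : wtv b = wtv a / q ^+ 2 by rewrite ba (wtvD q0) wtvN1.
suff -> : h * (wtv a / q ^+ 2) / (wtv a / q ^+ 2 - wtv a) + q^-1 = 0 by rewrite scale0r scaler0.
have q21 : q ^+ 2 - 1 != 0.
  by rewrite subr_eq0; have := @qn 1; rewrite muln1; apply; rewrite nE.
have w0 := wtv_neq0 q0 a.
field; rewrite q0 (_ : _ + _ = - wtv a * (q ^+ 2 - 1)); last by ring.
by rewrite mulf_neq0 ?oppr_eq0.
Qed.
End Matrices.

Ltac nc_done := rewrite ?subrr ?(mulr0, mul0r, scaler0, oppr0, addr0, add0r, subr0) //.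

(** * Consequences of the q-Brauer relations *)

Section BraidInverse.
Context (F : fieldType) (A : algType F) (x y x' y' : A).
Context (xx : x * x' = 1) (x'x : x' * x = 1) (yy : y * y' = 1) (y'y : y' * y = 1).
Context (br : x * y * x = y * x * y).
Lemma braid_inv1 : x' * y' * x = y * x' * y'.
Proof.
nc_cert (x' * y' * x * ((1 - y * y') + y * (1 - x * x') * y') + x' * y' * (x * y * x - y * x * y) * x' * y'
  + (x' * (y' * y - 1) * x + (x' * x - 1)) * y * x' * y').
by rewrite xx x'x yy y'y br; rewrite !subrr !(mulr0, mul0r, addr0).
Qed.
End BraidInverse.

Lemma inv_comm (F : fieldType) (A : algType F) (x x' y : A) :
  x * x' = 1 -> x' * x = 1 -> x * y = y * x -> x' * y = y * x'.
Proof.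
move=> xx x'x c; nc_cert (x' * y * (1 - x * x') + x' * (y * x - x * y) * x' + (x' * x - 1) * y * x').
by rewrite xx x'x c; rewrite !subrr !(mulr0, mul0r, addr0).
Qed.

Section Relations.
Set Default Proof Using "All".
Context (F : fieldType) (A : algType F) (q z : F) (n : nat) (T : nat -> A) (E : A).
Context (q0 : q != 0) (z0 : z != 0) (h0 : q - q^-1 != 0) (zz0 : z - z^-1 != 0).
Context (rel : qB_relations n q z T E).
Notation h := (q - q^-1).
Notation dl := (qB_delta q z).
Notation U i := (qB_Tinv q T i).

Lemma delta_neq0 : dl != 0.
Proof. by rewrite /qB_delta mulf_neq0 // invr_eq0. Qed.
Lemma h_delta : h * dl = z - z^-1.
Proof. by rewrite /qB_delta mulrC divfK. Qed.

Lemma qB_hecke : hecke_rel q n T.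
Proof.
split=> [i im|i j i0 ij jn|i i0 iN].
- have [TU _] := qB_TinvP q0 rel im; rewrite /qB_Tinv in TU.
  nc_cert (T i * (T i - (q - q^-1) *: 1) - 1); by rewrite TU subrr.
- by apply: rel; apply: qB_comm; rewrite ?ij // ?i0 ?(ltn_trans i0) ?jn //; lia.
by apply: rel; apply: qB_braid.
Qed.
Lemma TU i : (0 < i < n)%N -> T i * U i = 1. Proof. by case/(qB_TinvP q0 rel). Qed.
Lemma UT i : (0 < i < n)%N -> U i * T i = 1. Proof. by case/(qB_TinvP q0 rel). Qed.
Lemma EE : E * E = dl *: E. Proof. by apply: rel; apply: qB_EE. Qed.
Lemma T1E : (1 < n)%N -> T 1 * E = q *: E. Proof. by move=> ?; apply: rel; apply: qB_TE. Qed.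
Lemma ET1 : (1 < n)%N -> E * T 1 = q *: E. Proof. by move=> ?; apply: rel; apply: qB_ET. Qed.
Lemma ET2E : (2 < n)%N -> E * T 2 * E = z *: E. Proof. by move=> ?; apply: rel; apply: qB_ETE. Qed.
Lemma TE i : (2 < i < n)%N -> T i * E = E * T i.
Proof. by move=> ?; apply: rel; apply: qB_TEcomm. Qed.
Lemma UE i : (2 < i < n)%N -> U i * E = E * U i.
Proof. by move=> im; rewrite /qB_Tinv mulrBl mulrBr TE // mulr_algl mulr_algr. Qed.
Lemma TUcomm i j : (0 < i)%N -> (i.+1 < j)%N -> (j < n)%N ->
  [/\ T i * T j = T j * T i, T i * U j = U j * T i, U i * T j = T j * U i & U i * U j = U j * U i].
Proof.
move=> i0 ij jn; have c : T i * T j = T j * T i by apply: (he_comm qB_hecke).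
have i1 : (0 < i < n)%N by lia. have j1 : (0 < j < n)%N by lia.
have c2 : U i * T j = T j * U i by apply: inv_comm c; rewrite (TU, UT).
have c3 : U j * T i = T i * U j by apply: inv_comm (esym c); rewrite (TU, UT).
by split=> //; apply: inv_comm (esym c3); rewrite (TU, UT).
Qed.

Lemma ET121E : (2 < n)%N -> E * T 2 * T 1 * T 2 * E = (q ^+ 2 * z) *: E.
Proof.
move=> n2; have n1 := ltnW n2; have b := he_braid qB_hecke (ltn0Sn 0) n2.
nc_cert (E * (T 2 * T 1 * T 2 - T 1 * T 2 * T 1) * E + (E * T 1 - q *: E) * T 2 * T 1 * E
  + q *: (E * T 2 * (T 1 * E - q *: E)) + q ^+ 2 *: (E * T 2 * E - z *: E)).
by rewrite b ET1 // T1E // ET2E // !subrr !(mulr0, mul0r, scaler0, addr0).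
Qed.

Section Four.
Context (n3 : (3 < n)%N).
Let n2 : (2 < n)%N. Proof. exact: ltnW. Qed.
Let n1 : (1 < n)%N. Proof. exact: ltnW. Qed.
Notation E2 := (qB_E2 q T E).
Definition qg : A := T 2 * T 3 * U 1 * U 2.
Let tu1 := TU (n1 : (0 < 1 < n)%N). Let ut1 := UT (n1 : (0 < 1 < n)%N).
Let tu2 := TU (n2 : (0 < 2 < n)%N). Let ut2 := UT (n2 : (0 < 2 < n)%N).
Let tu3 := TU (n3 : (0 < 3 < n)%N). Let ut3 := UT (n3 : (0 < 3 < n)%N).
Let br12 := he_braid qB_hecke (ltn0Sn 0) n2.
Let br23 := he_braid qB_hecke (ltn0Sn 1) n3.

Lemma E2_def : E2 = E * qg * E.
Proof. by rewrite /qB_E2 /qg !mulrA. Qed.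
Lemma gE2 : qg * E2 = E2.
Proof. by apply: rel; apply: qB_E2l. Qed.
Lemma E2g : E2 * qg = E2.
Proof. by apply: rel; apply: qB_E2r. Qed.
Lemma g_T1 : qg * T 1 = T 3 * qg.
Proof.
have b := braid_inv1 tu1 ut1 tu2 ut2 br12; rewrite /qg.
nc_cert (T 2 * T 3 * (U 1 * U 2 * T 1 - T 2 * U 1 * U 2) + (T 2 * T 3 * T 2 - T 3 * T 2 * T 3) * U 1 * U 2).
by rewrite b br23 !subrr !(mulr0, mul0r, addr0).
Qed.
Lemma EE2 : E * E2 = dl *: E2.
Proof. by rewrite E2_def !mulrA EE -!scalerAl. Qed.
Lemma E2E : E2 * E = dl *: E2.
Proof. by rewrite E2_def -mulrA EE -!scalerAr. Qed.
Lemma T1E2 : T 1 * E2 = q *: E2.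
Proof. by rewrite E2_def !mulrA T1E // -!scalerAl. Qed.
Lemma E2T1 : E2 * T 1 = q *: E2.
Proof. by rewrite E2_def -mulrA ET1 // -!scalerAr. Qed.
Definition qgi : A := T 2 * T 1 * U 3 * U 2.
Lemma g_gi : qg * qgi = 1.
Proof.
have [c13 cu1 cu3 cuu] := TUcomm (ltn0Sn 0) (ltnSn 2) n3.
rewrite /qg /qgi; nc_cert (T 2 * T 3 * U 1 * (U 2 * T 2 - 1) * T 1 * U 3 * U 2
  + T 2 * T 3 * (U 1 * T 1 - 1) * U 3 * U 2 + T 2 * (T 3 * U 3 - 1) * U 2 + (T 2 * U 2 - 1)).
by rewrite ut2 ut1 tu3 tu2; nc_done.
Qed.
Lemma T3E2 : T 3 * E2 = q *: E2.
Proof.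
have e3 : T 3 * E = E * T 3 by apply: TE; rewrite n3.
have gt := g_T1; have e1 := T1E n1; rewrite E2_def; move: qg gt => g gt.
nc_cert ((T 3 * E - E * T 3) * g * E - E * (g * T 1 - T 3 * g) * E + E * g * (T 1 * E - q *: E)).
by rewrite e3 gt e1; nc_done.
Qed.
Lemma E2T3 : E2 * T 3 = q *: E2.
Proof.
have := g_gi; have := E2g; have := E2T1; have := g_T1; move: qg qgi E2 => g gi e gt et eg ggi.
nc_cert (e * T 3 * (1 - g * gi) - e * (g * T 1 - T 3 * g) * gi + (e * g - e) * T 1 * gi
  + (e * T 1 - q *: e) * gi - q *: ((e * g - e) * gi) + q *: (e * (g * gi - 1))).
by rewrite ggi eg et gt; nc_done.
Qed.
Lemma E2E2 : E2 * E2 = dl ^+ 2 *: E2.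
Proof.
have H : E2 * E2 = E2 * E * qg * E by rewrite {2}E2_def !mulrA.
have eE := E2E; have eg := E2g; rewrite H; move: E2 eE eg {H} => e eE eg.
by rewrite eE -!scalerAl eg eE scalerA.
Qed.
Lemma T3T2E2 : T 3 * T 2 * E2 = T 1 * T 2 * E2.
Proof.
have H : U 1 * U 2 * E2 = U 3 * U 2 * E2.
  have := gE2; rewrite /qg; move: E2 => e ge.
  nc_cert (U 3 * U 2 * (T 2 * T 3 * U 1 * U 2 * e - e) + U 3 * (1 - U 2 * T 2) * T 3 * U 1 * U 2 * e
    + (1 - U 3 * T 3) * U 1 * U 2 * e).
  by rewrite ge ut2 ut3; nc_done.
have := T1E2; have := T3E2; rewrite /qB_Tinv in H *; move: E2 H => e H e3 e1.
nc_cert (- ((T 1 - h *: 1) * (T 2 - h *: 1) * e - (T 3 - h *: 1) * (T 2 - h *: 1) * e)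
  - h *: ((T 1 * e - q *: e) - (T 3 * e - q *: e))).
by rewrite H e1 e3; nc_done.
Qed.
Lemma E2T2T3 : E2 * T 2 * T 3 = E2 * T 2 * T 1.
Proof.
have H : E2 * T 2 * T 3 * U 1 * U 2 = E2 by rewrite -[RHS]E2g /qg !mulrA.
nc_cert (E2 * T 2 * T 3 * (1 - U 1 * T 1) + E2 * T 2 * T 3 * U 1 * (1 - U 2 * T 2) * T 1 
  + (E2 * T 2 * T 3 * U 1 * U 2 - E2) * T 2 * T 1).
by rewrite H ut1 ut2 !subrr !(mulr0, mul0r, addr0).
Qed.
Lemma ET3T2E : E * T 3 * T 2 * E = z *: (T 3 * E).
Proof.
have e3 : T 3 * E = E * T 3 by apply: TE; rewrite n3.
by rewrite -e3 -!mulrA (mulrA E) ET2E // -scalerAr.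
Qed.
Lemma ET2T3E : E * T 2 * T 3 * E = z *: (T 3 * E).
Proof.
have e3 : T 3 * E = E * T 3 by apply: TE; rewrite n3.
by rewrite -mulrA e3 mulrA ET2E // -scalerAl.
Qed.
Lemma ET232E : E * T 2 * T 3 * T 2 * E = z *: (E + h *: (T 3 * E)).
Proof.
have e3 : T 3 * E = E * T 3 by apply: TE; rewrite n3.
have q3 := he_quad qB_hecke (n3 : (0 < 3 < n)%N); have e2 := ET2E n2.
nc_cert (E * (T 2 * T 3 * T 2 - T 3 * T 2 * T 3) * E - (T 3 * E - E * T 3) * T 2 * T 3 * E
  + T 3 * E * T 2 * (T 3 * E - E * T 3) + T 3 * (E * T 2 * E - z *: E) * T 3
  - z *: (T 3 * (T 3 * E - E * T 3)) + z *: ((T 3 * T 3 - (1 + h *: T 3)) * E)).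
by rewrite br23 e3 e2 q3; nc_done.
Qed.
(** This is where E2 enters: a braid of four points between two factors E does not reduce to
    multiples of E and T 3 * E. *)
Lemma ET2132E : E * T 2 * T 1 * T 3 * T 2 * E = E2 + (h * z) *: (E + q *: (T 3 * E)).
Proof.
have c13 : T 1 * T 3 = T 3 * T 1 by apply: (he_comm qB_hecke).
have e1 := T1E n1; have e23 := ET2T3E; have e232 := ET232E; rewrite /qB_E2 /qB_Tinv.
nc_cert (E * T 2 * (T 1 * T 3 - T 3 * T 1) * T 2 * E
 + h *: (E * T 2 * T 3 * (T 1 * E - q *: E)) + (h * q - h ^+ 2) *: (E * T 2 * T 3 * E - z *: (T 3 * E))
 + h *: (E * T 2 * T 3 * T 2 * E - z *: (E + h *: (T 3 * E)))).
all: try by field; rewrite ?q0.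
by rewrite c13 e1 e23 e232; nc_done.
Qed.
(** E2 is fixed by the anti-automorphism that reverses products, which makes the relations of
    the q-Brauer algebra self-dual, see qB_op. *)
Lemma E2_op : E * U 2 * U 1 * T 3 * T 2 * E = E2.
Proof.
have e1 := ET1 n1; have e32 := ET3T2E; have e232 := ET232E; have e := ET2132E.
rewrite {1 2}/qB_Tinv; move: E2 e => e e'.
nc_cert ((E * T 2 * T 1 * T 3 * T 2 * E - (e + (h * z) *: (E + q *: (T 3 * E))))
  - h *: (E * T 2 * T 3 * T 2 * E - z *: (E + h *: (T 3 * E)))
  - h *: ((E * T 1 - q *: E) * T 3 * T 2 * E) - (h * q - h ^+ 2) *: (E * T 3 * T 2 * E - z *: (T 3 * E))).
all: try by field; rewrite ?q0.
by rewrite e' e1 e32 e232; nc_done.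
Qed.
Lemma E2_gop : E2 * (U 2 * U 1 * T 3 * T 2) = E2.
Proof.
have := E2T2T3; have := E2T1; have := E2T3; have t3 := ut3; have t2 := ut2.
have H e : e * T 3 = q *: e -> e * T 1 = q *: e -> e * T 2 * T 3 = e * T 2 * T 1 ->
    e * U 2 * U 1 = e * U 2 * U 3.
  move=> e3 e1 e23; rewrite /qB_Tinv.
  nc_cert (- (e * T 2 * T 3 - e * T 2 * T 1) - h *: ((e * T 1 - q *: e) - (e * T 3 - q *: e))).
  by rewrite e3 e1 e23; nc_done.
move=> e3 e1 e23; have := H _ e3 e1 e23; move: E2 {e3 e1 e23} => e e'.
nc_cert ((e * U 2 * U 1 - e * U 2 * U 3) * T 3 * T 2 + e * U 2 * (U 3 * T 3 - 1) * T 2 + e * (U 2 * T 2 - 1)).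
by rewrite e' t2 t3; nc_done.
Qed.
Lemma gop_E2 : U 2 * U 1 * T 3 * T 2 * E2 = E2.
Proof.
have := T3T2E2; have := ut1; have := ut2; move: E2 => e t2 t1 e'.
nc_cert (U 2 * U 1 * (T 3 * T 2 * e - T 1 * T 2 * e) + U 2 * (U 1 * T 1 - 1) * T 2 * e + (U 2 * T 2 - 1) * e).
by rewrite e' t2 t1; nc_done.
Qed.
Lemma TE2 i : (4 < i < n)%N -> T i * E2 = E2 * T i.
Proof.
move=> /andP[i4 iN]; have ei : T i * E = E * T i by apply: TE; lia.
have [c2 _ d2 _] := TUcomm (ltn0Sn 1) (ltac:(lia) : (3 < i)%N) iN.
have [c1 _ d1 _] := TUcomm (ltn0Sn 0) (ltac:(lia) : (2 < i)%N) iN.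
have [c3 _ d3 _] := TUcomm (ltn0Sn 2) (ltac:(lia) : (4 < i)%N) iN.
by rewrite /qB_E2 !mulrA ei -(mulrA E) -c2 !mulrA -(mulrA _ (T i)) -c3 !mulrA
  -(mulrA _ (T i)) -d1 !mulrA -(mulrA _ (T i)) -d2 !mulrA -(mulrA _ (T i)) ei !mulrA.
Qed.
End Four.
Section Five.
Context (n4 : (4 < n)%N).
Let n3 : (3 < n)%N. Proof. exact: ltnW. Qed.
Let n2 : (2 < n)%N. Proof. exact: ltnW. Qed.
Let n1 : (1 < n)%N. Proof. exact: ltnW. Qed.
Notation E2 := (qB_E2 q T E).
Let tu i : (0 < i < n)%N -> T i * U i = 1. Proof. exact: TU. Qed.
Let ut i : (0 < i < n)%N -> U i * T i = 1. Proof. exact: UT. Qed.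

Lemma T4_g : T 4 * qg = qg * (T 4 * U 3 * T 2 * T 3 * U 4).
Proof.
have tu2 := tu (n2 : (0 < 2 < n)%N); have ut2 := ut (n2 : (0 < 2 < n)%N).
have tu3 := tu (n3 : (0 < 3 < n)%N); have ut3 := ut (n3 : (0 < 3 < n)%N).
have tu4 := tu (n4 : (0 < 4 < n)%N); have ut4 := ut (n4 : (0 < 4 < n)%N).
have br23 := he_braid qB_hecke (ltn0Sn 1) n3; have br34 := he_braid qB_hecke (ltn0Sn 2) n4.
have b := braid_inv1 tu2 ut2 tu3 ut3 br23.
have [c24 _ d24 _] := TUcomm (ltn0Sn 1) (ltnSn 3) n4.
have [c14 _ d14 _] := TUcomm (ltn0Sn 0) (ltnW (ltnSn 3)) n4.
have [c13 _ d13 _] := TUcomm (ltn0Sn 0) (ltnSn 2) n3.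
have u3 : U 3 * T 3 = 1 := ut3.
rewrite /qg; move: (U 1) (U 2) (U 3) (U 4) d13 d14 d24 b tu4 u3 {ut3 tu3 tu2 ut2 ut4} => u1 u2 u3 u4 d13 d14 d24 b tu4 u3'.
nc_cert (- (T 2 * T 4 - T 4 * T 2) * T 3 * u1 * u2
  + T 2 * T 4 * T 3 * u1 * u2 * (1 - T 4 * u4)
  + T 2 * T 4 * T 3 * u1 * (u2 * T 4 - T 4 * u2) * u4
  + T 2 * T 4 * T 3 * (u1 * T 4 - T 4 * u1) * u2 * u4
  - T 2 * (T 3 * T 4 * T 3 - T 4 * T 3 * T 4) * u1 * u2 * u4
  - T 2 * T 3 * T 4 * (u1 * T 3 - T 3 * u1) * u2 * u4
  - T 2 * T 3 * (u1 * T 4 - T 4 * u1) * T 3 * u2 * u4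
  - T 2 * T 3 * u1 * T 4 * T 3 * u2 * (u3 * T 3 - 1) * u4
  - T 2 * T 3 * u1 * T 4 * (u2 * u3 * T 2 - T 3 * u2 * u3) * T 3 * u4
  - T 2 * T 3 * u1 * (u2 * T 4 - T 4 * u2) * u3 * T 2 * T 3 * u4).
by rewrite c24 tu4 d24 d14 br34 d13 b u3'; nc_done.
Qed.
Lemma E2T4E2 : E2 * T 4 * E2 = (dl * z) *: E2.
Proof.
have d0 := delta_neq0.
have e3 : T 3 * E = E * T 3 by apply: TE; rewrite n3.
have e4 : T 4 * E = E * T 4 by apply: TE; rewrite n4.
have f3 : U 3 * E = E * U 3 by apply: UE; rewrite n3.
have f4 : U 4 * E = E * U 4 by apply: UE; rewrite n4.
have := E2T3 n3; have := gE2 n3; have := E2g n3; have := EE2 n3; have := E2E n3; have := E2E2 n3; have := T4_g.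
have := ET2E n2.
have := ut (n3 : (0 < 3 < n)%N); have := tu (n4 : (0 < 4 < n)%N).
move: qg E2 => g e t4 t3 et2 tg ee eE Ee eg ge _.
have H1 : e * T 4 * e = e * (T 4 * U 3 * T 2 * T 3 * U 4) * e.
  have -> : e * T 4 * e = e * (T 4 * g) * e by rewrite -!mulrA ge.
  by rewrite tg !mulrA eg.
have H2 : dl ^+ 2 *: (e * (T 4 * U 3 * T 2 * T 3 * U 4) * e) = (z * dl ^+ 3) *: e.
  have -> : dl ^+ 2 *: (e * (T 4 * U 3 * T 2 * T 3 * U 4) * e)
     = e * E * (T 4 * U 3 * T 2 * T 3 * U 4) * (E * e).
    by rewrite eE Ee -scalerAl -!scalerAl -scalerAr scalerA.
  have -> : e * E * (T 4 * U 3 * T 2 * T 3 * U 4) * (E * e) = e * T 4 * U 3 * (E * T 2 * E) * T 3 * U 4 * e.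
    nc_cert (- e * (T 4 * E - E * T 4) * U 3 * T 2 * T 3 * U 4 * E * e
      - e * T 4 * (U 3 * E - E * U 3) * T 2 * T 3 * U 4 * E * e
      + e * T 4 * U 3 * E * T 2 * T 3 * (U 4 * E - E * U 4) * e
      + e * T 4 * U 3 * E * T 2 * (T 3 * E - E * T 3) * U 4 * e).
    by rewrite e3 e4 f3 f4; nc_done.
  rewrite et2 -scalerAr -!scalerAl; have -> : e * T 4 * U 3 * E * T 3 * U 4 * e = e * E * e.
    nc_cert (- e * T 4 * U 3 * (T 3 * E - E * T 3) * U 4 * e + e * T 4 * (U 3 * T 3 - 1) * E * U 4 * e
      - e * T 4 * (U 4 * E - E * U 4) * e + e * (T 4 * U 4 - 1) * E * e).
    by rewrite e3 t3 f4 t4; nc_done.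
  by rewrite eE -scalerAl ee !scalerA; congr (_ *: _); ring.
have d2 : dl ^+ 2 != 0 by rewrite expf_neq0.
apply: (scalerI d2); rewrite H1 H2 scalerA; congr (_ *: _); ring.
Qed.
End Five.
Section Six.
Context (n5 : (5 < n)%N).
Let n4 : (4 < n)%N. Proof. exact: ltnW. Qed.
Let n3 : (3 < n)%N. Proof. exact: ltnW. Qed.
Let n2 : (2 < n)%N. Proof. exact: ltnW. Qed.
Let n1 : (1 < n)%N. Proof. exact: ltnW. Qed.
Notation E2 := (qB_E2 q T E).
Definition qg' : A := T 4 * T 5 * U 3 * U 4.
(** The braids qg and qg' move pairs of neighbouring strands past each other, so they satisfy
    the braid relation. *)
Lemma ggg : qg * qg' * qg = qg' * qg * qg'.
Proof.
have tu2 := TU (n2 : (0 < 2 < n)%N); have ut2 := UT (n2 : (0 < 2 < n)%N).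
have tu1 := TU (n1 : (0 < 1 < n)%N); have ut1 := UT (n1 : (0 < 1 < n)%N).
have tu3 := TU (n3 : (0 < 3 < n)%N); have ut3 := UT (n3 : (0 < 3 < n)%N).
have tu4 := TU (n4 : (0 < 4 < n)%N); have ut4 := UT (n4 : (0 < 4 < n)%N).
have br23 := he_braid qB_hecke (ltn0Sn 1) n3; have br34 := he_braid qB_hecke (ltn0Sn 2) n4.
have br12 := he_braid qB_hecke (ltn0Sn 0) n2; have br45 := he_braid qB_hecke (ltn0Sn 3) n5.
have [c24 e24 d24 f24] := TUcomm (ltn0Sn 1) (ltnSn 3) n4.
have [c25 e25 d25 f25] := TUcomm (ltn0Sn 1) (ltnW (ltnSn 4)) n5.
have [c14 e14 d14 f14] := TUcomm (ltn0Sn 0) (ltnW (ltnSn 3)) n4.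
have [c13 e13 d13 f13] := TUcomm (ltn0Sn 0) (ltnSn 2) n3.
have [c15 e15 d15 f15] := TUcomm (ltn0Sn 0) (ltnW (ltnW (ltnSn 4))) n5.
have [c35 e35 d35 f35] := TUcomm (ltn0Sn 2) (ltnSn 4) n5.
have G1 : qg * qg' * T 1 = T 3 * (qg * qg').
  have c : qg' * T 1 = T 1 * qg'.
    rewrite /qg' -!mulrA; rewrite -e14 (mulrA (U 3)) -e13 -mulrA (mulrA (T 5)) -c15 -mulrA (mulrA (T 4)) -c14.
    by rewrite -!mulrA.
  by rewrite -mulrA c mulrA g_T1 // !mulrA.
have G3 : qg * qg' * T 3 = T 5 * (qg * qg').
  have b := braid_inv1 tu3 ut3 tu4 ut4 br34.
  have c : qg' * T 3 = T 5 * qg'.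
    rewrite /qg'; nc_cert (T 4 * T 5 * (U 3 * U 4 * T 3 - T 4 * U 3 * U 4)
      + (T 4 * T 5 * T 4 - T 5 * T 4 * T 5) * U 3 * U 4).
    by rewrite b br45; nc_done.
  have c' : qg * T 5 = T 5 * qg.
    rewrite /qg -!mulrA d25 (mulrA (U 1)) d15 -mulrA (mulrA (T 3)) c35 -mulrA (mulrA (T 2)) c25.
    by rewrite -!mulrA.
  by rewrite -mulrA c mulrA c' !mulrA.
have G2 : qg * qg' * T 2 = T 4 * (qg * qg').
  have b := braid_inv1 tu2 ut2 tu3 ut3 br23.
  rewrite /qg /qg'; move: (U 1) (U 2) (U 3) (U 4) b d24 d25 e24 d14 d13 => u1 u2 u3 u4 b d24 d25 e24 d14 d13.
  nc_cert (T 2 * T 3 * u1 * (u2 * T 4 - T 4 * u2) * T 5 * u3 * u4 * T 2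
    + T 2 * T 3 * u1 * T 4 * (u2 * T 5 - T 5 * u2) * u3 * u4 * T 2
    - T 2 * T 3 * u1 * T 4 * T 5 * u2 * u3 * (T 2 * u4 - u4 * T 2)
    + T 2 * T 3 * u1 * T 4 * T 5 * (u2 * u3 * T 2 - T 3 * u2 * u3) * u4
    - T 2 * T 3 * u1 * T 4 * (T 3 * T 5 - T 5 * T 3) * u2 * u3 * u4
    + T 2 * T 3 * (u1 * T 4 - T 4 * u1) * T 3 * T 5 * u2 * u3 * u4
    + T 2 * T 3 * T 4 * (u1 * T 3 - T 3 * u1) * T 5 * u2 * u3 * u4
    + T 2 * (T 3 * T 4 * T 3 - T 4 * T 3 * T 4) * u1 * T 5 * u2 * u3 * u4
    + (T 2 * T 4 - T 4 * T 2) * T 3 * T 4 * u1 * T 5 * u2 * u3 * u4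
    - T 4 * T 2 * T 3 * u1 * (u2 * T 4 - T 4 * u2) * T 5 * u3 * u4
    - T 4 * T 2 * T 3 * u1 * T 4 * (u2 * T 5 - T 5 * u2) * u3 * u4
    - T 4 * T 2 * T 3 * (u1 * T 4 - T 4 * u1) * T 5 * u2 * u3 * u4).
  by rewrite b c24 d24 d25 e24 c35 d14 d13 br34; nc_done.
have H w : w * T 2 = T 4 * w -> w * T 3 = T 5 * w -> w * T 1 = T 3 * w -> w * qg = qg' * w.
  move=> W2 W3 W1; rewrite /qg /qg' /qB_Tinv.
  nc_cert ((w * T 2 - T 4 * w) * T 3 * (T 1 - h *: 1) * (T 2 - h *: 1)
    + T 4 * (w * T 3 - T 5 * w) * (T 1 - h *: 1) * (T 2 - h *: 1)
    + T 4 * T 5 * (w * T 1 - T 3 * w) * (T 2 - h *: 1)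
    + T 4 * T 5 * (T 3 - h *: 1) * (w * T 2 - T 4 * w)).
  by rewrite W1 W2 W3; nc_done.
by rewrite (H _ G2 G3 G1) mulrA.
Qed.
Lemma g'_E2g'E2 : qg' * (E2 * qg' * E2) = E2 * qg' * E2 /\ E2 * qg' * E2 * qg' = E2 * qg' * E2.
Proof.
have c : qg' * E = E * qg'.
  have e4 : T 4 * E = E * T 4 by apply: TE; rewrite n4.
  have e5 : T 5 * E = E * T 5 by apply: TE; rewrite n5.
  have f3 : U 3 * E = E * U 3 by apply: UE; rewrite n3.
  have f4 : U 4 * E = E * U 4 by apply: UE; rewrite n4.
  by rewrite /qg' -!mulrA f4 (mulrA (U 3)) f3 -mulrA (mulrA (T 5)) e5 -mulrA (mulrA (T 4)) e4 -mulrA.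
have := E2g n3; have := gE2 n3; have := EE2 n3; have := E2E n3; have := E2_def n3; have := ggg.
move: qg qg' E2 c => g g' e c gg eD eE Ee ge eg.
have X1 : e * g' * e = dl *: (e * g' * g * E).
  have -> : e * g' * e = e * g' * (E * g * E) by rewrite -eD.
  by rewrite !mulrA -(mulrA e) c !mulrA eE -!scalerAl.
have X2 : e * g' * e = dl *: (E * g * g' * e).
  have -> : e * g' * e = (E * g * E) * g' * e by rewrite -eD.
  by rewrite -(mulrA _ E) -c !mulrA -(mulrA _ E) Ee -scalerAr.
split.
  rewrite X2 -scalerAr; congr (_ *: _).
  nc_cert ((g' * E - E * g') * g * g' * e - E * (g * g' * g - g' * g * g') * e + E * g * g' * (g * e - e)).
  by rewrite c gg ge; nc_done.
rewrite X1 -scalerAl; congr (_ *: _).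
nc_cert (- (e * g' * g * (g' * E - E * g')) - e * (g * g' * g - g' * g * g') * E + (e * g - e) * g' * g * E).
by rewrite c gg eg; nc_done.
Qed.
End Six.
End Relations.
Unset Default Proof Using.

Section Derived.
Context (F : fieldType) (A : algType F) (q z : F) (n : nat) (T : nat -> A) (E : A).
Context (q0 : q != 0) (z0 : z != 0) (h0 : q - q^-1 != 0) (zz0 : z - z^-1 != 0).
Context (rel : qB_relations n q z T E).
Notation h := (q - q^-1).
Notation dl := (qB_delta q z).
Notation E2 := (qB_E2 q T E).

Lemma opE2 : (3 < n)%N -> @qB_E2 F q (op_alg A) T E = E2.
Proof. by move=> n3; rewrite -[RHS](E2_op q0 z0 h0 zz0 rel n3) -!mulrA. Qed.

Lemma qB_op : @qB_relations F n q z (op_alg A) T E.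
Proof.
move=> x y; case=> {x y}.
- move=> i im; have Q := he_quad (qB_hecke q0 z0 h0 zz0 rel) im.
  have : (T i + q^-1%:A) * (T i - q%:A) = 0; last exact.
  nc_cert (T i * T i - (1 + h *: T i)).
  all: try by field.
  by rewrite Q subrr.
- move=> i j im jm ij; have : T j * T i = T i * T j; last exact.
  by apply: rel; apply: qB_comm => //; rewrite orbC.
- move=> k k1 kn; have : T k * (T k.+1 * T k) = T k.+1 * (T k * T k.+1); last exact.
  by rewrite !mulrA; apply: rel; apply: qB_braid.
- exact: (EE q0 z0 h0 zz0 rel).
- by move=> n1; exact: (ET1 q0 z0 h0 zz0 rel n1).
- by move=> n1; exact: (T1E q0 z0 h0 zz0 rel n1).
- by move=> n2; have := ET2E q0 z0 h0 zz0 rel n2; rewrite -mulrA.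
- by move=> i im; exact: (esym (TE q0 z0 h0 zz0 rel im)).
- move=> n3; rewrite opE2 //.
  have : E2 * (qB_Tinv q T 2 * (qB_Tinv q T 1 * (T 3 * T 2))) = E2; last exact.
  by rewrite -[RHS](E2_gop q0 z0 h0 zz0 rel n3) -!mulrA.
move=> n3; rewrite opE2 //.
have : (qB_Tinv q T 2 * (qB_Tinv q T 1 * (T 3 * T 2))) * E2 = E2; last exact.
by rewrite -[RHS](gop_E2 q0 z0 h0 zz0 rel n3) !mulrA.
Qed.

(** The elements T_3, T_4, ... and E2 / delta satisfy the relations of the algebra on n - 2
    points: they act behind the arc of E. *)
Lemma psi_rel : (3 < n)%N -> qB_relations (n - 2) q z (fun i => T i.+2) (dl^-1 *: E2).
Proof.
move=> n3; have d0 := delta_neq0 q0 z0 h0 zz0 rel; have HP := qB_hecke q0 z0 h0 zz0 rel.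
have ZZ (c d : F) (x : A) : (c *: x) * (d *: x) = (c * d) *: (x * x).
  by rewrite -scalerAl -scalerAr scalerA.
have big k : (k < n - 2)%N -> (k.+2 < n)%N by lia.
move=> x y; case=> {x y}.
- move=> i /andP[i1 /big i2]; have Q := he_quad HP (i2 : (0 < i.+2 < n)%N).
  nc_cert (T i.+2 * T i.+2 - (1 + h *: T i.+2)).
  all: try by field.
  by rewrite Q subrr.
- move=> i j /andP[i1 /big i2] /andP[j1 /big j2] ij.
  by apply: rel; apply: qB_comm; rewrite ?i2 ?j2 //.
- by move=> k _ /big kn; apply: rel; apply: qB_braid.
- by rewrite ZZ (E2E2 q0 z0 h0 zz0 rel n3) !scalerA; congr (_ *: _); field.
- by move=> _; rewrite -scalerAr (T3E2 q0 z0 h0 zz0 rel n3) !scalerA mulrC.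
- by move=> _; rewrite -scalerAl (E2T3 q0 z0 h0 zz0 rel n3) !scalerA mulrC.
- move=> n4; rewrite -!scalerAl -scalerAr (E2T4E2 q0 z0 h0 zz0 rel) ?scalerA; last by lia.
  by congr (_ *: _); field.
- move=> i /andP[i2 /big i3]; rewrite -scalerAl -scalerAr (TE2 q0 z0 h0 zz0 rel n3) //; lia.
- move=> n5; have [+ _] := g'_E2g'E2 q0 z0 h0 zz0 rel (ltac:(lia) : (5 < n)%N).
  move=> H.
  have -> : qB_E2 q (fun i => T i.+2) (dl^-1 *: E2) = dl ^- 2 *: (E2 * qg' q T * E2).
    rewrite {1}/qB_E2 -scalerAr -!scalerAl scalerA /qg' !mulrA; congr (_ *: _); field => //.
  rewrite -scalerAr; congr (_ *: _); rewrite -[RHS]H /qg' !mulrA //.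
move=> n5; have [_ +] := g'_E2g'E2 q0 z0 h0 zz0 rel (ltac:(lia) : (5 < n)%N) => H.
have -> : qB_E2 q (fun i => T i.+2) (dl^-1 *: E2) = dl ^- 2 *: (E2 * qg' q T * E2).
  rewrite {1}/qB_E2 -scalerAr -!scalerAl scalerA /qg' !mulrA; congr (_ *: _); field => //.
by rewrite -scalerAl; congr (_ *: _); rewrite -[RHS]H /qg' !mulrA.
Qed.
End Derived.

(** * Coset representatives and commuting sums *)

Lemma hecke_op (F : fieldType) (A : algType F) (q : F) n (T : nat -> A) :
  hecke_rel q n T -> @hecke_rel F (op_alg A) q n T.
Proof.
move=> TP; split=> [i im|i j i0 ij jn|i i0 iN]; first exact: (he_quad TP im).
  exact: (esym (he_comm TP i0 ij jn)).
by have : T i * (T i.+1 * T i) = T i.+1 * (T i * T i.+1); [rewrite !mulrA (he_braid TP) | ].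
Qed.

Lemma hecke_rev (F : fieldType) (A : algType F) (q : F) n (T : nat -> A) :
  hecke_rel q n T -> hecke_rel q n (fun i => T (n - i)%N).
Proof.
move=> TP; split=> [i im|i j i0 ij jn|i i0 iN]; first by apply: (he_quad TP); lia.
  by apply/esym; apply: (he_comm TP); lia.
have -> : (n - i)%N = (n - i.+1).+1 by lia.
by apply/esym; apply: (he_braid TP); lia.
Qed.

Fixpoint dc (F : fieldType) (A : algType F) (T : nat -> A) (a m : nat) : A :=
  if m is k.+1 then T (a + k)%N * dc T a k else 1.
Definition up (F : fieldType) (A : algType F) (T : nat -> A) (a m : nat) : A :=
  dc (T : nat -> op_alg A) a m.
Fixpoint yp (F : fieldType) (A : algType F) (T : nat -> A) (a m : nat) : A :=
  if m is k.+1 then T a * yp T a.+1 k * T a else 1.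

Section Cosets.
Context (F : fieldType) (A : algType F) (T : nat -> A).
Lemma dcS a m : dc T a m.+1 = T (a + m)%N * dc T a m. Proof. by []. Qed.
Lemma dcSr a m : dc T a m.+1 = dc T a.+1 m * T a.
Proof.
elim: m a => [|m IH] a; first by rewrite /= addn0 mul1r mulr1.
by rewrite dcS IH mulrA addnS.
Qed.
Lemma dc_comm a m (x : A) : (forall l, (a <= l < a + m)%N -> T l * x = x * T l) ->
  dc T a m * x = x * dc T a m.
Proof.
elim: m => [|m IH] H; first by rewrite /= mul1r mulr1.
rewrite dcS -mulrA IH => [|l lm]; last by apply: H; lia.
by rewrite !mulrA H //; lia.
Qed.
Context (q : F) (n : nat) (TP : hecke_rel q n T).
Lemma dc_far a m l : (0 < a)%N -> (a + m < l)%N -> (l < n)%N -> T l * dc T a m = dc T a m * T l.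
Proof.
by move=> a0 al ln; apply/esym; apply: dc_comm => i ai; apply: (he_comm TP); lia.
Qed.
Lemma dc_slide a m l : (0 < a)%N -> (a <= l)%N -> (l.+1 < a + m)%N -> (a + m <= n)%N ->
  T l * dc T a m = dc T a m * T l.+1.
Proof.
move=> a0 al; elim: m => [|m IH] lm mn; first by lia.
rewrite dcS; have [lm'|lm'] := ltnP l.+1 (a + m)%N.
  by rewrite mulrA (he_comm TP) -?mulrA ?IH ?mulrA //; lia.
case: m IH lm mn lm' => [|m] IH lm mn lm'; first by lia.
have -> : (a + m.+1)%N = l.+1 by lia.
rewrite dcS; have -> : (a + m)%N = l by lia.
rewrite !mulrA (he_braid TP) -?mulrA ?dc_far //; lia.
Qed.
End Cosets.

Section CosetsOp.
Context (F : fieldType) (A : algType F) (T : nat -> A).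
Lemma upS a m : up T a m.+1 = up T a m * T (a + m)%N. Proof. by []. Qed.
Lemma upSr a m : up T a m.+1 = T a * up T a.+1 m.
Proof. exact: (@dcSr F (op_alg A) T a m). Qed.
Lemma up_comm a m (x : A) : (forall l, (a <= l < a + m)%N -> T l * x = x * T l) ->
  up T a m * x = x * up T a m.
Proof. by move=> H; exact: (esym (@dc_comm F (op_alg A) T a m x (fun l al => esym (H l al)))). Qed.
Context (q : F) (n : nat) (TP : hecke_rel q n T).
Lemma up_far a m l : (0 < a)%N -> (a + m < l)%N -> (l < n)%N -> T l * up T a m = up T a m * T l.
Proof. by move=> a0 al ln; exact: (esym (dc_far (hecke_op TP) a0 al ln)). Qed.
Lemma up_slide a m l : (0 < a)%N -> (a <= l)%N -> (l.+1 < a + m)%N -> (a + m <= n)%N ->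
  T l.+1 * up T a m = up T a m * T l.
Proof. by move=> a0 al lm mn; exact: (esym (dc_slide (hecke_op TP) a0 al lm mn)). Qed.

Definition rop a M (x : A) : A := \sum_(m < M) dc T a m * x * up T a m.

(** Summing over the cosets of a parabolic subgroup turns an element that commutes with
    the smaller Hecke algebra into one that commutes with the larger. *)
Lemma rop_comm a M x l : (0 < a)%N -> (a + M)%N = n.+1 ->
  (forall i, (a < i < n)%N -> T i * x = x * T i) -> (a <= l < n)%N ->
  T l * rop a M x = rop a M x * T l.
Proof.
move=> a0 aM xc /andP[al ln]; pose k := (l - a)%N; have lE : l = (a + k)%N by rewrite /k; lia.
pose f m := dc T a m * x * up T a m.
have kM : (k < M)%N by lia. have k1M : (k.+1 < M)%N by lia.
apply/eqP; rewrite -subr_eq0; apply/eqP; rewrite /rop mulr_sumr mulr_suml -sumrB.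
rewrite (bigD1 (Ordinal kM)) //= (bigD1 (Ordinal k1M)) //=; last first.
  by rewrite -val_eqE /=; lia.
rewrite big1 ?addr0 => [|[m mM] /=]; last first.
  rewrite -!val_eqE /= => /andP[mk mk1]; apply/eqP; rewrite subr_eq0; apply/eqP.
  have [km|mk2] := ltnP k m.
    rewrite !mulrA (dc_slide TP) //; [| lia..].
    have -> : dc T a m * T l.+1 * x = dc T a m * x * T l.+1 by rewrite -mulrA xc ?mulrA //; lia.
    by rewrite -mulrA up_slide ?mulrA //; lia.
  rewrite !mulrA (dc_far TP) //; [| lia..].
  have -> : dc T a m * T l * x = dc T a m * x * T l by rewrite -mulrA xc ?mulrA //; lia.
  by rewrite -mulrA up_far ?mulrA //; lia.
rewrite -lE; set y := dc T a k * x * up T a k.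
have -> : T l * dc T a k * x * (up T a k.+1) = T l * y * T l by rewrite upS -lE /y !mulrA.
have Q := he_quad TP (ltac:(lia) : (0 < l < n)%N).
nc_cert ((T l * T l - (1 + (q - q^-1) *: T l)) * y * T l - T l * y * (T l * T l - (1 + (q - q^-1) *: T l))).
by rewrite Q; nc_done.
Qed.

(** The elements yp are the Jucys-Murphy elements counted from the last strand. *)
Lemma yp_jm j : (j <= n)%N -> jm (fun i => T (n - i)%N) j = yp T (n - j) j.
Proof.
elim: j => // j IH jn; rewrite jm_S IH ?(ltnW jn) //=.
by have -> : (n - j)%N = (n - j.+1).+1 by lia.
Qed.
Lemma yp_comm a m l : (0 < a)%N -> (a + m)%N = n -> (a < l < n)%N -> T l * yp T a m = yp T a m * T l.
Proof.
move=> a0 am la; have -> : a = (n - m)%N by lia.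
rewrite -yp_jm; last by lia.
have := T_jm_near (hecke_rev TP) (i := m) (j := n - l); rewrite subKn; last by lia.
case: m am => [|m] am; first by rewrite /jm mulr1 mul1r.
apply; try lia.
Qed.

Definition refl a k : A := dc T a k.+1 * up T a.+1 k.
Lemma yp_sum a m : (0 < a)%N -> (a + m <= n)%N ->
  yp T a m = 1 + (q - q^-1) *: \sum_(k < m) refl a k.
Proof.
elim: m a => [|m IH] a a0 mn; first by rewrite big_ord0 scaler0 addr0.
rewrite /= IH //; last by lia.
rewrite big_ord_recl mulrDr mulrDl mulr1 (he_quad TP); last by lia.
rewrite -addrA scalerDr; congr (_ + (_ + _)).
  by rewrite /refl /= addn0 !mulr1.
rewrite -scalerAr -scalerAl mulr_sumr mulr_suml; congr (_ *: _); apply: eq_bigr => k _.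
rewrite /refl lift0 dcSr (dcSr T a) (dcSr T a.+1) (upSr a.+1).
have c1 : T a * dc T a.+2 k = dc T a.+2 k * T a.
  by apply/esym; apply: dc_comm => l al; apply/esym; apply: (he_comm TP); have := ltn_ord k; lia.
have c2 : up T a.+2 k * T a = T a * up T a.+2 k.
  by apply: up_comm => l al; apply/esym; apply: (he_comm TP); have := ltn_ord k; lia.
have km := ltn_ord k; have br := he_braid TP a0 (ltac:(lia) : (a.+1 < n)%N).
nc_cert ((T a * dc T a.+2 k - dc T a.+2 k * T a) * T a.+1 * up T a.+2 k * T a
  + dc T a.+2 k * T a * T a.+1 * (up T a.+2 k * T a - T a * up T a.+2 k)
  + dc T a.+2 k * (T a * T a.+1 * T a - T a.+1 * T a * T a.+1) * up T a.+2 k).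
by rewrite c1 c2 br; nc_done.
Qed.

Lemma T_yp a m : q != 0 -> (0 < a)%N -> (a + m.+1 <= n)%N ->
  (T a + q^-1%:A) * yp T a m.+1 = q%:A + q ^+ 2 *: T a +
   (q - q^-1) *: \sum_(k < m) dc T a k.+2 * (1 + q *: T a.+1) * up T a.+2 k.
Proof.
move=> q0 a0 mn; rewrite yp_sum // big_ord_recl.
rewrite (eq_bigr (fun i : 'I_m => refl a i.+1)) => [|i _]; last by rewrite lift0.
have -> : (T a + q^-1%:A) * (1 + (q - q^-1) *: (refl a 0 + \sum_(i < m) refl a i.+1)) =
  (T a + q^-1%:A) * (1 + (q - q^-1) *: refl a 0) +
  (q - q^-1) *: \sum_(i < m) (T a + q^-1%:A) * refl a i.+1.
  by rewrite -mulr_sumr; move: (\sum_(i < m) _) (refl a 0) => s1 s2; nc.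
congr (_ + _ *: _).
  have Q := he_quad TP (ltac:(lia) : (0 < a < n)%N); rewrite /refl /= addn0 /up /= !mulr1.
  nc_cert ((q - q^-1) *: (T a * T a - (1 + (q - q^-1) *: T a))).
  all: try by field.
  by rewrite Q; nc_done.
apply: eq_bigr => k _; have km := ltn_ord k.
have sl := dc_slide TP a0 (leqnn a) (ltac:(lia) : (a.+1 < a + k.+2)%N) (ltac:(lia) : (a + k.+2 <= n)%N).
have Q := he_quad TP (ltac:(lia) : (0 < a.+1 < n)%N).
rewrite /refl upSr; nc_cert ((T a * dc T a k.+2 - dc T a k.+2 * T a.+1) * T a.+1 * up T a.+2 k
  + dc T a k.+2 * (T a.+1 * T a.+1 - (1 + (q - q^-1) *: T a.+1)) * up T a.+2 k).
all: try by field.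
by rewrite sl Q; nc_done.
Qed.
End CosetsOp.

(** * The left ideal generated by E *)

Section Span.
Set Default Proof Using "All".
Context (F : fieldType) (A : algType F) (q z : F) (n : nat) (T : nat -> A) (E : A).
Context (q0 : q != 0) (z0 : z != 0) (h0 : q - q^-1 != 0) (zz0 : z - z^-1 != 0).
Context (rel : qB_relations n q z T E).
Context (D : algType F) (psi : {lrmorphism D -> A}).
Context (psiE : forall d, E * psi d = psi d * E)
        (psiT : forall i, (2 < i < n)%N -> exists d, T i = psi d)
        (psi2 : (3 < n)%N -> exists d, qB_E2 q T E = E * psi d).
Notation h := (q - q^-1).
Notation dl := (qB_delta q z).
Notation E2 := (qB_E2 q T E).
Let HP : hecke_rel q n T := qB_hecke q0 z0 h0 zz0 rel.
Notation dc := (dc T).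

(** The products dc 1 i * dc 2 j represent the cosets of the braids that fix the arc of E; times
    the smaller algebra they span the left ideal of E. *)
Inductive cspan : A -> Prop :=
| cs0 : cspan 0
| csD i j d x : (i < n)%N -> (j < n.-1)%N -> cspan x ->
    cspan (dc 1 i * (dc 2 j * E * psi d) + x).

Lemma cs_add x y : cspan x -> cspan y -> cspan (x + y).
Proof.
move=> + sy; elim=> {x} [|i j d x im jm _ IH]; first by rewrite add0r.
by rewrite -addrA; apply: csD.
Qed.
Lemma cs_gen i j d : (i < n)%N -> (j < n.-1)%N -> cspan (dc 1 i * (dc 2 j * E * psi d)).
Proof. by move=> im jm; rewrite -[X in cspan X]addr0; apply: csD => //; apply: cs0. Qed.
Lemma cs_scale (c : F) x : cspan x -> cspan (c *: x).
Proof.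
elim=> {x} [|i j d x im jm _ IH]; first by rewrite scaler0; apply: cs0.
by rewrite scalerDr !scalerAr -linearZ_LR; apply: csD.
Qed.

Lemma dc_im a m : (2 < a)%N -> (a + m <= n)%N -> exists d, dc a m = psi d.
Proof.
move=> a2; elim: m => [|m IH] am; first by exists 1; rewrite rmorph1.
have [d dE] := IH ltac:(lia); have [d' dE'] := psiT (ltac:(lia) : (2 < a + m < n)%N).
by exists (d' * d); rewrite dcS dE dE' rmorphM.
Qed.

Lemma cs_T2 i j k d : (i < n)%N -> (j < n.-1)%N -> (1 < k < n)%N ->
  cspan (dc 1 i * (T k * (dc 2 j * E * psi d))).
Proof.
move=> im jm km.
have pull l : (2 < l < n)%N -> cspan (dc 1 i * (dc 2 j * T l * E * psi d)).
  move=> lm; have [d' dE] := psiT lm.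
  by rewrite -(mulrA _ (T l)) dE -psiE -!mulrA -rmorphM !mulrA -!(mulrA (dc 1 i)); apply: cs_gen.
case: (ltngtP k j.+2) => kj.
- have [kj1|kj1] := ltnP k j.+1.
    rewrite !(mulrA (T k)) (dc_slide HP) //; [apply: pull; lia | lia..].
  case: j jm kj kj1 pull => [|j] jm kj kj1 pull; first by lia.
  have kE : k = (2 + j)%N by lia.
  have Q := he_quad HP (ltac:(lia) : (0 < k < n)%N).
  have -> : T k * (dc 2 j.+1 * E * psi d) = dc 2 j * E * psi d + h *: (dc 2 j.+1 * E * psi d).
    rewrite dcS -kE; nc_cert ((T k * T k - (1 + h *: T k)) * dc 2 j * E * psi d).
    by rewrite Q; nc_done.
  rewrite mulrDr -scalerAr; apply: cs_add; first by apply: cs_gen => //; lia.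
  by apply: cs_scale; apply: cs_gen.
- by rewrite !(mulrA (T k)) (dc_far HP) //; [apply: pull; lia | lia..].
have -> : T k * (dc 2 j * E * psi d) = dc 2 j.+1 * E * psi d by rewrite dcS kj !mulrA.
by apply: cs_gen => //; lia.
Qed.

Lemma cs_T l x : (0 < l < n)%N -> cspan x -> cspan (T l * x).
Proof.
move=> lm; elim=> {x} [|i j d x im jm _ IH]; first by rewrite mulr0; apply: cs0.
rewrite mulrDr; apply: cs_add IH; case: (ltngtP l i.+1) => li.
- have [li1|li1] := ltnP l i.
    by rewrite mulrA (dc_slide HP) //; [rewrite -(mulrA _ (T l.+1)); apply: cs_T2 => //; lia | lia..].
  case: i im li li1 => [|i] im li li1; first by lia.
  have lE : l = (1 + i)%N by lia.
  have Q := he_quad HP lm.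
  have -> : T l * (dc 1 i.+1 * (dc 2 j * E * psi d)) = dc 1 i * (dc 2 j * E * psi d) +
      h *: (dc 1 i.+1 * (dc 2 j * E * psi d)).
    rewrite dcS -lE; nc_cert ((T l * T l - (1 + h *: T l)) * dc 1 i * dc 2 j * E * psi d).
    by rewrite Q; nc_done.
  apply: cs_add; first by apply: cs_gen => //; lia.
  by apply: cs_scale; apply: cs_gen.
- rewrite mulrA (dc_far HP) //; [|lia..].
  by rewrite -(mulrA _ (T l)); apply: cs_T2 => //; lia.
have -> : T l * (dc 1 i * (dc 2 j * E * psi d)) = dc 1 i.+1 * (dc 2 j * E * psi d).
  by rewrite dcS li !mulrA.
by apply: cs_gen => //; lia.
Qed.

Lemma E_dc a m : (2 < a)%N -> (a + m <= n)%N -> E * dc a m = dc a m * E.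
Proof. by move=> a2 am; have [d ->] := dc_im a2 am; rewrite psiE. Qed.

Lemma EdcE i j : (i < n)%N -> (j < n.-1)%N -> exists d, E * (dc 1 i * dc 2 j) * E = E * psi d.
Proof.
move=> im jm.
have out a m x : (2 < a)%N -> (a + m <= n)%N -> (exists d, E * x * E = E * psi d) ->
    exists d, E * (dc a m * x) * E = E * psi d.
  move=> a2 am [d dE]; have [d' dE'] := dc_im a2 am; exists (d' * d).
  by rewrite mulrA E_dc // -!mulrA (mulrA E) dE dE' rmorphM !mulrA psiE.
have sc x (c : F) : E * x * E = c *: E -> exists d, E * x * E = E * psi d.
  by move=> ->; exists (c%:A); rewrite linearZ_LR rmorph1 mulr_algr.
have case0 : exists d, E * dc 2 j * E = E * psi d.
  case: j jm => [|j] jm; first by apply: (sc _ dl); rewrite mulr1 (EE q0 z0 h0 zz0 rel).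
  rewrite dcSr; apply: out => //; first by lia.
  by apply: (sc _ z); apply: (ET2E q0 z0 h0 zz0 rel); lia.
case: i im => [|[|i]] im; first by rewrite mul1r.
  have [d dE] := case0; exists (q *: d); have n1 : (1 < n)%N by lia.
  by rewrite /= mulr1 mulrA (ET1 q0 z0 h0 zz0 rel) // linearZ_LR -!scalerAl dE scalerAr.
have -> : dc 1 i.+2 * dc 2 j = dc 3 i * (T 2 * (T 1 * dc 2 j)) by rewrite 2!dcSr !mulrA.
apply: (out 3%N i) => //.
case: j jm case0 => [|[|j]] jm _.
- apply: (sc _ (q * z)); have n2 : (2 < n)%N by lia.
  rewrite mulr1 -!mulrA (T1E q0 z0 h0 zz0 rel) ?(ltnW n2) // -!scalerAr !mulrA.
  by rewrite (ET2E q0 z0 h0 zz0 rel) // scalerA.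
- apply: (sc _ (q ^+ 2 * z)); rewrite /= mulr1 !mulrA (ET121E q0 z0 h0 zz0 rel) //; lia.
have n3 : (3 < n)%N by lia.
have c : T 2 * (T 1 * dc 2 j.+2) = dc 4 j * (T 2 * T 1 * T 3 * T 2).
  have f l : (l < 3)%N -> (0 < l)%N -> T l * dc 4 j = dc 4 j * T l.
    by move=> l3 l0; apply/esym; apply: dc_comm => i' ai; apply/esym; apply: (he_comm HP); lia.
  rewrite 2!dcSr; nc_cert (T 2 * (T 1 * dc 4 j - dc 4 j * T 1) * T 3 * T 2 + (T 2 * dc 4 j - dc 4 j * T 2) * T 1 * T 3 * T 2).
  by rewrite !f //; nc_done.
rewrite c; apply: out => //; first by lia.
have [d dE] := psi2 n3; have [d' dE'] := psiT (n3 : (2 < 3 < n)%N).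
exists (d + (h * z) *: (1 + q *: d')).
have := ET2132E q0 z0 h0 zz0 rel n3; rewrite !mulrA => ->; rewrite dE dE' -psiE.
have -> : psi (d + (h * z) *: (1 + q *: d')) = psi d + (h * z) *: (1 + q *: psi d').
  by rewrite linearD linearZ_LR linearD linearZ_LR rmorph1.
nc.
Qed.

Hypothesis gen : forall x : A, in_alg_of (fun y => gens T n y \/ y = E) x.
Hypothesis n2 : (1 < n)%N.

Lemma cs_E x : cspan x -> exists d, E * x = E * psi d.
Proof.
elim=> {x} [|i j d x im jm _ [d' dE']]; first by exists 0; rewrite mulr0 rmorph0 mulr0.
have [d1 dE] := EdcE im jm; exists (d1 * d + d').
by rewrite rmorphD rmorphM mulrDr mulrDr dE' !mulrA -(mulrA E) dE -!mulrA.
Qed.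
Lemma cspan_left x y : cspan y -> cspan (x * y).
Proof.
move: (gen x) y; elim=> {x} [x [[i [im ->]]|->]|c|x y _ IH1 _ IH2|x y _ IH1 _ IH2] w sw.
- exact: cs_T.
- have [d ->] := cs_E sw; have := @cs_gen 0 0 d; rewrite /= !mul1r; apply; lia.
- by rewrite -scalerAl mul1r; apply: cs_scale.
- by rewrite mulrDl; apply: cs_add; [apply: IH1 | apply: IH2].
by rewrite -mulrA; apply/IH1/IH2.
Qed.
Lemma cspanE x : cspan (x * E).
Proof.
apply: cspan_left; have := @cs_gen 0 0 1; rewrite /= rmorph1 !mul1r mulr1; apply; lia.
Qed.
(** Because A E is spanned by cspan, it suffices to reduce E times the coset representatives
    times E, see EdcE. *)
Lemma EAE x : exists d, E * x * E = E * psi d.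
Proof. by rewrite -mulrA; apply/cs_E/cspanE. Qed.
End Span.

(** * A Casimir element *)

Section Casimir.
Set Default Proof Using "All".
Context (F : fieldType) (A : algType F) (q z : F) (n : nat) (T : nat -> A) (E : A).
Context (q0 : q != 0) (z0 : z != 0) (h0 : q - q^-1 != 0) (zz0 : z - z^-1 != 0).
Context (rel : qB_relations n q z T E) (n2 : (1 < n)%N).
Notation h := (q - q^-1).
Notation dl := (qB_delta q z).
Notation E2 := (qB_E2 q T E).
Let HP : hecke_rel q n T := qB_hecke q0 z0 h0 zz0 rel.
Notation dc := (dc T).
Notation up := (up T).
Notation yp := (yp T).

Definition gen2 : A := if (3 < n)%N then E2 else 0.
Definition qS : A := rop T 2 n.-1 E.
(** The sum of the conjugates of E over all pairs of points. It commutes with the Hecke algebra,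
    and modulo the ideal of E2 it acts on E through the central element yp 1 * yp 2, see qQ_E. *)
Definition qQ : A := rop T 1 n qS.

Lemma TE' l : (2 < l < n)%N -> T l * E = E * T l. Proof. exact: (TE q0 z0 h0 zz0 rel). Qed.
Lemma qS_comm l : (2 <= l < n)%N -> T l * qS = qS * T l.
Proof. by move=> lm; apply: (rop_comm HP) => //; [lia | exact: TE']. Qed.
Lemma qQ_comm l : (0 < l < n)%N -> T l * qQ = qQ * T l.
Proof. by move=> lm; apply: (rop_comm HP) => //; exact: qS_comm. Qed.

Lemma up_E a m : (2 < a)%N -> (a + m <= n)%N -> up a m * E = E * up a m.
Proof. by move=> a2 am; apply: up_comm => l lm; apply: TE'; lia. Qed.

Lemma qS_E : h *: (qS * E) = (z *: yp 2 n.-2 - z^-1%:A) * E.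
Proof.
have nE : n.-1 = n.-2.+1 by lia.
rewrite /qS /rop nE big_ord_recl /= mulr1 mul1r mulrDl (EE q0 z0 h0 zz0 rel) mulr_suml.
rewrite (yp_sum HP) //; last by lia.
rewrite scalerDr scalerA (h_delta q0 z0 h0 zz0 rel).
have -> : \sum_(i < n.-2) dc 2 (bump 0 i) * E * up 2 (bump 0 i) * E = z *: (\sum_(k < n.-2) refl T 2 k) * E.
  rewrite scaler_sumr mulr_suml; apply: eq_bigr => k _; have km := ltn_ord k.
  have -> : bump 0 k = k.+1 by [].
  have e := ET2E q0 z0 h0 zz0 rel (ltac:(lia) : (2 < n)%N).
  have ue := @up_E 3 k isT (ltac:(lia) : (3 + k <= n)%N).
  rewrite (upSr T 2) /refl; nc_cert (dc 2 k.+1 * E * T 2 * (up 3 k * E - E * up 3 k)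
    + dc 2 k.+1 * (E * T 2 * E - z *: E) * up 3 k - z *: (dc 2 k.+1 * (up 3 k * E - E * up 3 k))).
  by rewrite ue e; nc_done.
nc.
Qed.

(** Congruence modulo the ideal of E2. *)
Definition eqI (x y : A) : Prop := tideal gen2 (x - y).
Lemma eqI_refl x : eqI x x. Proof using Type. by rewrite /eqI subrr; apply: tideal0. Qed.
Lemma eqI_trans y x w : eqI x y -> eqI y w -> eqI x w.
Proof using Type. by move=> xy yw; have := tidealD xy yw; rewrite addrA subrK. Qed.
Lemma eqI_D x y x' y' : eqI x y -> eqI x' y' -> eqI (x + x') (y + y').
Proof using Type. by move=> H1 H2; have := tidealD H1 H2; rewrite addrACA -opprD. Qed.
Lemma eqI_M a b x y : eqI x y -> eqI (a * x * b) (a * y * b).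
Proof using Type. by move=> H; have := tidealMr b (tidealMl a H); rewrite mulrBr mulrBl. Qed.
Lemma eqI_Z (c : F) x y : eqI x y -> eqI (c *: x) (c *: y).
Proof using Type. by move=> H; have := tidealZ c H; rewrite scalerBr. Qed.
Lemma eqI_sum (m : nat) (f g : 'I_m -> A) : (forall i, eqI (f i) (g i)) ->
  eqI (\sum_i f i) (\sum_i g i).
Proof using Type.
move=> H; rewrite /eqI -sumrB; apply: (big_ind (tideal gen2)) => [||i _]; last exact: H.
  exact: tideal0.
exact: tidealD.
Qed.

Lemma qS_T12E : (2 < n)%N ->
  eqI (qS * T 1 * T 2 * E) (z *: ((T 2 + q^-1%:A) * yp 2 n.-2 * E)).
Proof.
move=> n3; have nE : n.-1 = n.-2.-1.+2 by lia. have nE2 : n.-2 = n.-2.-1.+1 by lia.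
rewrite nE2 (T_yp HP) //; last by lia.
rewrite /qS /rop nE 2!big_ord_recl !mulrDl.
have e1 := ET1 q0 z0 h0 zz0 rel n2; have e2 := ET2E q0 z0 h0 zz0 rel n3.
have t1 := T1E q0 z0 h0 zz0 rel n2.
have br := he_braid HP (ltn0Sn 0) n3.
set s := \sum_(i < n.-2.-1) _; set s' := \sum_(i < n.-2.-1) _.
have Hs : eqI (s * T 1 * T 2 * E) ((h * z) *: (s' * E)).
  rewrite /s /s' !mulr_suml scaler_sumr; apply: eqI_sum => k; have km := ltn_ord k.
  have n4 : (3 < n)%N by lia.
  have -> : lift ord0 (lift ord0 k) = k.+2 :> nat by [].
  have c13 : T 1 * T 3 = T 3 * T 1 by apply: (he_comm HP).
  have u4 l : (0 < l < 3)%N -> T l * up 4 k = up 4 k * T l.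
    by move=> lm; apply/esym; apply: up_comm => i ai; apply/esym; apply: (he_comm HP); lia.
  have uE := @up_E 4 k isT (ltac:(lia) : (4 + k <= n)%N).
  have e3 : T 3 * E = E * T 3 by apply: TE'; lia.
  have -> : dc 2 k.+2 * E * up 2 k.+2 * T 1 * T 2 * E = dc 2 k.+2 * (E * T 2 * T 1 * T 3 * T 2 * E) * up 4 k.
    rewrite 2!(upSr T) ; have v1 := u4 1%N isT; have v2 := u4 2%N isT.
    nc_cert (- (dc 2 k.+2 * E * T 2 * T 3 * (T 1 * up 4 k - up 4 k * T 1) * T 2 * E)
      - dc 2 k.+2 * E * T 2 * T 3 * T 1 * (T 2 * up 4 k - up 4 k * T 2) * E
      + dc 2 k.+2 * E * T 2 * T 3 * T 1 * T 2 * (up 4 k * E - E * up 4 k)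
      - dc 2 k.+2 * E * T 2 * (T 1 * T 3 - T 3 * T 1) * T 2 * E * up 4 k).
    by rewrite v1 v2 uE c13; nc_done.
  rewrite (ET2132E q0 z0 h0 zz0 rel n4).
  have -> : (h * z) *: (dc 2 k.+2 * (1 + q *: T 3) * up 4 k * E) =
    dc 2 k.+2 * ((h * z) *: (E + q *: (T 3 * E))) * up 4 k.
    nc_cert ((h * z) *: (dc 2 k.+2 * (1 + q *: T 3) * (up 4 k * E - E * up 4 k))).
    by rewrite uE; nc_done.
  apply: eqI_M; rewrite /eqI addrK /gen2 n4; exact: tideal_self.
have -> : z *: (q%:A * E + q ^+ 2 *: T 2 * E + h *: s' * E) =
   z *: ((q%:A + q ^+ 2 *: T 2) * E) + (h * z) *: (s' * E) by nc.
rewrite addrA; apply: eqI_D Hs.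
suff -> : z *: ((q%:A + q ^+ 2 *: T 2) * E) = dc 2 0 * E * up 2 0 * T 1 * T 2 * E + dc 2 1 * E * up 2 1 * T 1 * T 2 * E.
  exact: eqI_refl.
rewrite (upSr T) /up /= addn0; have e121 := ET121E q0 z0 h0 zz0 rel n3.
nc_cert (- (E * T 1 - q *: E) * T 2 * E - q *: (E * T 2 * E - z *: E)
  - T 2 * (E * T 2 * T 1 * T 2 * E - (q ^+ 2 * z) *: E)).
by rewrite e1 e2 e121; nc_done.
Qed.

Lemma T1_Y12 : T 1 * (yp 1 n.-1 * yp 2 n.-2) = yp 1 n.-1 * yp 2 n.-2 * T 1.
Proof.
have Y12 : yp 1 n.-1 * yp 2 n.-2 = yp 2 n.-2 * yp 1 n.-1.
  have := jm_comm (hecke_rev HP) (ltac:(lia) : (n.-1 < n)%N) (ltac:(lia) : (n.-2 < n)%N).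
  rewrite !(yp_jm T); try lia.
  have a1 : (n - n.-1)%N = 1%N by lia.
  have a2 : (n - n.-2)%N = 2%N by lia.
  by rewrite a1 a2.
have y1 : yp 1 n.-1 = T 1 * yp 2 n.-2 * T 1 by have -> : n.-1 = n.-2.+1 by lia.
by rewrite {1}Y12 [in LHS]y1 [in RHS]y1 !mulrA.
Qed.

Lemma qQ_E : eqI (h *: (qQ * E))
  ((1 + q ^+ 2) *: (((z * q ^- 2) *: (yp 1 n.-1 * yp 2 n.-2) - z^-1%:A) * E)).
Proof.
have nE : n = n.-2.+2 by lia. have nE1 : n.-1 = n.-2.+1 by lia.
have e1 := T1E q0 z0 h0 zz0 rel n2.
set X := yp 1 n.-1 * yp 2 n.-2; set Y := yp 2 n.-2.
have TX : T 1 * X * E = q *: (X * E) by rewrite T1_Y12 -mulrA e1 -scalerAr.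
(* T_yp gives the factor (T_1 + 1/q) Y_1, and the rest of Y_1 Y_2 is moved through E. *)
have P := T_yp HP q0 (ltn0Sn 0) (ltac:(lia) : (1 + n.-2.+1 <= n)%N); rewrite -nE1 in P.
set s := \sum_(k < n.-2) _ in P.
have XE : (1 + q ^+ 2) *: ((z * q ^- 2) *: (X * E)) =
    (z * q^-1) *: ((q%:A + q ^+ 2 *: T 1 + h *: s) * Y * E).
  rewrite -P; nc_cert (- (z * q^-1) *: (T 1 * X * E - q *: (X * E)) - (z * q^-1) *: ((T 1 + q^-1%:A) * (yp 1 n.-1 * Y * E - X * E))).
  all: try by field.
  by rewrite TX /X /Y; nc_done.
have -> : (1 + q ^+ 2) *: (((z * q ^- 2) *: X - z^-1%:A) * E) =
   (1 + q ^+ 2) *: ((z * q ^- 2) *: (X * E)) - ((1 + q ^+ 2) * z^-1) *: E.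
  by nc_cert (0 : A); try by field.
rewrite XE.
have SE := qS_E.
have -> : (z * q^-1) *: ((q%:A + q ^+ 2 *: T 1 + h *: s) * Y * E) - ((1 + q ^+ 2) * z^-1) *: E =
   (1 + q *: T 1) * (h *: (qS * E)) + (h * z * q^-1) *: (s * Y * E).
  rewrite SE -/Y; nc_cert (q * z^-1 *: (T 1 * E - q *: E)).
  all: try by field; rewrite ?z0 ?q0.
  by rewrite e1; nc_done.
have -> : h *: (qQ * E) = (1 + q *: T 1) * (h *: (qS * E)) +
   h *: \sum_(k < n.-2) dc 1 k.+2 * (qS * T 1 * T 2 * E) * up 3 k.
  rewrite /qQ /rop; have -> : \sum_(m < n) dc 1 m * qS * up 1 m = \sum_(m < n.-2.+2) dc 1 m * qS * up 1 m.
    by rewrite -nE.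
  rewrite 2!big_ord_recl !mulrDl addrA !scalerDr; congr (_ + _).
    change (h *: (dc 1 0 * qS * up 1 0 * E) + h *: (dc 1 1 * qS * up 1 1 * E) =
      1 * (h *: (qS * E)) + q *: T 1 * (h *: (qS * E))).
    rewrite (upSr T) /up /= addn0; nc_cert (h *: (T 1 * qS * (T 1 * E - q *: E))).
    by rewrite e1; nc_done.
  rewrite mulr_suml; congr (_ *: _); apply: eq_bigr => k _; have km := ltn_ord k.
  have -> : lift ord0 (lift ord0 k) = k.+2 :> nat by [].
  rewrite 2!(upSr T); have uE := @up_E 3 k isT (ltac:(lia) : (3 + k <= n)%N).
  nc_cert (dc 1 k.+2 * qS * T 1 * T 2 * (up 3 k * E - E * up 3 k)).
  by rewrite uE; nc_done.
apply: eqI_D; first exact: eqI_refl.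
have -> : (h * z * q^-1) *: (s * Y * E) =
  h *: \sum_(k < n.-2) dc 1 k.+2 * (z *: ((T 2 + q^-1%:A) * yp 2 n.-2 * E)) * up 3 k.
  rewrite /s !mulr_suml -[h * z * q^-1]mulrA -scalerA; congr (_ *: _); rewrite scaler_sumr.
  apply: eq_bigr => k _; have km := ltn_ord k.
  have uE := @up_E 3 k isT (ltac:(lia) : (3 + k <= n)%N).
  have uY : up 3 k * Y = Y * up 3 k.
    by apply: up_comm => l lm; apply: (yp_comm HP) => //; lia.
  rewrite -/Y; nc_cert (dc 1 k.+2 * (z *: ((T 2 + q^-1%:A) * ((up 3 k * Y - Y * up 3 k) * E + Y * (up 3 k * E - E * up 3 k))))).
  all: try by field.
  by rewrite uE uY; nc_done.
apply: eqI_Z; apply: eqI_sum => k; apply: eqI_M; apply: qS_T12E.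
by have := ltn_ord k; lia.
Qed.
End Casimir.
Unset Default Proof Using.

Section Annihilate.
Context (F : fieldType) (A : algType F) (q z : F) (n : nat) (T : nat -> A) (E : A).
Context (q0 : q != 0) (z0 : z != 0) (h0 : q - q^-1 != 0) (zz0 : z - z^-1 != 0).
Context (rel : qB_relations n q z T E) (n2 : (1 < n)%N) (qq0 : 1 + q ^+ 2 != 0).
Notation h := (q - q^-1).
Let HP : hecke_rel q n T := qB_hecke q0 z0 h0 zz0 rel.
Notation I2 := (gen2 q n T E).
Notation eqI := (eqI q n T E).
Notation X := (yp T 1 n.-1 * yp T 2 n.-2).
Context (f : {poly F}) (fX : (T 1 + q^-1%:A) * horner_alg X f = 0)
  (fz : f.[q ^+ 2 * z ^- 2] != 0).
Context (c : A) (cE : tideal E c) (cI : forall y, tideal I2 y -> c * y = y).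

Lemma eqI_sym x y : eqI x y -> eqI y x.
Proof. by move=> H; have := tidealN H; rewrite opprB. Qed.

(** An element of A E killed from the left by every E a vanishes: modulo the ideal of E2
    it is an eigenvector of the central element of the Hecke algebra, with an
    eigenvalue excluded by the spectrum, so it lies in that ideal, where c is a unit. *)
Lemma left_faithful (a y : A) : in_alg_of (gens T n) a -> eqI y (a * E) ->
  (forall b, E * b * y = 0) -> y = 0.
Proof.
move=> aH ya Ey.
have Qy : qQ n T E * y = 0.
  rewrite /qQ /rop mulr_suml big1 // => i _; rewrite -2!mulrA /qS /rop mulr_suml.
  rewrite [X in _ * X]big1 ?mulr0 // => j _.
  by rewrite -2!mulrA (mulrA (up T 2 j)) (mulrA E) Ey mulr0.
have Qa b : in_alg_of (gens T n) b -> b * qQ n T E = qQ n T E * b.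
  move=> bH; apply: ia_comm bH => _ [l [lm ->]].
  exact: (qQ_comm q0 z0 h0 zz0 rel n2).
have XH : in_alg_of (gens T n) X.
  have ypH m a' : (0 < a')%N -> (a' + m <= n)%N -> in_alg_of (gens T n) (yp T a' m).
    elim: m a' => [|m IH] a' a0 am; first exact: ia_one.
    have Ta : in_alg_of (gens T n) (T a') by apply: ia_gen; exists a'; split=> //; lia.
    by rewrite /=; apply: ia_mul => //; apply: ia_mul => //; apply: IH; lia.
  by apply: ia_mul; apply: ypH; lia.
pose al := (z * q ^- 2 * (1 + q ^+ 2))^-1 * h; pose ka := q ^+ 2 * z ^- 2.
pose W := al *: qQ n T E + ka%:A.
have XE : eqI (X * E) (W * E).
  have QE := qQ_E q0 z0 h0 zz0 rel n2.
  have -> : X * E = (z * q ^- 2 * (1 + q ^+ 2))^-1 *: ((1 + q ^+ 2) *: (((z * q ^- 2) *: X - z^-1%:A) * E)) + ka *: E.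
    rewrite /ka; move: X => w; nc_cert (0 : A).
    all: try by field; rewrite ?q0 ?z0 ?qq0.
    by [].
  have -> : W * E = (z * q ^- 2 * (1 + q ^+ 2))^-1 *: (h *: (qQ n T E * E)) + ka *: E.
    by rewrite /W /al; nc.
  apply: eqI_D; last exact: eqI_refl.
  by apply: eqI_Z; apply: eqI_sym.
have XW g : eqI (horner_alg X g * E) (horner_alg W g * E).
  elim/poly_ind: g => [|g k IH]; first by rewrite !raddf0; apply: eqI_refl.
  rewrite !rmorphD !rmorphM /= !horner_algX !horner_algC !mulrDl.
  apply: eqI_D; last exact: eqI_refl.
  have gH : in_alg_of (gens T n) (horner_alg X g) by apply: horner_alg_gens.
  have WgX : horner_alg X g * W = W * horner_alg X g.
    by rewrite /W mulrDr mulrDl -scalerAr -scalerAl Qa // mulr_algr mulr_algl.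
  have := eqI_M (horner_alg X g) 1 XE; rewrite !mulr1 !mulrA => H1.
  apply: eqI_trans H1 _; rewrite WgX.
  have := eqI_M W 1 IH; rewrite !mulr1 !mulrA => H2; apply: eqI_trans H2 _.
  have -> : W * horner_alg W g = horner_alg W g * W by apply: horner_alg_intertwine.
  exact: eqI_refl.
have fE : horner_alg X f * E = 0.
  have TX : T 1 * horner_alg X f = horner_alg X f * T 1.
    by apply: horner_alg_intertwine; apply: (T1_Y12 q0 z0 h0 zz0 rel n2).
  have e1 := T1E q0 z0 h0 zz0 rel n2.
  have : (q^-1 * (1 + q ^+ 2)) *: (horner_alg X f * E) = 0.
    move: (horner_alg X f) fX TX => w fw tw.
    nc_cert (- w * (T 1 * E - q *: E) + ((T 1 + q^-1%:A) * w) * E - (T 1 * w - w * T 1) * E).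
    all: try by field.
    by rewrite e1 fw tw; nc_done.
  by move/eqP; rewrite scaler_eq0 mulf_eq0 invr_eq0 (negPf q0) (negPf qq0) => /eqP.
have Wa : horner_alg W f * a = a * horner_alg W f.
  apply/esym; apply: horner_alg_intertwine.
  by rewrite /W mulrDr mulrDl -scalerAr -scalerAl Qa // mulr_algr mulr_algl.
have yI : tideal I2 y.
  have H1 := eqI_M a 1 (XW f); rewrite fE mulr0 !mulr1 mulrA -Wa -mulrA in H1.
  have H2 := eqI_M (horner_alg W f) 1 ya; rewrite !mulr1 in H2.
  have Wy : horner_alg W f * y = f.[ka] *: y.
    by apply: horner_alg_eigen; rewrite /W mulrDl -scalerAl Qy scaler0 add0r mulr_algl.
  have := eqI_trans H2 (eqI_sym H1); rewrite Wy /eqI subr0 => H3.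
  by have := tidealZ (f.[ka]^-1) H3; rewrite scalerA mulVf // scale1r.
rewrite -(cI yI); move: cE; apply: (tideal_ind (P := fun c => c * y = 0)).
- by rewrite mul0r.
- by move=> u v; rewrite -mulrA -(mulrA u) (mulrA E) Ey mulr0.
by move=> u v Hu Hv; rewrite mulrDl Hu Hv addr0.
Qed.
End Annihilate.

(** * Orthogonalisation of idempotents *)

Section Greedy.
Context (F : fieldType) (A : algType F) (fs : seq A).
Context (f_idem : forall f, f \in fs -> f * f = f)
  (f_corner : forall f x, f \in fs -> exists c : F, f * x * f = c *: f)
  (f_link : forall f g x, f \in fs -> g \in fs -> f * x * g != 0 ->
     exists y, f * x * g * y * f = f)
  (f_left : forall f v, f \in fs -> v * f = v -> v != 0 -> exists y, y * v = f).
Implicit Types (l : seq (A * A * A)).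

(** A triple (v, y, f) stands for the idempotent v * y, which is equivalent to f. *)
Definition linked (t : A * A * A) : Prop :=
  [/\ t.2 \in fs, t.1.2 * t.1.1 = t.2, t.1.1 * t.2 = t.1.1 & t.2 * t.1.2 = t.1.2].
Fixpoint orthsys l : Prop :=
  if l is t :: l' then [/\ linked t,
    forall u, u \in l' -> t.1.2 * u.1.1 = 0 /\ u.1.2 * t.1.1 = 0 & orthsys l'] else True.
Definition tidem (t : A * A * A) : A := t.1.1 * t.1.2.
Definition csum l : A := \sum_(t <- l) tidem t.

Lemma os_linked l t : orthsys l -> t \in l -> linked t.
Proof.
by elim: l => // u l IH [lu _ ol]; rewrite inE => /predU1P[->|/(IH ol)].
Qed.
Lemma os_orth l t u : orthsys l -> t \in l -> u \in l -> t != u -> t.1.2 * u.1.1 = 0.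
Proof.
elim: l => // w l IH [lw ow ol]; rewrite !inE => /predU1P[->|tl] /predU1P[->|ul] tu.
- by rewrite eqxx in tu.
- by case: (ow _ ul).
- by case: (ow _ tl).
exact: IH.
Qed.
Lemma os_v l t : orthsys l -> t \in l -> csum l * t.1.1 = t.1.1 /\ t.1.2 * csum l = t.1.2.
Proof.
elim: l => // w l IH [[wf yv vf fy] ow ol]; rewrite /csum big_cons -/(csum l).
have cw : csum l * w.1.1 = 0 /\ w.1.2 * csum l = 0.
  rewrite /csum mulr_suml mulr_sumr !big_seq !big1 // => u ul; have [a b] := ow _ ul.
    by rewrite /tidem mulrA a mul0r.
  by rewrite /tidem -mulrA b mulr0.
rewrite inE mulrDl mulrDr => /predU1P[->|tl].
  case: cw => -> ->; rewrite !addr0 /tidem -mulrA yv vf; split=> //.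
  by rewrite mulrA yv fy.
have [-> ->] := IH ol tl; have [a b] := ow _ tl.
by rewrite /tidem -mulrA a mulr0 add0r mulrA b mul0r add0r.
Qed.
Lemma os_csum l : orthsys l -> csum l * csum l = csum l.
Proof.
move=> ol; rewrite {2 3}/csum mulr_sumr big_seq [in RHS]big_seq; apply: eq_bigr => t tl.
by rewrite /tidem mulrA; have [-> _] := os_v ol tl.
Qed.

(** Each vector v is made orthogonal to the sum of the idempotents found so far; if the rest
    v' is not zero then y v' = f for some y by f_left, and v' y (1 - sum) is a new idempotent. *)
Lemma greedy (vs : seq (A * A)) : (forall v, v \in vs -> v.2 \in fs /\ v.1 * v.2 = v.1) ->
  exists2 l, orthsys l & forall v, v \in vs -> csum l * v.1 = v.1.
Proof.
elim: vs => [|[v f] vs IH] H; first by exists [::].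
have [w wvs|l ol lv] := IH; first by apply: H; rewrite inE wvs orbT.
have [/= ff vf] := H (v, f) (mem_head _ _).
have cc := os_csum ol; pose v' := (1 - csum l) * v.
have [v0|v0] := eqVneq v' 0.
  exists l => // w; rewrite inE => /predU1P[->|/lv //]; apply/esym/eqP.
  by rewrite -subr_eq0 -[X in X - _]mul1r -mulrBl; apply/eqP.
have [y0 yE] := f_left ff (ltac:(by rewrite /v' -mulrA vf) : v' * f = v') v0.
pose y := f * y0 * (1 - csum l).
have c1 : (1 - csum l) * (1 - csum l) = 1 - csum l.
  nc_cert (csum l * csum l - csum l); by rewrite cc subrr.
have yv' : y * v' = f.
  have -> : y * v' = f * (y0 * v') by rewrite /y /v' -!mulrA (mulrA (1 - _)) c1.
  by rewrite yE f_idem.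
have vf' : v' * f = v' by rewrite /v' -mulrA vf.
have fy : f * y = y by rewrite /y !mulrA f_idem.
have ort u : u \in l -> y * u.1.1 = 0 /\ u.1.2 * v' = 0.
  move=> ul; have [a b] := os_v ol ul; split.
    by rewrite /y -mulrA mulrBl mul1r a subrr mulr0.
  by rewrite /v' mulrA mulrBr mulr1 b subrr mul0r.
exists ((v', y, f) :: l); first by split.
have lift w : csum l * w = w -> csum ((v', y, f) :: l) * w = w.
  move=> cw; rewrite /csum big_cons -/(csum l) mulrDl cw /tidem /= -mulrA.
  have -> : y * w = 0 by rewrite /y -mulrA mulrBl mul1r cw subrr mulr0.
  by rewrite mulr0 add0r.
move=> w; rewrite inE => /predU1P[->|/lv /lift //] /=.
rewrite /csum big_cons -/(csum l) /tidem /= mulrDl.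
have yv : y * v = f.
  by rewrite -yv' /v' mulrA; congr (_ * _); rewrite /y -[in RHS](mulrA (f * y0)) c1.
by rewrite -mulrA yv vf' /v' mulrBl mul1r subrK.
Qed.

Lemma tidem_corner l t x : orthsys l -> t \in l ->
  exists c : F, tidem t * x * tidem t = c *: tidem t.
Proof.
move=> ol tl; have [ff yv vf fy] := os_linked ol tl.
have [c E] := f_corner (t.1.2 * x * t.1.1) ff; exists c.
rewrite /tidem.
have -> : t.1.1 * t.1.2 * x * (t.1.1 * t.1.2) = t.1.1 * (t.2 * (t.1.2 * x * t.1.1) * t.2) * t.1.2.
  by rewrite -{1}fy -{2}vf !mulrA.
by rewrite E -scalerAr -scalerAl vf.
Qed.
Lemma tidem_link l t u x : orthsys l -> t \in l -> u \in l -> tidem t * x * tidem u != 0 ->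
  exists y, tidem t * x * tidem u * y * tidem t = tidem t.
Proof.
move=> ol tl ul nz; have [ff yv vf fy] := os_linked ol tl; have [gf yv' vg gy] := os_linked ol ul.
have [|w E] := @f_link t.2 u.2 (t.1.2 * x * u.1.1) ff gf.
  apply: contraNneq nz => E; rewrite /tidem.
  have -> : t.1.1 * t.1.2 * x * (u.1.1 * u.1.2) = t.1.1 * (t.2 * (t.1.2 * x * u.1.1) * u.2) * u.1.2.
    by rewrite -{1}fy -{1}vg !mulrA.
  by rewrite E mulr0 mul0r.
exists (u.1.1 * w * t.1.2); rewrite /tidem.
have -> : t.1.1 * t.1.2 * x * (u.1.1 * u.1.2) * (u.1.1 * w * t.1.2) * (t.1.1 * t.1.2) =
   t.1.1 * (t.1.2 * x * u.1.1 * (u.1.2 * u.1.1) * w * (t.1.2 * t.1.1)) * t.1.2 by rewrite !mulrA.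
rewrite yv' yv; have -> : t.1.2 * x * u.1.1 * u.2 * w * t.2 = t.2 * (t.1.2 * x * u.1.1) * u.2 * w * t.2.
  by rewrite -{1}fy !mulrA.
by rewrite E vf.
Qed.
Lemma tidem_orth l t u : orthsys l -> t \in l -> u \in l -> tidem t != tidem u ->
  tidem t * tidem u = 0.
Proof.
move=> ol tl ul tu; have tu' : t != u by apply: contra_neq tu => ->.
by rewrite /tidem mulrA -(mulrA t.1.1) (os_orth ol tl ul tu') mulr0 mul0r.
Qed.
Lemma tidem_idem l t : orthsys l -> t \in l -> tidem t * tidem t = tidem t.
Proof.
move=> ol tl; have [ff yv vf fy] := os_linked ol tl.
by rewrite /tidem mulrA -(mulrA t.1.1) yv -mulrA fy.
Qed.
End Greedy.

(** * The tower of q-Brauer algebras *)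

Section HSpan.
Context (F : fieldType) (A : algType F) (H : A -> Prop) (E : A).
Inductive hsp : A -> Prop :=
| hsp0 : hsp 0
| hspD h b x : H h -> hsp x -> hsp (h * E * b + x).
Lemma hsp_add x y : hsp x -> hsp y -> hsp (x + y).
Proof. by move=> + sy; elim=> {x} [|h b x Hh _ IH]; rewrite ?add0r // -addrA; apply: hspD. Qed.
Lemma hsp_gen h b : H h -> hsp (h * E * b).
Proof. by move=> Hh; rewrite -[X in hsp X]addr0; apply: hspD => //; apply: hsp0. Qed.
Lemma hsp_Mr x a : hsp x -> hsp (x * a).
Proof.
elim=> {x} [|h b x Hh _ IH]; first by rewrite mul0r; apply: hsp0.
by rewrite mulrDl -mulrA; apply: hspD.
Qed.
Lemma hsp_Ml x a : (forall h, H h -> H (a * h)) -> hsp x -> hsp (a * x).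
Proof.
move=> Ha; elim=> {x} [|h b x Hh _ IH]; first by rewrite mulr0; apply: hsp0.
by rewrite mulrDr !mulrA; apply: hspD => //; apply: Ha.
Qed.
Lemma hsp_Z (c : F) x : hsp x -> hsp (c *: x).
Proof. by move=> Hx; rewrite -mulr_algr; apply: hsp_Mr. Qed.
End HSpan.

Section Tower.
Context (F : fieldType) (q z : F) (n : nat).
Context (A : algType F) (T : nat -> A) (E : A) (D : algType F) (psi : {lrmorphism D -> A}).
Notation E2 := (qB_E2 q T E).
Notation dl := (qB_delta q z).
Notation HA := (in_alg_of (gens T n)).

(** What the induction needs to know about the copy of the smaller algebra: it commutes with E,
    contains the far braids and accounts for E2, and modulo the ideal of E2 it acts on E
    through the Hecke algebra. *)
Definition tower : Prop :=
  [/\ forall d, E * psi d = psi d * E,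
      forall i, (2 < i < n)%N -> exists d, T i = psi d,
      (3 < n)%N -> exists2 e, E2 = E * psi e & forall d, hsp HA E2 (E * psi (d * e)) &
      forall d, exists2 h, HA h & eqI q n T E (E * psi d) (h * E)].

Context (q0 : q != 0) (z0 : z != 0) (h0 : q - q^-1 != 0) (zz0 : z - z^-1 != 0).
Context (rel : qB_relations n q z T E).

Lemma tower_psi td e : (3 < n)%N ->
  (forall d, in_alg_of (fun y => gens td (n - 2) y \/ y = e) d) ->
  (forall i, (0 < i < n - 2)%N -> psi (td i) = T i.+2) -> psi e = dl^-1 *: E2 ->
  (forall d, hsp (in_alg_of (gens td (n - 2))) e (d * e)) -> tower.
Proof.
move=> n3 Dgen pT pe He; have d0 := delta_neq0 q0 z0 h0 zz0 rel.
have psiE d : E * psi d = psi d * E.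
  elim: (Dgen d) => {d} [_ [[i [im ->]]|->]|c|x y _ IH1 _ IH2|x y _ IH1 _ IH2].
  - by rewrite pT //; apply/esym; apply: (TE q0 z0 h0 zz0 rel); lia.
  - by rewrite pe -scalerAr -scalerAl (EE2 q0 z0 h0 zz0 rel n3) (E2E q0 z0 h0 zz0 rel n3).
  - by rewrite linearZ_LR rmorph1 mulr_algl mulr_algr.
  - by rewrite rmorphD mulrDr mulrDl IH1 IH2.
  by rewrite rmorphM mulrA IH1 -mulrA IH2 mulrA.
have psie : E * psi e = E2.
  by rewrite pe -scalerAr (EE2 q0 z0 h0 zz0 rel n3) scalerA mulVf // scale1r.
have psiH h : in_alg_of (gens td (n - 2)) h -> HA (psi h).
  elim=> {h} [_ [i [im ->]]|c|x y _ IH1 _ IH2|x y _ IH1 _ IH2].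
  - by rewrite pT //; apply: ia_gen; exists i.+2; split=> //; lia.
  - by rewrite linearZ_LR rmorph1; apply: ia_scal.
  - by rewrite rmorphD; apply: ia_add.
  by rewrite rmorphM; apply: ia_mul.
have psiT i : (2 < i < n)%N -> exists d, T i = psi d.
  case: i => [|[|i]] // im; exists (td i); rewrite pT //; lia.
split=> // [_|d].
  exists e => // d; elim: (He d) => [|h b x Hh _ IH]; first by rewrite rmorph0 mulr0; apply: hsp0.
  rewrite rmorphD mulrDr; apply: hsp_add => //.
  have -> : E * psi (h * e * b) = psi h * E2 * psi b by rewrite -psie !rmorphM !mulrA psiE.
  by apply: hsp_gen; apply: psiH.
elim: (Dgen d) => {d} [_ [[i [im ->]]|->]|c|x y _ [h1 H1 e1] _ [h2 H2 e2]|x y _ [h1 H1 e1] _ [h2 H2 e2]].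
- exists (psi (td i)); last by rewrite psiE; apply: eqI_refl.
  by apply: psiH; apply: ia_gen; exists i.
- exists 0; first exact: ia_zero.
  by rewrite psie mul0r /eqI subr0 /gen2 n3; apply: tideal_self.
- exists (c%:A); first exact: ia_scal.
  by rewrite linearZ_LR rmorph1 mulr_algl mulr_algr; apply: eqI_refl.
- exists (h1 + h2); first exact: ia_add.
  by rewrite rmorphD mulrDr mulrDl; apply: eqI_D.
exists (h1 * h2); first exact: ia_mul.
have := eqI_M 1 (psi y) e1; rewrite !mul1r => e1'.
have := eqI_M h1 1 e2; rewrite !mulr1 => e2'.
rewrite rmorphM mulrA; apply: eqI_trans e1' _.
have -> : h1 * E * psi y = h1 * (E * psi y) by rewrite mulrA.
have -> : h1 * h2 * E = h1 * (h2 * E) by rewrite mulrA.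
exact: e2'.
Qed.

Context (psiP : tower) (n2 : (1 < n)%N).
Context (gen : forall x : A, in_alg_of (fun y => gens T n y \/ y = E) x).

Lemma tower_cspan x : cspan n T E psi (x * E).
Proof.
case: psiP => p1 p2 p3 p4; apply: (cspanE q0 z0 h0 zz0 rel p1 p2 _ gen n2).
by move=> n3; have [e -> _] := p3 n3; exists e.
Qed.
(** Hence the corner of E is a copy of the smaller algebra. *)
Lemma tower_EAE x : exists d, E * x * E = E * psi d.
Proof.
case: psiP => p1 p2 p3 p4; apply: (EAE q0 z0 h0 zz0 rel p1 p2 _ gen n2).
by move=> n3; have [e -> _] := p3 n3; exists e.
Qed.
Lemma dc_gens a m : (0 < a)%N -> (a + m <= n)%N -> HA (dc T a m).
Proof.
move=> a0; elim: m => [|m IH] am; first exact: ia_one.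
by rewrite dcS; apply: ia_mul; [apply: ia_gen; exists (a + m)%N; split=> //; lia | apply: IH; lia].
Qed.
Lemma tower_hsp x : hsp HA E (x * E).
Proof.
elim: (tower_cspan x) => [|i j d y im jm _ IH]; first exact: hsp0.
apply: hsp_add IH; rewrite !mulrA; apply: hsp_gen.
by apply: ia_mul; apply: dc_gens; lia.
Qed.
Lemma tower_mod x : exists2 a, HA a & eqI q n T E (x * E) (a * E).
Proof.
case: psiP => p1 p2 p3 p4.
elim: (tower_cspan x) => [|i j d y im jm _ [b Hb eb]].
  by exists 0; [exact: ia_zero | rewrite mul0r; apply: eqI_refl].
have [h Hh eh] := p4 d; exists (dc T 1 i * dc T 2 j * h + b).
  by apply: ia_add => //; apply: ia_mul => //; apply: ia_mul; apply: dc_gens; lia.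
rewrite mulrDl; apply: eqI_D => //.
by have := eqI_M (dc T 1 i * dc T 2 j) 1 eh; rewrite !mulr1 !mulrA.
Qed.

(** The ideal of E2 lies in the span of the products phi b * E * a, so that a unit of the ideal
    of E on n - 1 points already acts as one on it. *)
Lemma second_ideal (B : algType F) (phi : {lrmorphism B -> A}) (e u : B) : (3 < n)%N ->
  phi e = E -> (forall i, (0 < i < n.-1)%N -> exists b, T i = phi b) ->
  (forall y, tideal e y -> u * y = y) ->
  forall y, tideal E2 y -> phi u * y = y.
Proof.
move=> n3 pe pT ue; have HP := qB_hecke q0 z0 h0 zz0 rel.
pose V := hsp (fun h => exists b, h = phi b) E.
have VM b x : V x -> V (phi b * x).
  by apply: hsp_Ml => _ [b' ->]; exists (b * b'); rewrite rmorphM.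
have uV x : V x -> phi u * x = x.
  elim=> {x} [|_ b x [b' ->] _ IH]; first by rewrite mulr0.
  have Q : phi u * (phi b' * phi e) = phi b' * phi e.
    by rewrite -!rmorphM ue // -[_ * e]mulr1; apply: tideal_gen.
  by rewrite mulrDr IH -pe !mulrA -(mulrA (phi u)) Q.
have HV m x : (m < n)%N -> in_alg_of (gens T m) x -> exists b, x = phi b.
  move=> mn; elim=> {x} [_ [i [im ->]]|c|x y _ [b1 ->] _ [b2 ->]|x y _ [b1 ->] _ [b2 ->]].
  - by apply: pT; lia.
  - by exists (c%:A); rewrite linearZ_LR rmorph1.
  - by exists (b1 + b2); rewrite rmorphD.
  by exists (b1 * b2); rewrite rmorphM.
have E2E' : E2 = E * (qg q T * E) by rewrite (E2_def q0 z0 h0 zz0 rel n3) mulrA.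
have V1 x : V (E * x).
  by have := @hsp_gen _ _ (fun h => exists b, h = phi b) E 1 x; rewrite mul1r; apply; exists 1; rewrite rmorph1.
have V3 k m : (2 < k)%N -> (k + m <= n)%N -> V (dc T k m * E2).
  move=> k2 km; rewrite E2E' mulrA dc_comm ?mulrA -?mulrA // => l lm.
  by apply: (TE q0 z0 h0 zz0 rel); lia.
have V2 : V (dc T 2 (n - 2) * E2).
  have -> : (n - 2)%N = (n - 4).+2 by lia.
  rewrite 2!dcSr -2!mulrA (mulrA (T 3)) (T3T2E2 q0 z0 h0 zz0 rel n3).
  have f l : (l < 3)%N -> (0 < l)%N -> dc T 4 (n - 4) * T l = T l * dc T 4 (n - 4).
    by move=> l3 l0; apply: dc_comm => i' ai; apply/esym; apply: (he_comm HP); lia.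
  have -> : dc T 4 (n - 4) * (T 1 * T 2 * E2) = T 1 * (T 2 * (dc T 4 (n - 4) * E2)).
    have f1 := f 1%N isT isT; have f2 := f 2%N isT isT.
    nc_cert ((dc T 4 (n - 4) * T 1 - T 1 * dc T 4 (n - 4)) * T 2 * E2
      + T 1 * (dc T 4 (n - 4) * T 2 - T 2 * dc T 4 (n - 4)) * E2).
    by rewrite f1 f2; nc_done.
  have [b1 ->] := pT 1%N (ltac:(lia)); have [b2 ->] := pT 2%N (ltac:(lia)).
  by apply/VM/VM; apply: V3; lia.
have V1' : V (dc T 1 (n - 1) * E2).
  have -> : (n - 1)%N = (n - 2).+1 by lia.
  by rewrite dcSr -mulrA (T1E2 q0 z0 h0 zz0 rel n3) -scalerAr; apply: hsp_Z.
have P m x : (m < n)%N -> in_alg_of (gens T m.+1) x -> V (dc T m.+1 (n - m.+1) * x * E2).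
  elim: m x => [|m IH] x mn xH.
    have [c ->] := gens_scalar (leqnn 1) xH; rewrite mulr_algr -scalerAl; exact: hsp_Z.
  have comm y : in_alg_of (gens T m.+1) y -> dc T m.+2 (n - m.+2) * y = y * dc T m.+2 (n - m.+2).
    move=> yH; apply: dc_comm => l lm; apply/esym; apply: ia_comm yH => _ [j [jm ->]].
    by apply: (he_comm HP); lia.
  have Vdc : V (dc T m.+2 (n - m.+2) * E2).
    case: m {IH xH comm} mn => [|m] mn; first exact: V2.
    by apply: V3; lia.
  elim: (sandwichP HP (ltac:(lia) : (0 < m.+1 < n)%N) xH) => {x xH} [y yH|y w yH wH|x y _ H1 _ H2].
  - have [b bE] := HV _ _ mn yH; rewrite comm // bE -mulrA; exact: VM.
  - have [b bE] := HV _ _ mn yH.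
    have -> : dc T m.+2 (n - m.+2) * (y * T m.+1 * w) * E2 = y * (dc T m.+1 (n - m.+1) * w * E2).
      have -> : (n - m.+1)%N = (n - m.+2).+1 by lia.
      by rewrite dcSr !mulrA comm.
    by rewrite bE; apply: VM; apply: IH => //; lia.
  by rewrite mulrDr mulrDl; apply: hsp_add.
have PH x : HA x -> V (x * E2).
  move=> xH; have := P n.-1 x (ltac:(lia)); rewrite (ltac:(lia) : (n.-1.+1 = n)%N) subnn /= mul1r.
  by apply.
move=> y; apply: (tideal_ind (P := fun y => phi u * y = y)); first by rewrite mulr0.
- move=> a b; apply: uV.
  case: psiP => p1 p2 p3 p4; have [e' e'E e'H] := p3 n3.
  rewrite {1}e'E; apply: hsp_Mr; rewrite !mulrA.
  elim: (tower_cspan a) => [|i j d x im jm _ IH]; first by rewrite mul0r; apply: hsp0.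
  rewrite mulrDl; apply: hsp_add IH.
  have -> : dc T 1 i * (dc T 2 j * E * psi d) * psi e' = dc T 1 i * dc T 2 j * (E * psi (d * e')).
    by rewrite rmorphM !mulrA.
  have gH : HA (dc T 1 i * dc T 2 j) by apply: ia_mul; apply: dc_gens; lia.
  elim: (e'H d) => [|h b' x' Hh _ IH]; first by rewrite mulr0; apply: hsp0.
  rewrite mulrDr; apply: hsp_add IH.
  have -> : dc T 1 i * dc T 2 j * (h * E2 * b') = dc T 1 i * dc T 2 j * h * E2 * b' by nc.
  by apply: hsp_Mr; apply: PH; apply: ia_mul.
by move=> x x' H1 H2; rewrite mulrDr H1 H2.
Qed.
End Tower.

(** * Sufficiency *)

Section Assemble.
Context (F : fieldType) (q z : F) (n : nat).
Context (A : algType F) (T : nat -> A) (E : A) (D : algType F) (psi : {lrmorphism D -> A}).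
Context (q0 : q != 0) (z0 : z != 0) (h0 : q - q^-1 != 0) (zz0 : z - z^-1 != 0).
Context (rel : qB_relations n q z T E) (n2 : (1 < n)%N).
Context (qn : forall k, (0 < k <= n)%N -> q ^+ (2 * k) != 1).
Context (gen : forall x : A, in_alg_of (fun y => gens T n y \/ y = E) x).
Context (psiP : tower q n T E psi) (ds : seq D) (dsP : min_idems ds).
Context (FL : forall x, (forall b, E * b * (x * E) = 0) -> x * E = 0)
        (FR : forall x, (forall b, E * x * b * E = 0) -> E * x = 0).
Notation dl := (qB_delta q z).
Notation HA := (in_alg_of (gens T n)).
Let HP : hecke_rel q n T := qB_hecke q0 z0 h0 zz0 rel.
Let d0 : dl != 0 := delta_neq0 q0 z0 h0 zz0 rel.
Notation pid := (pid q T).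
Notation eps := (dl^-1 *: E).
Let fs : seq A := [seq psi p * eps | p <- ds].

Let psiE d : E * psi d = psi d * E. Proof. by case: psiP. Qed.
Let eps2 : eps * eps = eps.
Proof. by rewrite -scalerAl -scalerAr (EE q0 z0 h0 zz0 rel) [dl^-1 *: (dl *: _)]scalerA mulVf // scale1r. Qed.
Let psieps d : eps * psi d = psi d * eps.
Proof. by rewrite -scalerAl -scalerAr psiE. Qed.
Let sandwich p x r : exists d, psi p * eps * x * (psi r * eps) = psi (p * d * r) * eps.
Proof.
have [d dE] := tower_EAE q0 z0 h0 zz0 rel psiP n2 gen x; exists (dl^-1 *: d).
rewrite -(psieps r) -!mulrA.
have -> : eps * (x * (eps * psi r)) = dl^-1 *: (eps * psi (d * r)).
  have -> : eps * (x * (eps * psi r)) = dl^-1 *: (dl^-1 *: (E * x * E)) * psi r by nc.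
  by rewrite dE rmorphM /=; nc.
have -> : psi (p * (dl^-1 *: d * r)) = dl^-1 *: (psi p * psi (d * r)).
  by rewrite -scalerAl -scalerAr linearZ_LR rmorphM.
by rewrite psieps; nc.
Qed.

Lemma fs_idem f : f \in fs -> f * f = f.
Proof.
case/mapP => p pd ->.
by rewrite -{1}psieps -!mulrA (mulrA (psi p)) -rmorphM (mi_idem dsP pd) mulrA psieps -mulrA eps2.
Qed.
Lemma fs_corner f x : f \in fs -> exists c : F, f * x * f = c *: f.
Proof.
case/mapP => p pd ->; have [d ->] := sandwich p x p.
by have [c ->] := mi_scal dsP d pd; exists c; rewrite linearZ_LR -scalerAl.
Qed.
Lemma fs_link f g x : f \in fs -> g \in fs -> f * x * g != 0 ->
  exists y, f * x * g * y * f = f.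
Proof.
case/mapP => p pd -> /mapP[r rd ->]; have [d dE] := sandwich p x r; rewrite dE => nz.
have [|y yE] := mi_inv dsP (x := d) pd rd.
  by apply: contraNneq nz => ->; rewrite rmorph0 mul0r.
exists (psi y); rewrite -(mulrA (psi _)) psieps !mulrA -rmorphM -(mulrA _ eps) psieps !mulrA -rmorphM.
by rewrite yE -mulrA eps2.
Qed.
Lemma fs_left f v : f \in fs -> v * f = v -> v != 0 -> exists y, y * v = f.
Proof.
case/mapP => p pd -> vf v0.
have [a va] : exists a, E * a * v != 0.
  apply: contrapT => H; case/negP: v0; rewrite -vf.
  have -> : v * (psi p * eps) = dl^-1 *: (v * psi p) * E by nc.
  apply/eqP; apply: FL => b; have -> : dl^-1 *: (v * psi p) * E = v * (psi p * eps) by nc.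
  by rewrite vf; apply/eqP; apply: contraT => nz; case: H; exists b.
have [d dE] := tower_EAE q0 z0 h0 zz0 rel psiP n2 gen (a * v).
have avE : E * a * v = E * psi (dl^-1 *: (d * p)).
  rewrite -[in LHS]vf; have -> : E * a * (v * (psi p * eps)) = dl^-1 *: (E * (a * v) * (psi p * E)) by nc.
  have -> : E * (a * v) * (psi p * E) = E * psi d * psi p by rewrite -psiE mulrA dE.
  by rewrite linearZ_LR rmorphM /=; nc.
have dp : d * p != 0.
  by apply: contraNneq va => dp; rewrite avE dp scaler0 rmorph0 mulr0.
have [b bE] := mi_simple dsP pd dp.
exists (psi b * (E * a)); rewrite -mulrA avE psiE mulrA -rmorphM.
have -> : b * (dl^-1 *: (d * p)) = dl^-1 *: p by rewrite -scalerAr bE.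
have Z : psi (dl^-1 *: p) * E = psi p * eps by rewrite linearZ_LR /=; nc.
exact: Z.
Qed.

(** The idempotents of the smaller algebra times E / delta are minimal. As A E and E A are
    faithful, they are spread over A E to orthogonal idempotents whose sum is a left unit of
    the ideal of E; dually there is a right unit, so this sum is the unit. Its complement times
    the weight idempotents of the Hecke algebra gives the rest. *)
Lemma brauer_idems : exists ps : seq A, min_idems ps.
Proof.
pose vs := [seq (dc T 1 ij.1 * dc T 2 ij.2 * f, f) |
   ij <- [seq (i, j) | i <- iota 0 n, j <- iota 0 n.-1], f <- fs].
have vsP v : v \in vs -> v.2 \in fs /\ v.1 * v.2 = v.1.
  by case/allpairsP => -[ij f] /= [_ ff ->] /=; rewrite -mulrA fs_idem.
have [l ol lv] := greedy fs_idem fs_left vsP; set c := csum l in lv.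
have cE x : c * (x * E) = x * E.
  elim: (tower_cspan q0 z0 h0 zz0 rel psiP n2 gen x) => [|i j d y im jm _ IH]; first by rewrite mulr0.
  rewrite mulrDr IH; congr (_ + _).
  have -> : dc T 1 i * (dc T 2 j * E * psi d) = dl *: (dc T 1 i * dc T 2 j * (\sum_(p <- ds) psi p * eps) * psi d).
    by rewrite -mulr_suml -rmorph_sum (mi_sum dsP) rmorph1; nc_cert (0 : A); try by field.
  rewrite -scalerAr mulr_sumr mulr_suml mulr_sumr; congr (_ *: _).
  rewrite !big_seq; apply: eq_bigr => p pd.
  have fv : (dc T 1 i * dc T 2 j * (psi p * eps), psi p * eps) \in vs.
    apply/allpairsP; exists ((i, j), psi p * eps); split=> //=.
      by apply/allpairsP; exists (i, j); rewrite !mem_iota.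
    by apply: map_f.
  by have /= H := lv _ fv; rewrite (mulrA c) H.
have cl y : tideal E y -> c * y = y.
  apply: (tideal_ind (P := fun y => c * y = y)); first by rewrite mulr0.
    by move=> a b; rewrite mulrA cE.
  by move=> u v Hu Hv; rewrite mulrDr Hu Hv.
have Ec : tideal E c.
  rewrite /c /csum big_seq; apply: tideal_sum => t tl; have [ff _ vf _] := os_linked ol tl.
  rewrite /tidem -vf; case/mapP: ff => p _ ->.
  have -> : t.1.1 * (psi p * eps) * t.1.2 = (dl^-1 *: (t.1.1 * psi p)) * E * t.1.2 by nc.
  exact: tideal_gen.
have kill r : (forall a, E * a * r = 0) -> c * r = 0.
  move=> Er; move: Ec; apply: (tideal_ind (P := fun c => c * r = 0)).
  - by rewrite mul0r.
  - by move=> a b; rewrite -2!mulrA (mulrA E) Er mulr0.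
  by move=> u v Hu Hv; rewrite mulrDl Hu Hv addr0.
have cr y : tideal E y -> y * c = y.
  move=> yE; apply/esym/eqP; rewrite -subr_eq0; set r := _ - _.
  have rI : tideal E r by apply: tidealB => //; apply: tidealMr.
  rewrite -(cl r rI) kill // => a; rewrite -mulrA; apply: FR => b.
  have -> : E * (a * r) * b * E = E * a * y * (b * E - c * (b * E)) by rewrite /r; nc.
  by rewrite cE subrr mulr0.
have cC x : c * x = x * c.
  have H1 : c * (x * c) = x * c by apply: cl; apply: tidealMl.
  have H2 : (c * x) * c = c * x by apply: cr; apply: tidealMr.
  by rewrite -H2 -mulrA.
have cc : c * c = c by apply: cl.
have decomp x : exists2 h, HA h & tideal E (x - h).
  elim: (gen x) => {x} [x [im|->]|k|x y _ [h1 H1 e1] _ [h2 H2 e2]|x y _ [h1 H1 e1] _ [h2 H2 e2]].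
  - by exists x; [apply: ia_gen | rewrite subrr; apply: tideal0].
  - by exists 0; [apply: ia_zero | rewrite subr0; apply: tideal_self].
  - by exists (k%:A); [apply: ia_scal | rewrite subrr; apply: tideal0].
  - by exists (h1 + h2); [apply: ia_add | rewrite opprD addrACA; apply: tidealD].
  exists (h1 * h2); first exact: ia_mul.
  have -> : x * y - h1 * h2 = (x - h1) * y + h1 * (y - h2) by nc.
  by apply: tidealD; [apply: tidealMr | apply: tidealMl].
have sub1 x h : tideal E (x - h) -> (1 - c) * x = (1 - c) * h.
  by move/cl; rewrite mulrBr => H; nc_cert (- (c * x - c * h - (x - h))); rewrite H subrr oppr0.
have c1 : (1 - c) * (1 - c) = 1 - c by nc_cert (c * c - c); rewrite cc subrr.
have c1C x : (1 - c) * x = x * (1 - c) by rewrite mulrBl mulrBr cC mul1r mulr1.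
have tc t : t \in l -> c * tidem t = tidem t /\ tidem t * c = tidem t.
  by move=> tl; have [a b] := os_v ol tl; rewrite /tidem mulrA a -mulrA b.
have tc1 t : t \in l -> (1 - c) * tidem t = 0 /\ tidem t * (1 - c) = 0.
  by move=> /tc[a b]; rewrite mulrBl mulrBr a b mul1r mulr1 subrr.
pose e t := (1 - c) * pid t.
have ee x t u : e t * x * e u = (1 - c) * (pid t * x * pid u).
  have H := cC (pid t * x); rewrite /e.
  nc_cert ((1 - c) * (c * (pid t * x) - pid t * x * c) * pid u + (c * c - c) * pid t * x * pid u).
  by rewrite H cc !subrr !(mulr0, mul0r, addr0).
have memt t : t \in tabs n -> content_seq t /\ (size t = n) by rewrite mem_tabs => /andP[-> /eqP].
have pg t : t \in tabs n -> HA (pid t) by case/memt => ct st; apply: pid_gens; rewrite st.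
exists ([seq tidem t | t <- l] ++ [seq e t | t <- tabs n]); split.
- rewrite big_cat !big_map /= -/(csum l) -mulr_sumr (pid_sum q0 h0 HP qn (leqnn n)) mulr1.
  by rewrite addrC subrK.
- move=> p; rewrite mem_cat => /orP[] /mapP[t tl ->]; first exact: (tidem_idem ol tl).
  have [ct st] := memt _ tl; have := ee 1 t t; rewrite !mulr1 => ->.
  by rewrite (pid_idem q0 h0 HP qn) // st.
- move=> p r; rewrite !mem_cat => /orP[] /mapP[t tl ->] /orP[] /mapP[u ul ->] tu.
  + exact: (tidem_orth ol tl ul tu).
  + by have [_ b] := tc1 _ tl; rewrite /e mulrA b mul0r.
  + by have [a _] := tc1 _ ul; rewrite /e c1C -mulrA a mulr0.
  have [ct st] := memt _ tl; have [cu su] := memt _ ul.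
  have tu' : t != u by apply: contra_neq tu => ->.
  have := ee 1 t u; rewrite !mulr1 => ->.
  by rewrite (pid_orth q0 h0 HP qn) ?mulr0 ?st ?su.
- move=> p x; rewrite mem_cat => /orP[] /mapP[t tl ->]; first exact: (tidem_corner fs_corner x ol tl).
  have [ct st] := memt _ tl; have [h Hh eh] := decomp x.
  have [k kE] := pid_corner q0 h0 HP qn ct (eq_leq st) (ltac:(by rewrite st) : in_alg_of (gens T (size t)) h).
  exists k; rewrite ee; have -> : (1 - c) * (pid t * x * pid t) = pid t * ((1 - c) * x) * pid t.
    by rewrite !mulrA c1C.
  by rewrite (sub1 _ _ eh) !mulrA -c1C -!mulrA (mulrA (pid t)) kE -scalerAr.
move=> p r x; rewrite !mem_cat => /orP[] /mapP[t tl ->] /orP[] /mapP[u ul ->] nz.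
- exact: (tidem_link fs_link ol tl ul nz).
- case/negP: nz; have [_ b] := tc1 _ tl.
  by rewrite /e mulrA -(mulrA _ x) -c1C !mulrA b !mul0r.
- case/negP: nz; have [a _] := tc1 _ ul.
  by rewrite /e -mulrA !mulrA c1C -!mulrA (mulrA (1 - c)) c1C -!mulrA a !mulr0.
have [ct st] := memt _ tl; have [cu su] := memt _ ul; have [h Hh eh] := decomp x.
have E1 : e t * x * e u = (1 - c) * (pid t * h * pid u).
  rewrite ee; have -> : (1 - c) * (pid t * x * pid u) = pid t * ((1 - c) * x) * pid u.
    by rewrite !mulrA c1C.
  by rewrite (sub1 _ _ eh) !mulrA -c1C -!mulrA.
have [|y yH yE] := pid_link q0 h0 HP qn (leqnn n) cu su ct st Hh.
  by apply: contraNneq nz => H; rewrite E1 H mulr0.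
exists y; rewrite E1 /e; move: (pid t * h * pid u) yE => w yE.
have H := cC (w * y); nc_cert ((1 - c) * (c * (w * y) - w * y * c) * pid t
  + (c * c - c) * w * y * pid t + (1 - c) * (w * y * pid t - pid t)).
by rewrite H cc yE !subrr !(mulr0, mul0r, addr0).
Qed.
End Assemble.

Section OpHom.
Context (F : fieldType) (A B : algType F) (f : {lrmorphism A -> B}).
Definition op_hom (x : op_alg A) : op_alg B := f x.
Fact op_hom_zmod : zmod_morphism op_hom. Proof. exact: (rmorphB f). Qed.
HB.instance Definition _ := GRing.isZmodMorphism.Build (op_alg A) (op_alg B) op_hom op_hom_zmod.
Fact op_hom_monoid : monoid_morphism op_hom.
Proof. by split=> [|x y]; [exact: (rmorph1 f) | exact: (rmorphM f (y : A) (x : A))]. Qed.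
HB.instance Definition _ := GRing.isMonoidMorphism.Build (op_alg A) (op_alg B) op_hom op_hom_monoid.
Fact op_hom_scalable : scalable op_hom.
Proof. by move=> c x; exact: (linearZ_LR f c (x : A)). Qed.
HB.instance Definition _ := GRing.isScalable.Build F (op_alg A) (op_alg B) *:%R op_hom op_hom_scalable.
Definition op_lr : {lrmorphism op_alg A -> op_alg B} := op_hom.
End OpHom.

Section ScalHom.
Context (F : fieldType) (A : algType F).
Definition scal_hom (x : F^o) : A := (x : F)%:A.
Fact scal_hom_zmod : zmod_morphism scal_hom. Proof. by move=> x y; rewrite /scal_hom scalerBl. Qed.
HB.instance Definition _ := GRing.isZmodMorphism.Build F^o A scal_hom scal_hom_zmod.
Fact scal_hom_monoid : monoid_morphism scal_hom.
Proof. by split=> [|x y]; rewrite /scal_hom ?scale1r // mulr_algl scalerA. Qed.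
HB.instance Definition _ := GRing.isMonoidMorphism.Build F^o A scal_hom scal_hom_monoid.
Fact scal_hom_scalable : scalable scal_hom.
Proof. by move=> c x; rewrite /scal_hom scalerA. Qed.
HB.instance Definition _ := GRing.isScalable.Build F F^o A *:%R scal_hom scal_hom_scalable.
Definition scal_lr : {lrmorphism F^o -> A} := scal_hom.
End ScalHom.

Lemma op_in_alg (F : fieldType) (A : algType F) (S : A -> Prop) x :
  in_alg_of S x -> @in_alg_of F (op_alg A) S x.
Proof.
elim=> {x} [x Sx|c|x y _ IH1 _ IH2|x y _ IH1 _ IH2]; [exact: ia_gen|exact: ia_scal|exact: ia_add|].
exact: (@ia_mul F (op_alg A) S y x).
Qed.
Lemma op_tideal (F : fieldType) (A : algType F) (x y : A) :
  tideal x y -> @tideal F (op_alg A) x y.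
Proof.
move=> H; apply: (tideal_ind (P := fun y : A => @tideal F (op_alg A) x y) _ _ _ H).
- exact: tideal0.
- move=> a b; have -> : a * x * b = ((b : op_alg A) * x * (a : op_alg A) : op_alg A) by exact: (esym (mulrA a x b)).
  exact: tideal_gen.
by move=> u v; apply: (@tidealD F (op_alg A)).
Qed.

Lemma op_sandwich (F : fieldType) (A : algType F) (e x b : A) :
  ((e : op_alg A) * (b : op_alg A) * ((x : op_alg A) * (e : op_alg A)) : op_alg A) = e * x * b * e.
Proof. by transitivity ((e * x) * (b * e)); last rewrite !mulrA. Qed.

Section BrauerGen.
Context (F : fieldType) (n : nat) (q z : F).
Local Notation B := (qBrauer n q z).
Lemma free_alg_gen (I : choiceType) (x : free_alg F I) :
  in_alg_of (fun y => exists i, y = free_gen F i) x.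
Proof.
have mon (m : {fmonom I}) : in_alg_of (fun y => exists i, y = free_gen F i) (mkmalgU m 1 : free_alg F I).
  case: m => s; elim: s => [|i s IH].
    have -> : (mkmalgU (FMonom [::]) 1 : free_alg F I) = 1.
      by congr (mkmalgU _ _); apply/eqP; rewrite fmP fm1.
    exact: ia_one.
  have -> : (mkmalgU (FMonom (i :: s)) 1 : free_alg F I) =
            free_gen F i * mkmalgU (FMonom s) 1.
    rewrite [RHS]fgmulUU mulr1; congr (mkmalgU _ _).
    by apply/eqP; rewrite fmP fmM fmU.
  by apply: ia_mul => //; apply: ia_gen; exists i.
rewrite [x]monalgE; apply: ia_sum => m _.
have -> : (mkmalgU m (x@_m) : free_alg F I) = x@_m *: (mkmalgU m 1 : free_alg F I).
  by apply/malgP => k; rewrite mcoeffZ !mcoeffU mulrnAr mulr1.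
exact: ia_scale.
Qed.
Lemma qB_gen (x : B) : in_alg_of (fun y => gens (qB_T n q z) n y \/ y = qB_E n q z) x.
Proof.
elim/qB_ind: x => x; elim: (free_alg_gen x) => {x} [_ [[j|] ->]|c|x y _ IH1 _ IH2|x y _ IH1 _ IH2].
- apply: ia_gen; left; exists (val j); split; first exact: (valP j).
  by rewrite /qB_T /qB_freeT valK.
- by apply: ia_gen; right.
- by rewrite linearZ_LR rmorph1; apply: ia_scal.
- by rewrite rmorphD; apply: ia_add.
by rewrite rmorphM; apply: ia_mul.
Qed.
End BrauerGen.

Lemma qB_relations_le (F : fieldType) (A : algType F) (q z : F) m n (T : nat -> A) E :
  (m <= n)%N -> qB_relations n q z T E -> qB_relations m q z T E.
Proof.
move=> mn rel x y xy; apply: rel; case: xy => {x y}.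
- by move=> i im; apply: qB_quad; lia.
- by move=> i j im jm ij; apply: qB_comm => //; lia.
- by move=> k k1 km; apply: qB_braid => //; lia.
- exact: qB_EE.
- by move=> m1; apply: qB_TE; lia.
- by move=> m1; apply: qB_ET; lia.
- by move=> m1; apply: qB_ETE; lia.
- by move=> i im; apply: qB_TEcomm; lia.
- by move=> m1; apply: qB_E2l; lia.
by move=> m1; apply: qB_E2r; lia.
Qed.

Section Towers.
Context (F : fieldType) (q z : F).
Context (q0 : q != 0) (z0 : z != 0) (h0 : q - q^-1 != 0) (zz0 : z - z^-1 != 0).
Local Notation B n := (qBrauer n q z).
Local Notation BT n := (qB_T n q z).
Local Notation BE n := (qB_E n q z).
Local Notation dl := (qB_delta q z).
Let rel n : qB_relations n q z (BT n) (BE n) := @qBrauer_relations F n q z.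
Let rel_op n : @qB_relations F n q z (op_alg (B n)) (BT n) (BE n) := qB_op q0 z0 h0 zz0 (@rel n).

Lemma gen_op n (x : op_alg (B n)) :
  in_alg_of (fun y : op_alg (B n) => gens (BT n) n y \/ y = BE n) x.
Proof. by apply: op_in_alg; apply: qB_gen. Qed.

Lemma tower_scal n (A D : algType F) (T : nat -> A) (E : A) (psi : {lrmorphism D -> A}) :
  (n <= 3)%N -> (forall d, exists c : F, psi d = c%:A) -> tower q n T E psi.
Proof.
move=> n3 sc; split=> [d|i im|n4|d]; [|lia|lia|].
  by have [c ->] := sc d; rewrite mulr_algl mulr_algr.
have [c cE] := sc d; exists (c%:A); first exact: ia_scal.
by rewrite cE mulr_algl mulr_algr; apply: eqI_refl.
Qed.

Lemma tower_ex n : (1 < n)%N -> exists (D : algType F) (psi : {lrmorphism D -> B n}),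
  [/\ tower q n (BT n) (BE n) psi,
      tower q n (A := op_alg (B n)) (BT n) (BE n) (op_lr psi),
      (3 < n)%N -> split_idems (B (n - 2)) -> split_idems D &
      (n <= 3)%N -> split_idems D].
Proof.
elim/ltn_ind: n => n IH n1; have [n3|n4] := leqP n 3.
  exists F^o, (scal_lr (B n)); split; [| |lia|].
  - by apply: tower_scal => // d; exists d.
  - by apply: tower_scal => // d; exists d.
  move=> _; exists [:: 1 : F^o]; split.
  - by rewrite big_seq1.
  - by move=> p; rewrite inE => /eqP->; rewrite mulr1.
  - by move=> p r; rewrite !inE => /eqP-> /eqP->; rewrite eqxx.
  - by move=> p x; rewrite inE => /eqP->; exists x; rewrite mul1r mulr1 [RHS]mulr1.
  move=> p r x; rewrite !inE => /eqP-> /eqP->; rewrite mul1r mulr1 => x0.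
  by exists (x^-1 : F); rewrite mulr1 (@mulfV F).
have [D' [psi' [tw tw_op _ _]]] := IH (n - 2)%N (ltac:(lia)) (ltac:(lia)).
have m1 : (1 < n - 2)%N by lia.
have [psi [psiT psiE] _] := qBrauer_universal (psi_rel q0 z0 h0 zz0 (@rel n) n4).
exists (B (n - 2)), psi; split; [| | by move=> _ H; exact: H | by lia].
  apply: (tower_psi q0 z0 h0 zz0 (@rel n) n4 (td := BT (n - 2)) (e := BE (n - 2))).
  - exact: qB_gen.
  - exact: psiT.
  - exact: psiE.
  by move=> d; apply: (tower_hsp q0 z0 h0 zz0 (@rel _) tw m1); apply: qB_gen.
apply: (@tower_psi F q z n (op_alg (B n)) (BT n) (BE n) (op_alg (B (n - 2))) (op_lr psi)
   q0 z0 h0 zz0 (@rel_op n) (BT (n - 2)) (BE (n - 2)) n4).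
- exact: gen_op.
- exact: psiT.
- by rewrite (opE2 q0 z0 h0 zz0 (@rel n) n4); exact: psiE.
by move=> d; apply: (tower_hsp q0 z0 h0 zz0 (@rel_op _) tw_op m1); apply: gen_op.
Qed.

(** The criterion of the theorem with the quantum characteristic written out. *)
Definition ss_cond (n : nat) : Prop :=
  (forall k, (0 < k <= n)%N -> q ^+ (2 * k) != 1) /\
  forall a : int, 4 - 2 * n%:Z <= a <= n%:Z - 2 ->
    ~ (4 - 2 * n%:Z < a <= 3 - n%:Z /\ ~~ (2 %| a)%Z) -> z ^+ 2 <> q ^ (2 * a).

Lemma ss_cond_le m n : (m <= n)%N -> ss_cond n -> ss_cond m.
Proof.
move=> mn [H1 H2]; split=> [k km|a am ex]; first by apply: H1; lia.
by apply: H2; [lia | move=> [H3 H4]; apply: ex; lia].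
Qed.

(** The conditions on q and z exclude the eigenvalue of the central element that the kernel
    would need, by left_faithful. The hypothesis on small provides the unit of the ideal of E
    on n - 1 points. Applied to the algebra and to its opposite. *)
Lemma faithful_E n (A : algType F) (T : nat -> A) (E : A) (D : algType F)
    (psi : {lrmorphism D -> A}) : (1 < n)%N -> ss_cond n ->
  qB_relations n q z T E -> (forall x : A, in_alg_of (fun y => gens T n y \/ y = E) x) ->
  tower q n T E psi ->
  ((3 < n)%N -> exists (B' : algType F) (phi : {lrmorphism B' -> A}) (e u : B'),
    [/\ phi e = E, forall i, (0 < i < n.-1)%N -> exists b, T i = phi b,
        tideal e u & forall y, tideal e y -> u * y = y]) ->
  forall x, (forall b, E * b * (x * E) = 0) -> x * E = 0.
Proof.
move=> n2 [qn zc] relA genA psiP small x xE.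
have HP := qB_hecke q0 z0 h0 zz0 relA; have HR := hecke_rev HP.
have qq0 : 1 + q ^+ 2 != 0.
  have := qn 2%N (ltac:(lia)); apply: contra_neq => E1.
  have e4 : q ^+ (2 * 2) = (1 + q ^+ 2) * (q ^+ 2 - 1) + 1 by rewrite exprM; ring.
  by rewrite e4 E1 mul0r add0r.
pose f := ann (wtv q) (last_sums n).
have fX : (T 1%N + q^-1%:A) * horner_alg (yp T 1 n.-1 * yp T 2 n.-2) f = 0.
  have := T_last_spectrum q0 h0 HR qn (ltac:(lia) : n = n.-2.+2).
  rewrite !(yp_jm T); try lia.
  have a1 : (n - n.-2.+1)%N = 1%N by lia. have a2 : (n - n.-2)%N = 2%N by lia.
  rewrite a1 a2; have -> : n.-2.+1 = n.-1 by lia.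
  have := jm_comm HR (ltac:(lia) : (n.-1 < n)%N) (ltac:(lia) : (n.-2 < n)%N).
  rewrite !(yp_jm T); try lia.
  have b1 : (n - n.-1)%N = 1%N by lia.
  by rewrite b1 a2 => -> H; exact: H.
have fz : f.[q ^+ 2 * z ^- 2] != 0.
  rewrite /f /ann horner_prod prodf_seq_neq0; apply/allP => s sl; rewrite /= !hornerE subr_eq0.
  have [s1 s2 s3] := last_sumsP sl.
  apply/eqP => E1; apply: (zc (1 - s)); [lia | by case=> H1 /s3; lia |].
  rewrite mulrBr expfzDr // mulr1 -mulrN -[q ^ (2 * - s)]/(wtv q (- s)) -exprnP.
  have : wtv q s * wtv q (- s) = 1 by rewrite -wtvD // subrr /wtv mulr0 expr0z.
  rewrite -E1 => H; have wn : wtv q (- s) = z ^+ 2 * q ^- 2 by apply: (mulfI (x := q ^+ 2 * z ^- 2)); [rewrite !mulf_neq0 ?invr_eq0 ?expf_neq0 | rewrite H; field; rewrite q0 z0].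
  by rewrite wn; field.
have [a aH ya] := tower_mod q0 z0 h0 zz0 relA psiP n2 genA x.
have [n3|n4] := leqP n 3.
  apply: (left_faithful q0 z0 h0 zz0 relA n2 qq0 fX fz (c := 0) _ _ aH ya xE).
    exact: tideal0.
  move=> y; rewrite /gen2 ltnNge n3 /= mul0r.
  by apply: (tideal_ind (P := fun y => 0 = y)) => [|b c|u v <- <-]; rewrite ?(mulr0, mul0r, addr0).
have [B' [phi [e [u [pe pT eu ue]]]]] := small n4.
apply: (left_faithful q0 z0 h0 zz0 relA n2 qq0 fX fz (c := phi u) _ _ aH ya xE).
  by rewrite -pe; apply: tideal_morph.
move=> y; rewrite /gen2 n4; exact: (second_ideal q0 z0 h0 zz0 relA psiP n2 genA n4 pe pT ue).
Qed.

Theorem brauer_split n : (1 < n)%N -> ss_cond n -> split_idems (B n).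
Proof.
elim/ltn_ind: n => n IH n2 cond.
have [D [psi [tw tw_op spD spD']]] := tower_ex n2.
have [ds dsP] : split_idems D.
  have [n3|n4] := leqP n 3; first exact: spD'.
  by apply: spD => //; apply: IH; [lia | lia | apply: ss_cond_le cond; lia].
have unit4 : (3 < n)%N -> exists2 u, tideal (BE n.-1) u &
    forall y, tideal (BE n.-1) y -> u * y = y /\ y * u = y.
  move=> n4; apply: semisimple_tideal_unit.
  have [||ps psP] := IH n.-1 (ltac:(lia)); [lia | by apply: ss_cond_le cond; lia |].
  exact: (min_idems_semisimple psP).
have [phi [phiT phiE] _] := qBrauer_universal (qB_relations_le (leq_pred n) (@rel n)).
have pT i : (0 < i < n.-1)%N -> exists b, BT n i = phi b.
  by move=> im; exists (BT n.-1 i); rewrite phiT.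
have F1 : forall x, (forall b, BE n * b * (x * BE n) = 0) -> x * BE n = 0.
  apply: (faithful_E n2 cond (@rel n) (@qB_gen F n q z) tw) => n4.
  have [u eu ue] := unit4 n4; exists (B n.-1), phi, (BE n.-1), u; split.
  - exact: phiE.
  - exact: pT.
  - exact: eu.
  by move=> y ye; exact: (proj1 (ue y ye)).
have F2 : forall x : B n, (forall b, BE n * x * b * BE n = 0) -> BE n * x = 0.
  move=> x xE; have := @faithful_E n (op_alg (B n)) (BT n) (BE n) (op_alg D) (op_lr psi) n2 cond
    (@rel_op n) (@gen_op n) tw_op.
  move=> H; apply: (H _ x).
    move=> n4; have [u eu ue] := unit4 n4.
    exists (op_alg (B n.-1)), (op_lr phi), (BE n.-1), u; split.
    - exact: phiE.
    - by move=> i /pT[b bE]; exists b.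
    - exact: op_tideal eu.
    move=> y ye; have := @op_tideal F (op_alg (B n.-1)) (BE n.-1) y ye => ye'.
    exact: (proj2 (ue y ye')).
  by move=> b; exact: (etrans (op_sandwich (BE n) x b) (xE b)).
exact: (brauer_idems q0 z0 h0 zz0 (@rel n) n2 (proj1 cond) (@qB_gen F n q z) tw dsP F1 F2).
Qed.
End Towers.

(** * Operators on functions of streams *)

(** A stream codes a perfect matching of the natural numbers: the first letter a says that the
    first point is joined to the a-th of the remaining points, counted from 0, and the tail
    codes the matching that is left when both points are removed. Functions of streams carry
    actions of the q-Brauer algebras of all sizes, computed letter by letter. *)
Definition scons (a : nat) (r : nat -> nat) : nat -> nat := fun i => if i is j.+1 then r j else a.
Lemma sconsE (s : nat -> nat) : s = scons (s 0%N) (fun i => s i.+1).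
Proof. by apply/funext => -[|i]. Qed.

Section Lend.
Variable F : fieldType.
Definition fn := (nat -> nat) -> F.
Definition lin_prop (L : fn -> fn) : Prop :=
  forall (k : F) u v s, L (fun s => k * u s + v s) s = k * L u s + L v s.
(** The F-linear endomorphisms of the space of functions of streams. *)
Record lend := Lend { lfun :> fn -> fn; lfunP : lin_prop lfun }.
Lemma lend_ext (x y : lend) : (forall f s, x f s = y f s) -> x = y.
Proof.
case: x y => [x xP] [y yP] /= E; have xy : x = y by apply/funext => f; apply/funext.
by subst y; rewrite (Prop_irrelevance xP yP).
Qed.
HB.instance Definition _ := gen_eqMixin lend.
HB.instance Definition _ := gen_choiceMixin lend.

Fact lend0P : lin_prop (fun _ _ => 0). Proof. by move=> k u v s; rewrite mulr0 addr0. Qed.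
Fact lendNP (x : lend) : lin_prop (fun f s => - x f s).
Proof. by move=> k u v s; rewrite lfunP mulrN opprD. Qed.
Fact lendDP (x y : lend) : lin_prop (fun f s => x f s + y f s).
Proof. by move=> k u v s; rewrite !lfunP mulrDr addrACA. Qed.
Fact lend1P : lin_prop (fun f => f). Proof. by []. Qed.
Fact lendMP (x y : lend) : lin_prop (fun f => x (y f)).
Proof.
move=> k u v s; rewrite -lfunP; congr (x _ s); apply/funext => s'; exact: lfunP.
Qed.
Fact lendZP (c : F) (x : lend) : lin_prop (fun f s => c * x f s).
Proof. by move=> k u v s; rewrite lfunP mulrDr mulrCA. Qed.
Definition lend0 := Lend lend0P.
Definition lendN x := Lend (lendNP x).
Definition lendD x y := Lend (lendDP x y).
Definition lend1 := Lend lend1P.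
Definition lendM x y := Lend (lendMP x y).
Definition lendZ c x := Lend (lendZP c x).

Lemma lin_add (x : lend) u v s : x (fun s => u s + v s) s = x u s + x v s.
Proof.
rewrite -[X in X + _]mul1r -lfunP; congr (x _ s); apply/funext => s'; by rewrite mul1r.
Qed.
Lemma lin_0 (x : lend) s : x (fun=> 0) s = 0.
Proof.
have := lin_add x (fun=> 0) (fun=> 0) s; have -> : (fun s : nat -> nat => 0 + 0 : F) = (fun=> 0).
  by apply/funext => ?; rewrite addr0.
by move=> E; apply: (addrI (x (fun=> 0) s)); rewrite -E addr0.
Qed.
Lemma lin_scale (x : lend) k u s : x (fun s => k * u s) s = k * x u s.
Proof.
rewrite -[RHS]addr0 -(lin_0 x s) -lfunP; congr (x _ s); apply/funext => s'; by rewrite addr0.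
Qed.

Fact lend_addA : associative lendD. Proof. by move=> x y z; apply: lend_ext => f s; rewrite /= addrA. Qed.
Fact lend_addC : commutative lendD. Proof. by move=> x y; apply: lend_ext => f s; rewrite /= addrC. Qed.
Fact lend_add0 : left_id lend0 lendD. Proof. by move=> x; apply: lend_ext => f s; rewrite /= add0r. Qed.
Fact lend_addN : left_inverse lend0 lendN lendD.
Proof. by move=> x; apply: lend_ext => f s; rewrite /= addNr. Qed.
HB.instance Definition _ := GRing.isZmodule.Build lend lend_addA lend_addC lend_add0 lend_addN.
Fact lend_mulA : associative lendM. Proof. by move=> x y z; apply: lend_ext. Qed.
Fact lend_mul1 : left_id lend1 lendM. Proof. by move=> x; apply: lend_ext. Qed.
Fact lend_mulr1 : right_id lend1 lendM. Proof. by move=> x; apply: lend_ext. Qed.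
Fact lend_mulDl : left_distributive lendM +%R. Proof. by move=> x y z; apply: lend_ext. Qed.
Fact lend_mulDr : right_distributive lendM +%R.
Proof. by move=> x y z; apply: lend_ext => f s /=; rewrite lin_add. Qed.
HB.instance Definition _ := GRing.Zmodule_isPzRing.Build lend
  lend_mulA lend_mul1 lend_mulr1 lend_mulDl lend_mulDr.
Fact lend_one_neq0 : (1 : lend) != 0.
Proof.
apply/eqP => /(congr1 (fun x : lend => x (fun=> 1) (fun=> 0%N))) /= /eqP.
by rewrite (negPf (oner_neq0 F)).
Qed.
HB.instance Definition _ := GRing.PzSemiRing_isNonZero.Build lend lend_one_neq0.
Fact lend_scaleA c d (x : lend) : lendZ c (lendZ d x) = lendZ (c * d) x.
Proof. by apply: lend_ext => f s; rewrite /= mulrA. Qed.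
Fact lend_scale1 : left_id 1 lendZ. Proof. by move=> x; apply: lend_ext => f s; rewrite /= mul1r. Qed.
Fact lend_scaleDr : right_distributive lendZ +%R.
Proof. by move=> c x y; apply: lend_ext => f s; rewrite /= mulrDr. Qed.
Fact lend_scaleDl (x : lend) : {morph lendZ^~ x : c d / c + d}.
Proof. by move=> c d; apply: lend_ext => f s; rewrite /= mulrDl. Qed.
HB.instance Definition _ := GRing.Zmodule_isLmodule.Build F lend
  lend_scaleA lend_scale1 lend_scaleDr lend_scaleDl.
Fact lend_scaleAl (c : F) (x y : lend) : c *: (x * y) = (c *: x) * y.
Proof. by apply: lend_ext. Qed.
HB.instance Definition _ := GRing.Lmodule_isLalgebra.Build F lend lend_scaleAl.
Fact lend_scaleAr (c : F) (x y : lend) : c *: (x * y) = x * (c *: y).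
Proof. by apply: lend_ext => f s; rewrite /= lin_scale. Qed.
HB.instance Definition _ := GRing.Lalgebra_isAlgebra.Build F lend lend_scaleAr.


Fact compP a : lin_prop (fun f r => f (scons a r)). Proof. by []. Qed.
(** An operator x is known when all the components dd a * x are. *)
Definition dd a : lend := Lend (compP a).
Lemma comp_ext (x y : lend) : (forall a, dd a * x = dd a * y) -> x = y.
Proof.
move=> E; apply: lend_ext => f s; rewrite (sconsE s).
exact: (congr1 (fun x : lend => x f (fun i => s i.+1)) (E (s 0%N))).
Qed.
Fact glueP (x : nat -> lend) : lin_prop (fun f s => x (s 0%N) f (fun i => s i.+1)).
Proof. by move=> k u v s; rewrite lfunP. Qed.
Definition glue (x : nat -> lend) : lend := Lend (glueP x).
Lemma dd_glue a x : dd a * glue x = x a.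
Proof. by apply: lend_ext. Qed.

Section Operators.
Context (q z : F).
Notation h := (q - q^-1).
Notation dl := (qB_delta q z).

(** The braid of the first two points. The term with h is present when the partner of the first
    point lies beyond that of the second. *)
Definition tt0 : lend := glue (fun a => if a is a'.+1 then
   glue (fun b => if (a' <= b)%N then dd a' * dd b.+2 else dd a'.-1 * dd b.+1 + h *: (dd b * dd a))
  else q *: dd 0).
(** The braid t i.+1 in terms of x = t i.-1 and y = t i: when the partner of the first point is
    not one of the two points that are braided, the braid acts on the tail, where its index is
    lowered by two or by one as that partner lies before them or not. *)
Definition ttS (i : nat) (x y : lend) : lend :=
  glue (fun a => if (a < i)%N then x * dd a else if a == i then dd i.+1
     else if a == i.+1 then dd i + h *: dd i.+1 else y * dd a).
Fixpoint tt2 (i : nat) : lend * lend :=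
  if i is j.+1 then let: (x, y) := tt2 j in (y, ttS j x y) else (0, tt0).
Definition tt i : lend := (tt2 i).2.

Lemma ttSE i : tt i.+1 = ttS i (tt i.-1) (tt i).
Proof. by rewrite /tt /=; case: i => [|i] /=; [congr ttS; case | case: (tt2 i)]. Qed.
End Operators.
End Lend.

Definition lend_alg (F : fieldType) : algType F := lend F.

Section Rep.
Context (F : fieldType) (q z : F).
Notation h := (q - q^-1).
Notation dl := (qB_delta q z).
Notation M := (lend F).
Notation d a := (dd F a).
Notation t i := (tt q i).
Implicit Types (w : M).
Ltac nc ::= nc_with (lend_alg F).


Lemma lend_dt_lt a k w : (a.+1 < k)%N -> d a * (t k * w) = t k.-2 * (d a * w).
Proof. by case: k => // k ak; rewrite !mulrA ttSE dd_glue ifT. Qed.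
Lemma lend_dt_eq a k w : a.+1 = k -> d a * (t k * w) = d k * w.
Proof. by move=> <-; rewrite mulrA ttSE dd_glue ltnn eqxx. Qed.
Lemma lend_dt_eqS a k w : (0 < k)%N -> a = k -> d a * (t k * w) = d k.-1 * w + h *: (d k * w).
Proof.
move=> + ->; case: k => // k _; rewrite mulrA ttSE dd_glue ltnNge leqnSn /=.
by rewrite gtn_eqF // eqxx mulrDl scalerAl.
Qed.
Lemma lend_dt_gt a k w : (0 < k)%N -> (k < a)%N -> d a * (t k * w) = t k.-1 * (d a * w).
Proof.
case: k => // k _ ka; rewrite !mulrA ttSE dd_glue ltnNge ltnW 1?ltnW //=.
by rewrite !gtn_eqF // ltnW.
Qed.
Lemma lend_dt00 w : d 0 * (t 0 * w) = q *: (d 0 * w).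
Proof. by rewrite mulrA dd_glue scalerAl. Qed.
Lemma lend_dt0_le b a w : (0 < a)%N -> (a.-1 <= b)%N ->
  d b * (d a * (t 0 * w)) = d a.-1 * (d b.+2 * w).
Proof. by case: a => // a _ ab; rewrite !mulrA -(mulrA (d b)) !dd_glue /= ab. Qed.
Lemma lend_dt0_gt b a w : (0 < a)%N -> (b < a.-1)%N ->
  d b * (d a * (t 0 * w)) = d a.-2 * (d b.+1 * w) + h *: (d b * (d a * w)).
Proof.
case: a => // a _ /= ab; rewrite !mulrA -(mulrA (d b)) !dd_glue leqNgt ab /=.
by rewrite mulrDl -scalerAl.
Qed.

Ltac dred := match goal with
  | |- context [@GRing.mul _ (dd _ ?a) (@GRing.mul _ (tt _ ?k) ?w)] =>
    first [ rewrite (@lend_dt_lt a k w ltac:(lia)) | rewrite (@lend_dt_eq a k w ltac:(lia))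
          | rewrite (@lend_dt_eqS a k w ltac:(lia) ltac:(lia)) | rewrite (@lend_dt_gt a k w ltac:(lia) ltac:(lia))
          | rewrite (lend_dt00 w) ]
  | |- context [@GRing.mul _ (dd _ ?b) (@GRing.mul _ (dd _ ?a) (@GRing.mul _ (tt _ 0) ?w))] =>
    first [ rewrite (@lend_dt0_le b a w ltac:(lia) ltac:(lia)) | rewrite (@lend_dt0_gt b a w ltac:(lia) ltac:(lia)) ]
  end.
Ltac dsplit := match goal with
  | |- context [@GRing.mul _ (dd _ ?b) (@GRing.mul _ (dd _ ?a) (@GRing.mul _ (tt _ 0) ?w))] =>
    case: (leqP a.-1 b) => ?
  | |- context [@GRing.mul _ (dd _ ?a) (@GRing.mul _ (tt _ ?k) ?w)] =>
    case: (ltngtP a.+1 k) => ?; [ | case: (ltngtP a k) => ?; [exfalso; lia | | ] | ]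
  end.
Ltac dall := repeat (progress (rewrite ?(mulrDl, mulrDr, scalerDr, mul1r) -?scalerAr -?scalerAl -?mulrA /=; try dred)).
Ltac idx := repeat match goal with
  | |- context [dd _ ?x] => match goal with |- context [dd _ ?y] =>
      tryif constr_eq x y then fail else (let E := fresh in assert (E : x = y) by lia; rewrite E; clear E) end
  | |- context [tt _ ?x] => match goal with |- context [tt _ ?y] =>
      tryif constr_eq x y then fail else (let E := fresh in assert (E : x = y) by lia; rewrite E; clear E) end
  end.

Lemma ext_w (x y : M) : (forall w, x * w = y * w) -> x = y.
Proof. by move=> H; rewrite -[x]mulr1 H mulr1. Qed.
Lemma comp_ext2 (x y : M) : (forall b a w, d b * (d a * (x * w)) = d b * (d a * (y * w))) -> x = y.
Proof.
move=> H; apply: ext_w => w; apply: comp_ext => a; apply: comp_ext => b; exact: H.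
Qed.

Lemma lend_t_quad (q0 : q != 0) i : t i * t i = 1 + h *: t i.
Proof.
elim/ltn_ind: i => -[|i] IH.
  apply: comp_ext2 => b [|a] w; dall.
    rewrite !scalerA -[X in _ = X + _]scale1r -scalerDl; congr (_ *: _); by field.
  clear q0; case: (leqP a b) => ab; dall; idx; nc.
clear q0; apply: ext_w => w; apply: comp_ext => a.
case: (ltngtP a.+1 i.+1) => ai; [|case: (ltngtP a i.+1) => ai'; [exfalso; lia| |]|]; dall.
- by rewrite !mulrA (IH i.-1 ltac:(lia)) mulrDl mul1r -!scalerAl mulrDl -!scalerAl.
- by rewrite !mulrA (IH i ltac:(lia)) mulrDl mul1r -!scalerAl mulrDl -!scalerAl.
- idx; nc.
idx; nc.
Qed.

Ltac dcase := repeat first [progress dall | dsplit]; try by (exfalso; lia).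

Lemma lend_t_comm i j : (i.+1 < j)%N -> t i * t j = t j * t i.
Proof.
elim/ltn_ind: i j => -[|i] IH j ij.
  apply: ext_w => w; apply: comp_ext => -[|a]; first by dcase; idx; nc.
  apply: comp_ext => b; case: (leqP a b) => ab; dcase; idx; nc.
apply: ext_w => w; apply: comp_ext => a; dcase; try (by idx; nc).
all: rewrite !mulrA; congr (_ * _ * _); apply: IH; lia.
Qed.

(** Only the braid relation of the first three points is not inductive; it is checked on the
    first three letters. *)
Lemma lend_t_braid (q0 : q != 0) i : t i * t i.+1 * t i = t i.+1 * t i * t i.+1.
Proof.
elim/ltn_ind: i => -[|i] IH.
  apply: comp_ext2 => b a w; apply: comp_ext => c.
  case: a => [|[|a]]; last case: (leqP a.+1 b) => ba; last case: b ba => [|b] ba.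
  1-5: by dcase; idx; nc; field.
apply: ext_w => w; apply: comp_ext => a; dcase; try (by idx; nc).
all: first [ by rewrite !mulrA; congr (_ * _ * _); apply: IH; lia
  | by rewrite !mulrA; congr (_ * _ * _); move: (IH i.-1 ltac:(lia)); rewrite (_ : i.-1.+1 = i); [|lia]
  | by rewrite (mulrA (t i) (t i)) lend_t_quad //; nc ].
Qed.
End Rep.

(** * The q-Brauer algebras acting on functions of matchings *)

Section Rep.
Context (F : fieldType) (q z : F) (M : algType F) (dd : nat -> M) (t : nat -> M) (cc : M).
Notation h := (q - q^-1).
Notation dl := (qB_delta q z).
Notation d := dd.
Implicit Types (w : M).

Fixpoint uu k : M := if k is j.+1 then uu j * t j else 1.
Fixpoint yy k : M := if k is j.+1 then yy j * t j.+1 else 1.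

(** The rules by which the components of t k * w and cc * w are computed. The element cc turns a
    function of matchings into one with two more points, with a coefficient that depends on
    the arc of the first point; E acts as cc * d 0. *)
Record stream_model : Prop := StreamModel {
  q_neq0 : q != 0;
  dd_ext : forall x y : M, (forall a, d a * x = d a * y) -> x = y;
  dt_lt : forall a k w, (a.+1 < k)%N -> d a * (t k * w) = t k.-2 * (d a * w);
  dt_eq : forall a k w, a.+1 = k -> d a * (t k * w) = d k * w;
  dt_eqS : forall a k w, (0 < k)%N -> a = k -> d a * (t k * w) = d k.-1 * w + h *: (d k * w);
  dt_gt : forall a k w, (0 < k)%N -> (k < a)%N -> d a * (t k * w) = t k.-1 * (d a * w);
  dt00 : forall w, d 0 * (t 0 * w) = q *: (d 0 * w);
  dt0_le : forall b a w, (0 < a)%N -> (a.-1 <= b)%N ->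
    d b * (d a * (t 0 * w)) = d a.-1 * (d b.+2 * w);
  dt0_gt : forall b a w, (0 < a)%N -> (b < a.-1)%N ->
    d b * (d a * (t 0 * w)) = d a.-2 * (d b.+1 * w) + h *: (d b * (d a * w));
  t_quad : forall i, t i * t i = 1 + h *: t i;
  t_comm : forall i j, (i.+1 < j)%N -> t i * t j = t j * t i;
  t_braid : forall i, t i * t i.+1 * t i = t i.+1 * t i * t i.+1;
  dd_c0 : forall w, d 0 * (cc * w) = dl *: w;
  dd_cS : forall a w, d a.+1 * (cc * w) = z *: (uu a * w) }.

Hypothesis SM : stream_model.
Let q0 := q_neq0 SM.
Lemma uu_yy k : uu k.+1 = t 0 * yy k.
Proof. by elim: k => [|k IH] /=; rewrite ?mul1r ?mulr1 // -/(uu k.+1) IH mulrA. Qed.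
Lemma d0c : d 0 * cc = dl *: 1. Proof. by rewrite -[cc]mulr1 (dd_c0 SM). Qed.
Lemma dSc a : d a.+1 * cc = z *: uu a. Proof. by rewrite -[cc]mulr1 (dd_cS SM) mulr1. Qed.
Lemma uu_comm k i : (k <= i)%N -> uu k * t i.+1 = t i.+1 * uu k.
Proof.
elim: k => [|k IH] ki /=; first by rewrite mul1r mulr1.
by rewrite -mulrA (t_comm SM) // mulrA IH 1?ltnW // mulrA.
Qed.
Lemma d0_yy k : d 0 * yy k = d k.
Proof.
elim: k => [|k IH] /=; first by rewrite mulr1.
by rewrite mulrA IH -[RHS]mulr1 -(@dt_eq SM k k.+1) // mulr1.
Qed.
Lemma d_yy_gt c x : (c < x)%N -> d x * yy c = uu c * d x.
Proof.
elim: c => [|c IH] cx /=; first by rewrite mulr1 mul1r.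
by rewrite mulrA IH 1?ltnW // -mulrA -[t c.+1]mulr1 (dt_gt SM) // mulr1 mulrA.
Qed.
Lemma d_yy_le c x : (0 < x <= c)%N ->
  d x * yy c = uu c.-1 * d x.-1 + h *: (uu x.-1 * d c).
Proof.
elim: c => [|c IH] /andP[x0 xc] /=; first by lia.
have [xc'|xc'] := leqP x c; last first.
  have -> : x = c.+1 by lia.
  rewrite mulrA d_yy_gt // -mulrA -[t c.+1]mulr1 (dt_eqS SM) //= mulr1; nc.
rewrite mulrA IH ?x0 //= mulrDl -!mulrA -[t c.+1]mulr1 (dt_lt SM) /=; last lia.
rewrite mulr1 -scalerAl -mulrA (dt_eq SM) //= mulr1 mulrA; case: c xc' {IH xc} => [|c] xc'; [lia|by []].
Qed.

(** By induction on x, with one more component on the left; it makes the components of cc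
    compatible with the first braid. *)
Lemma d_uu_swap x y : (x <= y)%N -> d x * uu y.+1 = q *: (d y * uu x).
Proof.
elim/ltn_ind: x y => -[|x] IH y xy.
  by rewrite uu_yy (dt00 SM) d0_yy mulr1.
rewrite !uu_yy; apply: (dd_ext SM) => e; rewrite -scalerAr.
have IH' u v : (u <= x)%N -> (u <= v)%N -> d u * uu v.+1 = q *: (d v * uu u) by move=> *; exact: IH.
clear IH.
case: (leqP y.-1 e) => ye.
  rewrite (dt0_le SM); [|lia|lia]; rewrite [in RHS](dt0_le SM); [|lia|lia].
  rewrite !d_yy_gt; [|lia|lia]; rewrite !mulrA (_ : y = y.-1.+1); last lia.
  by rewrite !succnK IH' -?scalerAl //; lia.
rewrite [in RHS](dt0_gt SM); [|lia|lia].
case: (leqP x e) => xe.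
  rewrite (dt0_le SM) /=; [|lia|lia].
  rewrite d_yy_le; last lia.
  rewrite [in RHS]d_yy_gt; [|lia]; rewrite [in RHS]d_yy_gt; [|lia] => /=.
  have E1 := IH' x y.-2 ltac:(lia) ltac:(lia); rewrite (_ : y.-2.+1 = y.-1) in E1; last lia.
  have E2 := IH' x e ltac:(lia) ltac:(lia).
  rewrite mulrDr !mulrA E1 -scalerAr mulrA E2; nc.
case: x xy IH' xe => [|x] xy IH' xe; first lia.
rewrite (dt0_gt SM) /=; [|lia|lia].
rewrite (@d_yy_gt x.+1 y); last lia.
rewrite (@d_yy_le x.+1 e.+1); last lia.
rewrite !d_yy_le /=; [|lia..].
have E1 := IH' x y.-2 ltac:(lia) ltac:(lia); rewrite (_ : y.-2.+1 = y.-1) in E1; last lia.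
have E2 := IH' e y.-2 ltac:(lia) ltac:(lia); rewrite (_ : y.-2.+1 = y.-1) in E2; last lia.
have E3 := IH' e x ltac:(lia) ltac:(lia).
have E4 : d x * uu e = q^-1 *: (d e * (uu x * t x)) by move: E3 => /= ->; rewrite scalerA mulVf // scale1r.
nc_cert ((d x * uu y.-1 - q *: (d y.-2 * uu x)) * d e
  + h *: ((d e * uu y.-1 - q *: (d y.-2 * uu e)) * d x.+1)
  + h *: ((d x * uu e - q^-1 *: (d e * (uu x * t x))) * d y)).
by rewrite E1 E2 E4 !subrr !mul0r !scaler0 !addr0.
Qed.


Lemma uu_slide i a : (i.+1 < a)%N -> t i.+1 * uu a = uu a * t i.
Proof.
elim: a => [//|a IH]; rewrite ltnS leq_eqVlt => /orP[/eqP <-|ia] /=.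
  by rewrite !mulrA -uu_comm // -!mulrA; congr (_ * _); rewrite !mulrA (t_braid SM).
by rewrite mulrA IH // -!mulrA (t_comm SM).
Qed.

Lemma tc i : t i.+2 * cc = cc * t i.
Proof.
apply: (dd_ext SM) => -[|a].
  by rewrite (dd_c0 SM) -[cc]mulr1 (dt_lt SM) //= (dd_c0 SM) -scalerAr mulr1.
rewrite (dd_cS SM); case: (ltngtP a i) => ai.
- by rewrite -[cc]mulr1 (dt_lt SM) ?ltnS //= (dd_cS SM) mulr1 -scalerAr; case: i ai => [//|i] ai; rewrite uu_comm.
- have [->|ai'] := eqVneq a i.+1.
    rewrite -[cc]mulr1 (dt_eqS SM) //= !(dd_cS SM) !mulr1 /= -!mulrA (t_quad SM) //; nc.
  rewrite -[cc]mulr1 (dt_gt SM) /=; [|by []|lia]; rewrite (dd_cS SM) mulr1 -scalerAr uu_slide //; lia.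
by rewrite ai -[cc]mulr1 (dt_eq SM) // (dd_cS SM) mulr1 /=.
Qed.

Lemma t0c : t 0 * cc = q *: cc.
Proof.
apply: (dd_ext SM) => -[|a].
  by rewrite -[cc]mulr1 (dt00 SM) -scalerAr.
apply: (dd_ext SM) => b; rewrite -scalerAr -[cc]mulr1 !(dd_cS SM); case: (leqP a b) => ab.
  by rewrite (dt0_le SM) // (dd_cS SM) !mulr1 -!scalerAr d_uu_swap // scalerA mulrC -scalerA.
rewrite (dt0_gt SM) //=; case: a ab => [//|a] ab /=; rewrite !(dd_cS SM) !mulr1 -!scalerAr.
have E := @d_uu_swap b a ab; rewrite -/(uu a.+1) E.
rewrite !scalerA -scalerDl; congr (_ *: _); by field.
Qed.

Lemma d0t1c : d 0 * t 1 * cc = z *: 1.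
Proof. by rewrite -mulrA -[cc]mulr1 (dt_eq SM) // (dd_cS SM) /= mulr1. Qed.
Lemma d0t0 : d 0 * t 0 = q *: d 0. Proof. by rewrite -[t 0]mulr1 (dt00 SM) mulr1. Qed.
Lemma d0t i : d 0 * t i.+2 = t i * d 0.
Proof. by rewrite -[t i.+2]mulr1 (dt_lt SM) //= mulr1. Qed.

(** This is the relation that determines how an arc passes another arc; it gives d0Gc, by which
    E2 acts as cc cc d d. *)
Lemma d2t0t1c : d 2 * t 0 * t 1 * cc = cc * d 0 + h *: (z *: (1 + q *: t 0)).
Proof.
rewrite -!mulrA; apply: (dd_ext SM) => -[|e].
  rewrite (dt0_gt SM) //= (dt_eqS SM) // (@dt_gt SM 2 1) // !dSc d0c /= mulrDr [in RHS]mulrDr (dd_c0 SM).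
  have E := d0t0; nc_cert ((h * z) *: ((d 0 * t 0 - q *: d 0) * t 0)).
  by rewrite E !subrr !mul0r !scaler0.
rewrite (dt0_le SM) // -[cc]mulr1 (dt_gt SM) //= !(dd_cS SM).
have -> : d 1 * (t 0 * (z *: (uu e.+2 * 1))) = z *: (d 1 * (t 0 * (t 0 * yy e.+1))).
  by rewrite mulr1 -!scalerAr uu_yy.
have -> : t 0 * (t 0 * yy e.+1) = yy e.+1 + h *: uu e.+2.
  by rewrite mulrA (t_quad SM) // mulrDl mul1r -scalerAl uu_yy.
rewrite mulrDr -scalerAr d_uu_swap // d_yy_le //= !mul1r [in RHS]mulrDr -[cc in RHS]mulr1 mulrA mulr1 (dd_cS SM).
nc.
Qed.

Notation G := (t 1 * t 2 * (t 0 - h%:A) * (t 1 - h%:A)).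
Lemma d0t1t2 : d 0 * t 1 * t 2 = d 2.
Proof. by rewrite -mulrA (dt_eq SM) // -[t 2]mulr1 (dt_eq SM) // mulr1. Qed.
Lemma d0Gc : d 0 * G * cc = cc * d 0.
Proof.
have E1 := d2t0t1c; have E2 : d 2 * t 1 * cc = z *: (t 0 * t 0).
  by rewrite -mulrA -[cc]mulr1 (dt_gt SM) // (dd_cS SM) /= mulr1 mul1r -scalerAr.
have E3 : d 2 * cc = z *: t 0 by rewrite -[cc]mulr1 (dd_cS SM) /= mulr1 mul1r.
have E4 : d 2 * t 0 * cc = q *: (z *: t 0) by rewrite -mulrA t0c -scalerAr E3.
rewrite (t_quad SM) // in E2.
rewrite !mulrA d0t1t2.
nc_cert ((d 2 * t 0 * t 1 * cc - (cc * d 0 + h *: (z *: (1 + q *: t 0))))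
  - h *: (d 2 * t 1 * cc - z *: (1 + h *: t 0)) - h *: (d 2 * t 0 * cc - q *: (z *: t 0))
  + (h * h) *: (d 2 * cc - z *: t 0)).
by rewrite E1 E2 E3 E4 !subrr !scaler0 !subr0 addr0.
Qed.

Lemma d0d0G : d 0 * d 0 * G = d 0 * d 0.
Proof.
have E : d 0 * d 0 * t 1 * t 2 = d 0 * d 0 * t 1 * t 0.
  transitivity (d 0 * d 2).
    by rewrite -!mulrA (dt_eq SM) // -[t 2]mulr1 (dt_eq SM) // mulr1.
  by rewrite -!mulrA (dt_eq SM) // -[t 0]mulr1 (dt0_le SM) //= mulr1.
rewrite !mulrA E.
have Q0 := t_quad SM 0; have Q1 := t_quad SM 1.
nc_cert (d 0 * d 0 * t 1 * (t 0 * t 0 - (1 + h *: t 0)) * (t 1 - h%:A)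
  + d 0 * d 0 * (t 1 * t 1 - (1 + h *: t 1))).
by rewrite Q0 Q1 !subrr !(mulr0, mul0r) addr0.
Qed.

(** Three components are computed by hand; the further ones follow since d a.+1 is d a times a
    braid that commutes with both sides. *)
Lemma t0t1cc : t 0 * t 1 * (cc * cc) = t 2 * t 1 * (cc * cc).
Proof.
have E1 := d2t0t1c.
have C0 := t0c; have D0 := d0c; have Q0 := t_quad SM 0; have Q1 := t_quad SM 1.
apply: (dd_ext SM) => a; rewrite -!mulrA; case: a => [|[|[|a]]].
- rewrite (dt00 SM) (dt_eq SM) // (dt_lt SM) //= (dt_eq SM) // !(dd_cS SM) /= !mul1r -scalerAr C0; nc.
- rewrite (@dt_eq SM 1 2) // (@dt_gt SM 2 1) // (dd_cS SM) /= mul1r -scalerAr C0 -scalerAr C0.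
  apply: (dd_ext SM) => b; rewrite (dt0_le SM) //= (dt_gt SM) // (dd_cS SM) uu_yy -!scalerAr -!mulrA !(dt00 SM) !mulrA d0_yy.
  nc.
- rewrite (@dt_eqS SM 2 2) // (@dt_eqS SM 1 1) // (@dt_gt SM 2 1) // !(dd_cS SM) (dd_c0 SM) /= !mul1r.
  nc_cert ((d 2 * t 0 * t 1 * cc - (cc * d 0 + h *: (z *: (1 + q *: t 0)))) * cc
   + cc * (d 0 * cc - dl *: 1) + (h * z * q) *: (t 0 * cc - q *: cc) - (h * z) *: (t 0 * (t 0 * cc - q *: cc))
   - (h * z * q) *: (t 0 * cc - q *: cc)).
    all: try by ring.
  by rewrite E1 C0 D0 !subrr !(mulr0, mul0r, scaler0) !subr0 !addr0.
elim: a => [|a IH].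
  have -> : d 3 * (t 0 * (t 1 * (cc * cc))) = d 2 * t 0 * t 1 * cc * t 1 * cc.
    rewrite -(@dt_eq SM 2 3) // -!mulrA; congr (_ * _).
    by rewrite (mulrA (t 3)) -(t_comm SM) // -!mulrA (mulrA (t 3)) -(t_comm SM) // -!mulrA (mulrA (t 3)) tc -!mulrA.
  rewrite (@dt_gt SM 3 2) // (dt_gt SM) //= (dd_cS SM) /= mul1r E1.
  have E2 := d0t1c; have B := t_braid SM 0.
  nc_cert (cc * (d 0 * t 1 * cc - z *: 1) - z *: (t 1 * (t 0 * t 0 - (1 + h *: t 0)) * t 1 * cc)
    - z *: ((t 1 * t 1 - (1 + h *: t 1)) * cc) + (z * h) *: ((t 0 * t 1 * t 0 - t 1 * t 0 * t 1) * cc)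
    - (z * h) *: (t 0 * t 1 * (t 0 * cc - q *: cc))).
    all: try by ring.
  by rewrite E2 Q0 Q1 B C0 !subrr !(mulr0, mul0r, scaler0) !subr0 !addr0.
have K x y : (y < 3)%N -> t a.+4 * (t y * x) = t y * (t a.+4 * x).
  by move=> y3; rewrite !mulrA -(@t_comm SM y a.+4) //; lia.
have KK : t a.+4 * (cc * cc) = cc * cc * t a by rewrite mulrA tc -mulrA tc mulrA.
rewrite -!(@dt_eq SM a.+3 a.+4) // !K // KK.
by move/(congr1 (fun x => x * t a)): IH; rewrite -!mulrA.
Qed.

Lemma Gcc : G * (cc * cc) = cc * cc.
Proof.
have E := t0t1cc; have C0 := t0c.
have C2 : t 2 * (cc * cc) = q *: (cc * cc) by rewrite mulrA tc -mulrA C0 -scalerAr.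
have C0' : t 0 * (cc * cc) = q *: (cc * cc) by rewrite mulrA C0 -scalerAl.
have Q2 := t_quad SM 2; have Q1 := t_quad SM 1.
move: (cc * cc) E C0' C2 => X E C0' C2.
nc_cert (t 1 * t 2 * (t 0 * t 1 * X - t 2 * t 1 * X) - h *: (t 1 * t 2 * (t 0 * X - q *: X))
  + h *: (t 1 * t 2 * (t 2 * X - q *: X)) + t 1 * (t 2 * t 2 - (1 + h *: t 2)) * (t 1 - h%:A) * X
  + (t 1 * t 1 - (1 + h *: t 1)) * X).
  all: try by ring.
by rewrite E C0' C2 Q1 Q2 !subrr !(mulr0, mul0r, scaler0) !subr0 !addr0.
Qed.
End Rep.

Section Rep.
Context (F : fieldType) (q z : F) (M : algType F) (d : nat -> M) (t : nat -> M) (cc : M).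
Hypothesis SM : stream_model q z d t cc.
Notation h := (q - q^-1).
Notation dl := (qB_delta q z).
Implicit Types (w : M).
Let q0 := q_neq0 SM.

Definition rT (i : nat) : M := t i.-1.
Definition rE : M := cc * d 0.

Lemma rT_hecke n : hecke_rel q n rT.
Proof.
split=> [i /andP[i0 _]|i j i0 ij _|i i0 _]; rewrite /rT.
- exact: (t_quad SM).
- by apply: (t_comm SM); lia.
by case: i i0 => // i _; exact: (t_braid SM).
Qed.

Lemma rho_E2 : qB_E2 q rT rE = cc * cc * (d 0 * d 0).
Proof.
have E := d0Gc SM.
rewrite /qB_E2 /rE /qB_Tinv /rT /=.
transitivity (cc * (d 0 * (t 1 * t 2 * (t 0 - h%:A) * (t 1 - h%:A)) * cc) * d 0); first by rewrite !mulrA.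
by rewrite E !mulrA.
Qed.

(** For every n at once, since the operators do not depend on n. *)
Lemma rho_relations n : qB_relations n q z rT rE.
Proof.
have D0 := d0c SM; have D1 := d0t1c SM; have C0 := t0c SM; have D2 := d0t0 SM.
have E2 := rho_E2.
move=> x y; case=> {x y} [i ii|i j i0 j0 ij|k k1 _||_|_|_|i /andP[i2 _]|_|_]; rewrite ?E2 /rE /rT /=.
- have E := t_quad SM i.-1; nc_cert (t i.-1 * t i.-1 - (1 + h *: t i.-1)); last by rewrite E subrr.
  by field.
- by case/orP: ij => ij; [|apply/esym]; apply: (t_comm SM); lia.
- by case: k k1 => // k _; exact: (t_braid SM).
- by rewrite -mulrA (mulrA (d 0)) D0 -!scalerAl mul1r -scalerAr.
- by rewrite mulrA C0 -scalerAl.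
- by rewrite -mulrA D2 -scalerAr.
- by rewrite -!mulrA (mulrA (t 1)) (mulrA (d 0)) (mulrA (d 0)) D1 -!scalerAl mul1r -scalerAr.
- case: i i2 => [|[|[|i]]] //= _; rewrite mulrA (tc SM) -mulrA.
  by rewrite -mulrA (d0t SM).
- have G := Gcc SM; rewrite mulrA; congr (_ * _); exact: G.
have G := d0d0G SM; rewrite -mulrA; congr (_ * _); exact: G.
Qed.

(** How the first letter a changes the number of points under consideration and of arcs that
    are still to be found: among the first k points lies the arc of the first point exactly
    if a < k - 1. *)
Definition ncl (km : nat * nat) (a : nat) : nat * nat :=
  if (a < km.1.-1)%N then (km.1.-2, km.2.-1) else (km.1.-1, km.2).
(** The element w vanishes on the streams that code at least m arcs among the first k points.
    Stated through components, so that it makes sense for elements of M. *)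
Fixpoint vanish (k m : nat) (w : M) {struct k} : Prop :=
  match k with
  | 0 => if m is 0 then w = 0 else True
  | k1.+1 => forall a, if (a < k1)%N then vanish (Nat.pred k1) m.-1 (d a * w) else vanish k1 m (d a * w)
  end.
Definition van (km : nat * nat) := vanish km.1 km.2.

Lemma van_step km w : (0 < km.1)%N -> van km w <-> forall a, van (ncl km a) (d a * w).
Proof.
case: km => [[|k] m] //= _; rewrite /van /ncl /=.
by split=> H a; move: (H a); case: ltnP => // _; case: k {H}.
Qed.
Lemma van0E k w : van (k, 0%N) w <-> w = 0.
Proof.
elim/ltn_ind: k w => -[|k] IH w; first by [].
rewrite van_step //; split=> [H|-> a]; last first.
  by rewrite mulr0 /ncl /=; case: ltnP => ak; apply/IH => //; lia.
apply: (dd_ext SM) => a; rewrite mulr0; move: (H a); rewrite /ncl /=.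
by case: ltnP => ak /IH -> //; lia.
Qed.
Lemma van_zero km : van km 0.
Proof.
case: km => k m; elim/ltn_ind: k m => -[|k] IH m; first by case: m.
by rewrite van_step // => a; rewrite mulr0 /ncl /=; case: ltnP => _; apply: IH; lia.
Qed.
Lemma van_add km x y : van km x -> van km y -> van km (x + y).
Proof.
case: km => k m; elim/ltn_ind: k m x y => -[|k] IH m x y.
  by rewrite /van /=; case: m => // -> ->; rewrite addr0.
rewrite !van_step // => Hx Hy a; rewrite mulrDr; move: (Hx a) (Hy a).
by rewrite /ncl /=; case: ltnP => _; apply: IH; lia.
Qed.
Lemma van_scale km (c : F) x : van km x -> van km (c *: x).
Proof.
case: km => k m; elim/ltn_ind: k m x => -[|k] IH m x.
  by rewrite /van /=; case: m => // ->; rewrite scaler0.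
rewrite !van_step // => Hx a; rewrite -scalerAr; move: (Hx a).
by rewrite /ncl /=; case: ltnP => _; apply: IH; lia.
Qed.

Lemma ncl_fst km a : (0 < km.1)%N -> ((ncl km a).1 < km.1)%N.
Proof. by rewrite /ncl; case: ifP => /= _; lia. Qed.

(** A braid of two of the first k points does not change the number of arcs among them. *)
Lemma van_t i km w : (i.+1 < km.1)%N -> van km w -> van km (t i * w).
Proof.
case: km => k m; elim/ltn_ind: k m i w => k IH m i w /= ik Hw.
have k0 : (0 < k)%N by lia.
have IH' km' i' w' : (km'.1 < k)%N -> (i'.+1 < km'.1)%N -> van km' w' -> van km' (t i' * w').
  by case: km' => ? ? /= ? ?; apply: IH.
have H1 := (van_step (km := (k, m)) w k0).1 Hw; apply/van_step => // a.
case: i ik => [|i] ik.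
  case: a => [|a]; first by rewrite (dt00 SM); apply: van_scale.
  have c0 : (0 < (ncl (k, m) a.+1).1)%N by rewrite /ncl /=; case: ifP => /= ?; lia.
  apply/van_step => // b; case: (leqP a b) => ab.
    rewrite (dt0_le SM) //=; have := H1 b.+2 => /van_step H2.
    have -> : ncl (ncl (k, m) a.+1) b = ncl (ncl (k, m) b.+2) a.
      by rewrite /ncl /=; case: (ltnP a.+1 k.-1) => ?; case: (ltnP b.+2 k.-1) => ? /=; case: ltnP => ?; case: ltnP => ? /=; congr (_, _); lia.
    by apply: H2; rewrite /ncl /=; case: ifP => /= ?; lia.
  rewrite (dt0_gt SM) //=; apply: van_add; last first.
    by apply: van_scale; have := H1 a.+1 => /van_step; apply.
  have := H1 b.+1 => /van_step H2.
  have -> : ncl (ncl (k, m) a.+1) b = ncl (ncl (k, m) b.+1) a.-1.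
    by rewrite /ncl /=; case: (ltnP a.+1 k.-1) => ?; case: (ltnP b.+1 k.-1) => ? /=; case: ltnP => ?; case: ltnP => ? /=; congr (_, _); lia.
  by apply: H2; rewrite /ncl /=; case: ifP => /= ?; lia.
case: (ltngtP a.+1 i.+1) => ai.
- rewrite (dt_lt SM) //; apply: IH' (H1 a); first exact: ncl_fst.
  by rewrite /ncl /=; case: ifP => /= ?; lia.
- have [->|ai'] := eqVneq a i.+1.
    rewrite (dt_eqS SM) //=; apply: van_add.
      have -> : ncl (k, m) i.+1 = ncl (k, m) i by rewrite /ncl /=; do 2!case: ltnP => ? //; lia.
      exact: H1.
    exact/van_scale/H1.
  rewrite (dt_gt SM) //=; last by lia.
  apply: IH' (H1 a); first exact: ncl_fst.
  by rewrite /ncl /=; case: ifP => /= ?; lia.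
rewrite (dt_eq SM) //.
have -> : ncl (k, m) a = ncl (k, m) i.+1 by rewrite /ncl /=; do 2!case: ltnP => ? //; lia.
exact: H1.
Qed.

Lemma van_far i km w : (km.1 <= i)%N -> van km w -> van km (t i * w).
Proof.
case: km => k m; elim/ltn_ind: k m i w => -[|k] IH m i w /= ik Hw.
  by move: Hw; rewrite /van /=; case: m => // ->; rewrite mulr0.
have IH' km' i' w' : (km'.1 < k.+1)%N -> (km'.1 <= i')%N -> van km' w' -> van km' (t i' * w').
  by case: km' => ? ? /= ? ?; apply: IH.
have H1 := (van_step (km := (k.+1, m)) w isT).1 Hw; apply/van_step => // a.
case: (ltngtP a.+1 i) => ai.
- rewrite (dt_lt SM) //; apply: IH' (H1 a); first exact: ncl_fst.
  by rewrite /ncl /=; case: ifP => /= ?; lia.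
- have [->|ai'] := eqVneq a i.
    rewrite (dt_eqS SM) //=; last by lia.
    apply: van_add; last exact/van_scale/H1.
    have -> : ncl (k.+1, m) i = ncl (k.+1, m) i.-1 by rewrite /ncl /=; do 2!case: ltnP => ? //; lia.
    exact: H1.
  rewrite (dt_gt SM) //=; [|lia|lia].
  apply: IH' (H1 a); first exact: ncl_fst.
  by rewrite /ncl /=; case: ifP => /= ?; lia.
rewrite (dt_eq SM) //.
have -> : ncl (k.+1, m) a = ncl (k.+1, m) i by rewrite /ncl /=; do 2!case: ltnP => ? //; lia.
exact: H1.
Qed.

Lemma van_succ k m w : van (k, m) w -> van (k.+1, m.+1) w.
Proof.
elim/ltn_ind: k m w => -[|k] IH m w H; first by apply/van_step.
case: m H => [|m] H; first by move/van0E: H => ->; apply: van_zero.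
apply/van_step => // a; move: ((van_step (km := (k.+1, m.+1)) w isT).1 H a); rewrite /ncl /=.
have [ak|ak|->] := ltngtP a k.
- by rewrite ltnS (ltnW ak); case: k {H} ak IH => // k _ IH /=; apply: IH.
- by rewrite ltnS leqNgt ak /=; apply: IH.
by rewrite leqnn.
Qed.

Lemma van_uu j km w : (j < km.1)%N -> van km w -> van km (uu t j * w).
Proof.
elim: j w => [|j IH] w jk H /=; first by rewrite mul1r.
by rewrite -mulrA; apply: IH; [lia|apply: van_t].
Qed.

(** A value of cc * w is a combination of values of w at matchings with one arc and two points
    less, so two arcs among the first k + 2 points leave one among the first k. *)
Lemma van_cc k w : van (k, 1%N) w -> van (k.+2, 2) (cc * w).
Proof.
move=> H; apply/van_step => // -[|a].
  by rewrite (dd_c0 SM); apply: van_scale.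
rewrite (dd_cS SM); apply: van_scale; rewrite /ncl /=; case: ltnP => ak; first by apply: van_uu => //=; lia.
have : (k <= a)%N by lia.
elim: a w H {ak} => [|a IH] w H ka.
  by rewrite mul1r; apply: van_succ.
case: (ltngtP k a.+1) ka => // ka _; last first.
  by apply: van_uu; [rewrite /= -ka | apply: van_succ].
rewrite /= -mulrA; apply: IH; [exact: van_far | lia].
Qed.

Lemma van_d0 k m w : van (k.+2, m.+1) w -> van (k, m) (d 0 * w).
Proof. by move/van_step => /(_ isT 0%N). Qed.
Lemma rE_van k w : van (k.+2, 1%N) w -> rE * w = 0.
Proof. by move/van_d0/van0E; rewrite /rE -mulrA => ->; rewrite mulr0. Qed.

(** The converse of rE_van: any arc among the first k points can be moved to the first two
    points by braids, where the component d 0 sees it. *)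
Lemma van_of_d0 k w : (forall x, in_alg_of (fun y => exists2 i, (i.+1 < k)%N & y = t i) x -> d 0 * (x * w) = 0) ->
  van (k, 1%N) w.
Proof.
elim: k w => [|k IH] w H; first by [].
apply/van_step => // a; rewrite /ncl /=; case: ltnP => ak.
  apply/van0E; rewrite -(d0_yy SM) -mulrA; apply: H.
  elim: a ak => [|a IHa] ak; first exact: ia_one.
  by apply: ia_mul; [apply: IHa; lia | apply: ia_gen; exists a.+1 => //; lia].
case: k ak IH H => [|[|k]] ak IH H; [by [] | by apply/van_step|].
apply: IH => x Hx.
have sh y : in_alg_of (fun y => exists2 i, (i.+1 < k.+2)%N & y = t i) y ->
    exists2 y', in_alg_of (fun y => exists2 i, (i.+1 < k.+3)%N & y = t i) y' & y * d a = d a * y'.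
  elim=> {y} [y [i ik ->]|c|y y' _ [u Hu uE] _ [v Hv vE]|y y' _ [u Hu uE] _ [v Hv vE]].
  - exists (t i.+1); first by apply: ia_gen; exists i.+1.
    by rewrite -[t i.+1]mulr1 (dt_gt SM) //= ?mulr1 //; lia.
  - by exists c%:A; [apply: ia_scal|rewrite mulr_algl mulr_algr].
  - by exists (u + v); [apply: ia_add|rewrite mulrDl mulrDr uE vE].
  by exists (u * v); [apply: ia_mul|rewrite -mulrA vE mulrA uE mulrA].
have [x' Hx' xE] := sh x Hx; rewrite (mulrA x) xE -mulrA.
have a2 : a = a.-2.+2 by lia.
have -> : d 0 * (d a * (x' * w)) = d a.-2 * (d 0 * (t 1 * t 0 * x' * w)).
  by rewrite -!mulrA (dt_eq SM) // (dt0_le SM) //= -a2.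
rewrite H ?mulr0 //; apply: ia_mul Hx'.
by apply: ia_mul; apply: ia_gen; [exists 1%N | exists 0%N].
Qed.
End Rep.

(** * Symmetrisers *)

Section Sym.
Context (F : fieldType) (A : algType F) (T : nat -> A) (lam : F).
Definition Rs a m : A := \sum_(j < m) lam ^+ j *: up T a j.
(** For lam = q and lam = -1/q these are the symmetriser and the antisymmetriser of m strands,
    built up one strand at a time. *)
Fixpoint Xs a m : A := if m is k.+1 then Xs a.+1 k * Rs a k.+1 else 1.
Definition qfact (m : nat) : F := \prod_(j < m) \sum_(i < j.+1) lam ^+ (2 * i).

Lemma eig_up x a j : (forall i, (a <= i < a + j)%N -> x * T i = lam *: x) ->
  x * up T a j = lam ^+ j *: x.
Proof.
elim: j => [|j IH] H; first by rewrite mulr1 scale1r.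
by rewrite upS mulrA IH => [|i ai]; rewrite -?scalerAl ?H ?scalerA -?exprSr //; lia.
Qed.
Lemma eig_Rs x a m : (forall i, (a <= i)%N -> (i.+1 < a + m)%N -> x * T i = lam *: x) ->
  x * Rs a m = (\sum_(i < m) lam ^+ (2 * i)) *: x.
Proof.
move=> H; rewrite mulr_sumr scaler_suml; apply: eq_bigr => j _.
rewrite -scalerAr eig_up ?scalerA -?exprD; first by rewrite addnn -mul2n.
by move=> i ai; apply: H; have := ltn_ord j; lia.
Qed.
Lemma eig_Xs x a m : (forall i, (a <= i)%N -> (i.+1 < a + m)%N -> x * T i = lam *: x) ->
  x * Xs a m = qfact m *: x.
Proof.
elim: m a => [|m IH] a H; first by rewrite /qfact big_ord0 mulr1 scale1r.
rewrite mulrA IH => [|i ai im]; last by apply: H; lia.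
by rewrite -scalerAl eig_Rs // scalerA; congr (_ *: _); rewrite [RHS]big_ord_recr.
Qed.

Context (q : F) (n : nat) (TP : hecke_rel q n T).
Notation h := (q - q^-1).
Context (lamP : lam ^+ 2 = 1 + h * lam).

(** The terms j = k and j = k + 1 of the sum are exchanged by T i up to the scalar lam, and all
    the other terms are eigenvectors; so the difference of the two sides telescopes. *)
Lemma Rs_eig x a m i : (0 < a)%N -> (a + m <= n.+1)%N ->
  (forall i, (a < i)%N -> (i.+1 < a + m)%N -> x * T i = lam *: x) ->
  (a <= i)%N -> (i.+1 < a + m)%N -> x * Rs a m * T i = lam *: (x * Rs a m).
Proof.
move=> a0 am xP ai im; have [k kE] : exists k, i = (a + k)%N by exists (i - a)%N; lia.
pose G := lam ^+ k *: (x * up T a k.+1) - lam ^+ k.+1 *: (x * up T a k).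
pose g j := if j == k.+1 then G else 0.
apply/eqP; rewrite -subr_eq0 /Rs mulr_sumr mulr_suml scaler_sumr -sumrB.
rewrite -(big_mkord xpredT (fun j => x * (lam ^+ j *: up T a j) * T i - lam *: (x * (lam ^+ j *: up T a j)))).
rewrite (eq_big_nat _ _ (F2 := fun j => g j.+1 - g j)); last first.
  move=> j /andP[_ jm]; rewrite /g eqSS -!scalerAr -!scalerAl -mulrA.
  case: (ltngtP j k) => jk.
  - rewrite -(up_far TP) // ?mulrA ?xP -?scalerAl; [|lia..].
    by rewrite ltn_eqF ?subrr ?sub0r ?oppr0 ?ltnS 1?ltnW // scalerA mulrC -scalerA subrr.
  - have [->|jk'] := eqVneq j k.+1.
      have Q := he_quad TP (ltac:(lia) : (0 < i < n)%N).
      have lamP' := lamP; rewrite expr2 in lamP'.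
      rewrite upS -kE -(mulrA (up T a k)) Q sub0r /G upS -kE exprS.
      move: (lam ^+ k) (up T a k) (T i) => L U V.
      nc_cert ((- L) *: ((lam * lam - (1 + h * lam)) *: (x * U * V))).
        all: try by ring.
      by rewrite lamP' subrr scale0r scaler0.
    rewrite -(up_slide TP) // ?mulrA ?xP -?scalerAl; [|lia..].
    by rewrite subrr scalerA mulrC -scalerA subrr.
  by rewrite jk ltn_eqF // subr0 kE -upS scalerA -exprS.
rewrite telescope_sumr // /g subr0 ifF ?eqxx //; apply/eqP; lia.
Qed.

Lemma Xs_eig a m i : (0 < a)%N -> (a + m <= n.+1)%N -> (a <= i)%N -> (i.+1 < a + m)%N ->
  Xs a m * T i = lam *: Xs a m.
Proof.
elim: m a i => [|m IH] a i a0 am ai im; first by lia.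
by apply: Rs_eig => // j aj jm; apply: IH; lia.
Qed.
End Sym.

Lemma Xs_morph (F : fieldType) (A B : algType F) (f : {lrmorphism A -> B}) (T : nat -> A) (T' : nat -> B)
    (lam : F) a m :
  (forall i, (a <= i)%N -> (i.+1 < a + m)%N -> f (T i) = T' i) -> f (Xs T lam a m) = Xs T' lam a m.
Proof.
elim: m a => [|m IH] a H /=; first by rewrite rmorph1.
rewrite rmorphM /= IH => [|i ai im]; last by apply: H; lia.
congr (_ * _); rewrite /Rs rmorph_sum; apply: eq_bigr => -[j jm] _ /=.
rewrite linearZ_LR; congr (_ *: _).
elim: j jm => [|j IHj] jm; first by rewrite rmorph1.
by rewrite !upS rmorphM /= IHj 1?ltnW // H //; lia.
Qed.

Section Tests.
Context (F : fieldType) (q z : F) (M : algType F) (d : nat -> M) (t : nat -> M) (cc : M).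
Context (SM : stream_model q z d t cc).
Context (glue : (nat -> M) -> M) (dglue : forall a x, d a * glue x = x a).
Notation h := (q - q^-1).
Notation T := (rT t).

(** The function supported on the matchings that join the point i to the point l + i for i up to
    l; KK l evaluates there. *)
Fixpoint jj l : M := if l is k.+1 then glue (fun a => if a == k then jj k else 0) else 1.
Fixpoint KK l : M := if l is k.+1 then KK k * d k else 1.
Lemma djj a l : d a * jj l.+1 = if a == l then jj l else 0. Proof. by rewrite dglue. Qed.
Lemma djj0 a l : a != l -> d a * jj l.+1 = 0. Proof. by rewrite djj => /negPf->. Qed.

Lemma jj_van l : van d (l, 1%N) (jj l).
Proof.
elim: l => [|l IH]; first by [].
apply/van_step => // a; rewrite /ncl /=; case: ltnP => al.
  by rewrite dglue ltn_eqF; [exact: (van_zero SM) | lia].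
by rewrite dglue; case: ifP => _ //; apply: (van_zero SM).
Qed.

Lemma yy_jj x c L : (x < L)%N -> (c < L)%N -> d x * (yy t c * jj L.+1) = 0.
Proof.
move=> xL cL; rewrite mulrA; case: (posnP x) => [->|x0].
  by rewrite (d0_yy SM) djj0 //; lia.
have [xc|xc] := leqP x c.
  rewrite (d_yy_le SM) ?x0 // mulrDl -scalerAl -!mulrA !djj0 ?mulr0 ?scaler0 ?addr0 //; lia.
by rewrite (d_yy_gt SM) // -mulrA djj0 ?mulr0 //; lia.
Qed.
Lemma yy_jj_gt x c L : (c < x)%N -> x != L -> d x * (yy t c * jj L.+1) = 0.
Proof. by move=> cx xL; rewrite mulrA (d_yy_gt SM) // -mulrA djj0 ?mulr0. Qed.

Lemma uu_jj L b i : (b < L)%N -> (i <= L)%N -> d b * (uu t i * jj L.+1) = 0.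
Proof.
elim: L b i => [//|L IH] b [|c] bL cL; first by rewrite mul1r djj0 //; lia.
rewrite (uu_yy t c) -mulrA; case: b bL => [|b] bL; first by rewrite (dt00 SM) yy_jj ?scaler0 //.
apply: (dd_ext SM) => e; rewrite mulr0; case: (leqP b e) => be.
  rewrite (dt0_le SM) //=; case: (ltngtP e.+2 L.+1) => eL; [rewrite yy_jj ?mulr0 //; lia| |].
    by rewrite yy_jj_gt ?mulr0 //; lia.
  rewrite [d e.+2 * _]mulrA (d_yy_gt SM); last by lia.
  by rewrite -mulrA djj eL eqxx IH.
by rewrite (dt0_gt SM) //= yy_jj ?(yy_jj bL) ?mulr0 ?scaler0 ?addr0 //; lia.
Qed.
Lemma uu_jj_top L i : (0 < i <= L)%N -> d L * (uu t i * jj L.+1) = 0.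
Proof.
case: i L => [//|c] [//|L] cL; rewrite (uu_yy t c) -mulrA.
apply: (dd_ext SM) => e; rewrite mulr0; case: (leqP L e) => be.
  by rewrite (dt0_le SM) //= yy_jj_gt ?mulr0 //; lia.
rewrite (dt0_gt SM) //= yy_jj ?mulr0 ?add0r; [|lia..].
rewrite [d L.+1 * _]mulrA (d_yy_gt SM); last by lia.
by rewrite -mulrA djj eqxx uu_jj ?scaler0 //; lia.
Qed.

Lemma up_uu j : up T 1 j = uu t j.
Proof. by elim: j => [|j IH] //; rewrite upS IH. Qed.

Variable lam : F.
Lemma dRs_jj L : d L * (Rs T lam 1 L.+1 * jj L.+1) = jj L.
Proof.
rewrite /Rs mulr_suml mulr_sumr big_ord_recl big1 ?addr0 => [|i _].
  by rewrite expr0 scale1r mul1r djj eqxx.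
rewrite -scalerAl -scalerAr up_uu uu_jj_top ?scaler0 //= /bump /=; have := ltn_ord i; lia.
Qed.

Lemma Xs_shift a m L : (0 < a)%N -> (a + m <= L.+1)%N -> d L * Xs T lam a.+1 m = Xs T lam a m * d L.
Proof.
elim: m a => [|m IH] a a0 am /=; first by rewrite mulr1 mul1r.
rewrite mulrA IH //; last by lia.
rewrite -!mulrA; congr (_ * _); rewrite /Rs mulr_sumr mulr_suml; apply: eq_bigr => -[j jm] _ /=.
rewrite -scalerAl -scalerAr; congr (_ *: _).
elim: j jm => [|j IHj] jm; first by rewrite mulr1 mul1r.
rewrite !upS mulrA IHj 1?ltnW // -!mulrA; congr (_ * _).
have E : rT t (a.+1 + j) = t (a + j)%N by rewrite /rT addSn.
by rewrite E -[t (a + j)%N]mulr1 (dt_gt SM) ?mulr1 //; lia.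
Qed.

(** Symmetrisers do not vanish in the representation: at the matching of jj l only the trivial
    term of each factor contributes. *)
Lemma KXj l : KK l * (Xs T lam 1 l * jj l) = 1.
Proof.
elim: l => [|l IH]; first by rewrite !mulr1.
rewrite -[Xs T lam 1 l.+1]/(Xs T lam 2 l * Rs T lam 1 l.+1) -[KK l.+1]/(KK l * d l).
have E := @Xs_shift 1 l l isT (ltac:(lia)).
by rewrite -!mulrA (mulrA (d l)) E -mulrA dRs_jj.
Qed.
End Tests.

(** * Necessity of the condition on q *)

Section CaseA.
Context (F : fieldType) (q z : F) (M : algType F) (d : nat -> M) (t : nat -> M) (cc : M).
Context (SM : stream_model q z d t cc).
Context (glue : (nat -> M) -> M) (dglue : forall a x, d a * glue x = x a).
Context (n : nat) (A : algType F) (T : nat -> A) (E : A) (rho : {lrmorphism A -> M}).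
Context (rhoT : forall i, (0 < i < n)%N -> rho (T i) = rT t i) (rhoE : rho E = rE d cc).
Context (gen : forall x : A, in_alg_of (fun y => gens T n y \/ y = E) x) (n2 : (1 < n)%N).

Lemma rho_van k (w : M) x : (n <= k)%N -> van d (k, 1%N) w -> van d (k, 1%N) (rho x * w).
Proof.
move=> nk; elim: (gen x) w => {x} [y [[i [ii ->]]|->]|c|x y _ Hx _ Hy|x y _ Hx _ Hy] w Hw.
- by rewrite rhoT //; apply: (van_t SM) => //=; lia.
- have kE : k.-2.+2 = k by lia.
  rewrite rhoE (_ : rE d cc * w = 0); first exact: (van_zero SM).
  by apply: (rE_van SM (k := k.-2)); rewrite kE.
- by rewrite linearZ_LR rmorph1 mulr_algl; apply: (van_scale SM).
- by rewrite rmorphD mulrDl; apply: (van_add SM); [apply: Hx|apply: Hy].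
by rewrite rmorphM -mulrA; apply/Hx/Hy.
Qed.
Lemma rho_tideal k (w : M) x : (n <= k)%N -> van d (k, 1%N) w -> tideal E x -> rho x * w = 0.
Proof.
move=> nk Hw; elim/tideal_ind: x / => [|a b|x y Hx Hy].
- by rewrite rmorph0 mul0r.
- have kE : k.-2.+2 = k by lia.
  rewrite !rmorphM /= rhoE -(mulrA _ (rho b)) -(mulrA (rho a)) (_ : rE d cc * (rho b * w) = 0) ?mulr0 //.
  by apply: (rE_van SM (k := k.-2)); rewrite kE; apply: rho_van.
by rewrite rmorphD mulrDl Hx Hy addr0.
Qed.

(** Let u be the unit of the ideal of E and X the symmetriser. If qfact vanishes then (1 - u) X
    generates a two-sided ideal of square zero, hence is zero, and X lies in the ideal of E. But
    that ideal kills jj n, and X does not. *)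
Lemma qfact_neq0 : q != 0 -> hecke_rel q n T -> E * T 1 = q *: E -> semisimple A -> qfact q n != 0.
Proof.
move=> q0 TP ET ssA; apply/eqP => f0.
have [u uE uP] := semisimple_tideal_unit E ssA.
pose X := Xs T q 1 n; pose x := X - u * X.
have lamP : q ^+ 2 = 1 + (q - q^-1) * q by field.
have XT i : (0 < i < n)%N -> X * T i = q *: X by move=> ii; apply: (Xs_eig TP lamP) => //; lia.
have xT i : (0 < i < n)%N -> x * T i = q *: x by move=> ii; rewrite mulrBl -mulrA XT // -scalerAr scalerBr.
have xJ y : tideal E y -> x * y = 0.
  move=> Hy; have [uy _] := uP (X * y) (tidealMl _ Hy); by rewrite mulrBl -mulrA uy subrr.
have xA a : exists c : F, x * a = c *: x.
  elim: (gen a) => {a} [y [[i [ii ->]]|->]|c|a b _ [c cE] _ [e eE]|a b _ [c cE] _ [e eE]].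
  - by exists q; apply: xT.
  - by exists 0; rewrite scale0r xJ //; apply: tideal_self.
  - by exists c; rewrite mulr_algr.
  - by exists (c + e); rewrite mulrDr cE eE scalerDl.
  by exists (c * e); rewrite mulrA cE -scalerAl eE scalerA.
have xx : x * x = 0.
  rewrite {2}/x mulrBr (mulrA x u) (xJ u uE) mul0r subr0 (eig_Xs (lam := q)) ?f0 ?scale0r //.
  by move=> i i1 im; apply: xT; lia.
have [v vx vP] := semisimple_tideal_unit x ssA.
have x0 : x = 0.
  have [vxx _] := vP x (tideal_self x); rewrite -vxx.
  apply: (tideal_ind (P := fun y => y * x = 0)) vx => [|a b|y y' Hy Hy']; first by rewrite mul0r.
    by have [c cE] := xA b; rewrite -(mulrA a) cE -mulrA -scalerAl xx scaler0 mulr0.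
  by rewrite mulrDl Hy Hy' addr0.
have XJ : tideal E X.
  have -> : X = u * X by apply/eqP; rewrite -subr_eq0; apply/eqP.
  exact: tidealMr.
have := rho_tideal (leqnn n) (jj_van SM dglue n) XJ.
rewrite (Xs_morph (T' := rT t)) => [H|i i1 im]; last by apply: rhoT; lia.
have := KXj SM dglue q n; rewrite H mulr0 => /eqP; by rewrite eq_sym oner_eq0.
Qed.
End CaseA.

(** * A functional for the exceptional parameters *)

Section Hook.
Context (F : fieldType) (q z : F) (q0 : q != 0) (z0 : z != 0) (h0 : q - q^-1 != 0) (zz0 : z - z^-1 != 0).
Context (A : algType F) (T : nat -> A) (E : A) (l : nat) (rel : qB_relations l.+3 q z T E).
Notation k := l.+3.
Notation h := (q - q^-1).
Notation dl := (qB_delta q z).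
Context (lam : F) (lamP : lam ^+ 2 = 1 + h * lam).
Context (e : A) (eT : forall i, (3 <= i < k)%N -> e * T i = lam *: e) (eE : e * E = dl *: e)
  (eT1 : e * T 1 = q *: e) (eE2 : (3 < k)%N -> e * qB_E2 q T E = 0).
Let TP := qB_hecke q0 z0 h0 zz0 rel.
Let dl0 : dl != 0. Proof. by rewrite /qB_delta mulf_neq0 // invr_neq0. Qed.

(** The functional e is an eigenvector of the braids T_3, T_4, ... Sums over cosets extend this
    to T_2 in hook2 and to all braids in hook1. *)
Definition hook2 : A := e * Rs T lam 2 l.+2.
Definition hook1 : A := hook2 * Rs T lam 1 k.
Definition gs (m : nat) : F := \sum_(i < m) lam ^+ (2 * i).
Definition D2 : F := dl + z * lam * gs l.+1.
Definition D2' : F := z * (q + lam * q ^+ 2) + h * z * (1 + q * lam) * lam ^+ 2 * gs l.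
Definition D1 : F := (1 + lam * q) * D2 + lam ^+ 2 * gs l.+1 * D2'.

Lemma gsP m : h * lam * gs m = lam ^+ (2 * m) - 1.
Proof.
have -> : h * lam = lam ^+ 2 - 1 by rewrite lamP; ring.
rewrite /gs; elim: m => [|m IH]; first by rewrite big_ord0 mulr0 muln0 expr0 subrr.
by rewrite big_ord_recr mulrDr IH /= mulnS exprD; ring.
Qed.
Lemma hD2 : h * D2 = z * lam ^+ (2 * l.+1) - z^-1.
Proof.
have E1 : h * dl = z - z^-1 by rewrite /qB_delta mulrC divfK.
have E2 := gsP l.+1.
have -> : h * D2 = h * dl + z * (h * lam * gs l.+1) by rewrite /D2; ring.
by rewrite E1 E2; ring.
Qed.

Lemma e2_T i : (2 <= i < k)%N -> hook2 * T i = lam *: hook2.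
Proof. by move=> ii; apply: (Rs_eig TP lamP) => // [j j2 jk||]; [apply: eT|..]; lia. Qed.
Lemma e1_T i : (1 <= i < k)%N -> hook1 * T i = lam *: hook1.
Proof. by move=> ii; apply: (Rs_eig TP lamP) => // [j j2 jk||]; [apply: e2_T|..]; lia. Qed.

(** The functional e factors through E. *)
Lemma e_corner x (c : F) : E * x = c *: E -> e * x = c *: e.
Proof.
move=> Ex; apply: (scalerI dl0); rewrite scalerAl -eE -mulrA Ex -scalerAr eE.
by rewrite !scalerA mulrC.
Qed.
Lemma eT2E : e * T 2 * E = z *: e.
Proof. by rewrite -mulrA; apply: e_corner; rewrite mulrA (ET2E q0 z0 h0 zz0 rel). Qed.
Lemma hook_up_E a m x : (2 < a)%N -> (a + m <= k)%N -> x * up T a m * E = x * E * up T a m.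
Proof.
move=> a2 am; rewrite -!mulrA; congr (_ * _); apply: up_comm => i ai.
by apply: (TE q0 z0 h0 zz0 rel); lia.
Qed.
Lemma up_T a m b : (0 < b)%N -> (b.+1 < a)%N -> (a + m <= k)%N -> up T a m * T b = T b * up T a m.
Proof. by move=> b0 ab am; apply: up_comm => i ai; apply/esym; apply: (he_comm TP); lia. Qed.
Lemma e_up a m : (2 < a)%N -> (a + m <= k)%N -> e * up T a m = lam ^+ m *: e.
Proof. by move=> a2 am; apply: eig_up => i ai; apply: eT; lia. Qed.

Lemma up1 a : up T a 1 = T a. Proof. by rewrite upSr mulr1. Qed.
(** The exceptional parameters are those where combinations of the scalars D2, D2' and D1 vanish. *)
Lemma e2E : hook2 * E = D2 *: e.
Proof.
rewrite /hook2 /Rs mulr_sumr mulr_suml big_ord_recl expr0 scale1r mulr1 eE.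
rewrite (eq_bigr (fun i : 'I_l.+1 => (z * lam * lam ^+ (2 * i)) *: e)) => [|i _].
  by rewrite -scaler_suml -mulr_sumr -scalerDl.
have il := ltn_ord i; rewrite /= /bump add1n upSr -scalerAr -scalerAl mulrA.
rewrite hook_up_E; [|by []|lia].
by rewrite eT2E -scalerAl e_up ?scalerA; [congr (_ *: _); rewrite mul2n -addnn exprD exprS; ring|by []|lia].
Qed.
Lemma eT2312 : (0 < l)%N -> e * (T 2 * T 3 * T 1 * T 2 * E) = (h * z * (1 + q * lam)) *: e.
Proof.
move=> l0; apply: (scalerI dl0); rewrite scalerAl -eE.
have c13 : T 1 * T 3 = T 3 * T 1 by apply: (he_comm TP).
have := @ET2132E F A q z k T E q0 z0 h0 zz0 rel ltac:(lia).
have -> : e * E * (T 2 * T 3 * T 1 * T 2 * E) = e * (E * T 2 * T 1 * T 3 * T 2 * E).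
  by rewrite -(mulrA (T 2) (T 3)) -c13 !mulrA.
move=> ->; rewrite mulrDr eE2; [|lia]; rewrite add0r -scalerAr mulrDr eE -scalerAr mulrA.
rewrite eT; [|lia]; rewrite -scalerAl eE !scalerA -scalerDl scalerA; congr (_ *: _); ring.
Qed.
Lemma e2T12E : hook2 * T 1 * T 2 * E = D2' *: e.
Proof.
rewrite /hook2 /Rs mulr_sumr !mulr_suml big_ord_recl expr0 scale1r mulr1 eT1 -!scalerAl eT2E.
rewrite big_ord_recl /= /bump /= !add1n up1 expr1 -scalerAr -!scalerAl.
have -> : e * T 2 * T 1 * T 2 * E = (q ^+ 2 * z) *: e.
  by rewrite -!mulrA; apply: e_corner; rewrite !mulrA (ET121E q0 z0 h0 zz0 rel).
rewrite (eq_bigr (fun i : 'I_l => (h * z * (1 + q * lam) * lam ^+ 2 * lam ^+ (2 * i)) *: e)) => [|i _].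
  rewrite -scaler_suml -mulr_sumr !scalerA -!scalerDl; congr (_ *: _); rewrite /D2' /gs; ring.
have il := ltn_ord i; rewrite /= /bump !add1n !upSr -scalerAr -!scalerAl !mulrA.
have U1 : up T 4 i * T 1 = T 1 * up T 4 i by apply: up_T => //; lia.
have U2 : up T 4 i * T 2 = T 2 * up T 4 i by apply: up_T => //; lia.
have UE : up T 4 i * E = E * up T 4 i by have := @hook_up_E 4 i 1 isT ltac:(lia); rewrite !mul1r.
have -> : e * T 2 * T 3 * up T 4 i * T 1 * T 2 * E = e * (T 2 * T 3 * T 1 * T 2 * E) * up T 4 i.
  by rewrite -!mulrA (mulrA (up T 4 i)) U1 -!mulrA (mulrA (up T 4 i)) U2 -!mulrA UE.
rewrite eT2312; last by lia.
rewrite -scalerAl e_up ?scalerA; [|by []|lia].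
congr (_ *: _); rewrite mul2n -addnn exprD !exprS; ring.
Qed.
Lemma e1E : hook1 * E = D1 *: e.
Proof.
rewrite /hook1 /Rs mulr_sumr mulr_suml 2!big_ord_recl /= /bump /= !add1n up1 expr0 scale1r mulr1 e2E expr1 -scalerAr -!scalerAl.
rewrite -(mulrA hook2) (T1E q0 z0 h0 zz0 rel) // -scalerAr e2E.
rewrite (eq_bigr (fun i : 'I_l.+1 => (D2' * lam ^+ 2 * lam ^+ (2 * i)) *: e)) => [|i _].
  rewrite -scaler_suml -mulr_sumr !scalerA -!scalerDl; congr (_ *: _); rewrite /D1 /gs; ring.
have il := ltn_ord i; rewrite /= /bump !add1n !upSr -scalerAr -!scalerAl !mulrA.
rewrite hook_up_E; [|by []|lia].
rewrite e2T12E -scalerAl e_up ?scalerA; [|by []|lia].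
congr (_ *: _); rewrite mul2n -addnn exprD !exprS; ring.
Qed.
Lemma e1T12E : hook1 * T 1 * T 2 * E = (lam ^+ 2 * D1) *: e.
Proof. by rewrite e1_T // -!scalerAl e1_T // -scalerAl e1E !scalerA expr2. Qed.

End Hook.

Section Kill.
Context (F : fieldType) (q z : F) (q0 : q != 0) (z0 : z != 0) (h0 : q - q^-1 != 0) (zz0 : z - z^-1 != 0).
Context (A : algType F) (T : nat -> A) (E : A) (l : nat) (rel : qB_relations l.+3 q z T E) (lam : F).
Notation k := l.+3.
Let TP := qB_hecke q0 z0 h0 zz0 rel.
(** A functional that the braids beyond T_1 scale and that kills E and T_1 T_2 E kills
    the whole left ideal of E, because that ideal is spanned by coset representatives. *)
Lemma dc_kill (p : A) i j : (forall i, (2 <= i < k)%N -> p * T i = lam *: p) -> p * E = 0 -> p * T 1 * T 2 * E = 0 ->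
  (i < k)%N -> (j < k.-1)%N -> p * (dc T 1 i * dc T 2 j * E) = 0.
Proof.
move=> pT pE pTT ik jk.
have dcp a m : (1 < a)%N -> (a + m <= k)%N -> p * dc T a m = lam ^+ m *: p.
  move=> a1; elim: m => [|m IH] am; first by rewrite mulr1 scale1r.
  by rewrite dcS mulrA pT -?scalerAl ?IH ?scalerA -?exprS //; lia.
case: i ik => [|i] ik; first by rewrite mul1r mulrA dcp -?scalerAl ?pE ?scaler0 //; lia.
rewrite dcSr -!mulrA (mulrA p) dcp // -scalerAl; case: j jk => [|j] jk.
  by rewrite /= mul1r (T1E q0 z0 h0 zz0 rel) // -!scalerAr pE !scaler0.
rewrite dcSr.
have C : dc T 3 j * T 1 = T 1 * dc T 3 j by apply: dc_comm => m ?; apply/esym; apply: (he_comm TP); lia.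
rewrite [T 1 * _]mulrA [T 1 * _]mulrA -C -!mulrA (mulrA p) dcp // -?scalerAl ?(mulrA p) ?(mulrA _ (T 2)) ?pTT ?scaler0 //; lia.
Qed.
End Kill.

(** * The exceptional parameters *)

Section Scalars.
Context (F : fieldType) (q z : F) (q0 : q != 0) (z0 : z != 0) (h0 : q - q^-1 != 0).
Notation h := (q - q^-1).
Notation dl := (qB_delta q z).
Variable l : nat.
Let Q := q ^+ (2 * l.+1).
Lemma q2_neq1 : q ^+ 2 != 1.
Proof.
apply: contra_neq h0 => q2; apply: (mulfI q0); rewrite mulr0 mulrBr divff // -expr2 q2 subrr; done.
Qed.
Let gq m : gs q m = (q ^+ (2 * m) - 1) / (q ^+ 2 - 1).
Proof.
have := @gsP F q q (ltac:(by field)) m => E; apply: (mulfI (x := q ^+ 2 - 1)).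
  by rewrite subr_eq0 q2_neq1.
rewrite [RHS]mulrC divfK ?subr_eq0 ?q2_neq1 // -E; congr (_ * _); by field.
Qed.
Let ql : q ^+ (2 * l) = Q / q ^+ 2.
Proof. by rewrite /Q mulnS exprD mulrC mulrA mulVf ?mul1r ?expf_neq0. Qed.
Let s0 : q ^+ 2 - 1 != 0. Proof. by rewrite subr_eq0 q2_neq1. Qed.
Let DqE : D2 q z l q = (z * Q - z^-1) / h.
Proof. by apply: (mulfI h0); rewrite hD2 //; [rewrite [RHS]mulrC divfK | field]. Qed.
Let Dq'E : D2' q z l q = z * (1 + q ^+ 2) * Q / q.
Proof. by rewrite /D2' gq ql; field; rewrite q0 s0. Qed.
Let D1E : D1 q z l q = (1 + q ^+ 2) * (z * Q ^+ 2 - z^-1) / h.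
Proof.
rewrite /D1 DqE Dq'E gq -/Q; field.
by rewrite q0 -expr2 s0 z0.
Qed.

Lemma D1_zero : z ^+ 2 * Q ^+ 2 = 1 -> D1 q z l q = 0.
Proof.
move=> H; rewrite D1E (_ : z * Q ^+ 2 - z^-1 = 0) ?mulr0 ?mul0r //.
apply: (mulfI z0); rewrite mulr0 mulrBr mulrA -expr2 H divff ?subrr //.
Qed.
(** The ratio at which the combination hook2 - kap * hook1 is killed by E. *)
Definition kap : F := h * q / (Q * q ^+ 4 - 1).
Lemma D_kap : Q * q ^+ 4 != 1 -> z ^+ 2 * Q = q ^+ 4 ->
  D2 q z l q - kap * D1 q z l q = 0 /\ D2' q z l q - kap * (q ^+ 2 * D1 q z l q) = 0.
Proof.
rewrite -subr_eq0 => k0 H; have Hz : z^-1 = z * Q / q ^+ 4.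
  by apply: (mulfI z0); rewrite divff // mulrA mulrA -expr2 H divff ?expf_neq0.
rewrite D1E Dq'E DqE Hz /kap; split; field; rewrite ?q0 ?s0 -?expr2 ?s0 ?k0 //.
Qed.
Lemma D_neg : z ^+ 2 = Q -> D2 q z l (- q^-1) = 0 /\ D2' q z l (- q^-1) = 0.
Proof.
move=> H; split; last by rewrite /D2'; field.
apply: (mulfI h0); rewrite mulr0 hD2 //; last by field.
by rewrite exprM sqrrN exprVn -exprVn -exprM exprVn -/Q -H; field.
Qed.
End Scalars.

Section Tests.
Context (F : fieldType) (q z : F) (M : algType F) (d : nat -> M) (t : nat -> M) (cc : M).
Context (SM : stream_model q z d t cc).
Context (z0 : z != 0) (h0 : q - q^-1 != 0) (zz0 : z - z^-1 != 0).
Context (glue : (nat -> M) -> M) (dglue : forall a x, d a * glue x = x a).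
Notation h := (q - q^-1).
Notation dl := (qB_delta q z).
Notation T := (rT t).
Notation E := (rE d cc).
Let q0 := q_neq0 SM.

(** P stands for the complement of the unit of the ideal generated by E on the first L points. *)
Record compl_unit (L : nat) (P : M) : Prop := ComplUnit {
  cu_comm : forall i, (i.+1 < L)%N -> P * t i = t i * P;
  cu_E : (1 < L)%N -> P * E = 0;
  cu_id : forall w, van d (L, 1%N) w -> P * w = w;
  cu_van : forall w, van d (L.+1, 1%N) w -> van d (L.+1, 1%N) (P * w) }.

Variables (l : nat) (P : M) (PP : compl_unit l.+1 P) (lam : F).
Hypothesis lamP : lam ^+ 2 = 1 + h * lam.
Notation L := l.+1.
Notation k := l.+3.
(** The projection P removes the contribution of the ideal of E; the result is symmetrised and
    evaluated at the matching of jj L. *)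
Definition kx : M := KK d L * Xs T lam 1 L * P.
Definition eps : M := kx * d 0.
Notation e2 := (hook2 T l lam eps).
Notation e1 := (hook1 T l lam eps).

Lemma eps_T i : (3 <= i < k)%N -> eps * T i = lam *: eps.
Proof.
case: i => [|[|[|i]]] // ii.
have E' : Xs T lam 1 L * t i = lam *: Xs T lam 1 L.
  by apply: (Xs_eig (rT_hecke SM L) lamP (a := 1) (m := L) (i := i.+1)); lia.
have -> : eps * T i.+3 = KK d L * (Xs T lam 1 L * t i) * P * d 0.
  rewrite /eps /kx /rT -[i.+3.-1]/(i.+2) -!(mulrA _ (d 0)) (d0t SM) !mulrA -(mulrA _ P) (cu_comm PP); last by lia.
  by rewrite !mulrA.
by rewrite E' /eps /kx -scalerAr -!scalerAl.
Qed.
Lemma eps_E : eps * E = dl *: eps.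
Proof. by rewrite /eps /rE -mulrA (mulrA (d 0)) (d0c SM) -scalerAl mul1r -scalerAr. Qed.
Lemma eps_T1 : eps * T 1 = q *: eps.
Proof. by rewrite /eps /rT /= -mulrA (d0t0 SM) -scalerAr. Qed.
Lemma eps_E2 : (3 < k)%N -> eps * qB_E2 q T E = 0.
Proof.
move=> k4; rewrite (rho_E2 SM) /eps /kx -(mulrA _ (d 0)).
have -> : d 0 * (cc * cc * (d 0 * d 0)) = dl *: (E * d 0).
  by rewrite !mulrA (d0c SM) -!scalerAl mul1r.
by rewrite -scalerAr mulrA -(mulrA _ P) (cu_E PP) ?mulr0 ?mul0r ?scaler0 //; lia.
Qed.
Let rel : qB_relations k q z T E := @rho_relations _ _ _ _ _ _ _ SM k.

Lemma up2_yy j : up T 2 j = yy t j.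
Proof. by elim: j => [|j IH] //; rewrite upS IH. Qed.
Lemma e2_sum : e2 = \sum_(x < L.+1) lam ^+ x *: (kx * d x).
Proof.
rewrite /hook2 /Rs mulr_sumr; apply: eq_bigr => x _.
by rewrite -scalerAr up2_yy /eps -mulrA (d0_yy SM).
Qed.
Lemma kx_jj : kx * jj glue L = 1.
Proof.
rewrite /kx -(mulrA _ P) (cu_id PP); last exact: (jj_van SM dglue L).
by rewrite -(mulrA (KK d L)) (KXj SM dglue).
Qed.

(** The functions w0 and w1 show that the functionals are not zero. *)
Definition w0 : M := glue (fun a => if a == 0%N then jj glue L else 0).
Lemma dw0 x : d x * w0 = if x == 0%N then jj glue L else 0. Proof. by rewrite dglue. Qed.
Lemma e2_w0 : e2 * w0 = 1.
Proof.
rewrite e2_sum mulr_suml big_ord_recl big1 ?addr0 => [|i _].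
  by rewrite -scalerAl -mulrA dw0 kx_jj expr0 scale1r.
by rewrite -scalerAl -mulrA dw0 mulr0 scaler0.
Qed.
Lemma yy_w0 c x : (0 < c)%N -> d x * (yy t c * w0) = if x == 1%N then uu t c.-1 * jj glue L else 0.
Proof.
move=> c0; rewrite mulrA; case: (posnP x) => [->|x0].
  by rewrite (d0_yy SM) dw0 ifF //; lia.
have [xc|xc] := leqP x c.
  rewrite (d_yy_le SM) ?x0 // mulrDl -scalerAl -!mulrA !dw0 (_ : (c == 0%N) = false); last by lia.
  by rewrite mulr0 scaler0 addr0; case: x x0 {xc} => [|[|x]] //=; rewrite mulr0.
rewrite (d_yy_gt SM) // -mulrA dw0 ifF ?mulr0 ?ifF //; lia.
Qed.
Lemma d_uu_w0 c x : (0 < c <= L)%N -> (x <= L)%N -> d x * (uu t c.+1 * w0) = 0.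
Proof.
move=> /andP[c0 cL] xL; rewrite (uu_yy t c) -mulrA; case: x xL => [|x] xL.
  by rewrite (dt00 SM) yy_w0 // scaler0.
apply: (dd_ext SM) => e; rewrite mulr0; case: (leqP x e) => xe.
  by rewrite (dt0_le SM) //= yy_w0 // mulr0.
rewrite (dt0_gt SM) //= !yy_w0 //; case: e xe => [|e] xe /=; last first.
  by rewrite mulr0 ifF ?mulr0 ?scaler0 ?addr0 //; lia.
rewrite ifF ?mulr0 ?scaler0 ?addr0; last by lia.
by apply: (uu_jj SM dglue); lia.
Qed.
Lemma t0_w0 : t 0 * w0 = q *: w0.
Proof.
apply: (dd_ext SM) => -[|x]; first by rewrite (dt00 SM) -scalerAr.
apply: (dd_ext SM) => b; rewrite -!scalerAr dw0 /= mulr0 scaler0; case: (leqP x b) => xb.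
  by rewrite (dt0_le SM) //= dw0 mulr0.
by rewrite (dt0_gt SM) //= !dw0 /= !mulr0 scaler0 addr0.
Qed.
Lemma e1_w0 : e1 * w0 = (1 + lam * q)%:A.
Proof.
rewrite /hook1 /Rs mulr_sumr mulr_suml 2!big_ord_recl big1 ?addr0 => [|[i ik] _] /=.
  rewrite /bump /= !add1n !up_uu expr0 expr1 scale1r mulr1 e2_w0 /= mul1r -scalerAr -scalerAl -mulrA t0_w0.
  by rewrite -scalerAr e2_w0 scalerA scalerDl scale1r.
rewrite /bump /= !add1n up_uu -scalerAr -scalerAl -mulrA e2_sum mulr_suml big1 ?scaler0 // => [[x xL] _].
by rewrite -scalerAl -mulrA [d _ * _]d_uu_w0 ?mulr0 ?scaler0 //; lia.
Qed.

Definition w1 : M := glue (fun a => if a is b.+2 then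
  glue (fun y => if y == 0%N then d b * jj glue L else 0) else 0).
Lemma dw1 x : (x <= L)%N -> d x * w1 = 0.
Proof.
move=> xL; rewrite dglue; case: x xL => [|[|x]] // xL.
apply: (dd_ext SM) => e; rewrite dglue mulr0; case: ifP => // _.
by rewrite (djj0 dglue) //; lia.
Qed.
Lemma e2_w1 : e2 * w1 = 0.
Proof.
rewrite e2_sum mulr_suml big1 // => [[x xL]] _ /=.
by rewrite -scalerAl -mulrA dw1 ?mulr0 ?scaler0.
Qed.
Lemma e2_t0w1 : e2 * (t 0 * w1) = lam%:A.
Proof.
rewrite e2_sum mulr_suml 2!big_ord_recl big1 ?addr0 => [|[x xL] _] /=.
  rewrite /bump /= -!scalerAl -!(mulrA kx) (dt00 SM) dw1 // scaler0 mulr0 scaler0 add0r add1n expr1.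
  have -> : d 1 * (t 0 * w1) = jj glue L.
    by apply: (dd_ext SM) => b; rewrite (dt0_le SM) // [d b.+2 * w1]dglue dglue.
  by rewrite kx_jj.
rewrite -scalerAl -mulrA /bump /= !add1n (_ : d x.+2 * (t 0 * w1) = 0) ?mulr0 ?scaler0 //.
apply: (dd_ext SM) => e; rewrite mulr0; case: (leqP x.+1 e) => xe.
  by rewrite (dt0_le SM) //= dglue dglue.
by rewrite (dt0_gt SM) //= !dw1 ?mulr0 ?scaler0 ?addr0 //; lia.
Qed.

(** By dc_kill such an element p kills the whole left ideal of E. *)
Record hook_fun (p : M) : Prop := HookFun {
  hf_neq0 : p != 0;
  hf_T : forall i, (2 <= i < k)%N -> p * T i = lam *: p;
  hf_E : p * E = 0;
  hf_TE : p * T 1 * T 2 * E = 0;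
  hf_word : exists2 g, in_alg_of (gens T k) g & p = eps * g }.

Let e2T := @e2_T F q z q0 z0 h0 zz0 M T E l rel lam lamP eps eps_T eps_E2.
Let e1T := @e1_T F q z q0 z0 h0 zz0 M T E l rel lam lamP eps eps_T eps_E2.
Let e2Ev := @e2E F q z q0 z0 h0 zz0 M T E l rel lam eps eps_T eps_E eps_E2.
Let e1Ev := @e1E F q z q0 z0 h0 zz0 M T E l rel lam eps eps_T eps_E eps_T1 eps_E2.
Let e2TEv := @e2T12E F q z q0 z0 h0 zz0 M T E l rel lam eps eps_T eps_E eps_T1 eps_E2.
Let e1TEv := @e1T12E F q z q0 z0 h0 zz0 M T E l rel lam lamP eps eps_T eps_E eps_T1 eps_E2.

Lemma Rs_word a m : (0 < a)%N -> (a + m <= k.+1)%N -> in_alg_of (gens T k) (Rs T lam a m).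
Proof.
move=> a0 am; apply: ia_sum => -[j jm] _; apply: ia_scale => /=.
elim: j jm => [|j IH] jm; first exact: ia_one.
by rewrite upS; apply: ia_mul; [apply: IH; lia | apply: ia_gen; exists (a + j)%N; split => //; lia].
Qed.
Let g2 := Rs T lam 2 l.+2.
Let g1 := g2 * Rs T lam 1 k.
Let g2w : in_alg_of (gens T k) g2. Proof. exact: Rs_word. Qed.
Let g1w : in_alg_of (gens T k) g1. Proof. by apply: ia_mul g2w _; apply: Rs_word. Qed.

Lemma hook_e1 : 1 + lam * q != 0 -> D1 q z l lam = 0 -> hook_fun e1.
Proof.
move=> n0 D0; split.
- by apply: contra_neq n0 => p0; move: e1_w0; rewrite p0 mul0r => /esym /eqP; rewrite scaler_eq0 oner_eq0 orbF => /eqP.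
- by move=> i /andP[i1 ik]; apply: e1T; rewrite ik ltnW.
- by rewrite e1Ev D0 scale0r.
- by rewrite e1TEv D0 mulr0 scale0r.
by exists g1; rewrite // /hook1 /hook2 /g1 mulrA.
Qed.
Lemma hook_e2 : D2 q z l lam = 0 -> D2' q z l lam = 0 -> hook_fun e2.
Proof.
move=> D0 D0'; split.
- by apply/eqP => p0; move: e2_w0; rewrite p0 mul0r => /esym/eqP; rewrite oner_eq0.
- exact: e2T.
- by rewrite e2Ev D0 scale0r.
- by rewrite e2TEv D0' scale0r.
by exists g2.
Qed.
Lemma hook_e12 kp : lam != 0 -> D2 q z l lam - kp * D1 q z l lam = 0 ->
  D2' q z l lam - kp * (lam ^+ 2 * D1 q z l lam) = 0 -> lam = q -> hook_fun (e2 - kp *: e1).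
Proof.
move=> l0 D0 D0' lq; split.
- apply/eqP => p0; have : (e2 - kp *: e1) * ((t 0 - lam%:A) * w1) = lam%:A.
    rewrite mulrBl -scalerAl (mulrA e1) (mulrBr e1) [e1 * t 0](e1T (isT : (0 < 1 < k)%N)) mulr_algr subrr mul0r scaler0 subr0.
    by rewrite mulrBl mulrBr e2_t0w1 mulr_algl -scalerAr e2_w1 scaler0 subr0.
  by rewrite p0 mul0r => /esym/eqP; rewrite scaler_eq0 oner_eq0 orbF (negPf l0).
- move=> i ii; have i1 : (0 < i < k)%N by case/andP: ii => i2 ->; rewrite ltnW.
  by rewrite mulrBl -scalerAl e2T // e1T // scalerBr !scalerA (mulrC kp).
- by rewrite mulrBl -scalerAl e2Ev e1Ev scalerA -scalerBl D0 scale0r.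
- by rewrite !mulrBl -!scalerAl e2TEv e1TEv scalerA -scalerBl D0' scale0r.
exists (g2 - kp *: g1); first by apply: ia_sub => //; apply: ia_scale.
by rewrite mulrBr -scalerAr /g1 mulrA.
Qed.
End Tests.

(** A functional that factors through the ideal of E0 on the one side and kills it on the other. *)
Definition bad (F : fieldType) (A M : algType F) (rho : {lrmorphism A -> M}) : Prop :=
  exists p r : M, exists E0 x : A,
    [/\ p != 0, forall a, p * rho a * rho E0 = 0 & p = r * rho E0 * rho x].

(** The unit of the ideal of E0 acts on p both as 1 and as 0. *)
Lemma bad_not_semisimple (F : fieldType) (A M : algType F) (rho : {lrmorphism A -> M}) :
  bad rho -> ~ semisimple A.
Proof.
move=> [p [r [E0 [x [p0 pE pr]]]]] ssA.
have [u uE uP] := semisimple_tideal_unit E0 ssA.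
have [_ xu] := uP (E0 * x) (tidealMr _ (tideal_self _)).
have pu : p * rho u = 0.
  apply: (tideal_ind (P := fun y => p * rho y = 0)) uE => [|a b|y y' Hy Hy'].
  - by rewrite rmorph0 mulr0.
  - by rewrite !rmorphM /= !mulrA pE mul0r.
  by rewrite rmorphD mulrDr Hy Hy' addr0.
case/eqP: p0; rewrite -pu pr -!mulrA -!rmorphM /=; congr (_ * _); congr (rho _).
by rewrite mulrA.
Qed.

Lemma dc_morph (F : fieldType) (A B : algType F) (f : {lrmorphism A -> B}) (T : nat -> A) (T' : nat -> B) a m :
  (forall i, (a <= i < a + m)%N -> f (T i) = T' i) -> f (dc T a m) = dc T' a m.
Proof.
elim: m => [|m IH] H; first by rewrite rmorph1.
by rewrite !dcS rmorphM /= IH => [|i ai]; rewrite H //; lia.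
Qed.

Section Bad.
Context (F : fieldType) (q z : F) (M : algType F) (d : nat -> M) (t : nat -> M) (cc : M).
Context (SM : stream_model q z d t cc).
Context (z0 : z != 0) (h0 : q - q^-1 != 0) (zz0 : z - z^-1 != 0).
Notation h := (q - q^-1).
Notation dl := (qB_delta q z).
Notation rT := (rT t).
Notation rE := (rE d cc).
Let q0 := q_neq0 SM.
Let dl0 : dl != 0. Proof. by rewrite /qB_delta mulf_neq0 // invr_neq0. Qed.

Record rep (n : nat) (A : algType F) (T : nat -> A) (E : A) (rho : {lrmorphism A -> M}) : Prop := Rep {
  repT : forall i, (0 < i < n)%N -> rho (T i) = rT i;
  repE : rho E = rE;
  rep_gen : forall x : A, in_alg_of (fun y => gens T n y \/ y = E) x }.

Lemma rep_word n A T E rho g : @rep n A T E rho -> in_alg_of (gens rT n) g ->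
  exists x, rho x = g.
Proof.
move=> R; elim=> {g} [g [i [ii ->]]|c|g g' _ [x <-] _ [y <-]|g g' _ [x <-] _ [y <-]].
- by exists (T i); apply: (repT R).
- by exists c%:A; rewrite linearZ_LR rmorph1.
- by exists (x + y); rewrite rmorphD.
by exists (x * y); rewrite rmorphM.
Qed.

Lemma compl_unit_triv : compl_unit d t cc 1 1.
Proof. by split=> // w; rewrite mul1r. Qed.

Lemma compl_unit_ideal n A T E rho u : @rep n A T E rho -> (1 < n)%N -> tideal E u ->
  (forall y, tideal E y -> u * y = y /\ y * u = y) -> compl_unit d t cc n (1 - rho u).
Proof.
move=> R n2 uE uP; split=> [i ii|_|w Hw|w Hw].
- have -> : t i = rho (T i.+1) by rewrite (repT R) //; lia.
  rewrite -(rmorph1 rho) -rmorphB -!rmorphM /=; congr (rho _).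
  have [_ e1] := uP _ (tidealMr (T i.+1) uE); have [e2 _] := uP _ (tidealMl (T i.+1) uE).
  by rewrite mulrBl mulrBr mul1r mulr1 -e1 -mulrA e2.
- have [e1 _] := uP _ (tideal_self E).
  by rewrite -(repE R) mulrBl mul1r -rmorphM /= e1 subrr.
- by rewrite mulrBl mul1r (rho_tideal SM (repT R) (repE R) (rep_gen R) n2 (leqnn n) Hw uE) subr0.
rewrite mulrBl mul1r -scaleN1r; apply: (van_add SM) => //; apply: (van_scale SM).
by apply: (rho_van SM (repT R) (repE R) (rep_gen R) n2).
Qed.

Section Level.
Variables (glue : (nat -> M) -> M) (dglue : forall a x, d a * glue x = x a).
Variables (l : nat) (P : M) (PP : compl_unit d t cc l.+1 P) (lam : F).
Hypothesis lamP : lam ^+ 2 = 1 + h * lam.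
Notation L := l.+1.
Notation k := l.+3.
Notation eps := (eps d t l P lam).
Variable p : M.
Hypothesis pP : hook_fun d t cc l P lam p.
Let rel n : qB_relations n q z rT rE := @rho_relations _ _ _ _ _ _ _ SM n.

Lemma eps_r : eps = (dl^-1 *: eps) * rE.
Proof. by rewrite -scalerAl (eps_E SM) scalerA mulVf // scale1r. Qed.

Lemma bad_of_kill n A T E rho : @rep n A T E rho -> (k <= n)%N ->
  (forall a, p * rho a * rE = 0) -> bad rho.
Proof.
move=> R kn pE; have [g Hg pg] := hf_word pP.
have [x xg] : exists x, rho x = g.
  apply: (rep_word R); elim: Hg => {pg} [y [i [ii ->]]|c|y y' _ H _ H'|y y' _ H _ H'].
  - by apply: ia_gen; exists i; split => //; lia.
  - exact: ia_scal.
  - exact: ia_add.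
  exact: ia_mul.
exists p, (dl^-1 *: eps), E, x; split=> [|a|]; first exact: (hf_neq0 pP).
  by rewrite (repE R).
by rewrite (repE R) -eps_r xg.
Qed.

Lemma kill_of_dc n (A : algType F) (T : nat -> A) (E : A) (D : algType F) (psi : {lrmorphism D -> A}) rho : @rep n A T E rho -> (1 < n)%N ->
  qB_relations n q z T E -> tower q n T E psi ->
  (forall i j, (i < n)%N -> (j < n.-1)%N -> p * (dc rT 1 i * dc rT 2 j * rE) = 0) ->
  forall a, p * rho a * rE = 0.
Proof.
move=> R n2 relA tw H a; rewrite -(repE R) -mulrA -rmorphM.
elim: (tower_cspan q0 z0 h0 zz0 relA tw n2 (rep_gen R) a) => [|i j e x im jm _ IH].
  by rewrite rmorph0 mulr0.
rewrite rmorphD mulrDr IH addr0 !rmorphM /= (repE R).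
rewrite (dc_morph (T' := rT)) => [|m mi]; last by apply: (repT R); lia.
rewrite (dc_morph (T' := rT)) => [|m mi]; last by apply: (repT R); lia.
have := H i j im jm; rewrite !mulrA => ->; by rewrite mul0r.
Qed.

Lemma kill_k : forall i j, (i < k)%N -> (j < k.-1)%N -> p * (dc rT 1 i * dc rT 2 j * rE) = 0.
Proof.
move=> i j ik jk; apply: (dc_kill q0 z0 h0 zz0 (@rel k) (hf_T pP) (hf_E pP) (hf_TE pP) ik jk).
Qed.

(** One point more: the braids through the new point are reduced to the complement of the
    ideal on the k-1 points that they leave free, where the arcs of c are too many for p. *)
Section Next.
Hypothesis pE : forall g, in_alg_of (gens rT k) g -> p * g * rE = 0.
Variables (A' : algType F) (T' : nat -> A') (E' : A') (rho' : {lrmorphism A' -> M}) (u : A').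
Hypothesis R' : @rep l.+2 A' T' E' rho'.
Hypothesis (uE : tideal E' u) (uP : forall y, tideal E' y -> u * y = y /\ y * u = y).
Notation HA := (in_alg_of (gens rT k)).
Variables (Y : M) (YE : Y = dc rT 2 l.+2).
(** With Y the braid T_k ... T_2, right multiplication by the braids of the k - 1 points beyond
    the arc of cc only changes g, see vv_T. *)
Definition vv g : M := p * g * Y * cc.

Lemma p_cc g : HA g -> p * g * cc = 0.
Proof.
move=> Hg; apply: (scalerI dl0); rewrite scaler0.
have -> : dl *: (p * g * cc) = p * g * rE * cc by rewrite /rE -!mulrA (d0c SM) -!scalerAr mulr1.
by rewrite pE // mul0r.
Qed.
Lemma HA_T i : (0 < i < k)%N -> HA (rT i).
Proof. by move=> ii; apply: ia_gen; exists i. Qed.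
Lemma vv_T g i : (0 < i < l.+2)%N -> vv g * rT i = vv (g * rT i.+1).
Proof.
move=> ii; rewrite /vv -!mulrA; congr (_ * (_ * _)).
have -> : cc * rT i = rT i.+2 * cc by rewrite /rT; case: i ii => // i _; rewrite (tc SM).
rewrite !mulrA; congr (_ * _); apply/esym; rewrite YE; apply: (dc_slide (rT_hecke SM l.+4)); lia.
Qed.
Lemma dc4_cc m : dc rT 4 m * cc = cc * dc rT 2 m.
Proof.
elim: m => [|m IH]; first by rewrite mulr1 mul1r.
rewrite !dcS -mulrA IH !mulrA; congr (_ * _).
by rewrite /rT !addSn /= (tc SM).
Qed.
Lemma vv_E g : HA g -> vv g * rE = 0.
Proof.
move=> Hg; have YE' : Y = dc rT 4 l * rT 3 * rT 2 by rewrite YE !dcSr.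
have C i : (0 < i < 3)%N -> dc rT 4 l * rT i = rT i * dc rT 4 l.
  by move=> ii; apply: dc_comm => m ml; apply/esym; apply: (he_comm (rT_hecke SM l.+4)); lia.
have C1 := C 1%N isT; have C2 := C 2%N isT; have Dc := dc4_cc l; have E1 := t0t1cc SM.
rewrite /vv YE' /rE; move: (dc rT 4 l) (dc rT 2 l) C1 C2 Dc => D4 D2 C1 C2 Dc {C YE'}.
have key : D4 * rT 3 * rT 2 * (cc * cc) = rT 1 * rT 2 * cc * (D2 * cc).
  rewrite -!mulrA (mulrA (rT 3)) -[rT 3 * rT 2 * _]E1 -/(rT 1) -/(rT 2).
  by rewrite !mulrA C1 -!mulrA; congr (_ * _); rewrite !mulrA C2 -!mulrA; congr (_ * _); rewrite !mulrA Dc.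
have -> : p * g * (D4 * rT 3 * rT 2) * cc * (cc * d 0) = p * g * (D4 * rT 3 * rT 2 * (cc * cc)) * d 0.
  by rewrite !mulrA.
rewrite key.
have -> : p * g * (rT 1 * rT 2 * cc * (D2 * cc)) * d 0 = p * (g * rT 1 * rT 2) * cc * (D2 * cc * d 0).
  by rewrite !mulrA.
rewrite p_cc ?mul0r //.
by do 2!(apply: ia_mul; [|by apply: HA_T]).
Qed.
Lemma vvD g g' : vv (g + g') = vv g + vv g'. Proof. by rewrite /vv mulrDr !mulrDl. Qed.
Lemma vvZ (c : F) g : vv (c *: g) = c *: vv g. Proof. by rewrite /vv -scalerAr -!scalerAl. Qed.

Lemma vv_rho g a : HA g -> exists2 g', HA g' & vv g * rho' a = vv g'.
Proof.
move=> Hg; elim: (rep_gen R' a) g Hg => {a} [a [[i [ii ->]]|->]|c|a b _ Ha _ Hb|a b _ Ha _ Hb] g Hg.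
- exists (g * rT i.+1); last by rewrite (repT R') // vv_T.
  by apply: ia_mul => //; apply: HA_T; lia.
- by exists 0; [exact: ia_zero|rewrite (repE R') vv_E // /vv mulr0 !mul0r].
- by exists (c *: g); [exact: ia_scale|rewrite linearZ_LR rmorph1 mulr_algr vvZ].
- have [x Hx xE] := Ha g Hg; have [y Hy yE] := Hb g Hg; exists (x + y); first exact: ia_add.
  by rewrite rmorphD mulrDr xE yE vvD.
have [x Hx xE] := Ha g Hg; have [y Hy yE] := Hb x Hx; exists y => //.
by rewrite rmorphM /= mulrA xE.
Qed.
Lemma vv_u g : HA g -> vv g * rho' u = 0.
Proof.
move=> Hg; apply: (tideal_ind (P := fun y => vv g * rho' y = 0)) uE => [|a b|y y' Hy Hy'].
- by rewrite rmorph0 mulr0.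
- have [g' Hg' gE] := vv_rho a Hg.
  by rewrite !rmorphM /= !mulrA gE (repE R') vv_E ?mul0r.
by rewrite rmorphD mulrDr Hy Hy' addr0.
Qed.
(** The ideal of E kills the complement of its unit, which vanishes on matchings with arcs by
    van_of_d0. *)
Lemma van_compl : van d (l.+2, 1%N) (1 - rho' u).
Proof.
apply: (van_of_d0 SM) => x Hx.
have [a <-] : exists a, rho' a = x.
  apply: (rep_word R'); elim: Hx => {x} [y [i ii ->]|c|y y' _ H _ H'|y y' _ H _ H'].
  - by apply: ia_gen; exists i.+1.
  - exact: ia_scal.
  - exact: ia_add.
  exact: ia_mul.
apply: (scalerI dl0); rewrite scaler0.
have -> : dl *: (d 0 * (rho' a * (1 - rho' u))) = d 0 * (rE * (rho' a * (1 - rho' u))).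
  by rewrite /rE !mulrA (d0c SM) -!scalerAl mul1r.
have [_ e1] := uP (tidealMr a (tideal_self E')).
by rewrite -(repE R') [rho' a * _]mulrBr mulr1 mulrBr -!rmorphM /= !mulrA e1 subrr mulr0.
Qed.
Lemma van_HA n m g w : (l.+3 < n)%N -> in_alg_of (gens rT n) g -> van d (n, m) w -> van d (n, m) (g * w).
Proof.
move=> ln Hg; elim: Hg w => {g} [g [i [ii ->]]|c|g g' _ H _ H'|g g' _ H _ H'] w Hw.
- by apply: (van_t SM) => //=; lia.
- by rewrite mulr_algl; apply: (van_scale SM).
- by rewrite mulrDl; apply: (van_add SM); [apply: H|apply: H'].
by rewrite -mulrA; apply/H/H'.
Qed.
Lemma Xs_van n m a j w : (0 < a)%N -> (a + j <= n)%N -> van d (n, m) w -> van d (n, m) (Xs rT lam a j * w).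
Proof.
elim: j a w => [|j IH] a w a0 an Hw; first by rewrite mul1r.
rewrite -[Xs _ _ _ _]/(Xs rT lam a.+1 j * Rs rT lam a j.+1) -mulrA; apply: IH => //; first by lia.
rewrite /Rs mulr_suml; apply: big_ind => [|x y Hx Hy|[i ij] _]; [exact: (van_zero SM) | exact: (van_add SM)|].
rewrite -scalerAl; apply: (van_scale SM) => /=.
elim: i ij w Hw => [|i IHi] ij w Hw; first by rewrite mul1r.
by rewrite upS -mulrA; apply: IHi; [lia|apply: (van_t SM) => //=; lia].
Qed.
(** The functional p evaluates behind an arc, at a matching that has one more arc among the next
    l + 2 points. *)
Lemma p_van w : van d (l.+4, 2) w -> p * w = 0.
Proof.
have [g Hg ->] := hf_word pP => Hw.
have Hg' : in_alg_of (gens rT l.+4) g.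
  elim: Hg => [y [i [ii ->]]|c|y y' _ H _ H'|y y' _ H _ H'].
  - by apply: ia_gen; exists i; split=> //; lia.
  - exact: ia_scal.
  - exact: ia_add.
  exact: ia_mul.
have H1 := van_d0 (van_HA (ltnSn _) Hg' Hw).
have H2 : van d (l.+2, 1%N) (Xs rT lam 1 L * (P * (d 0 * (g * w)))) by apply: Xs_van => //; apply: (cu_van PP).
have := (van_step d (km := (l.+2, 1%N)) _ isT).1 H2 l; rewrite /ncl [X in if X then _ else _]ltnSn => /(van0E SM).
rewrite /eps /kx -[KK d L]/(KK d l * d l); move: (Xs rT lam 1 L) => X H.
by rewrite -!mulrA H mulr0.
Qed.
Lemma vv0 g : HA g -> vv g = 0.
Proof.
move=> Hg; have -> : vv g = vv g * (1 - rho' u) by rewrite mulrBr mulr1 vv_u // subr0.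
rewrite /vv -!mulrA; apply: p_van.
have Hg' : in_alg_of (gens rT l.+4) g.
  elim: Hg => [y [i [ii ->]]|c|y y' _ H _ H'|y y' _ H _ H'].
  - by apply: ia_gen; exists i; split=> //; lia.
  - exact: ia_scal.
  - exact: ia_add.
  exact: ia_mul.
apply: van_HA => //; apply: van_HA => //; last exact: (van_cc SM van_compl).
rewrite YE; have : (l.+2 <= l.+2)%N by [].
elim: {1 4}l.+2 => [|m IH] ml; first exact: ia_one.
by rewrite dcS; apply: ia_mul; [apply: ia_gen; exists (2 + m)%N; split => //; lia | apply: IH; lia].
Qed.
Lemma top_kill g : HA g -> p * (g * (Y * rE)) = 0.
Proof.
move=> Hg; have -> : p * (g * (Y * rE)) = vv g * d 0 by rewrite /vv /rE !mulrA.
by rewrite vv0 // mul0r.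
Qed.

(** The coset representatives that involve the new point all end in Y E, and are handled by
    top_kill. *)
Lemma kill_next i j : (i < k.+1)%N -> (j < k)%N -> p * (dc rT 1 i * dc rT 2 j * rE) = 0.
Proof.
move=> ik jk.
have HAdc m : (m < k)%N -> HA (dc rT 1 m).
  elim: m => [|m IH] mk; first exact: ia_one.
  by rewrite dcS; apply: ia_mul; [apply: HA_T; lia|apply: IH; lia].
have [ik'|ik'] := ltnP i k.
  have [jk'|jk'] := ltnP j l.+2; first by apply: kill_k; lia.
  have -> : j = l.+2 by lia.
  by rewrite -YE -(mulrA (dc rT 1 i)) top_kill //; apply: HAdc.
have -> : i = l.+3 by lia.
have T1E : rT 1 * rE = q *: rE by apply: (T1E q0 z0 h0 zz0 (@rel 4)).
have top m : (m < k)%N -> p * (dc rT 1 m * (Y * (rT 1 * rE))) = 0.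
  by move=> mk; rewrite T1E -!scalerAr top_kill ?scaler0 //; apply: HAdc.
have slide m : (m <= l.+2)%N -> dc rT 1 l.+3 * dc rT 2 m = dc rT 1 m * dc rT 1 l.+3.
  elim: m => [|m IH] ml; first by rewrite mulr1 mul1r.
  rewrite !dcS mulrA add2n add1n.
  rewrite -(dc_slide (rT_hecke SM l.+4) (a := 1) (m := l.+3) (l := m.+1)); [|lia..].
  by rewrite -mulrA IH 1?ltnW // mulrA.
rewrite slide; last by lia.
by rewrite [dc rT 1 l.+3]dcSr -YE -(mulrA (dc rT 1 j)) -(mulrA Y); apply: top; lia.
Qed.
End Next.
End Level.

(** Adding an arc at the front relates the algebra on n points to the one on n - 2 points: the
    functional is composed with d 0, and d 0 a cc lies in the image of the smaller algebra for
    every a in the larger one. *)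
Lemma bad_step n (A : algType F) (T : nat -> A) (E : A) rho (B : algType F) (TB : nat -> B) (EB : B) rhoB (psi : {lrmorphism B -> A}) :
  @rep n A T E rho -> @rep (n - 2) B TB EB rhoB -> (3 < n)%N ->
  (forall i, (0 < i < n - 2)%N -> psi (TB i) = T i.+2) -> psi EB = dl^-1 *: qB_E2 q T E ->
  (forall b, E * psi b = psi b * E) -> (forall a, exists b, E * a * E = E * psi b) ->
  bad rhoB -> bad rho.
Proof.
move=> R RB n4 psiT psiE psiC corner [p [r [E0 [x [p0 pE pr]]]]].
have D0 : d 0 * cc = dl *: 1 := d0c SM.
have rE2 : rho (qB_E2 q T E) = cc * cc * (d 0 * d 0).
  rewrite -(rho_E2 SM) /qB_E2 /qB_Tinv !rmorphM !rmorphB /= !linearZ_LR !rmorph1 (repE R).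
  by rewrite !(repT R) //; lia.
have psid b : d 0 * rho (psi b) = rhoB b * d 0.
  elim: (rep_gen RB b) => {b} [y [[i [ii ->]]|->]|c|a b _ Ha _ Hb|a b _ Ha _ Hb].
  - rewrite psiT // (repT R) ?(repT RB) //; last by lia.
    by rewrite /rT; case: i ii => // i _; rewrite (d0t SM).
  - rewrite psiE linearZ_LR /= rE2 (repE RB) -scalerAr !mulrA D0 -!scalerAl mul1r scalerA mulVf // scale1r.
    by rewrite -mulrA.
  - by rewrite !linearZ_LR !rmorph1 mulr_algl mulr_algr.
  - by rewrite !rmorphD mulrDr mulrDl Ha Hb.
  by rewrite !rmorphM /= mulrA Ha -mulrA Hb mulrA.
have Ecc : d 0 * rE = dl *: d 0 by rewrite /rE mulrA D0 -scalerAl mul1r.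
exists (p * d 0), (dl^-1 *: (r * d 0)), (psi E0 * E), (psi x); split=> [|a|].
- apply: contra_neq p0 => pd; have := congr1 (fun y => dl^-1 *: (y * cc)) pd.
  by rewrite mul0r scaler0 -mulrA D0 -scalerAr mulr1 scalerA mulVf // scale1r.
- have [b bE] := corner a.
  have key : d 0 * rho a * cc = rhoB b.
    have H : rE * rho a * rE = rE * rho (psi b) by rewrite -(repE R) -!rmorphM bE.
    have H1 : d 0 * rho a * rE = rhoB b * d 0.
      apply: (scalerI dl0); rewrite -psid !scalerAl -Ecc -(mulrA (d 0) rE) -(mulrA (d 0)).
      by rewrite H mulrA.
    apply: (scalerI dl0).
    have -> : dl *: (d 0 * rho a * cc) = d 0 * rho a * rE * cc.
      by rewrite /rE -!mulrA D0 -!scalerAr mulr1.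
    by rewrite H1 -mulrA D0 -scalerAr mulr1.
  rewrite -psiC rmorphM /= (repE R) /rE !mulrA.
  rewrite -(mulrA p) -(mulrA p) key -mulrA psid mulrA.
  by rewrite pE mul0r.
rewrite rmorphM /= (repE R) -scalerAl.
have -> : rho (psi E0) * rE = rE * rho (psi E0) by rewrite -(repE R) -!rmorphM psiC.
rewrite -scalerAl (mulrA _ rE) -(mulrA r (d 0) rE) Ecc -scalerAr -!scalerAl scalerA mulVf // scale1r.
by rewrite -(mulrA r (d 0)) psid (mulrA r) -(mulrA _ (d 0)) psid mulrA -pr.
Qed.
End Bad.

(** * Necessity of the condition on z *)

Lemma stream_ex (F : fieldType) (q z : F) : q != 0 ->
  exists (M : algType F) (d t : nat -> M) (cc : M) (glue : (nat -> M) -> M),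
    stream_model q z d t cc /\ forall a x, d a * glue x = x a.
Proof.
move=> q0; pose M := lend_alg F.
exists M, (dd F : nat -> M), (tt q : nat -> M),
  (glue (fun a => if a is b.+1 then z *: @uu F M (tt q) b else qB_delta q z *: (1 : M))), (@glue F).
split; last by move=> a x; apply: dd_glue.
split.
- exact: q0.
- exact: comp_ext.
- exact: lend_dt_lt.
- exact: lend_dt_eq.
- exact: lend_dt_eqS.
- exact: lend_dt_gt.
- exact: lend_dt00.
- exact: lend_dt0_le.
- exact: lend_dt0_gt.
- exact: (lend_t_quad q0).
- exact: lend_t_comm.
- exact: (lend_t_braid q0).
- move=> w; rewrite mulrA; have -> := dd_glue 0 (fun a => if a is b.+1 then z *: @uu F M (tt q) b else qB_delta q z *: (1 : M)).
  by rewrite -scalerAl mul1r.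
move=> a w; rewrite mulrA; have -> := dd_glue a.+1 (fun a => if a is b.+1 then z *: @uu F M (tt q) b else qB_delta q z *: (1 : M)).
by rewrite -scalerAl.
Qed.

Section Necessity.
Context (F : fieldType) (q z : F).
Context (q0 : q != 0) (z0 : z != 0) (h0 : q - q^-1 != 0) (zz0 : z - z^-1 != 0).
Notation h := (q - q^-1).
Notation dl := (qB_delta q z).
Local Notation B n := (qBrauer n q z).
Local Notation BT n := (qB_T n q z).
Local Notation BE n := (qB_E n q z).
Let relB n : qB_relations n q z (BT n) (BE n) := @qBrauer_relations F n q z.

Lemma tower_step n : (3 < n)%N -> exists psi : {lrmorphism B (n - 2) -> B n},
  [/\ forall i, (0 < i < n - 2)%N -> psi (BT (n - 2) i) = BT n i.+2,
      psi (BE (n - 2)) = dl^-1 *: qB_E2 q (BT n) (BE n) & tower q n (BT n) (BE n) psi].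
Proof.
move=> n4; have m1 : (1 < n - 2)%N by lia.
have [D' [psi' [tw _ _ _]]] := tower_ex q0 z0 h0 zz0 m1.
have [psi [psiT psiE] _] := qBrauer_universal (psi_rel q0 z0 h0 zz0 (@relB n) n4).
exists psi; split; [exact: psiT | exact: psiE |].
apply: (tower_psi q0 z0 h0 zz0 (@relB n) n4 (td := BT (n - 2)) (e := BE (n - 2))).
- exact: qB_gen.
- exact: psiT.
- exact: psiE.
by move=> d; apply: (tower_hsp q0 z0 h0 zz0 (@relB _) tw m1); apply: qB_gen.
Qed.

Lemma split_idems_unit (A : algType F) (x : A) : split_idems A ->
  exists2 u, tideal x u & forall y, tideal x y -> u * y = y /\ y * u = y.
Proof. by move=> [ps psP]; apply: semisimple_tideal_unit; apply: min_idems_semisimple psP. Qed.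

Context (M : algType F) (d t : nat -> M) (cc : M) (glue : (nat -> M) -> M).
Context (SM : stream_model q z d t cc) (dglue : forall a x, d a * glue x = x a).

Lemma rep_ex n : exists rho : {lrmorphism B n -> M}, rep d t cc n (BT n) (BE n) rho.
Proof.
have [rho [rhoT rhoE] _] := qBrauer_universal (@rho_relations _ _ _ _ _ _ _ SM n).
by exists rho; split; [exact: rhoT | exact: rhoE | exact: qB_gen].
Qed.

Lemma hecke_necessity n : (1 < n)%N -> semisimple (B n) -> forall k, (0 < k <= n)%N -> q ^+ (2 * k) != 1.
Proof.
move=> n1 ssB k /andP[k0 kn]; have [rho R] := rep_ex n.
have := qfact_neq0 SM dglue (repT R) (repE R) (rep_gen R) n1 q0 (qB_hecke q0 z0 h0 zz0 (@relB n))
  (ET1 q0 z0 h0 zz0 (@relB n) n1) ssB.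
apply: contra_neq => qk; case: k k0 kn qk => // k _ kn qk.
have E := @gsP F q q (ltac:(by field)) k.+1; rewrite qk subrr in E.
move/eqP: E; rewrite !mulf_eq0 (negPf h0) (negPf q0) /= => /eqP E.
by rewrite /qfact (bigD1 (Ordinal kn)) //= -/(gs q k.+1) E mul0r.
Qed.

(** Each of the three boundary values of a makes the scalars of one of the functionals vanish. *)
Lemma hook_ex l P (a : int) : compl_unit d t cc l.+1 P ->
  q ^+ (2 * l.+3) != 1 -> q ^+ 4 != 1 -> z ^+ 2 = q ^ (2 * a) ->
  a = 4 - 2 * l.+3%:Z \/ a = 4 - l.+3%:Z \/ a = l.+3%:Z - 2 ->
  exists lam p, lam ^+ 2 = 1 + h * lam /\ hook_fun d t cc l P lam p.
Proof.
move=> PP qk q4 za aP.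
have lq : q ^+ 2 = 1 + h * q by field.
have ln : (- q^-1) ^+ 2 = 1 + h * (- q^-1) by field.
case: aP => [aE|[aE|aE]].
- exists q, (hook1 (rT t) l q (eps d t l P q)); split=> //; apply: (hook_e1 SM) => //.
    apply: contra_neq q4 => q2; have -> : q ^+ 4 = (q ^+ 2) ^+ 2 by rewrite -exprM.
    have -> : q ^+ 2 = -1 by apply/eqP; rewrite -subr_eq0 opprK addrC expr2 q2.
    by rewrite sqrrN expr1n.
  apply: D1_zero => //; rewrite za -exprM exprnP -expfzDr //.
  by have -> : 2 * a + (2 * l.+1 * 2)%N%:Z = 0 by lia.
- exists q, (hook2 (rT t) l q (eps d t l P q) - kap q l *: hook1 (rT t) l q (eps d t l P q)); split=> //.
  have [E1 E2] : D2 q z l q - kap q l * D1 q z l q = 0 /\ D2' q z l q - kap q l * (q ^+ 2 * D1 q z l q) = 0.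
    apply: D_kap => //.
      by rewrite -exprD; have -> : (2 * l.+1 + 4 = 2 * l.+3)%N by lia.
    rewrite za exprnP -expfzDr // exprnP; congr (q ^ _); lia.
  exact: (hook_e12 SM z0 h0 zz0 dglue PP lq q0 E1 E2).
exists (- q^-1), (hook2 (rT t) l (- q^-1) (eps d t l P (- q^-1))); split=> //.
have [E1 E2] : D2 q z l (- q^-1) = 0 /\ D2' q z l (- q^-1) = 0.
  apply: D_neg => //; rewrite za exprnP; congr (q ^ _); lia.
exact: (hook_e2 SM z0 h0 zz0 dglue PP ln E1 E2).
Qed.

Lemma compl_ex l : ss_cond q z l.+1 -> exists P, compl_unit d t cc l.+1 P.
Proof.
case: l => [|l] ssc; first by exists 1; apply: compl_unit_triv.
have [rho R] := rep_ex l.+2.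
have [u uE uP] := split_idems_unit (BE l.+2) (brauer_split q0 z0 h0 zz0 (isT : (1 < l.+2)%N) ssc).
by exists (1 - rho u); apply: (compl_unit_ideal SM R).
Qed.

(** The same functional serves for k and k + 1 points, and bad_step goes on by two points. *)
Lemma bad_range l P lam p n (rho : {lrmorphism B n -> M}) : compl_unit d t cc l.+1 P ->
  ss_cond q z l.+2 -> lam ^+ 2 = 1 + h * lam -> hook_fun d t cc l P lam p ->
  (l.+3 <= n)%N -> rep d t cc n (BT n) (BE n) rho -> bad rho.
Proof.
move=> PP ssc lamP pP; elim/ltn_ind: n rho => n IH rho kn R.
have tw m : (1 < m)%N -> exists (D : algType F) (psi : {lrmorphism D -> B m}), tower q m (BT m) (BE m) psi.
  by move=> m1; have [D [psi [tw _ _ _]]] := tower_ex q0 z0 h0 zz0 m1; exists D, psi.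
have kill_all m (rm : {lrmorphism B m -> M}) : rep d t cc m (BT m) (BE m) rm -> (1 < m)%N ->
    (forall i j, (i < m)%N -> (j < m.-1)%N -> p * (dc (rT t) 1 i * dc (rT t) 2 j * rE d cc) = 0) ->
    forall a, p * rm a * rE d cc = 0.
  move=> Rm m1 H; have [D [psi tp]] := tw m m1.
  exact: (kill_of_dc SM z0 h0 zz0 Rm m1 (@relB m) tp H).
have [rk Rk] := rep_ex l.+3.
have killk := kill_all _ rk Rk isT (kill_k SM z0 h0 zz0 pP).
have [nk|nk] := leqP n l.+3.
  have nE : n = l.+3 by lia.
  by subst n; apply: (bad_of_kill SM z0 h0 zz0 pP R (leqnn _)); apply: kill_all R _ (kill_k SM z0 h0 zz0 pP).
have [nk'|nk'] := leqP n l.+4.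
  have nE : n = l.+4 by lia.
  subst n; apply: (bad_of_kill SM z0 h0 zz0 pP R) => //; apply: kill_all R _ _ => //.
  have pE g : in_alg_of (gens (rT t) l.+3) g -> p * g * rE d cc = 0.
    by move=> Hg; have [x <-] := rep_word Rk Hg; apply: killk.
  have [r' R'] := rep_ex l.+2.
  have [u uE uP] := split_idems_unit (BE l.+2) (brauer_split q0 z0 h0 zz0 (isT : (1 < l.+2)%N) ssc).
  exact: (kill_next SM z0 h0 zz0 PP pP pE R' uE uP (erefl _)).
have n4 : (3 < n)%N by lia.
have [psi [psiT psiE tp]] := tower_step n4.
have [rB RB] := rep_ex (n - 2).
have m1 : (1 < n)%N by lia.
apply: (bad_step SM z0 h0 zz0 R RB n4 psiT psiE).
- by case: tp.
- exact: (tower_EAE q0 z0 h0 zz0 (@relB n) tp m1 (rep_gen R)).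
by apply: IH RB; lia.
Qed.

(** Going down to the smallest number of points for which the condition on z fails, the exponent
    is one of the boundary values of hook_ex and all smaller algebras are semisimple. *)
Lemma parameter_necessity n m : (1 < n)%N -> (n <= m)%N ->
  (forall k, (0 < k <= m)%N -> q ^+ (2 * k) != 1) -> ~ ss_cond q z n -> ~ semisimple (B m).
Proof.
elim/ltn_ind: n => n IH n1 nm qm nss.
have [n2|n3] := leqP n 2.
  case: nss; split=> [k kn|a a1 a2 za]; first by apply: qm; lia.
  have a0 : a = 0 by lia.
  move: zz0; rewrite (_ : z - z^-1 = 0) ?eqxx //; apply: (mulfI z0).
  by rewrite mulr0 mulrBr divff // -expr2 za a0 mulr0 expr0z subrr.
case: (pselect (ss_cond q z n.-1)) => [ss1|nss1]; last by apply: (IH n.-1) => //; lia.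
case: n n1 nm nss n3 ss1 {IH} => [|[|[|l]]] // n1 nm nss n3 ss1.
have [a [a1 a2 za]] : exists a : int, [/\ 4 - 2 * l.+3%:Z <= a <= l.+3%:Z - 2,
    ~ (4 - 2 * l.+3%:Z < a <= 3 - l.+3%:Z /\ ~~ (2 %| a)%Z) & z ^+ 2 = q ^ (2 * a)].
  apply: contrapT => H; apply: nss; split=> [k kn|a a1 a2 za]; first by apply: qm; lia.
  by apply: H; exists a.
have aP : a = 4 - 2 * l.+3%:Z \/ a = 4 - l.+3%:Z \/ a = l.+3%:Z - 2.
  apply: contrapT => H; case: ss1 => _ /(_ a) ss1; apply: ss1 za; first by lia.
  by move=> [H1 H2]; apply: H; lia.
have [P PP] := compl_ex (ss_cond_le (leqnSn l.+1) ss1).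
have q4 : q ^+ 4 != 1 by apply: (qm 2%N); lia.
have qk : q ^+ (2 * l.+3) != 1 by apply: qm; lia.
have [lam [p [lamP pP]]] := hook_ex PP qk q4 za aP.
have [rho R] := rep_ex m.
exact: (bad_not_semisimple (bad_range PP ss1 lamP pP nm R)).
Qed.
End Necessity.

Theorem theorem1 (n : nat) (F : fieldType) (q z : F)
    (n_ge2 : (2 <= n)%N)
    (q_neq0 : q != 0) (z_neq0 : z != 0)
    (qq_neq0 : q - q^-1 != 0) (zz_neq0 : z - z^-1 != 0) :
  let semisimplicity_condition : Prop :=
    ltn_qchar n (quantum_char (q ^+ 2)) /\
    forall a : int,
      4 - 2 * n%:Z <= a <= n%:Z - 2 ->
      ~ (4 - 2 * n%:Z < a <= 3 - n%:Z /\ ~~ (2 %| a)%Z) ->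
      z ^+ 2 <> q ^ (2 * a) in
  (semisimple (qBrauer n q z) <-> semisimplicity_condition) /\
  (split_semisimple (qBrauer n q z) <-> semisimplicity_condition).
Proof.
move=> cond.
have condP : cond <-> ss_cond q z n.
  have qE e : (\sum_(i < e) (q ^+ 2) ^+ i = 0) <-> q ^+ (2 * e) = 1.
    have E := @gsP F q q (ltac:(by field)) e.
    have -> : \sum_(i < e) (q ^+ 2) ^+ i = gs q e by apply: eq_bigr => i _; rewrite exprM.
    split=> [e0|e1]; first by move: E; rewrite e0 mulr0 => /esym/eqP; rewrite subr_eq0 => /eqP.
    by move/eqP: E; rewrite e1 subrr !mulf_eq0 (negPf qq_neq0) (negPf q_neq0) => /eqP.
  split=> -[H1 H2]; split=> //.
    by move=> k kn; apply/eqP => /qE; move/quantum_charP: H1; apply.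
  by apply/quantum_charP => e en /qE; apply/eqP; apply: H1.
have sufficient : ss_cond q z n -> split_idems (qBrauer n q z).
  exact: (brauer_split q_neq0 z_neq0 qq_neq0 zz_neq0 n_ge2).
have necessary : semisimple (qBrauer n q z) -> ss_cond q z n.
  move=> ssB; apply: contrapT => nss.
  have [M [d [t [cc [glue [SM dglue]]]]]] := stream_ex z q_neq0.
  apply: (parameter_necessity q_neq0 z_neq0 qq_neq0 zz_neq0 SM dglue n_ge2 (leqnn n) _ nss ssB).
  exact: (hecke_necessity q_neq0 z_neq0 qq_neq0 zz_neq0 SM dglue n_ge2 ssB).
have toss : split_idems (qBrauer n q z) -> semisimple (qBrauer n q z).
  by move=> [ps psP]; apply: min_idems_semisimple psP.
split; split=> [H|/condP/sufficient [ps psP]].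
- exact/condP/necessary.
- exact: min_idems_semisimple psP.
- by apply/condP/necessary/toss; apply: split_semisimple_idems.
exact: min_idems_split psP.
Qed.
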